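(* Let $\Sigma$ be an open simply connected Riemann surface with global conformal parameter $z$, and let $G:\Sigma\to\mathbb{H}^2\subset\mathbb{L}^3$ be a harmonic map admitting Weierstrass data $\{-Q,2\tau\}$. Assume the set of singular points of $G$ has empty interior, let $z_0\in\Sigma$ be a regular point of $G$ and $\vartheta_0\in\mathbb{C}$. Then there exists a conformal immersion $\psi=(N,h):\Sigma\to\mathbb{H}^2\times\mathbb{R}\subset\mathbb{L}^4$ with regular vertical projection and constant mean curvature $1/2$ with respect to its canonical orientation, unique up to vertical translations, such that: (i) $G$ is the hyperbolic Gauss map of $\psi$; (ii) $\tau=\lambda u^2/2$, where $\langle d\psi,d\psi\rangle=\lambda|dz|^2$ and $u$ is the angle function of $\psi$; (iii) $dh(z_0)=\vartheta_0\,dz+\overline{\vartheta_0}\,d\bar z$. Moreover, $h$ is the (unique up to additive constants) solution of $$h_{zz}=(\log\tau)_z\,h_z+Q\sqrt{\frac{\tau+2|h_z|^2}{\tau}},\qquad h_{z\bar z}=\frac12\sqrt{\tau(\tau+2|h_z|^2)},\qquad h_z(z_0)=\vartheta_0,$$ and $$\psi=\left(\frac{4\,\mathrm{Re}\big(G_z(2\overline{Q}h_z+\tau h_{\bar z})\big)}{\tau^2-4|Q|^2}+G\sqrt{\frac{\tau+2|h_z|^2}{\tau}},\ h\right)$$ at every regular point of $G$.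
   Context: $\mathbb{L}^4$ is $\mathbb{R}^4$ with metric $\langle,\rangle=-dx_0^2+dx_1^2+dx_2^2+dx_3^2$, $\mathbb{L}^3$ the first three coordinates, $\mathbb{H}^2=\{x\in\mathbb{L}^3:\langle x,x\rangle=-1,x_0>0\}$, $\mathbb{H}^2\times\mathbb{R}\subset\mathbb{L}^4$; vertical translations are $(x,t)\mapsto(x,t+c)$. For a conformal immersion $\psi=(N,h)$ with metric $\lambda|dz|^2$: $\eta=(\hat N,u)$ is its unit normal tangent to $\mathbb{H}^2\times\mathbb{R}$ and $u$ the angle function; regular vertical projection means $u\ne0$ everywhere, canonical orientation means $u>0$; the hyperbolic Gauss map $G$ is defined by $(G,1)=(\eta+N)/u$. For a harmonic map $G$ into $\mathbb{H}^2$, with $Q_0=\langle G_z,G_z\rangle$ and $\mu=2\langle G_z,G_{\bar z}\rangle$, Weierstrass data is a pair $\{Q_0,\tau_0\}$, $\tau_0>0$ smooth, with $\mu=\tau_0/4+4|Q_0|^2/\tau_0$; here $Q_0=-Q$, $\tau_0=2\tau$. A regular point of $G$ is one where $dG$ has rank 2. *)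

(* Defs.v *)
(* Points of the Riemann surface are points of the
   domain Omega in C = R*R (global conformal parameter z = x + i y). *)
From Stdlib Require Import Reals Lra.
From Coquelicot Require Import Coquelicot.
Open Scope R_scope.

Definition pd (b : bool) (f : C -> R) : C -> R := fun p =>
  if b then Derive (fun t => f (fst p, t)) (snd p)
  else Derive (fun t => f (t, snd p)) (fst p).
Definition dx := pd false.
Definition dy := pd true.
Fixpoint pds (l : list bool) (f : C -> R) : C -> R :=
  match l with nil => f | cons b l' => pd b (pds l' f) end.

Definition smooth_on (Om : C -> Prop) (f : C -> R) : Prop :=
  forall (l : list bool) (p : C), Om p ->
    ex_derive (fun t => pds l f (t, snd p)) (fst p) /\
    ex_derive (fun t => pds l f (fst p, t)) (snd p) /\
    continuous (pds l f) p.

Definition dz (f : C -> R) : C -> C := fun p => (dx f p / 2, - dy f p / 2).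
Definition dzb (f : C -> R) : C -> C := fun p => (dx f p / 2, dy f p / 2).
Definition dzC (F : C -> C) : C -> C := fun p =>
  ((dx (fun q => Re (F q)) p + dy (fun q => Im (F q)) p) / 2,
   (dx (fun q => Im (F q)) p - dy (fun q => Re (F q)) p) / 2).
Definition dzbC (F : C -> C) : C -> C := fun p =>
  ((dx (fun q => Re (F q)) p - dy (fun q => Im (F q)) p) / 2,
   (dx (fun q => Im (F q)) p + dy (fun q => Re (F q)) p) / 2).

Definition lor3 (a b : nat -> R) : R := - a 0%nat * b 0%nat + a 1%nat * b 1%nat + a 2%nat * b 2%nat.
Definition lor4 (a b : nat -> R) : R := lor3 a b + a 3%nat * b 3%nat.
Definition lor3C (a b : nat -> C) : C :=
  Cplus (Cplus (Copp (Cmult (a 0%nat) (b 0%nat))) (Cmult (a 1%nat) (b 1%nat)))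
        (Cmult (a 2%nat) (b 2%nat)).

Definition in_H2 (v : nat -> R) : Prop := lor3 v v = -1 /\ 0 < v 0%nat.

(* maps into L^3 / L^4 are given by component functions F k, k < 3 resp. k < 4 *)
Definition at_ (F : nat -> C -> R) (p : C) : nat -> R := fun k => F k p.
Definition dxv (F : nat -> C -> R) (p : C) : nat -> R := fun k => dx (F k) p.
Definition dyv (F : nat -> C -> R) (p : C) : nat -> R := fun k => dy (F k) p.
Definition lapv (F : nat -> C -> R) (p : C) : nat -> R :=
  fun k => dx (dx (F k)) p + dy (dy (F k)) p.
Definition dzv (F : nat -> C -> R) (p : C) : nat -> C := fun k => dz (F k) p.
Definition dzbv (F : nat -> C -> R) (p : C) : nat -> C := fun k => dzb (F k) p.

(* harmonic map into H^2 : smooth, valued in H^2, tension field (tangential part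
   of the Laplacian, H^2 having unit normal G) vanishes *)
Definition harmonic_H2 (Om : C -> Prop) (G : nat -> C -> R) : Prop :=
  (forall k, (k < 3)%nat -> smooth_on Om (G k)) /\
  (forall p, Om p -> in_H2 (at_ G p)) /\
  (forall p, Om p -> forall k, (k < 3)%nat ->
     lapv G p k + lor3 (lapv G p) (at_ G p) * G k p = 0).

Definition weierstrass_data (Om : C -> Prop) (G : nat -> C -> R)
    (Q0 : C -> C) (tau0 : C -> R) : Prop :=
  smooth_on Om tau0 /\
  forall p, Om p ->
    0 < tau0 p /\
    Q0 p = lor3C (dzv G p) (dzv G p) /\
    Cmult (RtoC 2) (lor3C (dzv G p) (dzbv G p))
      = RtoC (tau0 p / 4 + 4 * (Cmod (Q0 p))^2 / tau0 p).

Definition regular_point (Om : C -> Prop) (G : nat -> C -> R) (p : C) : Prop :=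
  Om p /\ ~ (exists a b : R, (a <> 0 \/ b <> 0) /\
              forall k, (k < 3)%nat -> a * dx (G k) p + b * dy (G k) p = 0).
Definition singular_point (Om : C -> Prop) (G : nat -> C -> R) (p : C) : Prop :=
  Om p /\ ~ regular_point Om G p.
Definition singular_set_empty_interior (Om : C -> Prop) (G : nat -> C -> R) : Prop :=
  forall U : C -> Prop, open U -> (forall p, U p -> singular_point Om G p) ->
    forall p, ~ U p.

Definition path_in (Om : C -> Prop) (g : R -> C) : Prop :=
  (forall t, continuous g t) /\ (forall t, 0 <= t <= 1 -> Om (g t)).
Definition simply_connected (Om : C -> Prop) : Prop :=
  (exists p, Om p) /\
  (forall p q, Om p -> Om q -> exists g, path_in Om g /\ g 0 = p /\ g 1 = q) /\
  (forall g, path_in Om g -> g 0 = g 1 ->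
     exists H : C -> C,
       (forall st, continuous H st) /\
       (forall s t, 0 <= s <= 1 -> 0 <= t <= 1 -> Om (H (s, t))) /\
       (forall s, 0 <= s <= 1 -> H (s, 0) = g s) /\
       (forall s, 0 <= s <= 1 -> H (s, 1) = H (0, 1)) /\
       (forall t, 0 <= t <= 1 -> H (0, t) = H (1, t))).

Definition psi4 (N : nat -> C -> R) (h : C -> R) : nat -> C -> R :=
  fun k => if (k <? 3)%nat then N k else h.

Definition unit_normal (N : nat -> C -> R) (h : C -> R) (p : C) (eta : nat -> R) : Prop :=
  lor3 eta (at_ N p) = 0 /\
  lor4 eta (dxv (psi4 N h) p) = 0 /\
  lor4 eta (dyv (psi4 N h) p) = 0 /\
  lor4 eta eta = 1.

Definition lambda_of (N : nat -> C -> R) (h : C -> R) (p : C) : R :=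
  lor4 (dxv (psi4 N h) p) (dxv (psi4 N h) p).

Definition good_psi (Om : C -> Prop) (G : nat -> C -> R) (tau : C -> R)
    (z0 : C) (th0 : C) (N : nat -> C -> R) (h : C -> R) : Prop :=
  (forall k, (k < 3)%nat -> smooth_on Om (N k)) /\ smooth_on Om h /\
  (forall p, Om p -> in_H2 (at_ N p)) /\
  (forall p, Om p ->
     lor4 (dxv (psi4 N h) p) (dxv (psi4 N h) p) = lor4 (dyv (psi4 N h) p) (dyv (psi4 N h) p) /\
     lor4 (dxv (psi4 N h) p) (dyv (psi4 N h) p) = 0 /\
     0 < lambda_of N h p) /\
  (* regular vertical projection *)
  (forall p eta, Om p -> unit_normal N h p eta -> eta 3%nat <> 0) /\
  (* w.r.t. the canonical orientation (u > 0): *)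
  (forall p eta, Om p -> unit_normal N h p eta -> 0 < eta 3%nat ->
     (* constant mean curvature 1/2 : <Delta psi, eta> = 2 lambda H *)
     lor4 (lapv (psi4 N h) p) eta = 2 * lambda_of N h p * (1/2) /\
     (* (i) G is the hyperbolic Gauss map : (G,1) = (eta + N)/u *)
     (forall k, (k < 3)%nat -> G k p = (eta k + N k p) / eta 3%nat) /\
     tau p = lambda_of N h p * (eta 3%nat)^2 / 2) /\
  dz h z0 = th0 /\ dzb h z0 = Cconj th0.

Definition h_system (Om : C -> Prop) (Q : C -> C) (tau : C -> R)
    (z0 : C) (th0 : C) (h : C -> R) : Prop :=
  (forall p, Om p ->
     dzC (dz h) p =
       Cplus (Cmult (dz (fun q => ln (tau q)) p) (dz h p))
             (Cmult (Q p) (RtoC (sqrt ((tau p + 2 * (Cmod (dz h p))^2) / tau p)))) /\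
     dzbC (dz h) p =
       RtoC (1/2 * sqrt (tau p * (tau p + 2 * (Cmod (dz h p))^2)))) /\
  dz h z0 = th0.

(* Main.v *)
(** The system for [h] becomes linear once [W = 1/u = sqrt ((tau + 2 |h_z|^2) / tau)] is adjoined as an unknown:
    for [(h_x, h_y, W, h)] it is a linear system in the plane, flat by the harmonicity of [G] (holomorphy of [Q]
    and the Bochner formula), and [W^2 - 2 |h_z|^2 / tau] is a first integral. Flat systems have unique global
    solutions on simply connected domains, by parallel transport along paths.

    At each point [tau = (|G_x|^2 + |G_y|^2)/2 + s J] with [s = 1] or [s = -1] and [J] the Jacobian of [G]. The sign
    could only change across a point where both roots agree to infinite order with [tau]; the logarithm of their
    quotient satisfies a linear elliptic equation, so strong unique continuation would make [G] singular on an open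
    set. With [s] constant, [e1 = G_x - s G ∧ G_y] and [e2 = G_y + s G ∧ G_x] are orthogonal of length [sqrt (2 tau)]
    and never degenerate; [N = W G + (h_x e1 + h_y e2) / (2 tau)] satisfies [N_x = h_x G + W e1] and
    [N_y = h_y G + W e2], which gives the immersion. Conversely the structure equations of any such immersion force
    these formulas at the regular points of [G], hence everywhere by density, so that uniqueness for the linear
    system gives uniqueness of the surface. *)

Require Import Defs.
From Stdlib Require Import Reals Lra Lia List ClassicalEpsilon.
From Coquelicot Require Import Coquelicot.
Open Scope R_scope.

(** * Partial derivatives and smooth functions *)

(** The equation for Weierstrass data is quadratic in [tau] with discriminant [4 J^2], so smoothness
    alone would let [tau] pass from one root to the other where the two touch to infinite order.
    This is what forces an analytic theorem into an otherwise algebraic proof. Unique continuation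
    is obtained from Almgren's frequency, which asks of [w] only that [w] times its Laplacian is
    nonnegative and that the Laplacian is at most [K] times [w] in absolute value.

    The frame comes from the surfaces themselves: for a solution, [N_x - h_x G] and [N_y - h_y G]
    are orthogonal to [G] and to each other, of equal length, and after division by [W] they depend
    on [G] alone. Written through [G] and its cross products, they keep their meaning where [dG]
    degenerates.

    In a flat system the local solution is built along a horizontal line and then along verticals,
    and its differentiability in the horizontal parameter is not known beforehand. The horizontal
    equation is therefore checked on difference quotients, with flatness making the error
    quadratic. *)

Definition slice (b : bool) (f : C -> R) (p : C) : R -> R :=
  fun t => if b then f (fst p, t) else f (t, snd p).
Definition crd (b : bool) (p : C) : R := if b then snd p else fst p.
(** Relational form of [pd]: it includes the existence of the derivative, so that a value can be
    synthesised by the rules below and compared afterwards with the desired one by [ring] or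
    [field]. *)
Definition is_pd (b : bool) (f : C -> R) (p : C) (l : R) : Prop :=
  is_derive (slice b f p) (crd b p) l.

Lemma slice_crd b f p : slice b f p (crd b p) = f p.
Proof. destruct b, p; reflexivity. Qed.

Lemma pd_Derive b f p : pd b f p = Derive (slice b f p) (crd b p).
Proof. destruct b; reflexivity. Qed.

Lemma is_pd_unique b f p l : is_pd b f p l -> pd b f p = l.
Proof. intros H; rewrite pd_Derive; exact (is_derive_unique _ _ _ H). Qed.

Lemma is_pd_val b f p l l' : is_pd b f p l -> l = l' -> is_pd b f p l'.
Proof. intros H <-; exact H. Qed.

Lemma locally_slice b (P : C -> Prop) p : locally p P ->
  locally (crd b p) (fun t => P (if b then (fst p, t) else (t, snd p))).
Proof.
intros [e He]; exists e; intros t Ht; apply He.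
destruct b; split; simpl; try exact Ht; apply ball_center.
Qed.

Lemma is_pd_ext_loc b f g p l :
  locally p (fun q => f q = g q) -> is_pd b f p l -> is_pd b g p l.
Proof.
intros E H; apply is_derive_ext_loc with (2 := H).
apply (locally_slice b) in E; revert E; apply filter_imp; intros t Ht.
destruct b; exact Ht.
Qed.

Lemma is_pd_const b c p : is_pd b (fun _ => c) p 0.
Proof.
unfold is_pd; apply is_derive_ext with (fun _ => c); [now destruct b|].
apply (is_derive_const (V := R_NormedModule)).
Qed.

Lemma is_pd_plus b f g p l m : is_pd b f p l -> is_pd b g p m ->
  is_pd b (fun q => f q + g q) p (l + m).
Proof.
intros Hf Hg; unfold is_pd.
apply is_derive_ext with (fun t => slice b f p t + slice b g p t); [now destruct b|].
exact (is_derive_plus _ _ _ _ _ Hf Hg).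
Qed.

Lemma is_pd_opp b f p l : is_pd b f p l -> is_pd b (fun q => - f q) p (- l).
Proof.
intros Hf; unfold is_pd.
apply is_derive_ext with (fun t => - slice b f p t); [now destruct b|].
exact (is_derive_opp _ _ _ Hf).
Qed.

Lemma is_pd_minus b f g p l m : is_pd b f p l -> is_pd b g p m ->
  is_pd b (fun q => f q - g q) p (l - m).
Proof. intros Hf Hg; apply is_pd_plus; [exact Hf|now apply is_pd_opp]. Qed.

Lemma is_pd_mult b f g p l m : is_pd b f p l -> is_pd b g p m ->
  is_pd b (fun q => f q * g q) p (l * g p + f p * m).
Proof.
intros Hf Hg; unfold is_pd.
apply is_derive_ext with (fun t => slice b f p t * slice b g p t); [now destruct b|].
rewrite <- (slice_crd b f p), <- (slice_crd b g p).
exact (is_derive_mult _ _ _ _ _ Hf Hg Rmult_comm).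
Qed.

Lemma is_pd_comp b (u : R -> R) f p l m :
  is_derive u (f p) l -> is_pd b f p m -> is_pd b (fun q => u (f q)) p (l * m).
Proof.
intros Hu Hf; unfold is_pd.
apply is_derive_ext with (fun t => u (slice b f p t)); [now destruct b|].
rewrite Rmult_comm.
apply (is_derive_comp u (slice b f p)); [|exact Hf].
now rewrite slice_crd.
Qed.

Lemma is_pd_inv b f p l : f p <> 0 -> is_pd b f p l ->
  is_pd b (fun q => / f q) p (- / (f p * f p) * l).
Proof.
intros Hf H; apply is_pd_comp; [|exact H].
auto_derive; [exact Hf|]. now field.
Qed.

Lemma is_pd_div b f g p l m : g p <> 0 -> is_pd b f p l -> is_pd b g p m ->
  is_pd b (fun q => f q / g q) p (l * / g p + f p * (- / (g p * g p) * m)).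
Proof. intros; apply is_pd_mult; [assumption|]. now apply is_pd_inv. Qed.

Lemma is_pd_ln b f p l : 0 < f p -> is_pd b f p l ->
  is_pd b (fun q => ln (f q)) p (/ f p * l).
Proof. intros Hf H; apply is_pd_comp; [now apply is_derive_ln|exact H]. Qed.

Lemma is_pd_pow2 b f p l : is_pd b f p l ->
  is_pd b (fun q => f q ^ 2) p (2 * f p * l).
Proof.
intros H; apply (is_pd_comp b (fun x => x ^ 2)); [|exact H].
auto_derive; [exact I|ring].
Qed.

(** [smooth_on] ranges over words of derivatives. Here the innermost derivative is peeled off
    instead, so that closure under products and inverses is an induction on the order. *)
Fixpoint Ck (k : nat) (Om : C -> Prop) (f : C -> R) : Prop :=
  (forall p, Om p -> continuous f p) /\
  match k with
  | O => True
  | S k' => forall b, (forall p, Om p -> is_pd b f p (pd b f p)) /\ Ck k' Om (pd b f)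
  end.

Lemma Ck_continuous k Om f : Ck k Om f -> forall p, Om p -> continuous f p.
Proof. destruct k; intros [H _]; exact H. Qed.

Lemma Ck_le k Om f : Ck (S k) Om f -> Ck k Om f.
Proof.
revert f; induction k; intros f [H1 H2]; split; try exact H1; auto.
intros b; destruct (H2 b) as [H3 H4]; split; [exact H3|]; now apply IHk.
Qed.

Lemma pds_app l b f : pds (l ++ b :: nil) f = pds l (pd b f).
Proof. induction l as [|c l IH]; simpl; [reflexivity|now rewrite IH]. Qed.

Lemma smooth_pd Om f b : smooth_on Om f -> smooth_on Om (pd b f).
Proof. intros H l p Hp. rewrite <- pds_app. now apply H. Qed.

Lemma smooth_is_pd Om f b p : smooth_on Om f -> Om p -> is_pd b f p (pd b f p).
Proof.
intros H Hp; rewrite pd_Derive; apply Derive_correct.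
destruct (H nil p Hp) as [H1 [H2 _]]; destruct b; assumption.
Qed.

Lemma smooth_continuous Om f p : smooth_on Om f -> Om p -> continuous f p.
Proof. intros H Hp; apply (H nil p Hp). Qed.

Lemma smooth_Ck Om f : smooth_on Om f -> forall k, Ck k Om f.
Proof.
intros H k; revert f H; induction k; intros f H; split; auto.
- intros p Hp; now apply (smooth_continuous Om).
- intros p Hp; now apply (smooth_continuous Om).
- intros b; split; [intros p Hp; now apply (smooth_is_pd Om)|].
  apply IHk; now apply smooth_pd.
Qed.

Lemma Ck_smooth Om f : (forall k, Ck k Om f) -> smooth_on Om f.
Proof.
intros H l; revert f H; induction l as [|b l IH] using rev_ind; intros f H p Hp.
- destruct (H 1%nat) as [H1 H2]; simpl; repeat split; [| |now apply H1].
  + exists (pd false f p); now apply (H2 false).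
  + exists (pd true f p); now apply (H2 true).
- rewrite pds_app; apply IH; [|exact Hp].
  intros k; apply (H (S k)).
Qed.

Section OpenDomain.
Variable Om : C -> Prop.
Hypothesis HOm : open Om.

Lemma locally_on (P : C -> Prop) p :
  (forall q, Om q -> P q) -> Om p -> locally p P.
Proof. intros H Hp; generalize (HOm p Hp); now apply filter_imp. Qed.

Lemma pd_ext_on b f g : (forall q, Om q -> f q = g q) ->
  forall p, Om p -> pd b f p = pd b g p.
Proof.
intros E p Hp; rewrite !pd_Derive; apply Derive_ext_loc.
assert (L : locally p (fun q => f q = g q)) by now apply locally_on.
apply (locally_slice b) in L; revert L; apply filter_imp.
intros t; now destruct b.
Qed.

Lemma is_pd_ext_on b f g p l : (forall q, Om q -> f q = g q) -> Om p ->
  is_pd b f p l -> is_pd b g p l.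
Proof. intros E Hp; apply is_pd_ext_loc; now apply locally_on. Qed.

Lemma is_pd_eq_on b f g p l m : (forall q, Om q -> f q = g q) -> Om p ->
  is_pd b f p l -> is_pd b g p m -> l = m.
Proof.
intros E Hp Hf Hg.
apply (is_pd_ext_on b f g p l E Hp) in Hf.
now rewrite <- (is_pd_unique _ _ _ _ Hf), <- (is_pd_unique _ _ _ _ Hg).
Qed.

Lemma Ck_ext k (f g : C -> R) : (forall q, Om q -> f q = g q) -> Ck k Om f -> Ck k Om g.
Proof.
assert (Hc : forall f g : C -> R, (forall q, Om q -> f q = g q) ->
  (forall p, Om p -> continuous f p) -> forall p, Om p -> continuous g p).
{ intros u v E Hu p Hp; apply continuous_ext_loc with u; [|now apply Hu].
  apply locally_on; [|exact Hp]. intros q Hq; now apply E. }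
revert f g; induction k; intros f g E [H1 H2]; (split; [now apply (Hc f)|]); auto.
intros b; destruct (H2 b) as [H3 H4]; split.
- intros p Hp; rewrite <- (pd_ext_on b f g E p Hp).
  apply (is_pd_ext_on b f g); auto.
- apply IHk with (pd b f); [|exact H4]. now apply pd_ext_on.
Qed.

(** The derivatives may be given by any formula valid on [Om], which is how differential equations
    and calculus rules feed the inductions on the order. *)
Lemma Ck_S k (f : C -> R) (df : bool -> C -> R) :
  (forall p, Om p -> continuous f p) ->
  (forall b p, Om p -> is_pd b f p (df b p)) ->
  (forall b, Ck k Om (df b)) -> Ck (S k) Om f.
Proof.
intros H1 H2 H3; split; [exact H1|]; intros b; split.
- intros p Hp; rewrite (is_pd_unique _ _ _ _ (H2 b p Hp)); now apply H2.
- apply Ck_ext with (df b); [|apply H3].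
  intros q Hq; symmetry; apply is_pd_unique; now apply H2.
Qed.

Lemma smooth_ext f g : (forall q, Om q -> f q = g q) -> smooth_on Om f -> smooth_on Om g.
Proof. intros E H; apply Ck_smooth; intros k; apply Ck_ext with f; auto; now apply smooth_Ck. Qed.

Lemma Ck_const k c : Ck k Om (fun _ => c).
Proof.
revert c; induction k; intros c.
- split; auto; intros; apply continuous_const.
- apply Ck_S with (fun _ _ => 0); auto.
  + intros; apply continuous_const.
  + intros; apply is_pd_const.
Qed.

Lemma Ck_plus k f g : Ck k Om f -> Ck k Om g -> Ck k Om (fun q => f q + g q).
Proof.
revert f g; induction k; intros f g Hf Hg.
- split; auto; intros p Hp; apply (continuous_plus (V := R_NormedModule));
    eapply Ck_continuous; eauto.
- apply Ck_S with (fun b q => pd b f q + pd b g q).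
  + intros p Hp; apply (continuous_plus (V := R_NormedModule)); eapply Ck_continuous; eauto.
  + intros b p Hp; apply is_pd_plus; [apply Hf|apply Hg]; exact Hp.
  + intros b; apply IHk; [apply Hf|apply Hg].
Qed.

Lemma Ck_mult k f g : Ck k Om f -> Ck k Om g -> Ck k Om (fun q => f q * g q).
Proof.
revert f g; induction k; intros f g Hf Hg.
- split; auto; intros p Hp; apply (continuous_mult (K := R_AbsRing));
    eapply Ck_continuous; eauto.
- apply Ck_S with (fun b q => pd b f q * g q + f q * pd b g q).
  + intros p Hp; apply (continuous_mult (K := R_AbsRing)); eapply Ck_continuous; eauto.
  + intros b p Hp; apply is_pd_mult; [apply Hf|apply Hg]; exact Hp.
  + intros b; apply Ck_plus; apply IHk; try (now apply Ck_le); [apply Hf|apply Hg].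
Qed.

(** The derivative is expressed through [/ f] itself, to which the induction hypothesis of one order
    less applies. *)
Lemma Ck_inv k f : (forall p, Om p -> f p <> 0) -> Ck k Om f -> Ck k Om (fun q => / f q).
Proof.
intros Hn.
assert (Hc : forall k, Ck k Om f -> forall p, Om p -> continuous (fun q => / f q) p).
{ intros k' Hf p Hp; apply (continuous_comp f Rinv).
  - eapply Ck_continuous; eauto.
  - apply continuous_Rinv; now apply Hn. }
induction k; intros Hf.
- split; auto; intros; now apply (Hc O).
- apply Ck_S with (fun b q => (-1) * (/ f q * / f q) * pd b f q).
  + now apply (Hc (S k)).
  + intros b p Hp; eapply is_pd_val; [apply is_pd_inv; [now apply Hn|apply Hf; exact Hp]|].
    cbv beta; field; now apply Hn.
  + intros b; assert (Hi : Ck k Om (fun q => / f q)) by (apply IHk; now apply Ck_le).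
    apply Ck_mult; [|apply Hf].
    apply Ck_mult; [apply Ck_const|now apply Ck_mult].
Qed.

Lemma smooth_const c : smooth_on Om (fun _ => c).
Proof. apply Ck_smooth; intros k; apply Ck_const. Qed.

Lemma smooth_plus f g : smooth_on Om f -> smooth_on Om g -> smooth_on Om (fun q => f q + g q).
Proof. intros Hf Hg; apply Ck_smooth; intros k; apply Ck_plus; now apply smooth_Ck. Qed.

Lemma smooth_mult f g : smooth_on Om f -> smooth_on Om g -> smooth_on Om (fun q => f q * g q).
Proof. intros Hf Hg; apply Ck_smooth; intros k; apply Ck_mult; now apply smooth_Ck. Qed.

Lemma smooth_inv f : (forall p, Om p -> f p <> 0) -> smooth_on Om f -> smooth_on Om (fun q => / f q).
Proof. intros Hn Hf; apply Ck_smooth; intros k; apply Ck_inv; auto; now apply smooth_Ck. Qed.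

Lemma smooth_opp f : smooth_on Om f -> smooth_on Om (fun q => - f q).
Proof.
intros Hf; apply smooth_ext with (fun q => -1 * f q); [intros; ring|].
apply smooth_mult; [apply smooth_const|exact Hf].
Qed.

Lemma smooth_minus f g : smooth_on Om f -> smooth_on Om g -> smooth_on Om (fun q => f q - g q).
Proof. intros Hf Hg; apply smooth_plus; [exact Hf|now apply smooth_opp]. Qed.

Lemma smooth_div f g : (forall p, Om p -> g p <> 0) ->
  smooth_on Om f -> smooth_on Om g -> smooth_on Om (fun q => f q / g q).
Proof. intros Hn Hf Hg; apply smooth_mult; [exact Hf|now apply smooth_inv]. Qed.

Lemma smooth_S (f : C -> R) (df : bool -> C -> R) :
  (forall p, Om p -> continuous f p) ->
  (forall b p, Om p -> is_pd b f p (df b p)) ->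
  (forall b, smooth_on Om (df b)) -> smooth_on Om f.
Proof.
intros H1 H2 H3; apply Ck_smooth; intros [|k]; [split; auto|].
apply Ck_S with df; auto; intros b; now apply smooth_Ck.
Qed.

Lemma smooth_ln f : (forall p, Om p -> 0 < f p) -> smooth_on Om f -> smooth_on Om (fun q => ln (f q)).
Proof.
intros Hp Hf; apply smooth_S with (fun b q => / f q * pd b f q).
- intros p HpO; apply (continuous_comp f ln); [now apply (smooth_continuous Om)|].
  apply continuous_ln; now apply Hp.
- intros b p HpO; apply is_pd_ln; [now apply Hp|now apply (smooth_is_pd Om)].
- intros b; apply smooth_mult; [|now apply smooth_pd].
  apply smooth_inv; [|exact Hf]. intros p HpO; apply Rgt_not_eq; now apply Hp.
Qed.

Lemma smooth_sub (U : C -> Prop) f : (forall p, U p -> Om p) -> smooth_on Om f -> smooth_on U f.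
Proof. intros HU H l p Hp; apply H; now apply HU. Qed.

Lemma continuous_2d (f : C -> R) x y : continuous f (x, y) ->
  continuity_2d_pt (fun u v => f (u, v)) x y.
Proof.
intros H; apply continuity_2d_pt_filterlim.
apply filterlim_ext with f; [intros [u v]; reflexivity|exact H].
Qed.

Lemma pd_comm f p : smooth_on Om f -> Om p ->
  pd true (pd false f) p = pd false (pd true f) p.
Proof.
intros Hf Hp; destruct p as [x y].
symmetry.
assert (S := Schwarz (fun u v => f (u, v)) x y).
apply S; clear S.
- apply locally_2d_locally.
  apply (locally_on (fun z => _ /\ _ /\ _ /\ _)); [|exact Hp].
  intros [u v] Hq; simpl; repeat split.
  + exists (pd false f (u, v)); exact (smooth_is_pd Om f false (u, v) Hf Hq).
  + exists (pd true f (u, v)); exact (smooth_is_pd Om f true (u, v) Hf Hq).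
  + exists (pd false (pd true f) (u, v));
      exact (smooth_is_pd Om _ false (u, v) (smooth_pd _ _ _ Hf) Hq).
  + exists (pd true (pd false f) (u, v));
      exact (smooth_is_pd Om _ true (u, v) (smooth_pd _ _ _ Hf) Hq).
- apply (continuous_2d (pd false (pd true f)));
    apply (smooth_continuous Om); auto; now do 2 apply smooth_pd.
- apply (continuous_2d (pd true (pd false f)));
    apply (smooth_continuous Om); auto; now do 2 apply smooth_pd.
Qed.

End OpenDomain.

(** Structural decomposition of the function; the nonvanishing of denominators is left as a goal. *)
Ltac smooth :=
  cbv beta;
  first [ eassumption | lazymatch goal with
  | |- smooth_on _ (fun q => @?f q + @?g q) => apply (smooth_plus _ ltac:(eassumption) f g); smooth
  | |- smooth_on _ (fun q => @?f q - @?g q) => apply (smooth_minus _ ltac:(eassumption) f g); smooth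
  | |- smooth_on _ (fun q => @?f q * @?g q) => apply (smooth_mult _ ltac:(eassumption) f g); smooth
  | |- smooth_on _ (fun q => @?f q / @?g q) => apply (smooth_div _ ltac:(eassumption) f g); [|smooth|smooth]
  | |- smooth_on _ (fun q => - @?f q) => apply (smooth_opp _ ltac:(eassumption) f); smooth
  | |- smooth_on _ (fun q => / @?f q) => apply (smooth_inv _ ltac:(eassumption) f); [|smooth]
  | |- smooth_on _ (fun q => pd _ _ q) => apply smooth_pd; smooth
  | |- smooth_on _ (pd _ _) => apply smooth_pd; smooth
  | |- smooth_on ?U (fun q => ?f q) => change (smooth_on U f); first [eassumption | solve [eauto 3] | idtac]
  | |- smooth_on _ (fun q => ?c) => apply (smooth_const _ ltac:(eassumption) c)
  | _ => first [solve [eauto 3] | idtac] end ].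

(** Synthesises the derivative from the syntax of the function. Leaves are looked up in the context
    before falling back to [pd], so that a differential equation present as a hypothesis is used
    automatically; nonvanishing of denominators is left as a goal. *)
Ltac pdauto :=
  cbv beta;
  first [ eassumption | simple apply is_pd_const | lazymatch goal with
  | |- is_pd _ (fun q => @?f q + @?g q) _ _ => apply (is_pd_plus _ f g); pdauto
  | |- is_pd _ (fun q => @?f q - @?g q) _ _ => apply (is_pd_minus _ f g); pdauto
  | |- is_pd _ (fun q => @?f q * @?g q) _ _ => apply (is_pd_mult _ f g); pdauto
  | |- is_pd _ (fun q => @?f q / @?g q) _ _ => apply (is_pd_div _ f g); [|pdauto|pdauto]
  | |- is_pd _ (fun q => - @?f q) _ _ => apply (is_pd_opp _ f); pdauto
  | |- is_pd _ (fun q => / @?f q) _ _ => apply (is_pd_inv _ f); [|pdauto]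
  | |- is_pd _ (fun q => @?f q ^ 2) _ _ => apply (is_pd_pow2 _ f); pdauto
  | |- is_pd ?b (fun q => ?f q) ?p ?l => change (is_pd b f p l);
      first [eassumption | eapply (smooth_is_pd _ f b p); [smooth|eassumption]]
  | |- is_pd ?b ?f ?p ?l => eapply (smooth_is_pd _ f b p); [smooth|eassumption] end ].

(** * Linear ordinary differential equations *)

(** Connectedness of the unit interval, by the supremum of the initial segments on which [P] holds.
    The local hypothesis is symmetric in [s] and [s']: it serves both to reach the supremum and to
    go beyond it. *)
Lemma interval_induction (P : R -> Prop) : P 0 ->
  (forall t, 0 <= t <= 1 -> exists d, 0 < d /\ forall s s', 0 <= s <= 1 -> 0 <= s' <= 1 ->
     Rabs (s - t) < d -> Rabs (s' - t) < d -> P s -> P s') ->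
  forall t, 0 <= t <= 1 -> P t.
Proof.
intros P0 Hloc.
set (E := fun x => 0 <= x <= 1 /\ forall s, 0 <= s <= x -> P s).
assert (E0 : E 0).
{ split; [lra|]; intros s Hs; replace s with 0 by lra; exact P0. }
destruct (completeness E) as [m [Hub Hlub]].
{ exists 1; intros x [Hx _]; lra. }
{ exists 0; exact E0. }
assert (Hm : 0 <= m <= 1).
{ split; [apply Hub, E0|]; apply Hlub; intros x [Hx _]; lra. }
destruct (Hloc m Hm) as [d [Hd Hdloc]].
assert (Hx : exists x, E x /\ m - d < x).
{ destruct (Classical_Prop.classic (exists x, E x /\ m - d < x)) as [H|H]; [exact H|].
  exfalso; assert (m <= m - d); [|lra].
  apply Hlub; intros x Hx; apply Rnot_lt_le; intros Hl; apply H; now exists x. }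
destruct Hx as [x [[Hx1 Hx2] Hxm]].
assert (Hxle : x <= m) by (apply Hub; split; assumption).
assert (Hall : forall s, 0 <= s <= 1 -> s < m + d -> P s).
{ intros s Hs Hsm; destruct (Rle_lt_dec s x) as [H|H]; [apply Hx2; lra|].
  apply (Hdloc x s Hx1 Hs); [apply Rabs_def1; lra..|apply Hx2; lra]. }
assert (Hm1 : m = 1).
{ apply Rle_antisym; [lra|].
  apply Rnot_lt_le; intros Hlt.
  assert (E (Rmin 1 (m + d / 2))).
  { split; [split; [apply Rmin_glb; lra|apply Rmin_l]|].
    intros s Hs; assert (H1 := Rmin_l 1 (m + d / 2)); assert (H2 := Rmin_r 1 (m + d / 2)).
    apply Hall; lra. }
  apply Hub in H; revert H; apply Rmin_case; lra. }
intros t Ht; apply Hall; lra.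
Qed.

Lemma ball_C (c p : C) (r : R) : ball c r p <-> Rabs (fst p - fst c) < r /\ Rabs (snd p - snd c) < r.
Proof. reflexivity. Qed.

(** A locally constant property pulled back along a path satisfies the local hypothesis of
    [interval_induction], by continuity of the path. *)
Lemma path_propagation (Om : C -> Prop) (S : C -> Prop) (g : R -> C) :
  path_in Om g ->
  (forall p, Om p -> exists r : posreal, forall q q', ball p r q -> ball p r q' ->
     Om q -> Om q' -> S q -> S q') ->
  S (g 0) -> forall t, 0 <= t <= 1 -> S (g t).
Proof.
intros [Hc Hg] Hloc H0.
apply interval_induction; [exact H0|].
intros t Ht; destruct (Hloc (g t) (Hg t Ht)) as [r Hr].
destruct (Hc t (ball (g t) r) (locally_ball _ r)) as [d Hd].
exists d; split; [apply cond_pos|].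
intros s s' Hs Hs' H1 H2; apply Hr; [apply Hd, H1|apply Hd, H2|now apply Hg|now apply Hg].
Qed.

Fixpoint vsum (n : nat) (f : nat -> R) : R :=
  match n with O => 0 | S m => vsum m f + f m end.

Lemma vsum_ext n f g : (forall i, (i < n)%nat -> f i = g i) -> vsum n f = vsum n g.
Proof.
intros H; induction n; simpl; [reflexivity|].
rewrite IHn by (intros; apply H; lia). rewrite H by lia; reflexivity.
Qed.

Lemma vsum_le n f g : (forall i, (i < n)%nat -> f i <= g i) -> vsum n f <= vsum n g.
Proof.
intros H; induction n; simpl; [lra|].
apply Rplus_le_compat; [apply IHn; intros; apply H; lia|apply H; lia].
Qed.

Lemma vsum_scal n c f : vsum n (fun i => c * f i) = c * vsum n f.
Proof. induction n; simpl; [ring|rewrite IHn; ring]. Qed.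

Lemma vsum_plus n f g : vsum n (fun i => f i + g i) = vsum n f + vsum n g.
Proof. induction n; simpl; [ring|rewrite IHn; ring]. Qed.

Lemma vsum_minus n f g : vsum n (fun i => f i - g i) = vsum n f - vsum n g.
Proof. induction n; simpl; [ring|rewrite IHn; ring]. Qed.

Lemma vsum_const n c : vsum n (fun _ => c) = INR n * c.
Proof. induction n; [simpl; ring|]. rewrite S_INR; simpl; rewrite IHn; ring. Qed.

Lemma vsum_abs n f : Rabs (vsum n f) <= vsum n (fun i => Rabs (f i)).
Proof.
induction n; simpl; [rewrite Rabs_R0; lra|].
eapply Rle_trans; [apply Rabs_triang|]; lra.
Qed.

Lemma vsum_pos n f : (forall i, (i < n)%nat -> 0 <= f i) -> 0 <= vsum n f.
Proof.
intros H; rewrite <- (Rmult_0_r (INR n)), <- vsum_const; now apply vsum_le.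
Qed.

Lemma vsum_term n f i : (forall i, (i < n)%nat -> 0 <= f i) -> (i < n)%nat -> f i <= vsum n f.
Proof.
intros H Hi; induction n; [lia|simpl].
assert (0 <= vsum n f) by (apply vsum_pos; intros; apply H; lia).
destruct (Nat.eq_dec i n) as [->|]; [lra|].
assert (f i <= vsum n f) by (apply IHn; [intros; apply H|]; lia).
assert (0 <= f n) by (apply H; lia); lra.
Qed.

Lemma vsum_continuous (U : UniformSpace) n (f : nat -> U -> R) x :
  (forall i, (i < n)%nat -> continuous (f i) x) -> continuous (fun t => vsum n (fun i => f i t)) x.
Proof.
intros H; induction n; simpl; [apply continuous_const|].
apply (continuous_plus (V := R_NormedModule)); [apply IHn; intros; apply H|apply H]; lia.
Qed.

Lemma vsum_lin_bound n (M v : nat -> R) K : (forall j, (j < n)%nat -> Rabs (M j) <= K) ->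
  Rabs (vsum n (fun j => M j * v j)) <= K * vsum n (fun j => Rabs (v j)).
Proof.
intros H; eapply Rle_trans; [apply vsum_abs|].
rewrite <- vsum_scal; apply vsum_le; intros i Hi.
rewrite Rabs_mult; apply Rmult_le_compat_r; [apply Rabs_pos|now apply H].
Qed.

(* Gronwall estimate on an interval so short that no exponential is needed. *)
Lemma linear_ode_bound n (M : nat -> nat -> R -> R) (E r : nat -> R -> R) a b c K rho :
  a <= b -> a <= c <= b -> 0 <= K -> 0 <= rho -> INR n * (b - a) * K <= 1 / 2 ->
  (forall i t, (i < n)%nat -> a <= t <= b ->
     is_derive (E i) t (vsum n (fun j => M i j t * E j t) + r i t)) ->
  (forall i j t, (i < n)%nat -> (j < n)%nat -> a <= t <= b -> Rabs (M i j t) <= K) ->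
  (forall i t, (i < n)%nat -> a <= t <= b -> Rabs (r i t) <= rho) ->
  forall t, a <= t <= b ->
    vsum n (fun i => Rabs (E i t)) <= 2 * vsum n (fun i => Rabs (E i c)) + 2 * (INR n * (b - a) * rho).
Proof.
intros Hab Hc HK Hrho Hs HE HM Hr.
set (nu := fun t => vsum n (fun i => Rabs (E i t))).
destruct (continuity_ab_maj nu a b Hab) as [x [Hx Hxab]].
{ intros t Ht; apply continuity_pt_filterlim.
  apply (vsum_continuous _ n (fun i t => Rabs (E i t))); intros i Hi.
  apply continuous_comp; [|apply continuous_Rabs].
  apply (ex_derive_continuous (K := R_AbsRing) (V := R_NormedModule)).
  eexists; now apply HE. }
assert (Hn : 0 <= INR n) by apply pos_INR.
(* The mean value theorem between [c] and the maximum point [x] bounds [nu x] by [nu c] plus at most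
   half of [nu x] and the source; the half is then absorbed. *)
assert (Hxc : nu x <= nu c + INR n * (b - a) * (K * nu x + rho)).
{ unfold nu at 1. apply Rle_trans with (vsum n (fun i => Rabs (E i c) + (b - a) * (K * nu x + rho))).
  2: { rewrite vsum_plus, vsum_const; unfold nu; lra. }
  apply vsum_le; intros i Hi.
  assert (HS : forall y, a <= y <= b ->
    Rabs (vsum n (fun j => M i j y * E j y) + r i y) <= K * nu x + rho).
  { intros y Hy; eapply Rle_trans; [apply Rabs_triang|].
    apply Rplus_le_compat; [|now apply Hr].
    eapply Rle_trans; [apply (vsum_lin_bound n _ _ K); intros; now apply HM|].
    apply Rmult_le_compat_l; [exact HK|]. now apply Hx. }
  assert (Hmm : forall y, Rmin c x <= y <= Rmax c x -> a <= y <= b).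
  { intros y; unfold Rmin, Rmax; destruct (Rle_dec c x); lra. }
  destruct (MVT_gen (E i) c x (fun y => vsum n (fun j => M i j y * E j y) + r i y)) as [y [Hy1 Hy2]].
  - intros y Hy; apply HE; [exact Hi|]; apply Hmm; lra.
  - intros y Hy; apply continuity_pt_filterlim.
    apply (ex_derive_continuous (K := R_AbsRing) (V := R_NormedModule)).
    eexists; apply HE; auto.
  - replace (E i x) with (E i c + (E i x - E i c)) by ring.
    rewrite Hy2. eapply Rle_trans; [apply Rabs_triang|]; apply Rplus_le_compat_l.
    rewrite Rabs_mult, Rmult_comm; apply Rmult_le_compat; try apply Rabs_pos.
    + apply Rabs_le; lra.
    + apply HS, Hmm, Hy1. }
assert (Hnx : 0 <= nu x) by (apply vsum_pos; intros; apply Rabs_pos).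
assert (INR n * (b - a) * K * nu x <= 1 / 2 * nu x) by now apply Rmult_le_compat_r.
intros t Ht; apply Rle_trans with (nu x); [now apply Hx|].
fold (nu c); lra.
Qed.

Lemma geometric_series_bound (a : nat -> R) A : (forall m, Rabs (a m) <= A * (1 / 2) ^ m) ->
  ex_series a /\ Rabs (Series a) <= 2 * A.
Proof.
intros H.
assert (Hg : is_series (fun m => A * (1 / 2) ^ m) (A * / (1 - 1 / 2))).
{ apply (is_series_scal (V := R_NormedModule)); apply is_series_geom; rewrite Rabs_pos_eq; lra. }
assert (Habs : ex_series (fun m => Rabs (a m))).
{ apply (ex_series_le (V := R_CompleteNormedModule)) with (fun m => A * (1 / 2) ^ m).
  - intros m; change (norm (Rabs (a m))) with (Rabs (Rabs (a m))); rewrite Rabs_Rabsolu; apply H.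
  - eexists; exact Hg. }
split; [now apply ex_series_Rabs|].
eapply Rle_trans; [now apply Series_Rabs|].
replace (2 * A) with (Series (fun m => A * (1 / 2) ^ m)).
- apply Series_le; [intros m; split; [apply Rabs_pos|apply H]|eexists; exact Hg].
- rewrite (is_series_unique _ _ Hg); field.
Qed.

Lemma geometric_series_tail (a : nat -> R) A N : (forall m, Rabs (a m) <= A * (1 / 2) ^ m) ->
  Rabs (Series a - vsum N a) <= 2 * A * (1 / 2) ^ N.
Proof.
intros H; destruct (geometric_series_bound a A H) as [Hex _].
assert (E : Series a - vsum N a = Series (fun k => a (N + k)%nat)).
{ induction N as [|N IH]; [simpl; rewrite Rminus_0_r; reflexivity|].
  simpl; replace (Series a - (vsum N a + a N)) with (Series a - vsum N a - a N) by ring.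
  rewrite IH, Series_incr_1.
  - rewrite Nat.add_0_r.
    rewrite (Series_ext (fun k => a (N + S k)%nat) (fun k => a (S (N + k)))).
    + ring.
    + intros k; now rewrite <- plus_n_Sm.
  - now apply (ex_series_incr_n a N). }
rewrite E. replace (2 * A * (1 / 2) ^ N) with (2 * (A * (1 / 2) ^ N)) by ring.
apply geometric_series_bound; intros m.
eapply Rle_trans; [apply H|]; rewrite pow_add; lra.
Qed.

(** Restates an equality in the carrier of an algebraic structure as one in [R], where [ring]
    recognises it. *)
Ltac toR := match goal with |- @eq _ ?a ?b => change (@eq R a b) end.

(** * Picard iteration for linear differential equations *)

Section Picard.
Variables (n : nat) (M : nat -> nat -> R -> R) (v : nat -> R) (c d K : R).
Hypothesis Hd : 0 <= d.
Hypothesis HK : 0 <= K.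
Hypothesis Hsmall : INR n * d * K <= 1 / 2.
Hypothesis HMc : forall i j t, (i < n)%nat -> (j < n)%nat -> continuous (M i j) t.
Hypothesis HMb : forall i j t, (i < n)%nat -> (j < n)%nat -> Rabs (M i j t) <= K.

(** Clamping the upper limit of integration makes every iterate continuous and bounded on the whole
    line, without changing it on the interval of interest. *)
Definition clamp (t : R) : R := Rmax (c - d) (Rmin (c + d) t).

Lemma clamp_id t : c - d <= t <= c + d -> clamp t = t.
Proof. intros H; unfold clamp; rewrite Rmin_right, Rmax_right; lra. Qed.

Lemma clamp_in t : c - d <= clamp t <= c + d.
Proof.
unfold clamp; split; [apply Rmax_l|].
apply Rmax_lub; [lra|apply Rmin_l].
Qed.

Lemma clamp_lip s t : Rabs (clamp s - clamp t) <= Rabs (s - t).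
Proof.
unfold clamp, Rmin, Rmax.
destruct (Rle_dec (c + d) s), (Rle_dec (c + d) t);
repeat match goal with |- context [Rle_dec ?x ?y] => destruct (Rle_dec x y) end;
unfold Rabs; repeat match goal with |- context [Rcase_abs ?x] => destruct (Rcase_abs x) end; lra.
Qed.

(** The [m]-th term of the Neumann series rather than the [m]-th Picard approximation; the solution
    is the sum of these terms. *)
Fixpoint picard (m : nat) (i : nat) (t : R) : R :=
  match m with
  | O => v i
  | S m' => RInt (fun s => vsum n (fun j => M i j s * picard m' j s)) c (clamp t)
  end.

Let V := vsum n (fun i => Rabs (v i)).

Lemma abs_RInt_bound (f : R -> R) a b B : (forall t, continuous f t) -> (forall t, Rabs (f t) <= B) ->
  Rabs (RInt f a b) <= Rabs (b - a) * B.
Proof.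
intros Hc Hb.
assert (Hex : forall a b, ex_RInt f a b).
{ intros x y; apply (ex_RInt_continuous (V := R_CompleteNormedModule)); auto. }
destruct (Rle_dec a b) as [H|H].
- rewrite (Rabs_pos_eq (b - a)) by lra; apply abs_RInt_le_const; auto.
- rewrite <- opp_RInt_swap by apply Hex.
  change (opp (RInt f b a)) with (- RInt f b a); rewrite Rabs_Ropp, (Rabs_left1 (b - a)) by lra.
  replace (- (b - a)) with (a - b) by ring. apply abs_RInt_le_const; auto; lra.
Qed.

Lemma RInt_lip (f : R -> R) B s t : (forall t, continuous f t) -> (forall t, Rabs (f t) <= B) ->
  Rabs (RInt f c (clamp s) - RInt f c (clamp t)) <= B * Rabs (s - t).
Proof.
intros Hc Hb.
assert (Hex : forall a b, ex_RInt f a b).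
{ intros x y; apply (ex_RInt_continuous (V := R_CompleteNormedModule)); auto. }
replace (RInt f c (clamp s) - RInt f c (clamp t)) with (RInt f (clamp t) (clamp s)).
- eapply Rle_trans; [now apply (abs_RInt_bound _ _ _ B)|].
  rewrite Rmult_comm; apply Rmult_le_compat_l; [|apply clamp_lip].
  eapply Rle_trans; [apply Rabs_pos|apply (Hb 0)].
- assert (HC := RInt_Chasles f c (clamp t) (clamp s) (Hex _ _) (Hex _ _)).
  change (RInt f c (clamp t) + RInt f (clamp t) (clamp s) = RInt f c (clamp s)) in HC; lra.
Qed.

Lemma lip_continuous (f : R -> R) B : (forall s t, Rabs (f s - f t) <= B * Rabs (s - t)) ->
  forall t, continuous f t.
Proof.
intros H t; apply filterlim_locally; intros eps.
assert (HB : 0 < Rabs B + 1) by (assert (H1 := Rabs_pos B); lra).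
assert (He : 0 < eps / (Rabs B + 1)) by (apply Rdiv_lt_0_compat; [apply cond_pos|exact HB]).
exists (mkposreal _ He); intros s Hs.
change (Rabs (s - t) < eps / (Rabs B + 1)) in Hs.
change (Rabs (f s - f t) < eps).
eapply Rle_lt_trans; [apply H|].
apply Rle_lt_trans with ((Rabs B + 1) * Rabs (s - t)).
- apply Rmult_le_compat_r; [apply Rabs_pos|]; assert (H1 := Rle_abs B); lra.
- apply Rlt_le_trans with ((Rabs B + 1) * (eps / (Rabs B + 1))).
  + now apply Rmult_lt_compat_l.
  + right; field; lra.
Qed.

(** Integration against [M] over a distance at most [d] has norm at most [INR n * d * K <= 1 / 2],
    hence the factor [1 / 2] at each step. *)
Lemma picard_spec m :
  (forall i t, (i < n)%nat -> continuous (picard m i) t) /\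
  (forall t, vsum n (fun i => Rabs (picard m i t)) <= V * (1 / 2) ^ m).
Proof.
induction m as [|m [IH1 IH2]]; simpl.
- split; [intros; apply continuous_const|intros _; unfold V; lra].
- assert (Hc : forall i t, (i < n)%nat ->
    continuous (fun s => vsum n (fun j => M i j s * picard m j s)) t).
  { intros i t Hi; apply (vsum_continuous _ n (fun j s => M i j s * picard m j s)); intros j Hj.
    apply (continuous_mult (K := R_AbsRing)); [now apply HMc|now apply IH1]. }
  assert (Hb : forall i t, (i < n)%nat ->
    Rabs (vsum n (fun j => M i j t * picard m j t)) <= K * (V * (1 / 2) ^ m)).
  { intros i t Hi; eapply Rle_trans; [apply (vsum_lin_bound n _ _ K); intros; now apply HMb|].
    now apply Rmult_le_compat_l. }
  split.
  + intros i t Hi; apply (lip_continuous _ (K * (V * (1 / 2) ^ m))); intros s t'.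
    apply RInt_lip; intros; [now apply Hc|now apply Hb].
  + intros t; apply Rle_trans with (vsum n (fun i => d * (K * (V * (1 / 2) ^ m)))).
    * apply vsum_le; intros i Hi.
      eapply Rle_trans; [apply (abs_RInt_bound _ _ _ (K * (V * (1 / 2) ^ m)));
        intros; [now apply Hc|now apply Hb]|].
      apply Rmult_le_compat_r.
      -- eapply Rle_trans; [apply Rabs_pos|]; apply (Hb i 0 Hi).
      -- assert (H := clamp_in t); apply Rabs_le; lra.
    * rewrite vsum_const.
      assert (HV : 0 <= V * (1 / 2) ^ m).
      { apply Rmult_le_pos; [apply vsum_pos; intros; apply Rabs_pos|apply pow_le; lra]. }
      assert (INR n * d * K * (V * (1 / 2) ^ m) <= 1 / 2 * (V * (1 / 2) ^ m))
        by now apply Rmult_le_compat_r.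
      lra.
Qed.

Definition picard_sol (i : nat) (t : R) : R := Series (fun m => picard m i t).

Lemma picard_term m i t : (i < n)%nat -> Rabs (picard m i t) <= V * (1 / 2) ^ m.
Proof.
intros Hi; eapply Rle_trans; [|apply (proj2 (picard_spec m) t)].
apply (vsum_term n (fun i => Rabs (picard m i t))); [intros; apply Rabs_pos|exact Hi].
Qed.

Lemma picard_sol_partial N i t : (i < n)%nat ->
  vsum N (fun m => picard (S m) i t) =
  RInt (fun s => vsum n (fun j => M i j s * vsum N (fun m => picard m j s))) c (clamp t).
Proof.
intros Hi; induction N as [|N IH]; simpl.
- rewrite (RInt_ext _ (fun _ => 0)).
  + rewrite RInt_const; unfold scal; simpl; unfold mult; simpl; ring.
  + intros s _; rewrite (vsum_ext n _ (fun j => 0 * 0)) by (intros; ring).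
    rewrite vsum_scal; toR; ring.
- simpl in IH; rewrite IH; clear IH.
  assert (Hex : forall f : nat -> R -> R, (forall j t, (j < n)%nat -> continuous (f j) t) ->
     ex_RInt (fun s => vsum n (fun j => M i j s * f j s)) c (clamp t)).
  { intros f Hf; apply (ex_RInt_continuous (V := R_CompleteNormedModule)); intros z _.
    apply (vsum_continuous _ n (fun j s => M i j s * f j s)); intros j Hj.
    apply (continuous_mult (K := R_AbsRing)); [now apply HMc|now apply Hf]. }
  symmetry; rewrite (RInt_ext _ (fun s =>
    plus (vsum n (fun j => M i j s * vsum N (fun m => picard m j s)))
         (vsum n (fun j => M i j s * picard N j s)))).
  + apply (RInt_plus (V := R_CompleteNormedModule)).
    * apply (Hex (fun j s => vsum N (fun m => picard m j s))); intros j t' Hj.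
      apply (vsum_continuous _ N (fun m s => picard m j s)); intros; now apply picard_spec.
    * apply (Hex (fun j s => picard N j s)); intros; now apply picard_spec.
  + intros s _; unfold plus; simpl; rewrite <- vsum_plus; apply vsum_ext; intros; ring.
Qed.

Lemma picard_sol_cont i t : (i < n)%nat -> continuous (picard_sol i) t.
Proof.
(* The terms have summable Lipschitz constants. One factor 2 is the sum of the geometric series, the
   other compensates for the index shift in the bound of term [S m]. *)
intros Hi; apply (lip_continuous _ (2 * (2 * (K * V)))); intros s t'.
unfold picard_sol; rewrite <- Series_minus;
  try (apply (geometric_series_bound _ V); intros; now apply picard_term).
replace (2 * (2 * (K * V)) * Rabs (s - t')) with (2 * (2 * (K * V) * Rabs (s - t'))) by ring.
assert (HV : 0 <= V) by (apply vsum_pos; intros; apply Rabs_pos).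
apply geometric_series_bound; intros [|m].
- simpl; rewrite Rminus_diag, Rabs_R0.
  assert (0 <= K * V * Rabs (s - t')) by (apply Rmult_le_pos; [now apply Rmult_le_pos|apply Rabs_pos]); lra.
- cbn [picard]. eapply Rle_trans.
  + apply (RInt_lip _ (K * (V * (1 / 2) ^ m))).
    * intros x; apply (vsum_continuous _ n (fun j s => M i j s * picard m j s)); intros j Hj.
      apply (continuous_mult (K := R_AbsRing)); [now apply HMc|now apply picard_spec].
    * intros x; eapply Rle_trans; [apply (vsum_lin_bound n _ _ K); intros; now apply HMb|].
      apply Rmult_le_compat_l; [exact HK|apply picard_spec].
  + right; simpl; field.
Qed.

(** Both sides are within a constant times [(1 / 2) ^ N] of the corresponding partial sums, for
    every [N], so their difference is zero. *)
Lemma picard_sol_eq i t : (i < n)%nat ->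
  picard_sol i t = v i + RInt (fun s => vsum n (fun j => M i j s * picard_sol j s)) c (clamp t).
Proof.
intros Hi.
set (I0 := RInt _ c (clamp t)).
assert (HV : 0 <= V) by (apply vsum_pos; intros; apply Rabs_pos).
assert (HB : forall N, Rabs (picard_sol i t - (v i + I0)) <=
   (2 * V + 2 * V * (d * (K * INR n))) * (1 / 2) ^ N).
{ intros N.
  replace (picard_sol i t - (v i + I0)) with
   ((picard_sol i t - vsum (S N) (fun m => picard m i t)) +
    (vsum N (fun m => picard (S m) i t) - I0)).
  2: { assert (E : vsum (S N) (fun m => picard m i t) = v i + vsum N (fun m => picard (S m) i t)).
       { clear; induction N; [simpl; ring|]. change (vsum (S (S N)) (fun m => picard m i t))
          with (vsum (S N) (fun m => picard m i t) + picard (S N) i t).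
         rewrite IHN; cbn [vsum]; ring. }
       rewrite E; ring. }
  eapply Rle_trans; [apply Rabs_triang|].
  rewrite Rmult_plus_distr_r; apply Rplus_le_compat.
  - eapply Rle_trans; [apply (geometric_series_tail _ V); intros; now apply picard_term|].
    simpl; assert (0 <= V * (1 / 2) ^ N) by (apply Rmult_le_pos; [exact HV|apply pow_le; lra]); lra.
  - rewrite picard_sol_partial by exact Hi; unfold I0.
    assert (Hc1 : forall s, continuous (fun s => vsum n (fun j => M i j s * vsum N (fun m => picard m j s))) s).
    { intros s; apply (vsum_continuous _ n (fun j s => M i j s * vsum N (fun m => picard m j s))); intros j Hj.
      apply (continuous_mult (K := R_AbsRing)); [now apply HMc|].
      apply (vsum_continuous _ N (fun m s => picard m j s)); intros; now apply picard_spec. }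
    assert (Hc2 : forall s, continuous (fun s => vsum n (fun j => M i j s * picard_sol j s)) s).
    { intros s; apply (vsum_continuous _ n (fun j s => M i j s * picard_sol j s)); intros j Hj.
      apply (continuous_mult (K := R_AbsRing)); [now apply HMc|now apply picard_sol_cont]. }
    assert (E := RInt_minus (V := R_CompleteNormedModule) _ _ c (clamp t)
      (ex_RInt_continuous _ c (clamp t) (fun s _ => Hc1 s))
      (ex_RInt_continuous _ c (clamp t) (fun s _ => Hc2 s))).
    unfold minus, plus, opp in E; simpl in E.
    match type of E with _ = ?r => replace (Rabs (_ - _)) with (Rabs r) by (f_equal; ring) end.
    rewrite <- E; clear E.
    eapply Rle_trans; [apply (abs_RInt_bound _ _ _ (K * (INR n * (2 * V * (1 / 2) ^ N))))|].
    + intros s; apply (continuous_plus (V := R_NormedModule)); [apply Hc1|].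
      apply (continuous_opp (V := R_NormedModule)); apply Hc2.
    + intros s.
      replace (_ + - _) with (vsum n (fun j => M i j s * (vsum N (fun m => picard m j s) - picard_sol j s))).
      * eapply Rle_trans; [apply (vsum_lin_bound n _ _ K); intros; now apply HMb|].
        apply Rmult_le_compat_l; [exact HK|].
        rewrite <- vsum_const; apply vsum_le; intros j Hj.
        rewrite Rabs_minus_sym.
        apply (geometric_series_tail (fun m => picard m j s)); intros; now apply picard_term.
      * rewrite (vsum_ext n _ (fun j => M i j s * vsum N (fun m => picard m j s) - M i j s * picard_sol j s))
          by (intros; ring).
        rewrite vsum_minus; reflexivity.
    + assert (H := clamp_in t).
      assert (0 <= K * (INR n * (2 * V * (1 / 2) ^ N))).
      { repeat apply Rmult_le_pos; try lra; [apply pos_INR|apply pow_le; lra]. }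
      apply Rle_trans with (d * (K * (INR n * (2 * V * (1 / 2) ^ N)))).
      * apply Rmult_le_compat_r; [assumption|apply Rabs_le; lra].
      * right; ring. }
assert (Hlim : is_lim_seq (fun N => (2 * V + 2 * V * (d * (K * INR n))) * (1 / 2) ^ N) 0).
{ replace (Finite 0) with (Rbar_mult (2 * V + 2 * V * (d * (K * INR n))) 0) by (simpl; f_equal; ring).
  apply is_lim_seq_scal_l; apply is_lim_seq_geom; rewrite Rabs_pos_eq; lra. }
assert (H0 : Rabs (picard_sol i t - (v i + I0)) <= 0).
{ apply (is_lim_seq_le (fun _ => Rabs (picard_sol i t - (v i + I0))) _
    (Rabs (picard_sol i t - (v i + I0))) 0 HB); [apply is_lim_seq_const|exact Hlim]. }
assert (H1 := Rabs_pos (picard_sol i t - (v i + I0))).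
assert (H2 : picard_sol i t - (v i + I0) = 0).
{ destruct (Req_dec (picard_sol i t - (v i + I0)) 0) as [|Hne]; [assumption|].
  apply Rabs_pos_lt in Hne; lra. }
lra.
Qed.

Lemma picard_sol_init i : (i < n)%nat -> picard_sol i c = v i.
Proof.
intros Hi; rewrite picard_sol_eq by exact Hi.
rewrite clamp_id by lra; rewrite RInt_point; unfold zero; simpl; ring.
Qed.

Lemma picard_sol_derive i t : (i < n)%nat -> c - d < t < c + d ->
  is_derive (picard_sol i) t (vsum n (fun j => M i j t * picard_sol j t)).
Proof.
intros Hi Ht.
assert (Hc2 : forall s, continuous (fun s => vsum n (fun j => M i j s * picard_sol j s)) s).
{ intros s; apply (vsum_continuous _ n (fun j s => M i j s * picard_sol j s)); intros j Hj.
  apply (continuous_mult (K := R_AbsRing)); [now apply HMc|now apply picard_sol_cont]. }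
apply is_derive_ext_loc with
  (fun t => v i + RInt (fun s => vsum n (fun j => M i j s * picard_sol j s)) c t).
- assert (He : 0 < Rmin (t - (c - d)) (c + d - t)) by (apply Rmin_glb_lt; lra).
  exists (mkposreal _ He); intros s Hs; change (Rabs (s - t) < Rmin (t - (c - d)) (c + d - t)) in Hs.
  assert (H1 := Rmin_l (t - (c - d)) (c + d - t)); assert (H2 := Rmin_r (t - (c - d)) (c + d - t)).
  apply Rabs_def2 in Hs; rewrite (picard_sol_eq i s Hi), clamp_id by lra; reflexivity.
- rewrite <- (Rplus_0_l (vsum _ _)).
  apply (is_derive_plus (V := R_NormedModule)); [apply (is_derive_const (V := R_NormedModule))|].
  apply (is_derive_RInt (V := R_NormedModule)
    (fun s => vsum n (fun j => M i j s * picard_sol j s)) _ c t); [|apply Hc2].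
  apply filter_forall; intros x; apply (RInt_correct (V := R_CompleteNormedModule)).
  apply (ex_RInt_continuous (V := R_CompleteNormedModule)); auto.
Qed.

End Picard.

(** * Flat linear systems in the plane *)

Lemma finite_delta n (P : nat -> R -> Prop) :
  (forall i, (i < n)%nat -> exists d, 0 < d /\ forall h, Rabs h < d -> P i h) ->
  exists d, 0 < d /\ forall i h, (i < n)%nat -> Rabs h < d -> P i h.
Proof.
intros H; induction n as [|n IH].
- exists 1; split; [lra|intros; lia].
- destruct IH as [d [Hd IH]]; [intros; apply H; lia|].
  destruct (H n) as [e [He Hn]]; [lia|].
  exists (Rmin d e); split; [now apply Rmin_glb_lt|].
  intros i h Hi Hh; assert (H1 := Rmin_l d e); assert (H2 := Rmin_r d e).
  destruct (Nat.eq_dec i n) as [->|]; [apply Hn; lra|apply IH; [lia|lra]].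
Qed.

Lemma vsum_exchange n m f : vsum n (fun i => vsum m (fun j => f i j)) = vsum m (fun j => vsum n (fun i => f i j)).
Proof.
induction n; simpl.
- rewrite vsum_const; ring.
- now rewrite IHn, <- vsum_plus.
Qed.

Lemma is_derive_vsum n (f : nat -> R -> R) (l : nat -> R) x :
  (forall i, (i < n)%nat -> is_derive (f i) x (l i)) ->
  is_derive (fun t => vsum n (fun i => f i t)) x (vsum n l).
Proof.
intros H; induction n; simpl; [apply (is_derive_const (V := R_NormedModule))|].
apply (is_derive_plus (V := R_NormedModule)); [apply IHn; intros; apply H|apply H]; lia.
Qed.

Lemma MVT_bound (f df : R -> R) a b L :
  (forall t, Rmin a b <= t <= Rmax a b -> is_derive f t (df t)) ->
  (forall t, Rmin a b <= t <= Rmax a b -> Rabs (df t) <= L) ->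
  Rabs (f b - f a) <= L * Rabs (b - a).
Proof.
intros H1 H2; destruct (MVT_gen f a b df) as [y [Hy1 Hy2]].
- intros t Ht; apply H1; lra.
- intros t Ht; apply continuity_pt_filterlim.
  apply (ex_derive_continuous (K := R_AbsRing) (V := R_NormedModule)).
  eexists; now apply H1.
- rewrite Hy2, Rabs_mult; apply Rmult_le_compat_r; [apply Rabs_pos|now apply H2].
Qed.

(** Two applications of the mean value inequality give the constant [L] instead of [L / 2]; only the
    quadratic order matters later. *)
Lemma Taylor1_bound (f df ddf : R -> R) a b L : 0 <= L ->
  (forall t, Rmin a b <= t <= Rmax a b -> is_derive f t (df t)) ->
  (forall t, Rmin a b <= t <= Rmax a b -> is_derive df t (ddf t)) ->
  (forall t, Rmin a b <= t <= Rmax a b -> Rabs (ddf t) <= L) ->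
  Rabs (f b - f a - (b - a) * df a) <= L * Rabs (b - a) * Rabs (b - a).
Proof.
intros HL H1 H2 H3.
replace (f b - f a - (b - a) * df a) with
  ((f b - b * df a) - (f a - a * df a)) by ring.
apply (MVT_bound (fun t => f t - t * df a) (fun t => df t - df a)).
- intros t Ht; apply (is_derive_minus (V := R_NormedModule)); [now apply H1|].
  auto_derive; [exact I|ring].
- intros t Ht.
  assert (Hs : forall s, Rmin a t <= s <= Rmax a t -> Rmin a b <= s <= Rmax a b).
  { intros s; revert Ht; unfold Rmin, Rmax; destruct (Rle_dec a b), (Rle_dec a t); lra. }
  eapply Rle_trans; [apply (MVT_bound df ddf a t L); intros; [apply H2|apply H3]; now apply Hs|].
  apply Rmult_le_compat_l; [exact HL|].
  revert Ht; unfold Rmin, Rmax; destruct (Rle_dec a b); intros Ht;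
  unfold Rabs; repeat match goal with |- context [Rcase_abs ?x] => destruct (Rcase_abs x) end; lra.
Qed.

Lemma between_near a b c r : Rabs (a - c) < r -> Rabs (b - c) < r ->
  forall t, Rmin a b <= t <= Rmax a b -> Rabs (t - c) < r.
Proof.
intros Ha Hb t Ht; apply Rabs_def2 in Ha; apply Rabs_def2 in Hb.
revert Ht; unfold Rmin, Rmax; destruct (Rle_dec a b); intros; apply Rabs_def1; lra.
Qed.

(** * Local existence and uniqueness for flat systems *)

Section LocalFlat.
Variables (n : nat) (Om : C -> Prop) (A B : nat -> nat -> C -> R).
Hypothesis HOm : open Om.
Hypothesis HA : forall i j, (i < n)%nat -> (j < n)%nat -> smooth_on Om (A i j).
Hypothesis HB : forall i j, (i < n)%nat -> (j < n)%nat -> smooth_on Om (B i j).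
(** Zero curvature, [A_y + A B = B_x + B A]: the two mixed derivatives of a solution of [X_x = A X],
    [X_y = B X] agree. *)
Hypothesis Hflat : forall p i k, Om p -> (i < n)%nat -> (k < n)%nat ->
  pd true (A i k) p + vsum n (fun j => A i j p * B j k p) =
  pd false (B i k) p + vsum n (fun j => B i j p * A j k p).

Definition eqn (v w : nat -> R) : Prop := forall i, (i < n)%nat -> v i = w i.

Definition sol_at (X : C -> nat -> R) (p : C) : Prop := forall i, (i < n)%nat ->
  is_pd false (fun q => X q i) p (vsum n (fun j => A i j p * X p j)) /\
  is_pd true (fun q => X q i) p (vsum n (fun j => B i j p * X p j)).

(** Two horizontal derivatives of [B] are controlled because the first-order Taylor remainder of [B]
    enters the estimate of the defect. *)
Definition bounded_coef (c : C) (r K : R) : Prop :=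
  forall q i j, ball c r q -> (i < n)%nat -> (j < n)%nat ->
  Rabs (A i j q) <= K /\ Rabs (B i j q) <= K /\ Rabs (pd false (B i j) q) <= K /\
  Rabs (pd false (pd false (B i j)) q) <= K.

Section LocalExistence.
Variables (c : C) (d r K : R) (v : nat -> R).
Hypothesis Hd : 0 < d < r.
Hypothesis HK : 0 <= K.
Hypothesis Hsmall : INR n * d * K <= 1 / 2.
Hypothesis HcOm : forall q, ball c r q -> Om q.
Hypothesis Hbd : bounded_coef c r K.

Let cx := fst c.
Let cy := snd c.
Let MA i j t := A i j (clamp cx d t, cy).
Let MB x i j t := B i j (x, clamp cy d t).
Let Y i x := picard_sol n MA v cx d i x.
(** [Y] solves along the horizontal line through [c], and each of its values is then continued
    vertically. The vertical equation holds by construction; the horizontal one, away from the base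
    line, is where flatness is spent. *)
Definition local_sol (p : C) (i : nat) : R := picard_sol n (MB (fst p)) (fun i => Y i (fst p)) cy d i (snd p).
Let X x y i := local_sol (x, y) i.

Let Hd0 : 0 <= d. Proof. lra. Qed.

Lemma in_big x y : Rabs (x - cx) <= d -> Rabs (y - cy) <= d -> ball c r (x, y).
Proof. intros H1 H2; apply ball_C; simpl; fold cx cy; lra. Qed.

Lemma clamp_near a t : Rabs (clamp a d t - a) <= d.
Proof. assert (H := clamp_in a d Hd0 t); apply Rabs_le; lra. Qed.

Lemma clamp_continuous a t : continuous (clamp a d) t.
Proof. apply (lip_continuous _ 1); intros s u; rewrite Rmult_1_l; apply clamp_lip; exact Hd0. Qed.

Lemma smooth_slice_clamp_x f y t : smooth_on Om f -> Rabs (y - cy) <= d ->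
  continuous (fun t => f (clamp cx d t, y)) t.
Proof.
intros Hf Hy; apply (continuous_comp (fun t => (clamp cx d t, y)) f).
- apply (continuous_comp_2 (clamp cx d) (fun _ => y) (fun a b => (a, b))).
  + apply clamp_continuous.
  + apply continuous_const.
  + apply continuous_ext with (fun x => x); [intros [? ?]; reflexivity|apply continuous_id].
- apply (smooth_continuous Om); [exact Hf|].
  apply HcOm, in_big; [apply clamp_near|exact Hy].
Qed.

Lemma smooth_slice_clamp_y f x t : smooth_on Om f -> Rabs (x - cx) <= d ->
  continuous (fun t => f (x, clamp cy d t)) t.
Proof.
intros Hf Hy; apply (continuous_comp (fun t => (x, clamp cy d t)) f).
- apply (continuous_comp_2 (fun _ => x) (clamp cy d) (fun a b => (a, b))).
  + apply continuous_const.
  + apply clamp_continuous.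
  + apply continuous_ext with (fun x => x); [intros [? ?]; reflexivity|apply continuous_id].
- apply (smooth_continuous Om); [exact Hf|].
  apply HcOm, in_big; [exact Hy|apply clamp_near].
Qed.

Let Hcy : Rabs (cy - cy) <= d.
Proof. rewrite Rminus_diag, Rabs_R0; lra. Qed.

Let MAc : forall i j t, (i < n)%nat -> (j < n)%nat -> continuous (MA i j) t.
Proof. intros i j t Hi Hj; apply smooth_slice_clamp_x; auto. Qed.
Let MAb : forall i j t, (i < n)%nat -> (j < n)%nat -> Rabs (MA i j t) <= K.
Proof. intros i j t Hi Hj; apply Hbd; auto; apply in_big; [apply clamp_near|auto]. Qed.
Let MBc x : Rabs (x - cx) <= d -> forall i j t, (i < n)%nat -> (j < n)%nat -> continuous (MB x i j) t.
Proof. intros Hx i j t Hi Hj; apply smooth_slice_clamp_y; auto. Qed.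
Let MBb x : Rabs (x - cx) <= d -> forall i j t, (i < n)%nat -> (j < n)%nat -> Rabs (MB x i j t) <= K.
Proof. intros Hx i j t Hi Hj; apply Hbd; auto; apply in_big; [auto|apply clamp_near]. Qed.

Lemma near_clamp a t : Rabs (t - a) < d -> clamp a d t = t.
Proof. intros H; apply Rabs_def2 in H; apply clamp_id; lra. Qed.

Lemma Y_derive i x : (i < n)%nat -> Rabs (x - cx) < d ->
  is_derive (Y i) x (vsum n (fun j => A i j (x, cy) * Y j x)).
Proof.
intros Hi Hx.
assert (H := picard_sol_derive n MA v cx d K Hd0 HK Hsmall MAc MAb i x Hi).
unfold MA in H at 2; rewrite (near_clamp cx x Hx) in H; apply H.
apply Rabs_def2 in Hx; lra.
Qed.

Lemma X_init i x : (i < n)%nat -> Rabs (x - cx) < d -> X x cy i = Y i x.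
Proof.
intros Hi Hx; apply (picard_sol_init n (MB x) (fun i => Y i x) cy d K Hd0 HK Hsmall); auto.
- apply MBc; lra.
- apply MBb; lra.
Qed.

Lemma X_derive_y i x y : (i < n)%nat -> Rabs (x - cx) < d -> Rabs (y - cy) < d ->
  is_derive (fun t => X x t i) y (vsum n (fun j => B i j (x, y) * X x y j)).
Proof.
intros Hi Hx Hy.
assert (Hx' : Rabs (x - cx) <= d) by lra.
assert (H := picard_sol_derive n (MB x) (fun i => Y i x) cy d K Hd0 HK Hsmall (MBc x Hx') (MBb x Hx') i y Hi).
unfold MB in H at 2; rewrite (near_clamp cy y Hy) in H; apply H.
apply Rabs_def2 in Hy; lra.
Qed.

Lemma short_interval (s a : R) : Rabs (s - a) < d ->
  INR n * (Rmax a s - Rmin a s) * K <= 1 / 2.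
Proof.
intros Hs; eapply Rle_trans; [|exact Hsmall].
apply Rmult_le_compat_r; [exact HK|]; apply Rmult_le_compat_l; [apply pos_INR|].
apply Rabs_def2 in Hs; unfold Rmin, Rmax; destruct (Rle_dec a s); lra.
Qed.

Let Hctr a : Rabs (a - a) < d.
Proof. rewrite Rminus_diag, Rabs_R0; lra. Qed.

Let mm a s : Rmin a s <= Rmax a s.
Proof. unfold Rmin, Rmax; destruct (Rle_dec a s); lra. Qed.
Let mma a s : Rmin a s <= a <= Rmax a s.
Proof. unfold Rmin, Rmax; destruct (Rle_dec a s); lra. Qed.
Let mms a s : Rmin a s <= s <= Rmax a s.
Proof. unfold Rmin, Rmax; destruct (Rle_dec a s); lra. Qed.

(** The 4 is the factor 2 of [linear_ode_bound], once for each direction. *)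
Let C0 := 4 * vsum n (fun i => Rabs (v i)).

Lemma Y_bound x : Rabs (x - cx) < d -> vsum n (fun i => Rabs (Y i x)) <= C0 / 2.
Proof.
intros Hx.
assert (H := linear_ode_bound n (fun i j t => A i j (t, cy)) Y (fun _ _ => 0)
  (Rmin cx x) (Rmax cx x) cx K 0 (mm _ _) (mma _ _) HK (Rle_refl 0) (short_interval x cx Hx)).
assert (E : vsum n (fun i => Rabs (Y i cx)) = vsum n (fun i => Rabs (v i))).
{ apply vsum_ext; intros i Hi; f_equal.
  apply (picard_sol_init n MA v cx d K Hd0 HK Hsmall); auto. }
cbv beta in H; rewrite E in H; unfold C0.
apply Rle_trans with (2 * vsum n (fun i => Rabs (v i)) + 2 * (INR n * (Rmax cx x - Rmin cx x) * 0)); [|lra].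
apply H; try (apply mms).
- intros i t Hi Ht; rewrite Rplus_0_r; apply Y_derive; [exact Hi|].
  now apply (between_near cx x).
- intros i j t Hi Hj Ht; apply Hbd; auto; apply in_big; auto.
  left; now apply (between_near cx x).
- intros; rewrite Rabs_R0; lra.
Qed.

Lemma X_bound x y : Rabs (x - cx) < d -> Rabs (y - cy) < d -> vsum n (fun i => Rabs (X x y i)) <= C0.
Proof.
intros Hx Hy.
assert (H := linear_ode_bound n (fun i j t => B i j (x, t)) (fun i t => X x t i) (fun _ _ => 0)
  (Rmin cy y) (Rmax cy y) cy K 0 (mm _ _) (mma _ _) HK (Rle_refl 0) (short_interval y cy Hy)).
assert (E : vsum n (fun i => Rabs (X x cy i)) = vsum n (fun i => Rabs (Y i x))).
{ apply vsum_ext; intros i Hi; f_equal; now apply X_init. }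
cbv beta in H; rewrite E in H; assert (HY := Y_bound x Hx).
apply Rle_trans with (2 * vsum n (fun i => Rabs (Y i x)) + 2 * (INR n * (Rmax cy y - Rmin cy y) * 0)); [|lra].
apply H; try (apply mms).
- intros i t Hi Ht; rewrite Rplus_0_r; apply X_derive_y; auto.
  now apply (between_near cy y).
- intros i j t Hi Hj Ht; apply Hbd; auto; apply in_big; [lra|].
  left; now apply (between_near cy y).
- intros; rewrite Rabs_R0; lra.
Qed.

Let C0_pos : 0 <= C0.
Proof. unfold C0; assert (H := vsum_pos n (fun i => Rabs (v i)) (fun i _ => Rabs_pos _)); lra. Qed.

Lemma B_lip i j x x' y : (i < n)%nat -> (j < n)%nat ->
  Rabs (x - cx) < d -> Rabs (x' - cx) < d -> Rabs (y - cy) < d ->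
  Rabs (B i j (x', y) - B i j (x, y)) <= K * Rabs (x' - x).
Proof.
intros Hi Hj Hx Hx' Hy.
assert (Hin : forall t, Rmin x x' <= t <= Rmax x x' -> ball c r (t, y)).
{ intros t Ht; apply in_big; [left; now apply (between_near x x')|lra]. }
apply (MVT_bound (fun t => B i j (t, y)) (fun t => pd false (B i j) (t, y))).
- intros t Ht; apply (smooth_is_pd Om (B i j) false (t, y)); auto.
- intros t Ht; apply Hbd; auto.
Qed.

Lemma B_taylor i j x x' y : (i < n)%nat -> (j < n)%nat ->
  Rabs (x - cx) < d -> Rabs (x' - cx) < d -> Rabs (y - cy) < d ->
  Rabs (B i j (x', y) - B i j (x, y) - (x' - x) * pd false (B i j) (x, y))
    <= K * Rabs (x' - x) * Rabs (x' - x).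
Proof.
intros Hi Hj Hx Hx' Hy.
assert (Hin : forall t, Rmin x x' <= t <= Rmax x x' -> ball c r (t, y)).
{ intros t Ht; apply in_big; [left; now apply (between_near x x')|lra]. }
apply (Taylor1_bound (fun t => B i j (t, y)) (fun t => pd false (B i j) (t, y))
  (fun t => pd false (pd false (B i j)) (t, y))); [exact HK|..].
- intros t Ht; apply (smooth_is_pd Om (B i j) false (t, y)); auto.
- intros t Ht; apply (smooth_is_pd Om (pd false (B i j)) false (t, y)); auto.
  apply smooth_pd; auto.
- intros t Ht; apply Hbd; auto.
Qed.

Lemma Y_lip i x x' : (i < n)%nat -> Rabs (x - cx) < d -> Rabs (x' - cx) < d ->
  Rabs (Y i x' - Y i x) <= K * C0 * Rabs (x' - x).
Proof.
intros Hi Hx Hx'.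
apply (MVT_bound (Y i) (fun t => vsum n (fun j => A i j (t, cy) * Y j t))).
- intros t Ht; apply Y_derive; auto; now apply (between_near x x').
- intros t Ht; assert (Ht' := between_near x x' cx d Hx Hx' t Ht).
  eapply Rle_trans; [apply (vsum_lin_bound n _ _ K); intros; apply Hbd; auto; apply in_big; [lra|auto]|].
  apply Rmult_le_compat_l; [exact HK|]; assert (H := Y_bound t Ht'); lra.
Qed.

(** The difference of two vertical solutions satisfies the vertical equation at [x] with the source
    [(B(x') - B(x)) X(x')], which is of order [x' - x]; its initial value is controlled by
    [Y_lip]. *)
Lemma X_lip x x' y : Rabs (x - cx) < d -> Rabs (x' - cx) < d -> Rabs (y - cy) < d ->
  vsum n (fun i => Rabs (X x' y i - X x y i)) <= (2 * INR n * K * C0 + 2 * (INR n * d * (K * C0))) * Rabs (x' - x).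
Proof.
intros Hx Hx' Hy.
assert (Hk := Rabs_pos (x' - x)).
assert (HKC : 0 <= K * C0) by now apply Rmult_le_pos.
assert (Hn := pos_INR n).
assert (H := linear_ode_bound n (fun i j t => B i j (x, t)) (fun i t => X x' t i - X x t i)
  (fun i t => vsum n (fun j => (B i j (x', t) - B i j (x, t)) * X x' t j))
  (Rmin cy y) (Rmax cy y) cy K (K * C0 * Rabs (x' - x)) (mm _ _) (mma _ _) HK
  (Rmult_le_pos _ _ HKC Hk) (short_interval y cy Hy)).
assert (E : vsum n (fun i => Rabs (X x' cy i - X x cy i)) <= INR n * (K * C0 * Rabs (x' - x))).
{ rewrite <- vsum_const; apply vsum_le; intros i Hi.
  rewrite !X_init by auto; now apply Y_lip. }
eapply Rle_trans; [apply H; try (apply mms)|].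
- intros i t Hi Ht; assert (Ht' := between_near cy y cy d (Hctr _) Hy t Ht).
  eapply is_derive_ext; [intros; reflexivity|].
  replace (_ + _) with (vsum n (fun j => B i j (x', t) * X x' t j) - vsum n (fun j => B i j (x, t) * X x t j)).
  + apply (is_derive_minus (V := R_NormedModule)); now apply X_derive_y.
  + rewrite <- vsum_minus, <- vsum_plus; apply vsum_ext; intros; ring.
- intros i j t Hi Hj Ht; apply Hbd; auto; apply in_big; [lra|].
  left; now apply (between_near cy y).
- intros i t Hi Ht; assert (Ht' := between_near cy y cy d (Hctr _) Hy t Ht).
  eapply Rle_trans; [apply (vsum_lin_bound n _ _ (K * Rabs (x' - x))); intros; now apply B_lip|].
  replace (K * C0 * Rabs (x' - x)) with (K * Rabs (x' - x) * C0) by ring.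
  apply Rmult_le_compat_l; [now apply Rmult_le_pos|now apply X_bound].
- assert (Hl : Rmax cy y - Rmin cy y <= d).
  { apply Rabs_def2 in Hy; unfold Rmin, Rmax; destruct (Rle_dec cy y); lra. }
  assert (INR n * (Rmax cy y - Rmin cy y) * (K * C0 * Rabs (x' - x)) <= INR n * d * (K * C0 * Rabs (x' - x))).
  { apply Rmult_le_compat_r; [now apply Rmult_le_pos|]; now apply Rmult_le_compat_l. }
  lra.
Qed.

(* The defect [E] of the horizontal equation satisfies, by flatness, a vertical linear equation with a
   quadratically small source term. *)
Lemma X_taylor x y : Rabs (x - cx) < d -> Rabs (y - cy) < d -> exists C2, 0 <= C2 /\
  forall x', Rabs (x' - cx) < d ->
  vsum n (fun i => Rabs (X x' y i - X x y i - (x' - x) * vsum n (fun j => A i j (x, y) * X x y j))) <=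
  2 * vsum n (fun i => Rabs (Y i x' - Y i x - (x' - x) * vsum n (fun j => A i j (x, cy) * Y j x)))
  + C2 * Rabs (x' - x) * Rabs (x' - x).
Proof.
intros Hx Hy.
set (C1 := 2 * INR n * K * C0 + 2 * (INR n * d * (K * C0))).
assert (HKC : 0 <= K * C0) by now apply Rmult_le_pos.
assert (Hn := pos_INR n).
assert (HC1 : 0 <= C1).
{ unfold C1; assert (0 <= INR n * (K * C0)) by now apply Rmult_le_pos.
  assert (0 <= INR n * d * (K * C0)) by (apply Rmult_le_pos; [apply Rmult_le_pos|]; lra). lra. }
assert (HKC1 : 0 <= K * C0 + K * C1).
{ assert (0 <= K * C1) by now apply Rmult_le_pos. lra. }
exists (2 * (INR n * d * (K * C0 + K * C1))); split.
{ assert (0 <= INR n * d * (K * C0 + K * C1)) by (apply Rmult_le_pos; [apply Rmult_le_pos|]; lra). lra. }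
intros x' Hx'.
set (k := x' - x); assert (Hk := Rabs_pos k).
assert (Hrho : 0 <= (K * C0 + K * C1) * Rabs k * Rabs k) by (repeat apply Rmult_le_pos; assumption).
(* The source of the defect has two parts: the Taylor remainder of [B] applied to [X x'], and [k]
   times [B_x] applied to [X x' - X x]. Both are quadratic in [k], the second by [X_lip]. *)
assert (H := linear_ode_bound n (fun i j t => B i j (x, t))
  (fun i t => X x' t i - X x t i - k * vsum n (fun j => A i j (x, t) * X x t j))
  (fun i t => vsum n (fun j => (B i j (x', t) - B i j (x, t) - k * pd false (B i j) (x, t)) * X x' t j)
     + vsum n (fun j => (k * pd false (B i j) (x, t)) * (X x' t j - X x t j)))
  (Rmin cy y) (Rmax cy y) cy K _ (mm _ _) (mma _ _) HK Hrho (short_interval y cy Hy)).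
assert (E : vsum n (fun i => Rabs (X x' cy i - X x cy i - k * vsum n (fun j => A i j (x, cy) * X x cy j))) =
  vsum n (fun i => Rabs (Y i x' - Y i x - k * vsum n (fun j => A i j (x, cy) * Y j x)))).
{ apply vsum_ext; intros i Hi; rewrite !X_init by auto.
  do 3 f_equal; apply vsum_ext; intros j Hj; now rewrite X_init. }
cbv beta in H; rewrite E in H; clear E.
eapply Rle_trans; [apply H; try (apply mms)|].
- intros i t Hi Ht; assert (Ht' := between_near cy y cy d (Hctr _) Hy t Ht).
  assert (HOt : Om (x, t)) by (apply HcOm, in_big; lra).
  assert (HD : is_derive (fun t => X x' t i - X x t i - k * vsum n (fun j => A i j (x, t) * X x t j)) t
    (vsum n (fun j => B i j (x', t) * X x' t j) - vsum n (fun j => B i j (x, t) * X x t j)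
     - k * vsum n (fun j => pd true (A i j) (x, t) * X x t j +
          A i j (x, t) * vsum n (fun l => B j l (x, t) * X x t l)))).
  { apply (is_derive_minus (V := R_NormedModule)).
    - apply (is_derive_minus (V := R_NormedModule)); now apply X_derive_y.
    - apply (is_derive_scal (fun t => vsum n (fun j => A i j (x, t) * X x t j))).
      apply (is_derive_vsum n (fun j t => A i j (x, t) * X x t j)); intros j Hj.
      apply (is_derive_mult (fun t => A i j (x, t)) (fun t => X x t j));
        [|now apply X_derive_y|apply Rmult_comm].
      exact (smooth_is_pd Om (A i j) true (x, t) (HA i j Hi Hj) HOt). }
  replace (vsum n _ + _) with (vsum n (fun j => B i j (x', t) * X x' t j) - vsum n (fun j => B i j (x, t) * X x t j)
     - k * vsum n (fun j => pd true (A i j) (x, t) * X x t j +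
          A i j (x, t) * vsum n (fun l => B j l (x, t) * X x t l))); [exact HD|].
  (* Flatness enters here: [A_y + A B], produced by differentiating the defect vertically, is
     exchanged for [B_x + B A]. *)
  assert (EF : vsum n (fun j => pd true (A i j) (x, t) * X x t j +
          A i j (x, t) * vsum n (fun l => B j l (x, t) * X x t l)) =
       vsum n (fun l => pd false (B i l) (x, t) * X x t l) +
       vsum n (fun j => B i j (x, t) * vsum n (fun l => A j l (x, t) * X x t l))).
  { rewrite vsum_plus.
    rewrite (vsum_ext n (fun j => A i j (x, t) * _) (fun j => vsum n (fun l => A i j (x, t) * B j l (x, t) * X x t l)))
      by (intros; rewrite <- vsum_scal; apply vsum_ext; intros; ring).
    rewrite (vsum_ext n (fun j => B i j (x, t) * _) (fun j => vsum n (fun l => B i j (x, t) * A j l (x, t) * X x t l)))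
      by (intros; rewrite <- vsum_scal; apply vsum_ext; intros; ring).
    rewrite (vsum_exchange n n (fun j l => A i j (x, t) * B j l (x, t) * X x t l)),
      (vsum_exchange n n (fun j l => B i j (x, t) * A j l (x, t) * X x t l)), <- !vsum_plus.
    apply vsum_ext; intros l Hl.
    assert (HF := Hflat (x, t) i l HOt Hi Hl).
    rewrite (vsum_ext n (fun j => A i j (x, t) * B j l (x, t) * X x t l)
       (fun j => X x t l * (A i j (x, t) * B j l (x, t)))) by (intros; ring).
    rewrite (vsum_ext n (fun j => B i j (x, t) * A j l (x, t) * X x t l)
       (fun j => X x t l * (B i j (x, t) * A j l (x, t)))) by (intros; ring).
    rewrite !vsum_scal.
    transitivity (X x t l * (pd true (A i l) (x, t) + vsum n (fun j => A i j (x, t) * B j l (x, t)))); [ring|].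
    rewrite HF; ring. }
  rewrite EF, Rmult_plus_distr_l, <- !vsum_scal, <- !vsum_plus, <- !vsum_minus.
  apply vsum_ext; intros j Hj; ring.
- intros i j t Hi Hj Ht; apply Hbd; auto; apply in_big; [lra|].
  left; now apply (between_near cy y).
- intros i t Hi Ht; assert (Ht' := between_near cy y cy d (Hctr _) Hy t Ht).
  eapply Rle_trans; [apply Rabs_triang|].
  replace ((K * C0 + K * C1) * Rabs k * Rabs k) with
    (K * Rabs k * Rabs k * C0 + K * Rabs k * (C1 * Rabs k)) by ring.
  apply Rplus_le_compat.
  + eapply Rle_trans; [apply (vsum_lin_bound n _ _ (K * Rabs k * Rabs k)); intros; now apply B_taylor|].
    apply Rmult_le_compat_l; [repeat apply Rmult_le_pos; assumption|now apply X_bound].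
  + eapply Rle_trans; [apply (vsum_lin_bound n _ (fun j => X x' t j - X x t j) (K * Rabs k))|].
    * intros j Hj; rewrite Rabs_mult, Rmult_comm; apply Rmult_le_compat_r; [exact Hk|].
      apply Hbd; auto; apply in_big; lra.
    * apply Rmult_le_compat_l; [now apply Rmult_le_pos|now apply X_lip].
- assert (Hl : Rmax cy y - Rmin cy y <= d).
  { apply Rabs_def2 in Hy; unfold Rmin, Rmax; destruct (Rle_dec cy y); lra. }
  assert (INR n * (Rmax cy y - Rmin cy y) * ((K * C0 + K * C1) * Rabs k * Rabs k)
     <= INR n * d * ((K * C0 + K * C1) * Rabs k * Rabs k)).
  { apply Rmult_le_compat_r; [exact Hrho|]; now apply Rmult_le_compat_l. }
  lra.
Qed.

(** On the base line the defect is [o(h)], since [Y] is differentiable there; [X_taylor] carries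
    this to height [y] with a quadratic error. *)
Lemma X_derive_x i x y : (i < n)%nat -> Rabs (x - cx) < d -> Rabs (y - cy) < d ->
  is_derive (fun t => X t y i) x (vsum n (fun j => A i j (x, y) * X x y j)).
Proof.
intros Hi Hx Hy; apply is_derive_Reals; intros eps Heps.
destruct (X_taylor x y Hx Hy) as [C2 [HC2 HT]].
assert (Hn1 : 0 < INR n) by (apply lt_0_INR; lia).
destruct (finite_delta n (fun j h => Rabs (Y j (x + h) - Y j x - h * vsum n (fun l => A j l (x, cy) * Y l x))
   <= eps / (8 * INR n) * Rabs h)) as [d1 [Hd1 HY]].
{ intros j Hj; assert (HD := Y_derive j x Hj Hx); apply is_derive_Reals in HD.
  destruct (HD (eps / (8 * INR n))) as [d1 HD1]; [apply Rdiv_lt_0_compat; lra|].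
  exists d1; split; [apply cond_pos|]; intros h Hh.
  destruct (Req_dec h 0) as [->|Hh0].
  - rewrite Rplus_0_r, Rminus_diag, Rmult_0_l, Rminus_diag, Rabs_R0; lra.
  - specialize (HD1 h Hh0 Hh).
    replace (Y j (x + h) - Y j x - h * vsum n (fun l => A j l (x, cy) * Y l x)) with
     (((Y j (x + h) - Y j x) / h - vsum n (fun l => A j l (x, cy) * Y l x)) * h) by (field; exact Hh0).
    rewrite Rabs_mult; apply Rmult_le_compat_r; [apply Rabs_pos|lra]. }
(* The base line contributes [2 * (eps / 8)] and the quadratic term [eps / 4], in total half of the
   allowed error, which keeps the inequality strict. *)
set (d2 := Rmin d1 (Rmin (d - Rabs (x - cx)) (eps / (4 * (C2 + 1))))).
assert (Hd2 : 0 < d2).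
{ repeat apply Rmin_glb_lt; try lra; apply Rdiv_lt_0_compat; lra. }
exists (mkposreal _ Hd2); intros h Hh0 Hh; simpl in Hh.
assert (H1 : d2 <= d1) by apply Rmin_l.
assert (H2 : d2 <= d - Rabs (x - cx)) by (eapply Rle_trans; [apply Rmin_r|apply Rmin_l]).
assert (H3 : d2 <= eps / (4 * (C2 + 1))) by (eapply Rle_trans; [apply Rmin_r|apply Rmin_r]).
assert (Hxh : Rabs (x + h - cx) < d).
{ replace (x + h - cx) with (x - cx + h) by ring.
  eapply Rle_lt_trans; [apply Rabs_triang|]; lra. }
specialize (HT (x + h) Hxh).
replace (x + h - x) with h in HT by ring.
set (f := fun i => Rabs (X (x + h) y i - X x y i - h * vsum n (fun j => A i j (x, y) * X x y j))) in HT.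
assert (Hf : f i <= vsum n f) by (apply vsum_term; auto; intros; apply Rabs_pos).
assert (HYs : vsum n (fun j => Rabs (Y j (x + h) - Y j x - h * vsum n (fun l => A j l (x, cy) * Y l x)))
   <= eps / 8 * Rabs h).
{ replace (eps / 8 * Rabs h) with (INR n * (eps / (8 * INR n) * Rabs h)) by (field; lra).
  rewrite <- vsum_const; apply vsum_le; intros j Hj; apply HY; [exact Hj|lra]. }
assert (Hhp : 0 < Rabs h) by now apply Rabs_pos_lt.
assert (HC : C2 * Rabs h * Rabs h <= eps / 4 * Rabs h).
{ apply Rmult_le_compat_r; [lra|].
  apply Rle_trans with ((C2 + 1) * (eps / (4 * (C2 + 1)))).
  - apply Rmult_le_compat; lra.
  - right; field; lra. }
replace ((X (x + h) y i - X x y i) / h - _) with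
  ((X (x + h) y i - X x y i - h * vsum n (fun j => A i j (x, y) * X x y j)) / h) by (field; exact Hh0).
unfold Rdiv; rewrite Rabs_mult, Rabs_inv.
apply Rmult_lt_reg_r with (Rabs h); [exact Hhp|].
rewrite Rmult_assoc, Rinv_l, Rmult_1_r by lra.
apply Rle_lt_trans with (f i); [right; reflexivity|].
assert (0 < eps * Rabs h) by now apply Rmult_lt_0_compat.
lra.
Qed.

Lemma local_sol_spec : eqn (local_sol c) v /\ forall p, ball c d p -> sol_at local_sol p.
Proof.
split.
- intros i Hi; transitivity (Y i cx).
  + exact (X_init i cx Hi (Hctr cx)).
  + apply (picard_sol_init n MA v cx d K Hd0 HK Hsmall); auto.
- intros [x y] Hp; apply (proj1 (ball_C _ _ _)) in Hp; destruct Hp as [Hx Hy]; intros i Hi; split.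
  + now apply X_derive_x.
  + now apply X_derive_y.
Qed.

End LocalExistence.

(** One horizontal and one vertical leg, each costing a factor 2. The equation is required just on
    the rectangle spanned by [p] and [q], so that solutions on two different squares can be compared
    on their overlap. *)
Lemma local_growth (c : C) r K (X : C -> nat -> R) p q :
  0 <= K -> INR n * (2 * r) * K <= 1 / 2 ->
  (forall q i j, ball c r q -> (i < n)%nat -> (j < n)%nat -> Rabs (A i j q) <= K /\ Rabs (B i j q) <= K) ->
  ball c r p -> ball c r q ->
  (forall a b, Rmin (fst p) (fst q) <= a <= Rmax (fst p) (fst q) ->
     Rmin (snd p) (snd q) <= b <= Rmax (snd p) (snd q) -> sol_at X (a, b)) ->
  vsum n (fun i => Rabs (X q i)) <= 4 * vsum n (fun i => Rabs (X p i)).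
Proof.
intros HK Hs Hb Hp Hq HX.
destruct p as [x y], q as [x' y']; simpl in HX.
apply (proj1 (ball_C _ _ _)) in Hp; destruct Hp as [Hp1 Hp2]; simpl in Hp1, Hp2.
apply (proj1 (ball_C _ _ _)) in Hq; destruct Hq as [Hq1 Hq2]; simpl in Hq1, Hq2.
assert (Hsh : forall s t a, Rabs (s - a) < r -> Rabs (t - a) < r ->
  INR n * (Rmax s t - Rmin s t) * K <= 1 / 2).
{ intros s t a H1 H2; eapply Rle_trans; [|exact Hs].
  apply Rmult_le_compat_r; [exact HK|]; apply Rmult_le_compat_l; [apply pos_INR|].
  apply Rabs_def2 in H1; apply Rabs_def2 in H2; unfold Rmin, Rmax; destruct (Rle_dec s t); lra. }
assert (mm : forall s t, Rmin s t <= Rmax s t /\ Rmin s t <= s <= Rmax s t /\ Rmin s t <= t <= Rmax s t).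
{ intros s t; unfold Rmin, Rmax; destruct (Rle_dec s t); lra. }
assert (H1 : vsum n (fun i => Rabs (X (x', y) i)) <= 2 * vsum n (fun i => Rabs (X (x, y) i))).
{ assert (H := linear_ode_bound n (fun i j t => A i j (t, y)) (fun i t => X (t, y) i) (fun _ _ => 0)
   (Rmin x x') (Rmax x x') x K 0 ltac:(apply mm) ltac:(apply mm) HK (Rle_refl 0) (Hsh _ _ _ Hp1 Hq1)).
  rewrite Rmult_0_r, Rmult_0_r, Rplus_0_r in H; apply H; try apply mm.
  - intros i t Hi Ht; rewrite Rplus_0_r; apply (HX t y Ht ltac:(apply mm) i Hi).
  - intros k j t Hk Hj Ht; apply Hb; auto; apply ball_C; split; simpl; [|exact Hp2].
    now apply (between_near x x').
  - intros; rewrite Rabs_R0; lra. }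
assert (H2 : vsum n (fun i => Rabs (X (x', y') i)) <= 2 * vsum n (fun i => Rabs (X (x', y) i))); [|lra].
assert (H := linear_ode_bound n (fun i j t => B i j (x', t)) (fun i t => X (x', t) i) (fun _ _ => 0)
 (Rmin y y') (Rmax y y') y K 0 ltac:(apply mm) ltac:(apply mm) HK (Rle_refl 0) (Hsh _ _ _ Hp2 Hq2)).
rewrite Rmult_0_r, Rmult_0_r, Rplus_0_r in H; apply H; try apply mm.
- intros i t Hi Ht; rewrite Rplus_0_r; apply (HX x' t ltac:(apply mm) Ht i Hi).
- intros k j t Hk Hj Ht; apply Hb; auto; apply ball_C; split; simpl; [exact Hq1|].
  now apply (between_near y y').
- intros; rewrite Rabs_R0; lra.
Qed.

Lemma local_uniqueness (c : C) r K (X X' : C -> nat -> R) p q :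
  0 <= K -> INR n * (2 * r) * K <= 1 / 2 ->
  (forall q i j, ball c r q -> (i < n)%nat -> (j < n)%nat -> Rabs (A i j q) <= K /\ Rabs (B i j q) <= K) ->
  ball c r p -> ball c r q ->
  (forall a b, Rmin (fst p) (fst q) <= a <= Rmax (fst p) (fst q) ->
     Rmin (snd p) (snd q) <= b <= Rmax (snd p) (snd q) -> sol_at X (a, b) /\ sol_at X' (a, b)) ->
  eqn (X p) (X' p) -> eqn (X q) (X' q).
Proof.
intros HK Hs Hb Hp Hq HX Hpq i Hi; apply Rminus_diag_uniq.
assert (H := local_growth c r K (fun o i => X o i - X' o i) p q HK Hs Hb Hp Hq).
cbv beta in H; rewrite (vsum_ext n (fun i => Rabs (X p i - X' p i)) (fun _ => 0)) in H.
2: { intros j Hj; rewrite (Hpq j Hj), Rminus_diag; apply Rabs_R0. }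
rewrite vsum_const in H.
assert (HS : vsum n (fun i => Rabs (X q i - X' q i)) <= 4 * (INR n * 0)).
{ apply H; intros a b Ha Hb'; destruct (HX a b Ha Hb') as [S1 S2]; intros j Hj.
  destruct (S1 j Hj) as [S3 S4]; destruct (S2 j Hj) as [S5 S6].
  split; (eapply is_pd_val; [apply is_pd_minus; eassumption|]);
  rewrite <- vsum_minus; apply vsum_ext; intros; ring. }
assert (HT := vsum_term n (fun i => Rabs (X q i - X' q i)) i (fun i _ => Rabs_pos _) Hi); simpl in HT.
assert (H0 := Rabs_pos (X q i - X' q i)).
destruct (Req_dec (X q i - X' q i) 0) as [|Hne]; [assumption|]; apply Rabs_pos_lt in Hne; lra.
Qed.

End LocalFlat.

Lemma finite_delta_bound n (P : nat -> R -> R -> Prop) :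
  (forall i d d' K K', d' <= d -> K <= K' -> P i d K -> P i d' K') ->
  (forall i, (i < n)%nat -> exists d K, 0 < d /\ 0 <= K /\ P i d K) ->
  exists d K, 0 < d /\ 0 <= K /\ forall i, (i < n)%nat -> P i d K.
Proof.
intros Hm H; induction n as [|n IH].
- exists 1, 0; repeat split; try lra; intros; lia.
- destruct IH as [d [K [Hd [HK IH]]]]; [intros; apply H; lia|].
  destruct (H n) as [e [L [He [HL Hn]]]]; [lia|].
  exists (Rmin d e), (Rmax K L); split; [now apply Rmin_glb_lt|split].
  + eapply Rle_trans; [exact HK|apply Rmax_l].
  + intros i Hi; destruct (Nat.eq_dec i n) as [->|].
    * eapply Hm; [apply Rmin_r|apply Rmax_r|exact Hn].
    * eapply Hm; [apply Rmin_l|apply Rmax_l|apply IH; lia].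
Qed.

Lemma continuous_locally_bounded (f : C -> R) p : continuous f p ->
  exists d K, 0 < d /\ 0 <= K /\ forall q, ball p d q -> Rabs (f q) <= K.
Proof.
intros H; assert (H1 := proj1 (filterlim_locally f (f p)) H (mkposreal 1 Rlt_0_1)).
destruct H1 as [d Hd]; exists d, (Rabs (f p) + 1).
assert (H0 := Rabs_pos (f p)).
repeat split; [apply cond_pos|lra|].
intros q Hq; specialize (Hd q Hq); change (Rabs (f q - f p) < 1) in Hd.
replace (f q) with (f p + (f q - f p)) by ring.
eapply Rle_trans; [apply Rabs_triang|lra].
Qed.

(** * Parallel transport, monodromy and global solutions *)

Section GlobalFlat.
Variables (n : nat) (Om : C -> Prop) (A B : nat -> nat -> C -> R).
Hypothesis HOm : open Om.
Hypothesis HA : forall i j, (i < n)%nat -> (j < n)%nat -> smooth_on Om (A i j).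
Hypothesis HB : forall i j, (i < n)%nat -> (j < n)%nat -> smooth_on Om (B i j).
Hypothesis Hflat : forall p i k, Om p -> (i < n)%nat -> (k < n)%nat ->
  pd true (A i k) p + vsum n (fun j => A i j p * B j k p) =
  pd false (B i k) p + vsum n (fun j => B i j p * A j k p).

Notation eqn := (eqn n).
Notation sol_at := (sol_at n A B).

Lemma eqn_sym v w : eqn v w -> eqn w v.
Proof. intros H i Hi; symmetry; now apply H. Qed.
Lemma eqn_trans u v w : eqn u v -> eqn v w -> eqn u w.
Proof. intros H1 H2 i Hi; rewrite H1 by exact Hi; now apply H2. Qed.
Lemma eqn_refl v : eqn v v.
Proof. intros i Hi; reflexivity. Qed.

Lemma sol_at_ext (X X' : C -> nat -> R) p :
  locally p (fun q => eqn (X q) (X' q)) -> sol_at X p -> sol_at X' p.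
Proof.
intros HL HS i Hi; destruct (HS i Hi) as [H1 H2].
assert (Hp : eqn (X p) (X' p)) by exact (locally_singleton _ _ HL).
assert (E : forall M : nat -> R, vsum n (fun j => M j * X p j) = vsum n (fun j => M j * X' p j)).
{ intros M; apply vsum_ext; intros j Hj; now rewrite Hp. }
rewrite E in H1; rewrite E in H2.
split; apply is_pd_ext_loc with (fun q => X q i); try assumption;
revert HL; apply filter_imp; intros q Hq; now apply Hq.
Qed.

(** A square (balls of the product metric) on which the initial value problem is solvable from every
    point, not only from the centre: a chart can then be restarted wherever a path has arrived. *)
Definition flat_ball (c : C) (r : R) : Prop :=
  0 < r /\ (forall q, ball c r q -> Om q) /\
  (exists K, 0 <= K /\ INR n * (2 * r) * K <= 1 / 2 /\
     forall q i j, ball c r q -> (i < n)%nat -> (j < n)%nat -> Rabs (A i j q) <= K /\ Rabs (B i j q) <= K) /\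
  (forall q v, ball c r q -> exists X, eqn (X q) v /\ forall p, ball c r p -> sol_at X p).

Definition chart (c : C) (r : R) (X : C -> nat -> R) : Prop :=
  flat_ball c r /\ forall p, ball c r p -> sol_at X p.

Lemma flat_ball_exists p : Om p -> exists r, flat_ball p r.
Proof.
intros Hp.
destruct (HOm p Hp) as [d0 Hd0].
assert (Hb : forall i j, (i < n)%nat -> (j < n)%nat -> exists d K, 0 < d /\ 0 <= K /\
  forall q, ball p d q -> Rabs (A i j q) <= K /\ Rabs (B i j q) <= K /\ Rabs (pd false (B i j) q) <= K /\
  Rabs (pd false (pd false (B i j)) q) <= K).
{ intros i j Hi Hj.
  set (F := fun k : nat => match k with 0%nat => A i j | 1%nat => B i j | 2%nat => pd false (B i j)
     | _ => pd false (pd false (B i j)) end).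
  destruct (finite_delta_bound 4 (fun k d K => forall q, ball p d q -> Rabs (F k q) <= K))
    as [d [K [Hd [HK H]]]].
  - intros k d d' K K' H1 H2 H3 q Hq; eapply Rle_trans; [|exact H2].
    apply H3; now apply ball_le with d'.
  - intros k Hk; apply continuous_locally_bounded; apply (smooth_continuous Om); [|exact Hp].
    destruct k as [|[|[|k]]]; simpl; [now apply HA|now apply HB|now apply smooth_pd, HB|now apply smooth_pd, smooth_pd, HB].
  - exists d, K; repeat split; auto.
    + now apply (H 0%nat); [lia|].
    + now apply (H 1%nat); [lia|].
    + now apply (H 2%nat); [lia|].
    + now apply (H 3%nat); [lia|]. }
destruct (finite_delta_bound n (fun i d K => forall q j, ball p d q -> (j < n)%nat ->
  Rabs (A i j q) <= K /\ Rabs (B i j q) <= K /\ Rabs (pd false (B i j) q) <= K /\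
  Rabs (pd false (pd false (B i j)) q) <= K)) as [d [K [Hd [HK H]]]].
{ intros i d d' K K' H1 H2 H3 q j Hq Hj.
  destruct (H3 q j (ball_le _ _ _ H1 _ Hq) Hj) as [H4 [H5 [H6 H7]]]; repeat split; lra. }
{ intros i Hi.
  destruct (finite_delta_bound n (fun j d K => forall q, ball p d q ->
    Rabs (A i j q) <= K /\ Rabs (B i j q) <= K /\ Rabs (pd false (B i j) q) <= K /\
    Rabs (pd false (pd false (B i j)) q) <= K)) as [d [K [Hd [HK H]]]].
  - intros j d d' K K' H1 H2 H3 q Hq.
    destruct (H3 q (ball_le _ _ _ H1 _ Hq)) as [H4 [H5 [H6 H7]]]; repeat split; lra.
  - intros j Hj; now apply Hb.
  - exists d, K; repeat split; try assumption; now apply H. }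
assert (Hn := pos_INR n).
assert (HnK : 0 <= INR n * K) by now apply Rmult_le_pos.
(* To cover [ball p r], a solution started at [q] needs existence radius [2 * r], hence coefficient
   bounds on radius [3 * r] about [q], within [4 * r] of [p]. The second entry makes the smallness
   condition [INR n * (2 * r) * K <= 1 / 2] hold. *)
set (r := Rmin (Rmin d d0 / 8) (/ (8 * (INR n * K + 1)))).
assert (Hr : 0 < r).
{ apply Rmin_glb_lt; [|apply Rinv_0_lt_compat; lra].
  assert (0 < Rmin d d0) by (apply Rmin_glb_lt; [exact Hd|apply cond_pos]); lra. }
assert (Hr1 : 8 * r <= d).
{ assert (r <= Rmin d d0 / 8) by apply Rmin_l; assert (H2 := Rmin_l d d0); lra. }
assert (Hr2 : 8 * r <= d0).
{ assert (r <= Rmin d d0 / 8) by apply Rmin_l; assert (H2 := Rmin_r d d0); lra. }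
assert (Hr3 : 8 * r * (INR n * K) <= 1).
{ apply Rle_trans with (8 * (/ (8 * (INR n * K + 1))) * (INR n * K + 1)).
  - apply Rmult_le_compat; try lra. apply Rmult_le_compat_l; [lra|apply Rmin_r].
  - right; field; lra. }
assert (Hbq : forall q s, ball p r q -> ball q (3 * r) s -> ball p (8 * r) s).
{ intros q s H1 H2; apply ball_le with (r + 3 * r); [lra|]; now apply ball_triangle with q. }
exists r; repeat split.
- exact Hr.
- intros q Hq; apply Hd0; now apply ball_le with r; [lra|].
- exists K; repeat split; try lra; apply (H i) with (q := q) (j := j); auto; now apply ball_le with r; [lra|].
- intros q v Hq.
  assert (HcOm : forall s, ball q (3 * r) s -> Om s).
  { intros s Hs; apply Hd0; apply ball_le with (8 * r); [lra|]; now apply Hbq with q. }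
  assert (Hbd : bounded_coef n A B q (3 * r) K).
  { intros s i j Hs Hi Hj; apply (H i Hi s j); auto; apply ball_le with (8 * r); [lra|]; now apply Hbq with q. }
  destruct (local_sol_spec n Om A B HA HB Hflat q (2 * r) (3 * r) K v) as [H1 H2]; auto; try lra.
  eexists; split; [exact H1|]; intros s Hs; apply H2.
  replace (2 * r) with (r + r) by ring; apply ball_triangle with p; [now apply ball_sym|exact Hs].
Qed.

(** The intersection of two squares contains the rectangle spanned by any two of its points, so
    [local_uniqueness] applies inside the overlap. *)
Lemma charts_agree c r c' r' X X' p q : chart c r X -> chart c' r' X' ->
  ball c r p -> ball c r q -> ball c' r' p -> ball c' r' q ->
  eqn (X p) (X' p) -> eqn (X q) (X' q).
Proof.
intros [[Hr [HO [[K [HK [HK1 HK2]]] _]]] HX] [_ HX'] Hp Hq Hp' Hq' E.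
apply (local_uniqueness n A B c r K X X' p q HK HK1 HK2 Hp Hq); [|exact E].
intros a b Ha Hb.
apply (proj1 (ball_C _ _ _)) in Hp; apply (proj1 (ball_C _ _ _)) in Hq; apply (proj1 (ball_C _ _ _)) in Hp'; apply (proj1 (ball_C _ _ _)) in Hq'.
destruct Hp, Hq, Hp', Hq'; split; [apply HX|apply HX']; apply ball_C; simpl; split.
- now apply (between_near (fst p) (fst q)).
- now apply (between_near (snd p) (snd q)).
- now apply (between_near (fst p) (fst q)).
- now apply (between_near (snd p) (snd q)).
Qed.

(* Parallel transport along [g] on [0, T]. *)
Definition lift_to (T : R) (g : R -> C) (Y : R -> nat -> R) : Prop :=
  forall t, 0 <= t <= T -> exists c r X d, chart c r X /\ 0 < d /\
    forall s, 0 <= s <= T -> Rabs (s - t) < d -> ball c r (g s) /\ eqn (Y s) (X (g s)).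
Notation lift := (lift_to 1).

Lemma lift_chart g Y a b c r X : lift g Y -> 0 <= a <= b -> b <= 1 ->
  chart c r X -> (forall s, a <= s <= b -> ball c r (g s)) ->
  eqn (Y a) (X (g a)) -> eqn (Y b) (X (g b)).
Proof.
intros HL Hab Hb1 HX Hin Ha.
set (sg := fun t => a + t * (b - a)).
assert (Hsg : forall t, 0 <= t <= 1 -> a <= sg t <= b).
{ intros t Ht; unfold sg; split; [assert (0 <= t * (b - a)) by (apply Rmult_le_pos; lra); lra|].
  assert (t * (b - a) <= 1 * (b - a)) by (apply Rmult_le_compat_r; lra); lra. }
assert (H := interval_induction (fun t => eqn (Y (sg t)) (X (g (sg t))))).
replace b with (sg 1) by (unfold sg; ring); apply H; [|clear H|lra].
- unfold sg; rewrite Rmult_0_l, Rplus_0_r; exact Ha.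
- intros t Ht; destruct (HL (sg t)) as [c' [r' [X' [d [HX' [Hd HY]]]]]]; [assert (H1 := Hsg t Ht); lra|].
  exists (d / (b - a + 1)); split; [apply Rdiv_lt_0_compat; lra|].
  assert (Hnear : forall s, 0 <= s <= 1 -> Rabs (s - t) < d / (b - a + 1) ->
    ball c' r' (g (sg s)) /\ eqn (Y (sg s)) (X' (g (sg s)))).
  { intros s Hs Hst; apply HY; [assert (H1 := Hsg s Hs); lra|].
    replace (sg s - sg t) with ((s - t) * (b - a)) by (unfold sg; ring).
    rewrite Rabs_mult, (Rabs_pos_eq (b - a)) by lra.
    apply Rle_lt_trans with (Rabs (s - t) * (b - a + 1)).
    - apply Rmult_le_compat_l; [apply Rabs_pos|lra].
    - apply Rlt_le_trans with (d / (b - a + 1) * (b - a + 1)); [apply Rmult_lt_compat_r; lra|].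
      right; field; lra. }
  intros s s' Hs Hs' H1 H2 HP.
  destruct (Hnear s Hs H1) as [B1 E1]; destruct (Hnear s' Hs' H2) as [B2 E2].
  apply eqn_trans with (1 := E2).
  apply (charts_agree c' r' c r X' X (g (sg s)) (g (sg s'))); auto.
  apply eqn_trans with (2 := HP); now apply eqn_sym.
Qed.

Lemma lift_unique g Y Y' : lift g Y -> lift g Y' -> eqn (Y 0) (Y' 0) ->
  forall t, 0 <= t <= 1 -> eqn (Y t) (Y' t).
Proof.
intros HL HL' H0; apply interval_induction; [exact H0|].
intros t Ht; destruct (HL t Ht) as [c [r [X [d [HX [Hd HY]]]]]].
destruct (HL' t Ht) as [c' [r' [X' [d' [HX' [Hd' HY']]]]]].
exists (Rmin d d'); split; [now apply Rmin_glb_lt|].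
intros s s' Hs Hs' H1 H2 HP; assert (M1 := Rmin_l d d'); assert (M2 := Rmin_r d d').
destruct (HY s Hs) as [B1 E1]; [lra|]; destruct (HY s' Hs') as [B2 E2]; [lra|].
destruct (HY' s Hs) as [B1' E1']; [lra|]; destruct (HY' s' Hs') as [B2' E2']; [lra|].
apply eqn_trans with (1 := E2); apply eqn_trans with (X' (g s')); [|now apply eqn_sym].
apply (charts_agree c r c' r' X X' (g s) (g s')); auto.
apply eqn_trans with (Y s); [now apply eqn_sym|]; now apply eqn_trans with (Y' s).
Qed.

Lemma path_near (g : R -> C) (t : R) (c : C) (r : R) : continuous g t -> ball c r (g t) ->
  exists d, 0 < d /\ forall s, Rabs (s - t) < d -> ball c r (g s).
Proof.
intros Hc Hb.
apply (proj1 (ball_C _ _ _)) in Hb; destruct Hb as [H1 H2].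
assert (He : 0 < Rmin (r - Rabs (fst (g t) - fst c)) (r - Rabs (snd (g t) - snd c)))
  by (apply Rmin_glb_lt; lra).
assert (H := proj1 (filterlim_locally g (g t)) Hc (mkposreal _ He)).
destruct H as [d Hd]; exists d; split; [apply cond_pos|].
intros s Hs; specialize (Hd s Hs); apply (proj1 (ball_C _ _ _)) in Hd; simpl in Hd; destruct Hd as [H3 H4].
assert (M1 := Rmin_l (r - Rabs (fst (g t) - fst c)) (r - Rabs (snd (g t) - snd c))).
assert (M2 := Rmin_r (r - Rabs (fst (g t) - fst c)) (r - Rabs (snd (g t) - snd c))).
apply ball_C; split.
- replace (fst (g s) - fst c) with (fst (g s) - fst (g t) + (fst (g t) - fst c)) by ring.
  eapply Rle_lt_trans; [apply Rabs_triang|lra].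
- replace (snd (g s) - snd c) with (snd (g s) - snd (g t) + (snd (g t) - snd c)) by ring.
  eapply Rle_lt_trans; [apply Rabs_triang|lra].
Qed.

(** Real induction on the end of the lifted segment. Near [t], a lift up to [s] is prolonged by the
    solution in a square about [g t] that takes the value [Y s] at [g s]; at the gluing point the
    two charts agree. *)
Lemma lift_exists g v : path_in Om g -> exists Y, lift g Y /\ eqn (Y 0) v.
Proof.
intros [Hc Hg].
apply (interval_induction (fun T => exists Y, lift_to T g Y /\ eqn (Y 0) v)); [| |lra].
- destruct (flat_ball_exists (g 0)) as [r Hr]; [apply Hg; lra|].
  assert (B0 : ball (g 0) r (g 0)) by (destruct Hr as [Hr _]; apply (ball_center _ (mkposreal r Hr))).
  destruct (proj2 (proj2 (proj2 Hr)) (g 0) v B0) as [X [X0 HX]].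
  exists (fun _ => X (g 0)); split; [|exact X0].
  intros t Ht; exists (g 0), r, X, 1; split; [now split|split; [lra|]].
  intros s Hs _; replace s with 0 by lra; split; [exact B0|apply eqn_refl].
- intros t Ht; destruct (flat_ball_exists (g t)) as [r Hr]; [now apply Hg|].
  destruct (path_near g t (g t) r (Hc t)) as [d [Hd Hnear]].
  { destruct Hr as [Hr _]; apply (ball_center _ (mkposreal r Hr)). }
  exists d; split; [exact Hd|].
  intros s s' Hs Hs' Hsd Hsd' [Y [HY Y0]].
  destruct (Rle_lt_dec s' s) as [Hle|Hlt].
  + exists Y; split; [|exact Y0]; intros u Hu.
    destruct (HY u) as [c [r1 [X [d1 [HX [Hd1 H1]]]]]]; [lra|].
    exists c, r1, X, d1; split; [exact HX|split; [exact Hd1|]]; intros w Hw; apply H1; lra.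
  + destruct (proj2 (proj2 (proj2 Hr)) (g s) (Y s) (Hnear s Hsd)) as [X [Xs HX]].
    exists (fun u => if Rle_dec u s then Y u else X (g u)); split.
    2: { destruct (Rle_dec 0 s); [exact Y0|lra]. }
    intros u Hu; destruct (Rtotal_order u s) as [Hus|[Hus|Hus]].
    * destruct (HY u) as [c [r1 [X1 [d1 [HX1 [Hd1 H1]]]]]]; [lra|].
      exists c, r1, X1, (Rmin d1 (s - u)); split; [exact HX1|split; [apply Rmin_glb_lt; lra|]].
      intros w Hw Hwu; assert (M1 := Rmin_l d1 (s - u)); assert (M2 := Rmin_r d1 (s - u)).
      assert (Hws : w <= s) by (assert (M3 := Rle_abs (w - u)); lra).
      destruct (Rle_dec w s); [|contradiction]; apply H1; lra.
    * subst u; destruct (HY s) as [c [r1 [X1 [d1 [HX1 [Hd1 H1]]]]]]; [lra|].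
      destruct (H1 s) as [Bs Es]; [lra|rewrite Rminus_diag, Rabs_R0; exact Hd1|].
      destruct (path_near g s c r1 (Hc s) Bs) as [d2 [Hd2 H2]].
      exists c, r1, X1, (Rmin d1 d2); split; [exact HX1|split; [now apply Rmin_glb_lt|]].
      intros w Hw Hwu; assert (M1 := Rmin_l d1 d2); assert (M2 := Rmin_r d1 d2).
      destruct (Rle_dec w s) as [Hws|Hws]; [apply H1; lra|].
      split; [apply H2; lra|].
      apply (charts_agree (g t) r c r1 X X1 (g s) (g w)); auto.
      -- now split.
      -- apply Hnear; apply Rabs_def2 in Hsd; apply Rabs_def2 in Hsd'; apply Rabs_def1; lra.
      -- apply H2; lra.
      -- now apply eqn_trans with (Y s).
    * exists (g t), r, X, (u - s); split; [now split|split; [lra|]].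
      intros w Hw Hwu; assert (M3 := Rle_abs (- (w - u))); rewrite Rabs_Ropp in M3.
      destruct (Rle_dec w s); [lra|]; split; [|apply eqn_refl].
      apply Hnear; apply Rabs_def2 in Hsd; apply Rabs_def2 in Hsd'; apply Rabs_def1; lra.
Qed.

Lemma lift_reparam g h Y a b : lift g Y -> (forall t, 0 <= t <= 1 -> 0 <= a + b * t <= 1) ->
  (forall t, 0 <= t <= 1 -> h t = g (a + b * t)) -> lift h (fun t => Y (a + b * t)).
Proof.
intros HL Hab Hh t Ht.
destruct (HL (a + b * t) (Hab t Ht)) as [c [r [X [d [HX [Hd H]]]]]].
exists c, r, X, (d / (Rabs b + 1)); assert (Hb := Rabs_pos b).
split; [exact HX|split; [apply Rdiv_lt_0_compat; lra|]].
intros s Hs Hst; rewrite Hh by exact Hs; apply H; [now apply Hab|].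
replace (a + b * s - (a + b * t)) with ((s - t) * b) by ring.
rewrite Rabs_mult; apply Rle_lt_trans with (Rabs (s - t) * (Rabs b + 1)).
- apply Rmult_le_compat_l; [apply Rabs_pos|lra].
- apply Rlt_le_trans with (d / (Rabs b + 1) * (Rabs b + 1)); [apply Rmult_lt_compat_r; lra|].
  right; field; lra.
Qed.

(** Transport as a relation with the path forgotten. It becomes a function of [q] once loops are
    known to act trivially. *)
Definition transported (p : C) (v : nat -> R) (q : C) (w : nat -> R) : Prop :=
  exists g Y, path_in Om g /\ lift g Y /\ g 0 = p /\ eqn (Y 0) v /\ g 1 = q /\ eqn (Y 1) w.

Lemma affine_continuous a b t : continuous (fun t : R => a + b * t) t.
Proof.
apply (lip_continuous _ (Rabs b)); intros x y.
replace (a + b * x - (a + b * y)) with (b * (x - y)) by ring; rewrite Rabs_mult; lra.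
Qed.

Lemma transported_sym p v q w : transported p v q w -> transported q w p v.
Proof.
intros [g [Y [[Hc Hg] [HL [G0 [Y0 [G1 Y1]]]]]]].
exists (fun t => g (1 + -1 * t)), (fun t => Y (1 + -1 * t)).
split; [split|split; [|split; [|split; [|split]]]].
- intros t; apply (continuous_comp (fun t => 1 + -1 * t) g); [apply affine_continuous|apply Hc].
- intros t Ht; apply Hg; lra.
- apply (lift_reparam g); [exact HL|intros; lra|reflexivity].
- now replace (1 + -1 * 0) with 1 by ring.
- now replace (1 + -1 * 0) with 1 by ring.
- now replace (1 + -1 * 1) with 0 by ring.
- now replace (1 + -1 * 1) with 0 by ring.
Qed.

(** The concatenated path is lifted afresh, and uniqueness of lifts identifies its two halves with
    the given ones. *)
Lemma transported_trans p v q w o u : transported p v q w -> transported q w o u -> transported p v o u.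
Proof.
intros [g [Y [[Hc Hg] [HL [G0 [Y0 [G1 Y1]]]]]]] [g' [Y' [[Hc' Hg'] [HL' [G0' [Y0' [G1' Y1']]]]]]].
set (cl := clamp (1 / 2) (1 / 2)).
assert (Hd : 0 <= 1 / 2) by lra.
(* Concatenation as a sum instead of a case distinction: on each half one of the two summands is
   frozen at [q], and continuity comes for free. *)
set (k := fun t : R => (fst (g (cl (0 + 2 * t))) + (fst (g' (cl (-1 + 2 * t))) - fst q),
                       snd (g (cl (0 + 2 * t))) + (snd (g' (cl (-1 + 2 * t))) - snd q))).
assert (Hcl : forall t, continuous cl t) by (intros; now apply clamp_continuous with 1; try lra).
assert (Hk1 : forall t, 0 <= t <= 1 / 2 -> k t = g (0 + 2 * t)).
{ intros t Ht; unfold k, cl; rewrite clamp_id by lra.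
  replace (clamp (1 / 2) (1 / 2) (-1 + 2 * t)) with 0.
  - rewrite G0'; destruct (g (0 + 2 * t)); simpl; f_equal; ring.
  - unfold clamp; rewrite Rmin_right, Rmax_left; lra. }
assert (Hk2 : forall t, 1 / 2 <= t <= 1 -> k t = g' (-1 + 2 * t)).
{ intros t Ht; unfold k, cl; rewrite (clamp_id _ _ (-1 + 2 * t)) by lra.
  replace (clamp (1 / 2) (1 / 2) (0 + 2 * t)) with 1.
  - rewrite G1; destruct (g' (-1 + 2 * t)); simpl; f_equal; ring.
  - unfold clamp; rewrite Rmin_left, Rmax_right; lra. }
assert (Hpk : path_in Om k).
{ split.
  - intros t; unfold k.
    assert (H1 : continuous (fun t => g (cl (0 + 2 * t))) t).
    { apply (continuous_comp (fun t => cl (0 + 2 * t)) g); [|apply Hc].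
      apply (continuous_comp (fun t => 0 + 2 * t) cl); [apply affine_continuous|apply Hcl]. }
    assert (H2 : continuous (fun t => g' (cl (-1 + 2 * t))) t).
    { apply (continuous_comp (fun t => cl (-1 + 2 * t)) g'); [|apply Hc'].
      apply (continuous_comp (fun t => -1 + 2 * t) cl); [apply affine_continuous|apply Hcl]. }
    assert (HF : forall (f : R -> C), continuous f t ->
      continuous (fun t => fst (f t)) t /\ continuous (fun t => snd (f t)) t).
    { intros f Hf; split; [apply (continuous_comp f fst)|apply (continuous_comp f snd)]; auto;
        [apply continuous_fst|apply continuous_snd]. }
    destruct (HF _ H1) as [F1 S1]; destruct (HF _ H2) as [F2 S2].
    apply (continuous_comp_2 (fun t => fst (g (cl (0 + 2 * t))) + (fst (g' (cl (-1 + 2 * t))) - fst q))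
      (fun t => snd (g (cl (0 + 2 * t))) + (snd (g' (cl (-1 + 2 * t))) - snd q)) (fun a b => (a, b))).
    + apply (continuous_plus (V := R_NormedModule)); [exact F1|].
      apply (continuous_minus (V := R_NormedModule)); [exact F2|apply continuous_const].
    + apply (continuous_plus (V := R_NormedModule)); [exact S1|].
      apply (continuous_minus (V := R_NormedModule)); [exact S2|apply continuous_const].
    + apply continuous_ext with (fun x => x); [intros [? ?]; reflexivity|apply continuous_id].
  - intros t Ht; destruct (Rle_lt_dec t (1 / 2)).
    + rewrite Hk1 by lra; apply Hg; lra.
    + rewrite Hk2 by lra; apply Hg'; lra. }
destruct (lift_exists k v Hpk) as [Z [HZ Z0]].
assert (L1 : lift g (fun t => Z (0 + 1 / 2 * t))).
{ apply (lift_reparam k); [exact HZ|intros; lra|].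
  intros t Ht; rewrite Hk1 by lra; f_equal; field. }
assert (L2 : lift g' (fun t => Z (1 / 2 + 1 / 2 * t))).
{ apply (lift_reparam k); [exact HZ|intros; lra|].
  intros t Ht; rewrite Hk2 by lra; f_equal; field. }
assert (E1 : eqn (Z (0 + 1 / 2 * 1)) (Y 1)).
{ apply (lift_unique g (fun t => Z (0 + 1 / 2 * t)) Y L1 HL); [|lra].
  replace (0 + 1 / 2 * 0) with 0 by field; apply eqn_trans with v; [exact Z0|now apply eqn_sym]. }
assert (E2 : eqn (Z (1 / 2 + 1 / 2 * 1)) (Y' 1)).
{ apply (lift_unique g' (fun t => Z (1 / 2 + 1 / 2 * t)) Y' L2 HL'); [|lra].
  replace (1 / 2 + 1 / 2 * 0) with (0 + 1 / 2 * 1) by field.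
  apply eqn_trans with (1 := E1); apply eqn_trans with w; [exact Y1|now apply eqn_sym]. }
exists k, Z; split; [exact Hpk|split; [exact HZ|split; [|split; [exact Z0|split]]]].
- rewrite Hk1 by lra; now replace (0 + 2 * 0) with 0 by ring.
- rewrite Hk2 by lra; now replace (-1 + 2 * 1) with 1 by ring.
- replace 1 with (1 / 2 + 1 / 2 * 1) by field; apply eqn_trans with (1 := E2); exact Y1'.
Qed.

Lemma transported_in_chart c r X p q : chart c r X -> ball c r p -> ball c r q ->
  transported p (X p) q (X q).
Proof.
intros HX Hp Hq.
set (g := fun t : R => (fst p + (fst q - fst p) * t, snd p + (snd q - snd p) * t)).
assert (Hin : forall t, 0 <= t <= 1 -> ball c r (g t)).
{ intros t Ht; apply (proj1 (ball_C _ _ _)) in Hp; apply (proj1 (ball_C _ _ _)) in Hq; apply ball_C; simpl.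
  assert (Hb : forall a b, Rmin a b <= a + (b - a) * t <= Rmax a b).
  { intros a b; unfold Rmin, Rmax; destruct (Rle_dec a b).
    - assert (0 <= (b - a) * t) by (apply Rmult_le_pos; lra).
      assert ((b - a) * t <= (b - a) * 1) by (apply Rmult_le_compat_l; lra); lra.
    - assert (0 <= (a - b) * t) by (apply Rmult_le_pos; lra).
      assert ((a - b) * t <= (a - b) * 1) by (apply Rmult_le_compat_l; lra); lra. }
  split; [apply (between_near (fst p) (fst q))|apply (between_near (snd p) (snd q))]; try apply Hb;
    try apply Hp; apply Hq. }
exists g, (fun t => X (g t)); split; [split|split; [|split; [|split; [|split]]]].
- intros t; apply (continuous_comp_2 (fun t => fst p + (fst q - fst p) * t)
    (fun t => snd p + (snd q - snd p) * t) (fun a b => (a, b))); try apply affine_continuous.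
  apply continuous_ext with (fun x => x); [intros [? ?]; reflexivity|apply continuous_id].
- intros t Ht; destruct HX as [[_ [HO _]] _]; apply HO; now apply Hin.
- intros t Ht; exists c, r, X, 1; split; [exact HX|split; [lra|]].
  intros s Hs _; split; [now apply Hin|apply eqn_refl].
- unfold g; destruct p; simpl; f_equal; ring.
- replace (g 0) with p; [apply eqn_refl|unfold g; destruct p; simpl; f_equal; ring].
- unfold g; destruct q; simpl; f_equal; ring.
- replace (g 1) with q; [apply eqn_refl|unfold g; destruct q; simpl; f_equal; ring].
Qed.

(** Lebesgue number argument on the unit square. The radius [2 * d] leaves room for a cell of side
    [/ INR N < d] around the sampled point. *)
Lemma grid_of_homotopy (H : C -> C) : (forall st, continuous H st) ->
  (forall s t, 0 <= s <= 1 -> 0 <= t <= 1 -> Om (H (s, t))) ->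
  exists N : nat, (0 < N)%nat /\ forall i j, (i < N)%nat -> (j < N)%nat -> exists c r, flat_ball c r /\
    forall s t, INR i / INR N <= s <= INR (S i) / INR N -> INR j / INR N <= t <= INR (S j) / INR N ->
    ball c r (H (s, t)).
Proof.
intros Hc HO.
assert (Hd : forall s t, exists d : posreal, 0 <= s <= 1 -> 0 <= t <= 1 ->
  exists c r, flat_ball c r /\ forall q, ball (s, t) (2 * d) q -> ball c r (H q)).
{ intros s t.
  destruct (Classical_Prop.classic (0 <= s <= 1 /\ 0 <= t <= 1)) as [[Hs Ht]|Hn].
  - destruct (flat_ball_exists (H (s, t)) (HO s t Hs Ht)) as [r Hr].
    assert (Hr0 := proj1 Hr).
    assert (HL := proj1 (filterlim_locally H (H (s, t))) (Hc (s, t)) (mkposreal r Hr0)).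
    destruct HL as [d Hd].
    assert (Hd2 : 0 < d / 2) by (assert (H1 := cond_pos d); lra).
    exists (mkposreal _ Hd2); intros _ _; exists (H (s, t)), r; split; [exact Hr|].
    intros q Hq; apply Hd; simpl in Hq; replace (2 * (d / 2)) with (pos d) in Hq by field; exact Hq.
  - exists (mkposreal 1 Rlt_0_1); intros; exfalso; now apply Hn. }
set (dl := fun s t => proj1_sig (constructive_indefinite_description _ (Hd s t))).
destruct (compactness_value_2d 0 1 0 1 dl) as [d Hdd].
destruct (archimed_cor1 d (cond_pos d)) as [N [HN HN0]].
exists N; split; [exact HN0|].
intros i j Hi Hj.
assert (HNp : 0 < INR N) by now apply lt_0_INR.
assert (Hbd : forall i, (i < N)%nat -> 0 <= INR i / INR N <= 1 /\ INR (S i) / INR N = INR i / INR N + / INR N).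
{ intros k Hk; split; [split|].
  - apply Rmult_le_pos; [apply pos_INR|left; now apply Rinv_0_lt_compat].
  - apply Rle_div_l; [exact HNp|]; rewrite Rmult_1_l; apply le_INR; lia.
  - rewrite S_INR; field; lra. }
destruct (Hbd i Hi) as [Hi1 Hi2]; destruct (Hbd j Hj) as [Hj1 Hj2].
apply Classical_Prop.NNPP; intros Hno.
apply (Hdd _ _ Hi1 Hj1); intros [u [v [Hu [Hv [H1 [H2 H3]]]]]].
apply Hno; unfold dl in H1, H2, H3.
destruct (constructive_indefinite_description _ (Hd u v)) as [e He]; simpl in H1, H2, H3.
destruct (He Hu Hv) as [c [r [Hg HB2]]]; exists c, r; split; [exact Hg|].
intros s t Hs Ht; apply HB2; apply ball_C; simpl.
rewrite Hi2 in Hs; rewrite Hj2 in Ht.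
apply Rabs_def2 in H1; apply Rabs_def2 in H2.
split; apply Rabs_def1; lra.
Qed.

(* Transport along the horizontal lines of the homotopy grid; by flatness each grid cell
   acts trivially, so the defect of closedness moves unchanged to the constant row. *)
Lemma loop_trivial g Y : simply_connected Om -> path_in Om g -> lift g Y -> g 0 = g 1 -> eqn (Y 0) (Y 1).
Proof.
intros [_ [_ HSC]] Hpg HL Hg01.
destruct (HSC g Hpg Hg01) as [H [Hc [HO [Hbot [Htop Hside]]]]].
destruct (grid_of_homotopy H Hc HO) as [N [HN Hcell]].
assert (HNp : 0 < INR N) by now apply lt_0_INR.
set (gr := fun i : nat => INR i / INR N).
assert (Hgr : forall i, (i <= N)%nat -> 0 <= gr i <= 1).
{ intros k Hk; unfold gr; split.
  - apply Rmult_le_pos; [apply pos_INR|left; now apply Rinv_0_lt_compat].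
  - apply Rle_div_l; [exact HNp|]; rewrite Rmult_1_l; now apply le_INR. }
assert (Hgs : forall i, gr i <= gr (S i)).
{ intros k; unfold gr; apply Rmult_le_compat_r; [left; now apply Rinv_0_lt_compat|]; apply le_INR; lia. }
assert (Hg0 : gr 0%nat = 0) by (unfold gr; simpl; unfold Rdiv; ring).
assert (HgN : gr N = 1) by (unfold gr; field; lra).
set (k := fun i j => H (gr i, gr j)).
assert (Hcorner : forall i j, (i < N)%nat -> (j < N)%nat -> exists c r, flat_ball c r /\
  ball c r (k i j) /\ ball c r (k (S i) j) /\ ball c r (k i (S j)) /\ ball c r (k (S i) (S j))).
{ intros i j Hi Hj; destruct (Hcell i j Hi Hj) as [c [r [Hgd Hb]]]; exists c, r; split; [exact Hgd|].
  assert (Hx := Hgs i); assert (Hy := Hgs j); fold (gr i) (gr (S i)) (gr j) (gr (S j)) in Hb.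
  unfold k; repeat split; apply Hb; lra. }
(* [cons j y]: the values [y i] at the vertices of row [j] are linked, along each horizontal edge,
   by a local solution. *)
set (cons := fun j (y : nat -> nat -> R) => forall i, (i < N)%nat -> exists c r X, chart c r X /\
   ball c r (k i j) /\ ball c r (k (S i) j) /\ eqn (X (k i j)) (y i) /\ eqn (X (k (S i) j)) (y (S i))).
assert (Hup : forall j, (j < N)%nat -> (forall y, cons (S j) y -> eqn (y O) (y N)) ->
  forall y, cons j y -> eqn (y O) (y N)).
{ intros j Hj IH y Hy.
  assert (Hv : forall i, exists w, (i <= N)%nat -> exists c r X, chart c r X /\
    ball c r (k i j) /\ ball c r (k i (S j)) /\ eqn (X (k i j)) (y i) /\ eqn (X (k i (S j))) w).
  { intros i; destruct (Compare_dec.le_lt_dec i N) as [Hi|Hi]; [|exists (y O); lia].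
    assert (Hgd : exists c r, flat_ball c r /\ ball c r (k i j) /\ ball c r (k i (S j))).
    { destruct (Nat.eq_dec i N) as [->|Hne].
      - destruct (Hcorner (N - 1)%nat j) as [c [r Hcr]]; [lia|exact Hj|].
        replace (S (N - 1)) with N in Hcr by lia; exists c, r; tauto.
      - destruct (Hcorner i j) as [c [r Hcr]]; [lia|exact Hj|]; exists c, r; tauto. }
    destruct Hgd as [c [r [Hgd [B1 B2]]]].
    destruct (proj2 (proj2 (proj2 Hgd)) (k i j) (y i) B1) as [X [X0 HX]].
    exists (X (k i (S j))); intros _; exists c, r, X; split; [now split|split; [exact B1|split; [exact B2|split; [exact X0|apply eqn_refl]]]]. }
  set (w := fun i => proj1_sig (constructive_indefinite_description _ (Hv i))).
  assert (Hw : forall i, (i <= N)%nat -> exists c r X, chart c r X /\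
    ball c r (k i j) /\ ball c r (k i (S j)) /\ eqn (X (k i j)) (y i) /\ eqn (X (k i (S j))) (w i)).
  { intros i Hi; unfold w; destruct (constructive_indefinite_description _ (Hv i)) as [u Hu]; simpl; auto. }
  assert (Hcw : cons (S j) w).
  { intros i Hi; destruct (Hcorner i j Hi Hj) as [c [r [Hgd [B1 [B2 [B3 B4]]]]]].
    destruct (proj2 (proj2 (proj2 Hgd)) (k i j) (y i) B1) as [X [X0 HX]].
    assert (HC : chart c r X) by now split.
    exists c, r, X; split; [exact HC|split; [exact B3|split; [exact B4|]]].
    destruct (Hy i Hi) as [c0 [r0 [X00 [HC0 [D1 [D2 [D3 D4]]]]]]].
    destruct (Hw i) as [c1 [r1 [X1 [HC1 [E1 [E2 [E3 E4]]]]]]]; [lia|].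
    destruct (Hw (S i)) as [c2 [r2 [X2 [HC2 [F1 [F2 [F3 F4]]]]]]]; [lia|].
    split.
    - apply eqn_trans with (2 := E4).
      apply (charts_agree c r c1 r1 X X1 (k i j)); auto.
      apply eqn_trans with (1 := X0); now apply eqn_sym.
    - apply eqn_trans with (2 := F4).
      apply (charts_agree c r c2 r2 X X2 (k (S i) j)); auto.
      apply eqn_trans with (y (S i)); [|now apply eqn_sym].
      apply eqn_trans with (2 := D4).
      apply (charts_agree c r c0 r0 X X00 (k i j)); auto.
      apply eqn_trans with (1 := X0); now apply eqn_sym. }
  assert (Hw0N := IH w Hcw).
  destruct (Hw O) as [c1 [r1 [X1 [HC1 [E1 [E2 [E3 E4]]]]]]]; [lia|].
  destruct (Hw N) as [c2 [r2 [X2 [HC2 [F1 [F2 [F3 F4]]]]]]]; [lia|].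
  (* The homotopy runs through closed loops, so the left and right edges of the grid coincide and
     transport along them is the same. *)
  assert (Hk : forall j, (j <= N)%nat -> k N j = k O j).
  { intros l Hl; unfold k; rewrite Hg0, HgN; symmetry; apply Hside; now apply Hgr. }
  rewrite !Hk in F1, F2, F3, F4 by lia.
  apply eqn_trans with (X1 (k O j)); [now apply eqn_sym|].
  apply eqn_trans with (2 := F3).
  apply (charts_agree c1 r1 c2 r2 X1 X2 (k O (S j))); auto.
  apply eqn_trans with (1 := E4); apply eqn_trans with (1 := Hw0N); now apply eqn_sym. }
assert (Htopc : forall y, cons N y -> eqn (y O) (y N)).
{ intros y Hy; assert (Hi : forall i, (i <= N)%nat -> eqn (y O) (y i)).
  { induction i as [|i IH]; intros Hi; [apply eqn_refl|].
    apply eqn_trans with (1 := IH ltac:(lia)).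
    destruct (Hy i) as [c [r [X [_ [_ [_ [E1 E2]]]]]]]; [lia|].
    assert (Ek : k (S i) N = k i N).
    { unfold k; rewrite HgN, (Htop (gr (S i))), (Htop (gr i)) by (apply Hgr; lia); reflexivity. }
    rewrite Ek in E2; apply eqn_trans with (2 := E2); now apply eqn_sym. }
  now apply Hi. }
assert (Hall : forall m, (m <= N)%nat -> forall y, cons (N - m)%nat y -> eqn (y O) (y N)).
{ induction m as [|m IH]; intros Hm y Hy.
  - rewrite Nat.sub_0_r in Hy; now apply Htopc.
  - apply (Hup (N - S m)%nat); [lia| |exact Hy].
    replace (S (N - S m)) with (N - m)%nat by lia; apply IH; lia. }
assert (HY : eqn (Y (gr O)) (Y (gr N))).
{ apply (Hall N (Nat.le_refl N) (fun i => Y (gr i))).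
  rewrite Nat.sub_diag; intros i Hi.
  destruct (Hcell i O Hi HN) as [c [r [Hgd Hb]]].
  fold (gr i) (gr (S i)) in Hb.
  assert (Hin : forall s, gr i <= s <= gr (S i) -> ball c r (g s)).
  { intros s Hs; rewrite <- Hbot.
    - assert (Hy := Hgs O); fold (gr O) (gr 1%nat) in Hb; rewrite Hg0 in Hb, Hy; apply Hb; lra.
    - assert (H1 := Hgr i); assert (H2 := Hgr (S i)).
      destruct H1 as [H1 _]; [lia|]; destruct H2 as [_ H2]; [lia|]; lra. }
  assert (Hx := Hgs i).
  assert (B1 : ball c r (g (gr i))) by (apply Hin; lra).
  destruct (proj2 (proj2 (proj2 Hgd)) (g (gr i)) (Y (gr i)) B1) as [X [X0 HX]].
  assert (Ek : forall l, (l <= N)%nat -> k l O = g (gr l)).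
  { intros l Hl; unfold k; rewrite Hg0; apply Hbot; now apply Hgr. }
  exists c, r, X; rewrite !Ek by lia.
  split; [now split|split; [exact B1|split; [apply Hin; lra|split; [exact X0|]]]].
  apply eqn_sym.
  assert (H1 := Hgr i ltac:(lia)); assert (H2 := Hgr (S i) ltac:(lia)).
  apply (lift_chart g Y (gr i) (gr (S i)) c r X HL); auto; try lra; [now split|now apply eqn_sym]. }
now rewrite Hg0, HgN in HY.
Qed.

(** The value at [q] is any transported one. Triviality of loops makes it independent of the path,
    hence equal to a chart solution near every point. *)
Theorem flat_global_solution z0 v0 : simply_connected Om -> Om z0 ->
  exists X, eqn (X z0) v0 /\ forall p, Om p -> sol_at X p.
Proof.
intros HSC Hz0.
assert (Hex : forall q, exists w, Om q -> transported z0 v0 q w).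
{ intros q; destruct (Classical_Prop.classic (Om q)) as [Hq|Hq]; [|exists v0; tauto].
  destruct (proj1 (proj2 HSC) z0 q Hz0 Hq) as [g [Hg [G0 G1]]].
  destruct (lift_exists g v0 Hg) as [Y [HY Y0]].
  exists (Y 1); intros _; exists g, Y; split; [exact Hg|split; [exact HY|split; [exact G0|split; [exact Y0|split; [exact G1|apply eqn_refl]]]]]. }
set (X := fun q => proj1_sig (constructive_indefinite_description _ (Hex q))).
assert (HX : forall q, Om q -> transported z0 v0 q (X q)).
{ intros q Hq; unfold X; destruct (constructive_indefinite_description _ (Hex q)) as [w Hw]; simpl; auto. }
assert (Huniq : forall q w w', transported z0 v0 q w -> transported z0 v0 q w' -> eqn w w').
{ intros q w w' H1 H2.
  destruct (transported_trans _ _ _ _ _ _ (transported_sym _ _ _ _ H1) H2)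
    as [g [Y [Hg [HL [G0 [Y0 [G1 Y1]]]]]]].
  assert (E := loop_trivial g Y HSC Hg HL (eq_trans G0 (eq_sym G1))).
  apply eqn_trans with (Y 0); [now apply eqn_sym|]; now apply eqn_trans with (Y 1). }
assert (Hloc : forall q c r X1, chart c r X1 -> ball c r q -> eqn (X1 q) (X q) ->
  forall q', ball c r q' -> eqn (X1 q') (X q')).
{ intros q c r X1 HC Hq E q' Hq'.
  assert (HOq := proj1 (proj2 (proj1 HC))).
  apply (Huniq q'); [|apply HX, HOq, Hq'].
  apply transported_trans with q (X1 q).
  - destruct (HX q (HOq q Hq)) as [g [Y [Hg [HL [G0 [Y0 [G1 Y1]]]]]]].
    exists g, Y; split; [exact Hg|split; [exact HL|split; [exact G0|split; [exact Y0|split; [exact G1|]]]]].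
    apply eqn_trans with (1 := Y1); now apply eqn_sym.
  - now apply transported_in_chart with c r. }
assert (Hchart : forall q, Om q -> exists r X1, chart q r X1 /\ ball q r q /\ eqn (X1 q) (X q)).
{ intros q Hq; destruct (flat_ball_exists q Hq) as [r Hr].
  assert (B0 : ball q r q) by (apply (ball_center q (mkposreal r (proj1 Hr)))).
  destruct (proj2 (proj2 (proj2 Hr)) q (X q) B0) as [X1 [E HX1]].
  exists r, X1; split; [now split|now split]. }
exists X; split.
- apply (Huniq z0); [now apply HX|].
  destruct (Hchart z0 Hz0) as [r [X1 [HC [B0 E]]]].
  destruct (proj2 (proj2 (proj2 (proj1 HC))) z0 v0 B0) as [X2 [E2 HX2]].
  destruct (transported_in_chart z0 r X2 z0 z0 (conj (proj1 HC) HX2) B0 B0)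
    as [g [Y [Hg [HL [G0 [Y0 [G1 Y1]]]]]]].
  exists g, Y; split; [exact Hg|split; [exact HL|split; [exact G0|split; [now apply eqn_trans with (X2 z0)|split; [exact G1|]]]]].
  now apply eqn_trans with (1 := Y1).
- intros p Hp; destruct (Hchart p Hp) as [r [X1 [HC [B0 E]]]].
  apply sol_at_ext with X1; [|now apply HC].
  exists (mkposreal r (proj1 (proj1 HC))); intros q Hq.
  now apply (Hloc p p r X1).
Qed.

Theorem flat_unique_solution z0 X X' : simply_connected Om -> Om z0 ->
  (forall p, Om p -> sol_at X p) -> (forall p, Om p -> sol_at X' p) ->
  eqn (X z0) (X' z0) -> forall p, Om p -> eqn (X p) (X' p).
Proof.
intros HSC Hz0 HX HX' E p Hp.
destruct (proj1 (proj2 HSC) z0 p Hz0 Hp) as [g [Hg [G0 G1]]].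
rewrite <- G1; apply (path_propagation Om (fun p => eqn (X p) (X' p)) g Hg); [|now rewrite G0|lra].
intros q Hq; destruct (flat_ball_exists q Hq) as [r Hr].
exists (mkposreal r (proj1 Hr)); intros a b Ha Hb _ _ Hab.
assert (HOq := proj1 (proj2 Hr)).
apply (charts_agree q r q r X X' a b); auto; split; auto.
Qed.

(** [sol_at] gives derivatives along the two axes only; joint continuity comes from a uniform bound
    of both on a square. *)
Lemma solution_continuous X p i : (forall q, Om q -> sol_at X q) -> Om p -> (i < n)%nat ->
  continuous (fun q => X q i) p.
Proof.
intros HX Hp Hi; destruct (flat_ball_exists p Hp) as [r [Hr [HO [[K [HK [HK1 HK2]]] _]]]].
set (V := 4 * vsum n (fun i => Rabs (X p i))).
assert (HV : 0 <= V).
{ unfold V; assert (H := vsum_pos n (fun i => Rabs (X p i)) (fun i _ => Rabs_pos _)); lra. }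
assert (B0 : ball p r p) by (apply (ball_center p (mkposreal r Hr))).
assert (Hbd : forall q, ball p r q -> vsum n (fun i => Rabs (X q i)) <= V).
{ intros q Hq; apply (local_growth n A B p r K X p q HK HK1 HK2 B0 Hq).
  intros a b Ha Hb; apply HX, HO, ball_C.
  apply (proj1 (ball_C _ _ _)) in Hq; apply (proj1 (ball_C _ _ _)) in B0; destruct Hq, B0; simpl; split.
  - now apply (between_near (fst p) (fst q)).
  - now apply (between_near (snd p) (snd q)). }
assert (HKV : 0 <= K * V) by now apply Rmult_le_pos.
apply filterlim_locally; intros eps.
assert (He : 0 < Rmin r (eps / (2 * (K * V + 1)))).
{ apply Rmin_glb_lt; [exact Hr|]; apply Rdiv_lt_0_compat; [apply cond_pos|lra]. }
exists (mkposreal _ He); intros q Hq; simpl in Hq.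
destruct p as [x y], q as [x' y'].
assert (Hqr : ball (x, y) r (x', y')) by (apply ball_le with (2 := Hq); apply Rmin_l).
apply (proj1 (ball_C _ _ _)) in Hq; apply (proj1 (ball_C _ _ _)) in Hqr.
apply (proj1 (ball_C _ _ _)) in B0; simpl in *.
destruct Hq as [H1 H2], Hqr as [H3 H4], B0 as [H5 H6].
assert (M := Rmin_r r (eps / (2 * (K * V + 1)))).
assert (E1 : Rabs (X (x', y) i - X (x, y) i) <= K * V * Rabs (x' - x)).
{ apply (MVT_bound (fun t => X (t, y) i) (fun t => vsum n (fun j => A i j (t, y) * X (t, y) j))).
  - intros t Ht; apply (HX (t, y)); [|exact Hi]; apply HO, ball_C; simpl; split; [|exact H6].
    now apply (between_near x x').
  - intros t Ht; assert (Bt : ball (x, y) r (t, y))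
      by (apply ball_C; simpl; split; [now apply (between_near x x')|exact H6]).
    eapply Rle_trans; [apply (vsum_lin_bound n _ _ K); intros; now apply HK2|].
    apply Rmult_le_compat_l; [exact HK|now apply Hbd]. }
assert (E2 : Rabs (X (x', y') i - X (x', y) i) <= K * V * Rabs (y' - y)).
{ apply (MVT_bound (fun t => X (x', t) i) (fun t => vsum n (fun j => B i j (x', t) * X (x', t) j))).
  - intros t Ht; apply (HX (x', t)); [|exact Hi]; apply HO, ball_C; simpl; split; [exact H3|].
    now apply (between_near y y').
  - intros t Ht; assert (Bt : ball (x, y) r (x', t))
      by (apply ball_C; simpl; split; [exact H3|now apply (between_near y y')]).
    eapply Rle_trans; [apply (vsum_lin_bound n _ _ K); intros; now apply HK2|].
    apply Rmult_le_compat_l; [exact HK|now apply Hbd]. }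
change (Rabs (X (x', y') i - X (x, y) i) < eps).
replace (X (x', y') i - X (x, y) i) with ((X (x', y) i - X (x, y) i) + (X (x', y') i - X (x', y) i)) by ring.
eapply Rle_lt_trans; [apply Rabs_triang|].
assert (F1 : K * V * Rabs (x' - x) <= K * V * (eps / (2 * (K * V + 1)))) by (apply Rmult_le_compat_l; lra).
assert (F2 : K * V * Rabs (y' - y) <= K * V * (eps / (2 * (K * V + 1)))) by (apply Rmult_le_compat_l; lra).
apply Rle_lt_trans with (2 * (K * V * (eps / (2 * (K * V + 1))))); [lra|].
assert (Hep := cond_pos eps).
replace (2 * (K * V * (eps / (2 * (K * V + 1))))) with (eps - eps / (K * V + 1)) by (field; lra).
assert (0 < eps / (K * V + 1)) by (apply Rdiv_lt_0_compat; lra); lra.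
Qed.

Lemma Ck_vsum k m (F : nat -> C -> R) : (forall j, (j < m)%nat -> Ck k Om (F j)) -> Ck k Om (fun q => vsum m (fun j => F j q)).
Proof.
intros H; induction m as [|m IH]; simpl; [now apply Ck_const|].
apply Ck_plus; [exact HOm|apply IH; intros; apply H; lia|apply H; lia].
Qed.

Theorem solution_smooth X : (forall q, Om q -> sol_at X q) ->
  forall i, (i < n)%nat -> smooth_on Om (fun q => X q i).
Proof.
intros HX.
assert (Hk : forall k i, (i < n)%nat -> Ck k Om (fun q => X q i)).
{ induction k as [|k IH]; intros i Hi.
  - split; [|exact I]; intros p Hp; now apply solution_continuous.
  - apply (Ck_S Om HOm k (fun q => X q i) (fun b q => if b then vsum n (fun j => B i j q * X q j)
      else vsum n (fun j => A i j q * X q j))).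
    + intros p Hp; now apply solution_continuous.
    + intros b p Hp; destruct b; now apply (HX p Hp i Hi).
    + intros b; destruct b.
      * apply (Ck_vsum k n (fun j q => B i j q * X q j)); intros j Hj.
        apply Ck_mult; [exact HOm|apply smooth_Ck; now apply HB|now apply IH].
      * apply (Ck_vsum k n (fun j q => A i j q * X q j)); intros j Hj.
        apply Ck_mult; [exact HOm|apply smooth_Ck; now apply HA|now apply IH]. }
intros i Hi; apply Ck_smooth; intros k; now apply Hk.
Qed.

End GlobalFlat.

(** * Strong unique continuation *)

Lemma monotone_le (F dF : R -> R) T : (forall t, t < T -> is_derive F t (dF t)) ->
  (forall t, t < T -> 0 <= dF t) -> forall s t, s <= t -> t < T -> F s <= F t.
Proof.
intros HD Hp s t Hst Ht.
destruct (MVT_gen F s t dF) as [x [Hx E]].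
- intros x; rewrite Rmin_left, Rmax_right by lra; intros; apply HD; lra.
- intros x; rewrite Rmin_left, Rmax_right by lra; intros; apply continuity_pt_filterlim.
  apply (ex_derive_continuous (K := R_AbsRing) (V := R_NormedModule)).
  eexists; apply HD; lra.
- rewrite Rmin_left, Rmax_right in Hx by lra.
  assert (0 <= dF x * (t - s)) by (apply Rmult_le_pos; [apply Hp|]; lra); lra.
Qed.

Lemma exp_small eps : 0 < eps -> exists t, forall s, s <= t -> exp s < eps.
Proof.
intros He; exists (ln eps - 1); intros s Hs.
rewrite <- (exp_ln eps) at 1 by exact He; apply exp_increasing; lra.
Qed.

(** Serves as boundary condition at the centre: with [t] the logarithm of the radius the centre is
    at [-oo], and a nondecreasing function tending to 0 there is nonnegative. *)
Lemma nonneg_of_decay (F : R -> R) T T1 Cst : (forall s t, s <= t -> t < T -> F s <= F t) ->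
  (forall s, s < T1 -> Rabs (F s) <= Cst * exp s) -> forall t, t < T -> 0 <= F t.
Proof.
intros Hm Hd t Ht; apply Rnot_lt_le; intros Hneg.
assert (HC : 0 < Rabs Cst + 1) by (assert (H := Rabs_pos Cst); lra).
destruct (exp_small (- F t / (Rabs Cst + 1))) as [u Hu]; [apply Rdiv_lt_0_compat; lra|].
set (s := Rmin u (Rmin t (T1 - 1))).
assert (Hs1 : s <= u) by apply Rmin_l.
assert (Hs2 : s <= t) by (eapply Rle_trans; [apply Rmin_r|apply Rmin_l]).
assert (Hs3 : s <= T1 - 1) by (eapply Rle_trans; [apply Rmin_r|apply Rmin_r]).
assert (H1 := Hm s t Hs2 Ht); assert (H2 := Hd s ltac:(lra)); assert (H3 := Hu s Hs1).
assert (Hep := exp_pos s).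
assert (Cst * exp s <= (Rabs Cst + 1) * exp s).
{ apply Rmult_le_compat_r; [lra|]; assert (H := Rle_abs Cst); lra. }
assert ((Rabs Cst + 1) * exp s < - F t).
{ apply Rlt_le_trans with ((Rabs Cst + 1) * (- F t / (Rabs Cst + 1))).
  - now apply Rmult_lt_compat_l.
  - right; field; lra. }
assert (H4 := Rle_abs (- F s)); rewrite Rabs_Ropp in H4; lra.
Qed.

Section Chain.
Variable U : C -> Prop.
Hypothesis HU : open U.

Lemma chain_rule (f : C -> R) (u v : R -> R) t du dv : smooth_on U f -> U (u t, v t) ->
  is_derive u t du -> is_derive v t dv ->
  is_derive (fun s => f (u s, v s)) t (pd false f (u t, v t) * du + pd true f (u t, v t) * dv).
Proof.
intros Hf Hp Hu Hv; apply is_derive_Reals.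
apply (derivable_pt_lim_comp_2d (fun x y => f (x, y))); try now apply is_derive_Reals.
apply filterdiff_differentiable_pt_lim.
assert (H := is_derive_filterdiff (fun x y => f (x, y)) (u t) (v t)
  (fun x y => pd false f (x, y)) (pd true f (u t, v t))).
apply H.
- apply (locally_on U HU (fun z : C => is_derive (fun s => f (s, snd z)) (fst z) (pd false f (fst z, snd z))));
    [|exact Hp].
  intros [x y] Hq; exact (smooth_is_pd U f false (x, y) Hf Hq).
- exact (smooth_is_pd U f true (u t, v t) Hf Hp).
- apply continuous_ext with (pd false f); [intros [x y]; reflexivity|].
  apply (smooth_continuous U); [now apply smooth_pd|exact Hp].
Qed.

Lemma smooth_fst : smooth_on U fst.
Proof.
apply (smooth_S U HU fst (fun b _ => if b then 0 else 1)).
- intros p Hp; apply continuous_fst.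
- intros b p Hp; unfold is_pd; destruct b; simpl.
  + apply (is_derive_const (V := R_NormedModule)).
  + apply (is_derive_id (K := R_AbsRing)).
- intros b; destruct b; now apply smooth_const.
Qed.

Lemma smooth_snd : smooth_on U snd.
Proof.
apply (smooth_S U HU snd (fun b _ => if b then 1 else 0)).
- intros p Hp; apply continuous_snd.
- intros b p Hp; unfold is_pd; destruct b; simpl.
  + apply (is_derive_id (K := R_AbsRing)).
  + apply (is_derive_const (V := R_NormedModule)).
- intros b; destruct b; now apply smooth_const.
Qed.
End Chain.

Lemma is_pd_fst b p : is_pd b fst p (if b then 0 else 1).
Proof.
destruct b; [apply (is_derive_const (V := R_NormedModule))|apply (is_derive_id (K := R_AbsRing))].
Qed.

Lemma is_pd_snd b p : is_pd b snd p (if b then 1 else 0).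
Proof.
destruct b; [apply (is_derive_id (K := R_AbsRing))|apply (is_derive_const (V := R_NormedModule))].
Qed.

(** * Logarithmic polar coordinates and circle integrals *)

Section Polar.
Variables (U : C -> Prop) (r0 : C) (R1 : R).
Hypothesis HU : open U.
Hypothesis HR1 : 0 < R1.
Hypothesis HRU : forall q, ball r0 R1 q -> U q.

(** The complex exponential centred at [r0]: the coordinates [t + i phi] are conformal, which keeps
    the Laplacian simple. *)
Definition polar (t phi : R) : C := (fst r0 + exp t * cos phi, snd r0 + exp t * sin phi).
Let T0 := ln R1.

(** The Euler field [r d/dr], equal to [d/dt] in polar coordinates; [rot] is the angular derivative
    [d/dphi]. Both are smooth across the centre. *)
Definition rad (g : C -> R) : C -> R := fun p =>
  (fst p - fst r0) * pd false g p + (snd p - snd r0) * pd true g p.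
Definition rot (g : C -> R) : C -> R := fun p =>
  - (snd p - snd r0) * pd false g p + (fst p - fst r0) * pd true g p.

Lemma radE g p : rad g p = (fst p - fst r0) * pd false g p + (snd p - snd r0) * pd true g p.
Proof. reflexivity. Qed.
Lemma rotE g p : rot g p = - (snd p - snd r0) * pd false g p + (fst p - fst r0) * pd true g p.
Proof. reflexivity. Qed.

Let Hfst : smooth_on U fst := smooth_fst U HU.
Let Hsnd : smooth_on U snd := smooth_snd U HU.

Lemma smooth_rad g : smooth_on U g -> smooth_on U (rad g).
Proof. intros Hg; unfold rad; smooth. Qed.
Lemma smooth_rot g : smooth_on U g -> smooth_on U (rot g).
Proof. intros Hg; unfold rot; smooth. Qed.

Lemma polar_ball t phi r : 0 < r -> t < ln r -> ball r0 r (polar t phi).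
Proof.
intros Hr Ht; apply ball_C; unfold polar; simpl.
assert (He : exp t < r) by (rewrite <- (exp_ln r Hr); now apply exp_increasing).
assert (Hp := exp_pos t).
assert (H1 := COS_bound phi); assert (H2 := SIN_bound phi).
split; ring_simplify (fst r0 + exp t * cos phi - fst r0) (snd r0 + exp t * sin phi - snd r0);
rewrite Rabs_mult, (Rabs_pos_eq (exp t)) by lra.
- apply Rle_lt_trans with (exp t * 1); [|lra]; apply Rmult_le_compat_l; [lra|]; apply Rabs_le; lra.
- apply Rle_lt_trans with (exp t * 1); [|lra]; apply Rmult_le_compat_l; [lra|]; apply Rabs_le; lra.
Qed.

Lemma polar_U t phi : t < T0 -> U (polar t phi).
Proof. intros Ht; apply HRU; now apply polar_ball. Qed.

Lemma polar_derive_t g t phi : smooth_on U g -> t < T0 ->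
  is_derive (fun s => g (polar s phi)) t (rad g (polar t phi)).
Proof.
intros Hg Ht.
replace (rad g (polar t phi)) with (pd false g (polar t phi) * (exp t * cos phi)
  + pd true g (polar t phi) * (exp t * sin phi)) by (unfold rad; simpl; ring).
apply (chain_rule U HU g (fun s => fst r0 + exp s * cos phi) (fun s => snd r0 + exp s * sin phi)); auto.
- now apply polar_U.
- auto_derive; [exact I|ring].
- auto_derive; [exact I|ring].
Qed.

Lemma polar_derive_phi g t phi : smooth_on U g -> t < T0 ->
  is_derive (fun s => g (polar t s)) phi (rot g (polar t phi)).
Proof.
intros Hg Ht.
replace (rot g (polar t phi)) with (pd false g (polar t phi) * (exp t * - sin phi)
  + pd true g (polar t phi) * (exp t * cos phi)) by (unfold rot; simpl; ring).
apply (chain_rule U HU g (fun s => fst r0 + exp t * cos s) (fun s => snd r0 + exp t * sin s)); auto.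
- now apply polar_U.
- auto_derive; [exact I|ring].
- auto_derive; [exact I|ring].
Qed.

Lemma polar_continuous t phi : continuous (fun z : R * R => polar (fst z) (snd z)) (t, phi).
Proof.
assert (He : forall z : R * R, continuous (fun z : R * R => exp (fst z)) z).
{ intros z; apply (continuous_comp fst exp); [apply continuous_fst|].
  apply (ex_derive_continuous (K := R_AbsRing) (V := R_NormedModule)); auto_derive; exact I. }
assert (Hc : forall z : R * R, continuous (fun z : R * R => cos (snd z)) z).
{ intros z; apply (continuous_comp snd cos); [apply continuous_snd|].
  apply (ex_derive_continuous (K := R_AbsRing) (V := R_NormedModule)); auto_derive; exact I. }
assert (Hs : forall z : R * R, continuous (fun z : R * R => sin (snd z)) z).
{ intros z; apply (continuous_comp snd sin); [apply continuous_snd|].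
  apply (ex_derive_continuous (K := R_AbsRing) (V := R_NormedModule)); auto_derive; exact I. }
apply (continuous_comp_2 (fun z : R * R => fst r0 + exp (fst z) * cos (snd z))
  (fun z : R * R => snd r0 + exp (fst z) * sin (snd z)) (fun a b => (a, b))).
- apply (continuous_plus (V := R_NormedModule)); [apply continuous_const|].
  apply (continuous_mult (K := R_AbsRing)); auto.
- apply (continuous_plus (V := R_NormedModule)); [apply continuous_const|].
  apply (continuous_mult (K := R_AbsRing)); auto.
- apply continuous_ext with (fun x => x); [intros [? ?]; reflexivity|apply continuous_id].
Qed.

Lemma polar_comp_continuous g t phi : smooth_on U g -> t < T0 ->
  continuity_2d_pt (fun s ps => g (polar s ps)) t phi.
Proof.
intros Hg Ht; apply continuity_2d_pt_filterlim.
apply (continuous_comp (fun z : R * R => polar (fst z) (snd z)) g (t, phi)).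
- apply polar_continuous.
- apply (smooth_continuous U); [exact Hg|now apply polar_U].
Qed.

Lemma circle_continuous g t phi : smooth_on U g -> t < T0 -> continuous (fun s => g (polar t s)) phi.
Proof.
intros Hg Ht; apply (ex_derive_continuous (K := R_AbsRing) (V := R_NormedModule)).
eexists; now apply polar_derive_phi.
Qed.

Lemma circle_integrable g t a b : smooth_on U g -> t < T0 -> ex_RInt (fun s => g (polar t s)) a b.
Proof.
intros Hg Ht; apply (ex_RInt_continuous (V := R_CompleteNormedModule)); intros; now apply circle_continuous.
Qed.

Definition circle_int (g : C -> R) (t : R) : R := RInt (fun s => g (polar t s)) 0 (2 * PI).

Let HPI : 0 < 2 * PI.
Proof. assert (H := PI_RGT_0); lra. Qed.

Lemma circle_int_derive g t : smooth_on U g -> t < T0 ->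
  is_derive (circle_int g) t (circle_int (rad g) t).
Proof.
intros Hg Ht.
assert (Hloc : locally t (fun s => s < T0)).
{ assert (Hd : 0 < T0 - t) by lra; exists (mkposreal _ Hd); intros s Hs.
  change (Rabs (s - t) < T0 - t) in Hs; apply Rabs_def2 in Hs; lra. }
unfold circle_int.
rewrite (RInt_ext (fun s => rad g (polar t s)) (fun s => Derive (fun u => g (polar u s)) t)).
2: { intros s _; symmetry; apply is_derive_unique; now apply polar_derive_t. }
apply (is_derive_RInt_param (fun u s => g (polar u s))).
- revert Hloc; apply filter_imp; intros s Hs phi _; eexists; now apply polar_derive_t.
- intros phi _; apply continuity_2d_pt_ext_loc with (fun u v => rad g (polar u v)).
  + apply locally_2d_locally; destruct Hloc as [d Hd]; exists d; intros [u v] Huv.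
    symmetry; apply is_derive_unique; apply polar_derive_t; [exact Hg|].
    apply Hd, (proj1 Huv).
  + apply polar_comp_continuous; [now apply smooth_rad|exact Ht].
- revert Hloc; apply filter_imp; intros s Hs; now apply circle_integrable.
Qed.

(** Integration by parts on the circle: an angular derivative has zero integral because [polar t] is
    periodic. *)
Lemma circle_int_rot g t : smooth_on U g -> t < T0 -> circle_int (rot g) t = 0.
Proof.
intros Hg Ht; unfold circle_int.
rewrite (is_RInt_unique _ _ _ _ (is_RInt_derive (V := R_CompleteNormedModule) (fun s => g (polar t s)) (fun s => rot g (polar t s)) 0 (2 * PI)
  (fun x _ => polar_derive_phi g t x Hg Ht)
  (fun x _ => circle_continuous (rot g) t x (smooth_rot g Hg) Ht))).
unfold polar; rewrite cos_2PI, sin_2PI, cos_0, sin_0.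
apply (minus_eq_zero (G := R_AbelianGroup)).
Qed.

Lemma circle_int_ext g h t : (forall phi, g (polar t phi) = h (polar t phi)) -> circle_int g t = circle_int h t.
Proof. intros H; apply RInt_ext; intros; apply H. Qed.

Lemma circle_int_le g h t : smooth_on U g -> smooth_on U h -> t < T0 ->
  (forall phi, g (polar t phi) <= h (polar t phi)) -> circle_int g t <= circle_int h t.
Proof.
intros Hg Hh Ht H; apply RInt_le; [lra|now apply circle_integrable|now apply circle_integrable|].
intros; apply H.
Qed.

Lemma circle_int_plus g h t : smooth_on U g -> smooth_on U h -> t < T0 ->
  circle_int (fun p => g p + h p) t = circle_int g t + circle_int h t.
Proof.
intros Hg Hh Ht; unfold circle_int.
apply (RInt_plus (V := R_CompleteNormedModule) (fun s => g (polar t s)) (fun s => h (polar t s)));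
  now apply circle_integrable.
Qed.

Lemma circle_int_scal c g t : smooth_on U g -> t < T0 ->
  circle_int (fun p => c * g p) t = c * circle_int g t.
Proof.
intros Hg Ht; unfold circle_int.
apply (RInt_scal (V := R_CompleteNormedModule) (fun s => g (polar t s))); now apply circle_integrable.
Qed.

Lemma circle_int_const c t : circle_int (fun _ => c) t = 2 * PI * c.
Proof. unfold circle_int; rewrite RInt_const; unfold scal; simpl; unfold mult; simpl; ring. Qed.

Lemma circle_int_bound g t B : smooth_on U g -> t < T0 -> (forall phi, Rabs (g (polar t phi)) <= B) ->
  Rabs (circle_int g t) <= 2 * PI * B.
Proof.
intros Hg Ht H; unfold circle_int.
replace (2 * PI * B) with ((2 * PI - 0) * B) by ring.
apply abs_RInt_le_const; [lra|now apply circle_integrable|]; intros; apply H.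
Qed.

(** The primitive of the integrand in the angle is squeezed to 0; recovering the integrand by
    differentiation requires an interior angle. *)
Lemma circle_int_zero g t phi : smooth_on U g -> t < T0 -> (forall p, 0 <= g p) ->
  circle_int g t = 0 -> 0 < phi < 2 * PI -> g (polar t phi) = 0.
Proof.
intros Hg Ht Hp H0 Hphi.
set (G := fun x => RInt (fun s => g (polar t s)) 0 x).
assert (Hex : forall a b, ex_RInt (fun s => g (polar t s)) a b) by (intros; now apply circle_integrable).
assert (Hz : forall x, 0 < x < 2 * PI -> G x = 0).
{ intros x Hx; assert (HC := RInt_Chasles _ 0 x (2 * PI) (Hex _ _) (Hex _ _)).
  unfold circle_int in H0; rewrite H0 in HC.
  assert (H1 : 0 <= G x) by (apply RInt_ge_0; [lra|apply Hex|intros; apply Hp]).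
  assert (H2 : 0 <= RInt (fun s => g (polar t s)) x (2 * PI)) by (apply RInt_ge_0; [lra|apply Hex|intros; apply Hp]).
  change (G x + RInt (fun s => g (polar t s)) x (2 * PI) = 0) in HC; lra. }
assert (HD : is_derive G phi (g (polar t phi))).
{ apply (is_derive_RInt (V := R_NormedModule) (fun s => g (polar t s)) G 0 phi).
  - apply filter_forall; intros x; apply (RInt_correct (V := R_CompleteNormedModule)), Hex.
  - now apply circle_continuous. }
rewrite <- (is_derive_unique _ _ _ HD).
rewrite (Derive_ext_loc G (fun _ => 0)); [apply Derive_const|].
assert (He : 0 < Rmin phi (2 * PI - phi)) by (apply Rmin_glb_lt; lra).
exists (mkposreal _ He); intros s Hs; change (Rabs (s - phi) < Rmin phi (2 * PI - phi)) in Hs.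
assert (M1 := Rmin_l phi (2 * PI - phi)); assert (M2 := Rmin_r phi (2 * PI - phi)).
apply Rabs_def2 in Hs; apply Hz; lra.
Qed.

(** * Almgren's frequency function *)

Section Frequency.
Variables (w : C -> R) (K : R).
Hypothesis Hw : smooth_on U w.
Hypothesis HK : 0 <= K.
Let lap (p : C) := pd false (pd false w) p + pd true (pd true w) p.
Hypothesis Hlap_sign : forall p, U p -> 0 <= w p * lap p.
Hypothesis Hlap_bound : forall p, U p -> Rabs (lap p) <= K * Rabs (w p).

Let rho2 (p : C) := (fst p - fst r0) * (fst p - fst r0) + (snd p - snd r0) * (snd p - snd r0).

Lemma rho2_polar t phi : rho2 (polar t phi) = exp (2 * t).
Proof.
unfold rho2, polar; simpl.
replace (2 * t) with (t + t) by ring; rewrite exp_plus.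
assert (H := sin2_cos2 phi); unfold Rsqr in H.
transitivity (exp t * exp t * (sin phi * sin phi + cos phi * cos phi)); [ring|rewrite H; ring].
Qed.

Let Hlap : smooth_on U lap.
Proof. unfold lap; smooth. Qed.
Let Hrho : smooth_on U rho2.
Proof. unfold rho2; smooth. Qed.
Let Hrw : smooth_on U (rad w) := smooth_rad w Hw.
Let Htw : smooth_on U (rot w) := smooth_rot w Hw.

Lemma rad_mult f g p : smooth_on U f -> smooth_on U g -> U p ->
  rad (fun q => f q * g q) p = rad f p * g p + f p * rad g p.
Proof.
intros Hf Hg Hp; unfold rad.
rewrite !(is_pd_unique _ (fun q => f q * g q) _ _ (is_pd_mult _ _ _ _ _ _
  (smooth_is_pd U f _ p Hf Hp) (smooth_is_pd U g _ p Hg Hp))); ring.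
Qed.

Lemma rot_mult f g p : smooth_on U f -> smooth_on U g -> U p ->
  rot (fun q => f q * g q) p = rot f p * g p + f p * rot g p.
Proof.
intros Hf Hg Hp; unfold rot.
rewrite !(is_pd_unique _ (fun q => f q * g q) _ _ (is_pd_mult _ _ _ _ _ _
  (smooth_is_pd U f _ p Hf Hp) (smooth_is_pd U g _ p Hg Hp))); ring.
Qed.

Lemma pd_rad b p : U p -> pd b (rad w) p =
  (if b then pd true w p else pd false w p) + (fst p - fst r0) * pd b (pd false w) p
  + (snd p - snd r0) * pd b (pd true w) p.
Proof.
intros Hp; apply is_pd_unique; unfold rad.
assert (X : is_pd b (fun q => fst q - fst r0) p ((if b then 0 else 1) - 0))
  by (apply (is_pd_minus b fst (fun _ => fst r0)); [apply is_pd_fst|apply is_pd_const]).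
assert (Y : is_pd b (fun q => snd q - snd r0) p ((if b then 1 else 0) - 0))
  by (apply (is_pd_minus b snd (fun _ => snd r0)); [apply is_pd_snd|apply is_pd_const]).
assert (A := smooth_is_pd U _ b p (smooth_pd U w false Hw) Hp).
assert (B := smooth_is_pd U _ b p (smooth_pd U w true Hw) Hp).
eapply is_pd_val; [exact (is_pd_plus _ _ _ _ _ _ (is_pd_mult _ _ _ _ _ _ X A) (is_pd_mult _ _ _ _ _ _ Y B))|].
destruct b; cbv beta; ring.
Qed.

Lemma pd_rot b p : U p -> pd b (rot w) p =
  (if b then - pd false w p else pd true w p) - (snd p - snd r0) * pd b (pd false w) p
  + (fst p - fst r0) * pd b (pd true w) p.
Proof.
intros Hp; apply is_pd_unique; unfold rot.
assert (X : is_pd b (fun q => fst q - fst r0) p ((if b then 0 else 1) - 0))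
  by (apply (is_pd_minus b fst (fun _ => fst r0)); [apply is_pd_fst|apply is_pd_const]).
assert (Y : is_pd b (fun q => snd q - snd r0) p ((if b then 1 else 0) - 0))
  by (apply (is_pd_minus b snd (fun _ => snd r0)); [apply is_pd_snd|apply is_pd_const]).
assert (A := smooth_is_pd U _ b p (smooth_pd U w false Hw) Hp).
assert (B := smooth_is_pd U _ b p (smooth_pd U w true Hw) Hp).
eapply is_pd_val; [exact (is_pd_plus _ _ _ _ _ _ (is_pd_mult _ _ _ _ _ _ (is_pd_opp _ _ _ _ Y) A) (is_pd_mult _ _ _ _ _ _ X B))|].
destruct b; cbv beta; ring.
Qed.

(** The Laplacian in the conformal coordinates [t + i phi], with conformal factor [rho2]. *)
Lemma rad_rad_rot_rot p : U p -> rad (rad w) p + rot (rot w) p = rho2 p * lap p.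
Proof.
intros Hp; rewrite (radE (rad w)), (rotE (rot w)), !pd_rad, !pd_rot by exact Hp.
assert (E := pd_comm U HU w p Hw Hp); unfold rho2, lap; rewrite E; ring.
Qed.

Lemma rad_rot_comm p : U p -> rad (rot w) p = rot (rad w) p.
Proof.
intros Hp; rewrite (radE (rot w)), (rotE (rad w)), !pd_rad, !pd_rot by exact Hp.
assert (E := pd_comm U HU w p Hw Hp); rewrite E; ring.
Qed.

(** [H] is the height and [I / H] the frequency, half the logarithmic derivative of [H]. [Er] and
    [Et] are the radial and angular energies, [P1] and [P2] the contributions of the Laplacian. The
    difference [S] is the quantity that is constant for harmonic functions. *)
Let H := circle_int (fun p => w p * w p).
Let I := circle_int (fun p => w p * rad w p).
Let Er := circle_int (fun p => rad w p * rad w p).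
Let Et := circle_int (fun p => rot w p * rot w p).
Let P1 := circle_int (fun p => w p * (rho2 p * lap p)).
Let P2 := circle_int (fun p => rad w p * (rho2 p * lap p)).
Let S t := Er t - Et t.

Lemma H_derive t : t < T0 -> is_derive H t (2 * I t).
Proof.
intros Ht; unfold I; rewrite <- circle_int_scal by (auto; smooth).
rewrite <- (circle_int_ext (rad (fun p => w p * w p))).
- apply circle_int_derive; [smooth|exact Ht].
- intros phi; rewrite rad_mult by (auto; now apply polar_U); ring.
Qed.

(** The term [w * rad (rad w)] is rewritten by the polar Laplacian, and its angular part integrated
    by parts into [Et]. *)
Lemma I_derive t : t < T0 -> is_derive I t (Er t + Et t + P1 t).
Proof.
intros Ht.
assert (HD := circle_int_derive (fun p => w p * rad w p) t ltac:(smooth) Ht); fold I in HD.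
replace (Er t + Et t + P1 t) with (circle_int (rad (fun p => w p * rad w p)) t); [exact HD|].
assert (E := circle_int_rot (fun p => w p * rot w p) t ltac:(smooth) Ht).
unfold Er, Et, P1.
rewrite <- (Rplus_0_r (circle_int (rad _) t)), <- E.
assert (Hrr : smooth_on U (rad (fun p => w p * rad w p))) by (apply smooth_rad; smooth).
assert (Htt : smooth_on U (rot (fun p => w p * rot w p))) by (apply smooth_rot; smooth).
rewrite <- !circle_int_plus by (auto; smooth).
apply circle_int_ext; intros phi.
assert (Hp := polar_U t phi Ht).
rewrite rad_mult, rot_mult by auto.
rewrite <- rad_rad_rot_rot by exact Hp; ring.
Qed.

(** Rellich-Pohozaev identity: adding twice the angular derivative of [rad w * rot w], of zero
    integral, cancels the mixed terms because [rad] and [rot] commute. *)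
Lemma S_derive t : t < T0 -> is_derive S t (2 * P2 t).
Proof.
intros Ht.
assert (Hrw2 : smooth_on U (fun p => rad w p * rad w p)) by smooth.
assert (Htw2 : smooth_on U (fun p => rot w p * rot w p)) by smooth.
assert (HD := is_derive_minus (V := R_NormedModule) _ _ _ _ _
  (circle_int_derive _ t Hrw2 Ht) (circle_int_derive _ t Htw2 Ht)).
match type of HD with is_derive _ _ ?l => replace (2 * P2 t) with l; [exact HD|] end.
assert (E := circle_int_rot (fun p => rad w p * rot w p) t ltac:(smooth) Ht).
unfold P2.
assert (S1 : smooth_on U (rad (fun p => rad w p * rad w p))) by now apply smooth_rad.
assert (S2 : smooth_on U (rad (fun p => rot w p * rot w p))) by now apply smooth_rad.
assert (S3 : smooth_on U (rot (fun p => rad w p * rot w p))) by (apply smooth_rot; smooth).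
change (circle_int (rad (fun p => rad w p * rad w p)) t - circle_int (rad (fun p => rot w p * rot w p)) t
  = 2 * circle_int (fun p => rad w p * (rho2 p * lap p)) t).
assert (E1 : circle_int (rad (fun p => rad w p * rad w p)) t + 2 * circle_int (rot (fun p => rad w p * rot w p)) t
  = 2 * circle_int (fun p => rad w p * (rho2 p * lap p)) t + circle_int (rad (fun p => rot w p * rot w p)) t).
{ rewrite <- !circle_int_scal, <- !circle_int_plus by (auto; smooth).
  apply circle_int_ext; intros phi; assert (Hp := polar_U t phi Ht).
  rewrite !rad_mult, rot_mult by auto.
  rewrite <- rad_rad_rot_rot, rad_rot_comm by exact Hp; ring. }
rewrite E in E1; lra.
Qed.

Lemma P1_pos t : t < T0 -> 0 <= P1 t.
Proof.
intros Ht; rewrite <- (Rmult_0_r (2 * PI)), <- (circle_int_const 0 t).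
apply circle_int_le; [now apply smooth_const|smooth|exact Ht|].
intros phi; rewrite rho2_polar.
assert (Hp := polar_U t phi Ht); assert (H1 := Hlap_sign _ Hp); assert (H2 := exp_pos (2 * t)).
replace (w (polar t phi) * (exp (2 * t) * lap (polar t phi))) with
  (exp (2 * t) * (w (polar t phi) * lap (polar t phi))) by ring.
apply Rmult_le_pos; lra.
Qed.

Lemma P2_bound t : t < T0 -> 2 * P2 t <= K * exp (2 * t) * (H t + Er t).
Proof.
intros Ht; unfold P2, H, Er.
rewrite <- circle_int_plus, <- !circle_int_scal by (auto; smooth).
apply circle_int_le; [smooth|smooth|exact Ht|].
intros phi; rewrite rho2_polar.
assert (Hp := polar_U t phi Ht); assert (H1 := Hlap_bound _ Hp); assert (H2 := exp_pos (2 * t)).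
set (a := w (polar t phi)) in *; set (b := rad w (polar t phi)) in *; set (l := lap (polar t phi)) in *.
replace (2 * (b * (exp (2 * t) * l))) with (exp (2 * t) * (2 * (b * l))) by ring.
replace (K * exp (2 * t) * (a * a + b * b)) with (exp (2 * t) * (K * (a * a + b * b))) by ring.
apply Rmult_le_compat_l; [lra|].
apply Rle_trans with (2 * (Rabs b * (K * Rabs a))).
- apply Rmult_le_compat_l; [lra|]; eapply Rle_trans; [apply Rle_abs|].
  rewrite Rabs_mult; apply Rmult_le_compat_l; [apply Rabs_pos|exact H1].
- replace (2 * (Rabs b * (K * Rabs a))) with (K * (2 * (Rabs b * Rabs a))) by ring.
  apply Rmult_le_compat_l; [exact HK|].
  rewrite <- (Rabs_pos_eq (a * a)), <- (Rabs_pos_eq (b * b)) by apply Rle_0_sqr.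
  rewrite !Rabs_mult; assert (H3 := Rle_0_sqr (Rabs a - Rabs b)); unfold Rsqr in H3; lra.
Qed.

Lemma square_int_pos g t : smooth_on U g -> t < T0 -> 0 <= circle_int (fun p => g p * g p) t.
Proof.
intros Hg Ht; rewrite <- (Rmult_0_r (2 * PI)), <- (circle_int_const 0 t).
apply circle_int_le; [now apply smooth_const|smooth|exact Ht|intros; apply Rle_0_sqr].
Qed.

Lemma cauchy_schwarz t : t < T0 -> I t * I t <= H t * Er t.
Proof.
intros Ht.
assert (H0 := square_int_pos w t Hw Ht); fold H in H0.
assert (Hq : forall x, 0 <= x * x * H t + 2 * x * I t + Er t).
{ intros x; unfold H, I, Er.
  rewrite <- !circle_int_scal, <- !circle_int_plus by (auto; smooth).
  rewrite (circle_int_ext _ (fun p => (x * w p + rad w p) * (x * w p + rad w p))) by (intros; ring).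
  apply (square_int_pos (fun p => x * w p + rad w p)); [smooth|exact Ht]. }
destruct (Req_dec (H t) 0) as [Hz|Hz].
- rewrite Hz in Hq |- *.
  destruct (Req_dec (I t) 0) as [HI|HI]; [rewrite HI; lra|].
  (* With [H t = 0] the quadratic polynomial is affine in [x]; unless [I t = 0], this [x] gives it
     the value [-1]. *)
  specialize (Hq (- (Er t + 1) / (2 * I t))).
  replace (2 * (- (Er t + 1) / (2 * I t)) * I t) with (- (Er t + 1)) in Hq by (field; exact HI); lra.
- specialize (Hq (- I t / H t)).
  replace (- I t / H t * (- I t / H t) * H t + 2 * (- I t / H t) * I t + Er t) with
   ((H t * Er t - I t * I t) / H t) in Hq by (field; exact Hz).
  assert (Hpos : 0 < H t) by lra.
  assert (0 <= (H t * Er t - I t * I t) / H t * H t) by now apply Rmult_le_pos; lra.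
  replace ((H t * Er t - I t * I t) / H t * H t) with (H t * Er t - I t * I t) in H1 by (field; exact Hz); lra.
Qed.

(** [rad w] and [rot w] carry a factor [exp t]. The energies thus decay like [exp (2 * t)], weakened
    to [exp t] for [t <= 0] to have a single constant. *)
Lemma decay_bounds : exists T1 Cst, T1 <= T0 /\ T1 <= 0 /\ 0 <= Cst /\ forall t, t < T1 ->
  Rabs (H t) <= Cst /\ Rabs (I t) <= Cst * exp t /\ Rabs (S t) <= Cst * exp t.
Proof.
assert (Hr0 : U r0) by (apply HRU; apply (ball_center r0 (mkposreal R1 HR1))).
destruct (continuous_locally_bounded w r0 (smooth_continuous U w r0 Hw Hr0)) as [d1 [K1 [Hd1 [HK1 B1]]]].
destruct (continuous_locally_bounded (pd false w) r0 (smooth_continuous U _ r0 (smooth_pd _ _ _ Hw) Hr0))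
  as [d2 [K2 [Hd2 [HK2 B2]]]].
destruct (continuous_locally_bounded (pd true w) r0 (smooth_continuous U _ r0 (smooth_pd _ _ _ Hw) Hr0))
  as [d3 [K3 [Hd3 [HK3 B3]]]].
set (T1 := Rmin (Rmin (ln d1) (ln d2)) (Rmin (Rmin (ln d3) T0) 0)).
assert (HT1 : T1 <= ln d1 /\ T1 <= ln d2 /\ T1 <= ln d3 /\ T1 <= T0 /\ T1 <= 0).
{ unfold T1; repeat split.
  - eapply Rle_trans; [apply Rmin_l|apply Rmin_l].
  - eapply Rle_trans; [apply Rmin_l|apply Rmin_r].
  - eapply Rle_trans; [apply Rmin_r|]; eapply Rle_trans; [apply Rmin_l|apply Rmin_l].
  - eapply Rle_trans; [apply Rmin_r|]; eapply Rle_trans; [apply Rmin_l|apply Rmin_r].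
  - eapply Rle_trans; [apply Rmin_r|apply Rmin_r]. }
assert (HP := PI_RGT_0).
set (L := K2 + K3).
assert (HL : 0 <= L) by (unfold L; lra).
assert (Hpt : forall t phi, t < T1 -> Rabs (w (polar t phi)) <= K1 /\
  Rabs (rad w (polar t phi)) <= L * exp t /\ Rabs (rot w (polar t phi)) <= L * exp t).
{ intros t phi Ht.
  assert (C1 := B1 (polar t phi) (polar_ball t phi d1 Hd1 ltac:(lra))).
  assert (C2 := B2 (polar t phi) (polar_ball t phi d2 Hd2 ltac:(lra))).
  assert (C3 := B3 (polar t phi) (polar_ball t phi d3 Hd3 ltac:(lra))).
  assert (He := exp_pos t).
  assert (Hc : Rabs (cos phi) <= 1) by (apply Rabs_le; assert (X := COS_bound phi); lra).
  assert (Hs : Rabs (sin phi) <= 1) by (apply Rabs_le; assert (X := SIN_bound phi); lra).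
  assert (Hb : forall a b c, Rabs a <= 1 -> Rabs b <= c -> 0 <= c -> Rabs (exp t * a * b) <= c * exp t).
  { intros a b c Ha Hb Hc0; rewrite !Rabs_mult, (Rabs_pos_eq (exp t)) by lra.
    rewrite Rmult_assoc, Rmult_comm; apply Rmult_le_compat_r; [lra|].
    rewrite <- (Rmult_1_l c); apply Rmult_le_compat; auto; apply Rabs_pos. }
  split; [exact C1|split].
  - replace (rad w (polar t phi)) with (exp t * cos phi * pd false w (polar t phi) + exp t * sin phi * pd true w (polar t phi))
      by (unfold rad; simpl; ring).
    eapply Rle_trans; [apply Rabs_triang|]; unfold L; rewrite Rmult_plus_distr_r.
    apply Rplus_le_compat; now apply Hb.
  - replace (rot w (polar t phi)) with (exp t * (- sin phi) * pd false w (polar t phi) + exp t * cos phi * pd true w (polar t phi))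
      by (unfold rot; simpl; ring).
    eapply Rle_trans; [apply Rabs_triang|]; unfold L; rewrite Rmult_plus_distr_r.
    apply Rplus_le_compat; apply Hb; auto; now rewrite Rabs_Ropp. }
exists T1, (2 * PI * (K1 * K1 + K1 * L + 2 * L * L)).
assert (HC1 : 0 <= K1 * K1) by now apply Rmult_le_pos.
assert (HC2 : 0 <= K1 * L) by now apply Rmult_le_pos.
assert (HC3 : 0 <= L * L) by now apply Rmult_le_pos.
split; [apply HT1|split; [apply HT1|split; [apply Rmult_le_pos; lra|]]].
intros t Ht; assert (Ht0 : t < T0) by lra.
assert (He := exp_pos t).
assert (He1 : exp t <= 1) by (rewrite <- exp_0; left; apply exp_increasing; lra).
assert (HLe : 0 <= L * exp t) by (apply Rmult_le_pos; lra).
assert (HLL : L * exp t * (L * exp t) <= L * L * exp t).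
{ replace (L * exp t * (L * exp t)) with (L * L * exp t * exp t) by ring.
  rewrite <- (Rmult_1_r (L * L * exp t)) at 2; apply Rmult_le_compat_l; [apply Rmult_le_pos|]; lra. }
assert (Hm : forall a b A B, Rabs a <= A -> Rabs b <= B -> Rabs (a * b) <= A * B).
{ intros a b A B Ha Hb; rewrite Rabs_mult; apply Rmult_le_compat; auto; apply Rabs_pos. }
split; [|split].
- eapply Rle_trans; [apply (circle_int_bound _ t (K1 * K1)); [smooth|exact Ht0|]|].
  + intros phi; apply Hm; now apply Hpt.
  + apply Rmult_le_compat_l; lra.
- eapply Rle_trans; [apply (circle_int_bound _ t (K1 * (L * exp t))); [smooth|exact Ht0|]|].
  + intros phi; apply Hm; now apply Hpt.
  + rewrite !(Rmult_assoc (2 * PI)); apply Rmult_le_compat_l; [lra|].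
    rewrite <- Rmult_assoc; apply Rmult_le_compat_r; lra.
- unfold S, Rminus; eapply Rle_trans; [apply Rabs_triang|]; rewrite Rabs_Ropp.
  assert (A1 : Rabs (Er t) <= 2 * PI * (L * exp t * (L * exp t))).
  { apply (circle_int_bound _ t); [smooth|exact Ht0|]; intros phi; apply Hm; now apply Hpt. }
  assert (A2 : Rabs (Et t) <= 2 * PI * (L * exp t * (L * exp t))).
  { apply (circle_int_bound _ t); [smooth|exact Ht0|]; intros phi; apply Hm; now apply Hpt. }
  apply Rle_trans with (2 * PI * (2 * (L * exp t * (L * exp t)))); [lra|].
  rewrite !(Rmult_assoc (2 * PI)); apply Rmult_le_compat_l; [lra|].
  apply Rle_trans with (2 * (L * L * exp t)); [lra|].
  rewrite !Rmult_plus_distr_r.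
  assert (0 <= K1 * K1 * exp t) by (apply Rmult_le_pos; lra).
  assert (0 <= K1 * L * exp t) by (apply Rmult_le_pos; lra). lra.
Qed.

(** [I] is nondecreasing, its derivative being a sum of nonnegative integrals, and tends to 0 at the
    centre. *)
Lemma I_pos t : t < T0 -> 0 <= I t.
Proof.
destruct decay_bounds as [T1 [Cst [HT1 [HT10 [HC HB]]]]].
apply (nonneg_of_decay I T0 T1 Cst).
- apply monotone_le with (fun t => Er t + Et t + P1 t); [apply I_derive|].
  intros s Hs; assert (A1 := square_int_pos _ s Hrw Hs); assert (A2 := square_int_pos _ s Htw Hs).
  assert (A3 := P1_pos s Hs); fold Er in A1; fold Et in A2; lra.
- intros s Hs; now apply HB.
Qed.

Lemma exp2_derive t : is_derive (fun t => exp (2 * t)) t (2 * exp (2 * t)).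
Proof. auto_derive; [exact Logic.I|ring]. Qed.

(** Substitute for the identity [S = 0] of harmonic functions. The derivative of the right side, [K
    * exp (2 * t) * (H + 3 * I + Er + Et + P1)], dominates that of [S], and both sides vanish at the
    centre. *)
Lemma S_bound t : t < T0 -> S t <= K * exp (2 * t) * (1 / 2 * H t + I t).
Proof.
intros Ht.
destruct decay_bounds as [T1 [Cst [HT1 [HT10 [HC HB]]]]].
assert (HF : 0 <= K * (exp (2 * t) * (1 / 2 * H t + I t)) - S t); [|lra].
apply (nonneg_of_decay (fun t => K * (exp (2 * t) * (1 / 2 * H t + I t)) - S t) T0 T1 (K * (2 * Cst) + Cst)); [| |exact Ht].
- apply monotone_le with (fun t => K * (2 * exp (2 * t) * (1 / 2 * H t + I t) +
     exp (2 * t) * (1 / 2 * (2 * I t) + (Er t + Et t + P1 t))) - 2 * P2 t).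
  + intros s Hs; apply (is_derive_minus (V := R_NormedModule)); [|now apply S_derive].
    apply (is_derive_scal (fun t => exp (2 * t) * (1 / 2 * H t + I t))).
    apply (is_derive_mult (fun t => exp (2 * t)) (fun t => 1 / 2 * H t + I t)); [apply exp2_derive| |apply Rmult_comm].
    apply (is_derive_plus (V := R_NormedModule)); [|now apply I_derive].
    apply (is_derive_scal H); now apply H_derive.
  + intros s Hs; assert (A0 := square_int_pos _ s Hw Hs); assert (A1 := square_int_pos _ s Hrw Hs).
    assert (A2 := square_int_pos _ s Htw Hs); fold H in A0; fold Er in A1; fold Et in A2.
    assert (A3 := P1_pos s Hs); assert (A4 := P2_bound s Hs); assert (A5 := I_pos s Hs).
    assert (He := exp_pos (2 * s)).
    assert (HKe : 0 <= K * exp (2 * s)) by (apply Rmult_le_pos; lra).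
    assert (0 <= K * exp (2 * s) * (3 * I s + Et s + P1 s)) by (apply Rmult_le_pos; lra).
    lra.
- intros s Hs; destruct (HB s Hs) as [B1 [B2 B3]].
  assert (He := exp_pos s).
  assert (He1 : exp s <= 1) by (rewrite <- exp_0; left; apply exp_increasing; lra).
  assert (He2 : exp (2 * s) <= exp s).
  { replace (2 * s) with (s + s) by ring; rewrite exp_plus.
    rewrite <- (Rmult_1_r (exp s)) at 3; apply Rmult_le_compat_l; lra. }
  assert (He3 := exp_pos (2 * s)).
  unfold Rminus; eapply Rle_trans; [apply Rabs_triang|]; rewrite Rabs_Ropp, Rmult_plus_distr_r.
  apply Rplus_le_compat; [|exact B3].
  rewrite Rabs_mult, (Rabs_pos_eq K) by exact HK; rewrite Rmult_assoc; apply Rmult_le_compat_l; [exact HK|].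
  rewrite Rabs_mult, (Rabs_pos_eq (exp (2 * s))) by lra.
  rewrite (Rmult_comm (2 * Cst)); apply Rmult_le_compat; try lra; [apply Rabs_pos|].
  eapply Rle_trans; [apply Rabs_triang|]; rewrite Rabs_mult, (Rabs_pos_eq (1 / 2)) by lra.
  assert (Cst * exp s <= Cst * 1) by (apply Rmult_le_compat_l; lra). lra.
Qed.

(** A bound [Gam] on the frequency limits the decay of [H] towards the centre to the rate
    [exp (2 * Gam * t)], whereas vanishing to order [m] forces the rate [exp (2 * INR m * t)] for
    every [m]. *)
Lemma H_positive_impossible t1 : t1 < T0 -> (forall t, t <= t1 -> 0 < H t) ->
  (forall m : nat, exists d c, 0 < d /\ forall q, ball r0 d q ->
     Rabs (w q) <= c * (Rmax (Rabs (fst q - fst r0)) (Rabs (snd q - snd r0))) ^ m) -> False.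
Proof.
intros Ht1 Hpos Hflat.
set (n := fun t => I t / H t).
(* Cauchy-Schwarz and [S_bound] give [n' >= - K * exp (2 * t) * (n + 1 / 2)]; the shift by [1 / 2]
   and the exponential factor integrate this inequality, so [g] is nondecreasing. *)
set (g := fun t => (n t + 1 / 2) * exp (K / 2 * exp (2 * t))).
assert (Hcs : forall t, t <= t1 -> is_derive g t (((Er t + Et t + P1 t) / H t - 2 * I t * I t / (H t * H t)
   + K * exp (2 * t) * (n t + 1 / 2)) * exp (K / 2 * exp (2 * t)))).
{ intros t Ht; assert (HH := Hpos t Ht); assert (HtT : t < T0) by lra.
  assert (HI := I_derive t HtT); assert (HD := H_derive t HtT).
  assert (EI := is_derive_unique _ _ _ HI); assert (EH := is_derive_unique _ _ _ HD).
  unfold g, n; auto_derive.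
  - repeat split; [exists (Er t + Et t + P1 t); exact HI|exists (2 * I t); exact HD|lra].
  - replace (Derive (fun x => I x) t) with (Er t + Et t + P1 t) by (symmetry; exact EI).
    replace (Derive (fun x => H x) t) with (2 * I t) by (symmetry; exact EH).
    field; lra. }
assert (Hmono : forall s, s <= t1 -> g s <= g t1).
{ intros s Hs.
  assert (Hd : forall t, t <= t1 -> 0 <= ((Er t + Et t + P1 t) / H t - 2 * I t * I t / (H t * H t)
   + K * exp (2 * t) * (n t + 1 / 2)) * exp (K / 2 * exp (2 * t))).
  { intros t Ht; assert (HH := Hpos t Ht); assert (HtT : t < T0) by lra.
    apply Rmult_le_pos; [|left; apply exp_pos].
    assert (A1 := cauchy_schwarz t HtT); assert (A2 := P1_pos t HtT); assert (A3 := S_bound t HtT).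
    unfold S in A3.
    replace ((Er t + Et t + P1 t) / H t - 2 * I t * I t / (H t * H t) + K * exp (2 * t) * (n t + 1 / 2))
      with ((2 * (H t * Er t - I t * I t) + H t * (P1 t + (K * exp (2 * t) * (1 / 2 * H t + I t) - (Er t - Et t)))) / (H t * H t))
      by (unfold n; field; lra).
    apply Rmult_le_pos; [|left; apply Rinv_0_lt_compat; now apply Rmult_lt_0_compat].
    apply Rplus_le_le_0_compat; [lra|apply Rmult_le_pos; lra]. }
  destruct (MVT_gen g s t1 (fun t => ((Er t + Et t + P1 t) / H t - 2 * I t * I t / (H t * H t)
   + K * exp (2 * t) * (n t + 1 / 2)) * exp (K / 2 * exp (2 * t)))) as [x [Hx E]].
  - intros x; rewrite Rmin_left, Rmax_right by lra; intros; apply Hcs; lra.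
  - intros x; rewrite Rmin_left, Rmax_right by lra; intros; apply continuity_pt_filterlim.
    apply (ex_derive_continuous (K := R_AbsRing) (V := R_NormedModule)).
    eexists; apply Hcs; lra.
  - rewrite Rmin_left, Rmax_right in Hx by lra.
    assert (Hdx := Hd x ltac:(lra)).
    assert (Hts : 0 <= t1 - s) by lra; assert (HX := Rmult_le_pos _ _ Hdx Hts); lra. }
set (Gam := g t1).
assert (HnG : forall t, t <= t1 -> n t <= Gam).
{ intros t Ht; assert (Hg := Hmono t Ht); fold Gam in Hg; unfold g in Hg.
  assert (Hn0 : 0 <= n t).
  { apply Rmult_le_pos; [apply I_pos; lra|left; apply Rinv_0_lt_compat; now apply Hpos]. }
  assert (He : 1 <= exp (K / 2 * exp (2 * t))).
  { rewrite <- exp_0; assert (0 <= K / 2 * exp (2 * t)) by (apply Rmult_le_pos; [lra|left; apply exp_pos]).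
    destruct H0 as [H0|H0]; [left; now apply exp_increasing|rewrite <- H0; lra]. }
  assert ((n t + 1 / 2) * 1 <= (n t + 1 / 2) * exp (K / 2 * exp (2 * t))) by (apply Rmult_le_compat_l; lra).
  lra. }
assert (HGpos : 0 <= Gam).
{ apply Rle_trans with (n t1); [|apply HnG; lra].
  apply Rmult_le_pos; [apply I_pos; lra|left; apply Rinv_0_lt_compat; apply Hpos; lra]. }
assert (Hgrow : forall t, t <= t1 -> H t1 * exp (2 * Gam * (t - t1)) <= H t).
{ intros t Ht.
  assert (Hm : forall x, x <= t1 -> is_derive (fun x => H x * exp (- (2 * Gam * x))) x
     ((2 * I x - 2 * Gam * H x) * exp (- (2 * Gam * x)))).
  { intros x Hx; assert (HD := H_derive x ltac:(lra)); assert (EH := is_derive_unique _ _ _ HD).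
    auto_derive; [exists (2 * I x); exact HD|].
    replace (Derive (fun x => H x) x) with (2 * I x) by (symmetry; exact EH); ring. }
  destruct (MVT_gen (fun x => H x * exp (- (2 * Gam * x))) t t1
    (fun x => (2 * I x - 2 * Gam * H x) * exp (- (2 * Gam * x)))) as [x [Hx E]].
  - intros x; rewrite Rmin_left, Rmax_right by lra; intros; apply Hm; lra.
  - intros x; rewrite Rmin_left, Rmax_right by lra; intros; apply continuity_pt_filterlim.
    apply (ex_derive_continuous (K := R_AbsRing) (V := R_NormedModule) (fun x => H x * exp (- (2 * Gam * x)))).
    exists ((2 * I x - 2 * Gam * H x) * exp (- (2 * Gam * x))); apply (Hm x); lra.
  - rewrite Rmin_left, Rmax_right in Hx by lra.
    assert (Hxn := HnG x ltac:(lra)); assert (HHx := Hpos x ltac:(lra)).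
    assert (HIx : I x <= Gam * H x).
    { replace (I x) with (n x * H x) by (unfold n; field; lra). apply Rmult_le_compat_r; lra. }
    assert (Hle : H t1 * exp (- (2 * Gam * t1)) <= H t * exp (- (2 * Gam * t))).
    { assert (0 <= (2 * Gam * H x - 2 * I x) * exp (- (2 * Gam * x)) * (t1 - t)).
      { apply Rmult_le_pos; [apply Rmult_le_pos; [lra|left; apply exp_pos]|lra]. }
      lra. }
    apply Rmult_le_reg_r with (exp (- (2 * Gam * t))); [apply exp_pos|].
    rewrite Rmult_assoc, <- exp_plus.
    replace (2 * Gam * (t - t1) + - (2 * Gam * t)) with (- (2 * Gam * t1)) by ring; exact Hle. }
(* An order above [Gam + 1] leaves a spare factor [exp t] in the comparison of the two rates, and
   that factor tends to 0. *)
destruct (archimed_cor1 (/ (Gam + 1))) as [m [Hm Hm0]]; [apply Rinv_0_lt_compat; lra|].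
assert (HmG : Gam + 1 < INR m).
{ apply Rinv_lt_cancel; [apply lt_0_INR; lia|exact Hm]. }
destruct (Hflat m) as [d [c [Hd Hdc]]].
assert (Hup : forall t, t < Rmin (ln d) T0 -> H t <= 2 * PI * (c * c) * exp (2 * INR m * t)).
{ intros t Ht; assert (M1 := Rmin_l (ln d) T0); assert (M2 := Rmin_r (ln d) T0).
  eapply Rle_trans; [apply Rle_abs|].
  replace (2 * PI * (c * c) * exp (2 * INR m * t)) with (2 * PI * (c * c * exp (2 * INR m * t))) by ring.
  apply (circle_int_bound _ t); [smooth|lra|]; intros phi.
  assert (Hb := Hdc (polar t phi) (polar_ball t phi d Hd ltac:(lra))).
  set (M := Rmax _ _) in Hb.
  assert (HM : M <= exp t).
  { assert (He := exp_pos t); unfold M, polar; simpl; apply Rmax_lub.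
    - replace (fst r0 + exp t * cos phi - fst r0) with (exp t * cos phi) by ring.
      rewrite Rabs_mult, (Rabs_pos_eq (exp t)) by lra.
      rewrite <- (Rmult_1_r (exp t)) at 2; apply Rmult_le_compat_l; [lra|].
      apply Rabs_le; assert (X := COS_bound phi); lra.
    - replace (snd r0 + exp t * sin phi - snd r0) with (exp t * sin phi) by ring.
      rewrite Rabs_mult, (Rabs_pos_eq (exp t)) by lra.
      rewrite <- (Rmult_1_r (exp t)) at 2; apply Rmult_le_compat_l; [lra|].
      apply Rabs_le; assert (X := SIN_bound phi); lra. }
  assert (HM0 : 0 <= M) by (eapply Rle_trans; [apply Rabs_pos|apply Rmax_l]).
  assert (Hw2 : Rabs (w (polar t phi)) <= Rabs c * exp t ^ m).
  { eapply Rle_trans; [exact Hb|].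
    apply Rle_trans with (Rabs c * M ^ m).
    - apply Rmult_le_compat_r; [now apply pow_le|apply Rle_abs].
    - apply Rmult_le_compat_l; [apply Rabs_pos|]; now apply pow_incr. }
  rewrite Rabs_mult.
  apply Rle_trans with (Rabs c * exp t ^ m * (Rabs c * exp t ^ m)).
  - apply Rmult_le_compat; auto; apply Rabs_pos.
  - right. rewrite <- (Rabs_pos_eq (c * c)) by apply Rle_0_sqr; rewrite Rabs_mult.
    replace (2 * INR m * t) with (INR m * t + INR m * t) by ring; rewrite exp_plus.
    assert (Ep : exp t ^ m = exp (INR m * t)).
    { clear; induction m; [simpl; now rewrite Rmult_0_l, exp_0|].
      rewrite S_INR, Rmult_plus_distr_r, exp_plus, <- IHm, Rmult_1_l; simpl; ring. }
    rewrite Ep; ring. }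
set (B := H t1 * exp (- (2 * Gam * t1))).
assert (HB : 0 < B) by (apply Rmult_lt_0_compat; [apply Hpos; lra|apply exp_pos]).
set (D := 2 * PI * (c * c) + 1).
assert (HD : 0 < D).
{ assert (HP := PI_RGT_0); assert (X := Rle_0_sqr c); unfold Rsqr in X; unfold D.
  assert (0 <= 2 * PI * (c * c)) by (apply Rmult_le_pos; lra); lra. }
destruct (exp_small (B / D)) as [u Hu]; [now apply Rdiv_lt_0_compat|].
set (t := Rmin (Rmin u t1) (Rmin (Rmin (ln d) T0 - 1) 0)).
assert (Ht : t <= u /\ t <= t1 /\ t <= Rmin (ln d) T0 - 1 /\ t <= 0).
{ unfold t; repeat split.
  - eapply Rle_trans; [apply Rmin_l|apply Rmin_l].
  - eapply Rle_trans; [apply Rmin_l|apply Rmin_r].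
  - eapply Rle_trans; [apply Rmin_r|apply Rmin_l].
  - eapply Rle_trans; [apply Rmin_r|apply Rmin_r]. }
destruct Ht as [Hta [Htb [Htc Htd]]].
assert (X1 := Hgrow t Htb); assert (X2 := Hup t ltac:(lra)); assert (X3 := Hu t Hta).
assert (X4 : B * exp (2 * Gam * t) <= D * exp (2 * INR m * t)).
{ replace (B * exp (2 * Gam * t)) with (H t1 * exp (2 * Gam * (t - t1))).
  - assert (X := exp_pos (2 * INR m * t)); unfold D; lra.
  - unfold B; rewrite (Rmult_assoc (H t1)), <- exp_plus; do 2 f_equal; ring. }
assert (X5 : B <= D * exp t).
{ apply Rmult_le_reg_r with (exp (2 * Gam * t)); [apply exp_pos|].
  apply Rle_trans with (1 := X4); rewrite (Rmult_assoc D), <- exp_plus.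
  apply Rmult_le_compat_l; [lra|].
  assert (Hle : 2 * INR m * t <= t + 2 * Gam * t).
  { assert (0 <= (2 * INR m - 1 - 2 * Gam) * - t) by (apply Rmult_le_pos; lra); lra. }
  destruct Hle as [Hle|Hle]; [left; now apply exp_increasing|rewrite Hle; lra]. }
assert (X6 : D * exp t < B); [|lra].
apply Rlt_le_trans with (D * (B / D)); [now apply Rmult_lt_compat_l|right; field; lra].
Qed.

(* Almgren's frequency I/H stays bounded as t -> -oo, so a solution that is not identically zero
   near [r0] has a finite order of vanishing there. *)
Theorem strong_unique_continuation :
  (forall m : nat, exists d c, 0 < d /\ forall q, ball r0 d q ->
     Rabs (w q) <= c * (Rmax (Rabs (fst q - fst r0)) (Rabs (snd q - snd r0))) ^ m) ->
  exists d, 0 < d /\ forall q, ball r0 d q -> snd r0 < snd q -> w q = 0.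
Proof.
intros Hflat.
assert (Hz : exists t2, t2 < T0 /\ H t2 = 0).
{ destruct (Classical_Prop.classic (exists t2, t2 < T0 /\ H t2 = 0)) as [Hex|Hno]; [exact Hex|exfalso].
  apply (H_positive_impossible (T0 - 1)); [lra| |exact Hflat].
  intros t Ht; assert (A := square_int_pos w t Hw ltac:(lra)); fold H in A.
  destruct A as [A|A]; [exact A|exfalso; apply Hno; exists t; split; [lra|now symmetry]]. }
destruct Hz as [t2 [Ht2 HH2]].
assert (HHz : forall t, t <= t2 -> H t = 0).
{ intros t Ht; apply Rle_antisym; [|apply square_int_pos; [exact Hw|lra]].
  rewrite <- HH2; apply (monotone_le H (fun t => 2 * I t) T0); auto.
  - apply H_derive.
  - intros s Hs; assert (X := I_pos s Hs); lra. }
exists (exp t2 / 2); assert (He := exp_pos t2); split; [lra|].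
intros q Hq Hs; apply (proj1 (ball_C _ _ _)) in Hq; destruct Hq as [Hq1 Hq2].
set (x := fst q - fst r0) in *; set (y := snd q - snd r0) in *.
assert (Hy : 0 < y) by (unfold y; lra).
set (rr := sqrt (x * x + y * y)).
assert (Hxy : 0 < x * x + y * y).
{ assert (X := Rle_0_sqr x); unfold Rsqr in X; assert (0 < y * y) by now apply Rmult_lt_0_compat. lra. }
assert (Hrr : 0 < rr) by now apply sqrt_lt_R0.
assert (Hrr2 : rr * rr = x * x + y * y) by (apply sqrt_sqrt; lra).
assert (Hrle : rr <= exp t2).
{ apply Rsqr_incr_0_var; [|lra]; unfold Rsqr; rewrite Hrr2.
  apply Rabs_def2 in Hq1; apply Rabs_def2 in Hq2.
  assert (x * x <= exp t2 / 2 * (exp t2 / 2)) by nra.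
  assert (y * y <= exp t2 / 2 * (exp t2 / 2)) by nra. nra. }
set (t := ln rr).
assert (Ht : t <= t2).
{ unfold t; rewrite <- (ln_exp t2); destruct Hrle as [Hr|Hr]; [left; now apply ln_increasing|rewrite Hr; lra]. }
assert (Het : exp t = rr) by now apply exp_ln.
assert (Hxr : -1 < x / rr < 1).
{ assert (Hx2 : (x / rr) * (x / rr) < 1).
  { replace (x / rr * (x / rr)) with (x * x / (rr * rr)) by (field; lra).
    apply Rlt_div_l; [nra|]; rewrite Hrr2; nra. }
  split; nra. }
(* [acos] provides an angle strictly between 0 and [PI] for points above the centre, as
   [circle_int_zero] requires. A half disc is enough to contradict the density of regular points. *)
set (phi := acos (x / rr)).
assert (Hc : cos phi = x / rr) by (apply cos_acos; lra).
assert (Hphi := acos_bound_lt (x / rr) Hxr); fold phi in Hphi.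
assert (Hsn : sin phi = y / rr).
{ unfold phi; rewrite sin_acos by lra.
  replace (1 - (x / rr)²) with ((y / rr) * (y / rr)).
  - apply sqrt_square; apply Rmult_le_pos; [lra|left; now apply Rinv_0_lt_compat].
  - unfold Rsqr; replace (1 - x / rr * (x / rr)) with ((rr * rr - x * x) / (rr * rr)) by (field; lra).
    replace (rr * rr - x * x) with (y * y) by lra; field; lra. }
assert (Hqp : polar t phi = q).
{ unfold polar; rewrite Het, Hc, Hsn; destruct q as [q1 q2]; unfold x, y; simpl; f_equal; field; lra. }
assert (H0 : w (polar t phi) * w (polar t phi) = 0).
{ apply (circle_int_zero (fun p => w p * w p) t phi); [smooth|lra|intros; apply Rle_0_sqr|now apply HHz|].
  assert (HP := PI_RGT_0); lra. }
rewrite Hqp in H0; now apply Rsqr_0_uniq.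
Qed.

End Frequency.
End Polar.

(** * Lorentz algebra and the moving frame of a harmonic map *)

(** Lorentzian cross product: the sign of the time component makes [lor3 w (cross u v)] the ordinary
    determinant of [w], [u], [v]. *)
Definition cross (u v : nat -> R) (k : nat) : R :=
  match k with
  | 0%nat => - (u 1%nat * v 2%nat - u 2%nat * v 1%nat)
  | 1%nat => u 2%nat * v 0%nat - u 0%nat * v 2%nat
  | _ => u 0%nat * v 1%nat - u 1%nat * v 0%nat
  end.

Definition det3 (u v w : nat -> R) : R := lor3 u (cross v w).

Lemma below3 (P : nat -> Prop) : P 0%nat -> P 1%nat -> P 2%nat -> forall k, (k < 3)%nat -> P k.
Proof. intros H0 H1 H2 [|[|[|k]]] Hk; auto; lia. Qed.

Lemma lor3_ext u v u' v' : (forall k, (k < 3)%nat -> u k = u' k) -> (forall k, (k < 3)%nat -> v k = v' k) ->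
  lor3 u v = lor3 u' v'.
Proof. intros H1 H2; unfold lor3; rewrite !H1, !H2 by lia; reflexivity. Qed.

Lemma cross_ext u v u' v' k : (forall k, (k < 3)%nat -> u k = u' k) -> (forall k, (k < 3)%nat -> v k = v' k) ->
  cross u v k = cross u' v' k.
Proof. intros H1 H2; destruct k as [|[|k]]; unfold cross; rewrite !H1, !H2 by lia; reflexivity. Qed.

Lemma lor3_sym u v : lor3 u v = lor3 v u.
Proof. unfold lor3; ring. Qed.

Lemma lor3_comb a b c u v w z :
  lor3 (fun k => a * u k + b * v k + c * w k) z = a * lor3 u z + b * lor3 v z + c * lor3 w z.
Proof. unfold lor3; ring. Qed.

(** The sign is opposite to that of the Euclidean triple product, owing to the signature. *)
Lemma cross_cross u v w k : (k < 3)%nat ->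
  cross u (cross v w) k = w k * lor3 u v - v k * lor3 u w.
Proof. revert k; apply below3; unfold cross, lor3; ring. Qed.

Lemma lor3_cross_cross u v w z :
  lor3 (cross u v) (cross w z) = - (lor3 u w * lor3 v z - lor3 u z * lor3 v w).
Proof. unfold cross, lor3; ring. Qed.

(** The right side is minus the Gram determinant, the metric having determinant [-1]. *)
Lemma det3_sq u v w : det3 u v w * det3 u v w =
  - (lor3 u u * (lor3 v v * lor3 w w - lor3 v w * lor3 v w)
     - lor3 u v * (lor3 u v * lor3 w w - lor3 v w * lor3 u w)
     + lor3 u w * (lor3 u v * lor3 v w - lor3 v v * lor3 u w)).
Proof. unfold det3, cross, lor3; ring. Qed.

Lemma lorentz_basis a b c v : det3 a b c <> 0 ->
  lor3 v a = 0 -> lor3 v b = 0 -> lor3 v c = 0 -> forall k, (k < 3)%nat -> v k = 0.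
Proof.
intros Hd Ha Hb Hc k Hk.
assert (E : det3 a b c * v k = lor3 v a * cross b c k + lor3 v b * cross c a k + lor3 v c * cross a b k).
{ revert k Hk; apply below3; unfold det3, cross, lor3; ring. }
rewrite Ha, Hb, Hc in E; apply Rmult_eq_reg_l with (det3 a b c); [rewrite E; ring|exact Hd].
Qed.

Lemma lorentz_basis_eq a b c u v : det3 a b c <> 0 ->
  lor3 u a = lor3 v a -> lor3 u b = lor3 v b -> lor3 u c = lor3 v c ->
  forall k, (k < 3)%nat -> u k = v k.
Proof.
intros Hd Ha Hb Hc k Hk; apply Rminus_diag_uniq.
apply (lorentz_basis a b c (fun k => u k - v k) Hd); [..|exact Hk].
- transitivity (lor3 u a - lor3 v a); [unfold lor3; ring|lra].
- transitivity (lor3 u b - lor3 v b); [unfold lor3; ring|lra].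
- transitivity (lor3 u c - lor3 v c); [unfold lor3; ring|lra].
Qed.

(** The tangent planes of the hyperboloid are spacelike: multiplied by the square of the time
    component of [g], the norm of [v] becomes the sum of squares in [E]. *)
Lemma tangent_pos g v : in_H2 g -> lor3 g v = 0 -> 0 <= lor3 v v /\ (lor3 v v = 0 -> forall k, (k < 3)%nat -> v k = 0).
Proof.
intros [Hg Hg0] Hv; unfold lor3 in *.
set (a := g 0%nat) in *; set (b := g 1%nat) in *; set (c := g 2%nat) in *.
assert (E : a * a * (- v 0%nat * v 0%nat + v 1%nat * v 1%nat + v 2%nat * v 2%nat) =
  v 1%nat * v 1%nat + v 2%nat * v 2%nat + (b * v 2%nat - c * v 1%nat) * (b * v 2%nat - c * v 1%nat)).
{ assert (Ea : a * a = 1 + b * b + c * c) by lra.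
  assert (Ev : a * v 0%nat = b * v 1%nat + c * v 2%nat) by lra.
  transitivity (- (a * v 0%nat) * (a * v 0%nat) + a * a * (v 1%nat * v 1%nat + v 2%nat * v 2%nat)); [ring|].
  rewrite Ev, Ea; ring. }
assert (Haa : 0 < a * a) by now apply Rmult_lt_0_compat.
assert (S1 := Rle_0_sqr (v 1%nat)); assert (S2 := Rle_0_sqr (v 2%nat)).
assert (S3 := Rle_0_sqr (b * v 2%nat - c * v 1%nat)); unfold Rsqr in *.
split.
- apply Rmult_le_reg_l with (a * a); [exact Haa|]; rewrite E; lra.
- intros H0; rewrite H0 in E.
  assert (Z1 : v 1%nat = 0) by (apply Rsqr_0_uniq; unfold Rsqr; lra).
  assert (Z2 : v 2%nat = 0) by (apply Rsqr_0_uniq; unfold Rsqr; lra).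
  assert (Z0 : v 0%nat = 0).
  { rewrite Z1, Z2 in Hv; apply Rmult_eq_reg_l with a; lra. }
  apply below3; assumption.
Qed.

Definition ip (F H : nat -> C -> R) (q : C) : R := lor3 (at_ F q) (at_ H q).
Definition pdv (b : bool) (F : nat -> C -> R) (k : nat) : C -> R := pd b (F k).
Definition crossf (F H : nat -> C -> R) (k : nat) (q : C) : R := cross (at_ F q) (at_ H q) k.

Section SmoothVectors.
Variable Om : C -> Prop.
Hypothesis HOm : open Om.
Definition smooth_vec (F : nat -> C -> R) := forall k, (k < 3)%nat -> smooth_on Om (F k).

Lemma smooth_pdv b F : smooth_vec F -> smooth_vec (pdv b F).
Proof. intros H k Hk; apply smooth_pd; now apply H. Qed.

Lemma smooth_ip F H : smooth_vec F -> smooth_vec H -> smooth_on Om (ip F H).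
Proof.
intros HF HH; unfold ip, lor3, at_.
assert (F0 := HF 0%nat ltac:(lia)); assert (F1 := HF 1%nat ltac:(lia)); assert (F2 := HF 2%nat ltac:(lia)).
assert (H0 := HH 0%nat ltac:(lia)); assert (H1 := HH 1%nat ltac:(lia)); assert (H2 := HH 2%nat ltac:(lia)).
smooth.
Qed.

Lemma smooth_crossf F H : smooth_vec F -> smooth_vec H -> smooth_vec (crossf F H).
Proof.
intros HF HH.
assert (F0 := HF 0%nat ltac:(lia)); assert (F1 := HF 1%nat ltac:(lia)); assert (F2 := HF 2%nat ltac:(lia)).
assert (H0 := HH 0%nat ltac:(lia)); assert (H1 := HH 1%nat ltac:(lia)); assert (H2 := HH 2%nat ltac:(lia)).
intros k Hk; revert k Hk; apply below3; unfold crossf, cross, at_; smooth.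
Qed.

Lemma is_pd_ip b F H F' H' p : (forall k, (k < 3)%nat -> is_pd b (F k) p (F' k)) ->
  (forall k, (k < 3)%nat -> is_pd b (H k) p (H' k)) ->
  is_pd b (ip F H) p (lor3 F' (at_ H p) + lor3 (at_ F p) H').
Proof.
intros HF HH; unfold ip, lor3, at_.
assert (F0 := HF 0%nat ltac:(lia)); assert (F1 := HF 1%nat ltac:(lia)); assert (F2 := HF 2%nat ltac:(lia)).
assert (H0 := HH 0%nat ltac:(lia)); assert (H1 := HH 1%nat ltac:(lia)); assert (H2 := HH 2%nat ltac:(lia)).
eapply is_pd_val; [pdauto|cbv beta; ring].
Qed.

Lemma is_pd_crossf b F H F' H' p k : (forall k, (k < 3)%nat -> is_pd b (F k) p (F' k)) ->
  (forall k, (k < 3)%nat -> is_pd b (H k) p (H' k)) -> (k < 3)%nat ->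
  is_pd b (crossf F H k) p (cross F' (at_ H p) k + cross (at_ F p) H' k).
Proof.
intros HF HH.
assert (F0 := HF 0%nat ltac:(lia)); assert (F1 := HF 1%nat ltac:(lia)); assert (F2 := HF 2%nat ltac:(lia)).
assert (H0 := HH 0%nat ltac:(lia)); assert (H1 := HH 1%nat ltac:(lia)); assert (H2 := HH 2%nat ltac:(lia)).
revert k; apply below3; unfold crossf, cross, at_; (eapply is_pd_val; [pdauto|cbv beta; ring]).
Qed.

Lemma smooth_vec_pd b F p k : smooth_vec F -> Om p -> (k < 3)%nat -> is_pd b (F k) p (at_ (pdv b F) p k).
Proof. intros H Hp Hk; apply (smooth_is_pd Om); [now apply H|exact Hp]. Qed.

Lemma pd_ip b F H p : smooth_vec F -> smooth_vec H -> Om p ->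
  pd b (ip F H) p = ip (pdv b F) H p + ip F (pdv b H) p.
Proof.
intros HF HH Hp; apply is_pd_unique; apply is_pd_ip; intros; now apply smooth_vec_pd.
Qed.

Lemma pd_ip_const b F H c p : smooth_vec F -> smooth_vec H -> (forall q, Om q -> ip F H q = c) -> Om p ->
  ip (pdv b F) H p + ip F (pdv b H) p = 0.
Proof.
intros HF HH E Hp; rewrite <- pd_ip by assumption.
apply is_pd_unique; apply (is_pd_ext_on Om HOm b (fun _ => c)); [|exact Hp|apply is_pd_const].
intros q Hq; symmetry; now apply E.
Qed.

Lemma is_pd_half_norm b F p : smooth_vec F -> Om p ->
  is_pd b (fun q => ip F F q * / 2) p (ip (pdv b F) F p).
Proof.
intros HF Hp; eapply is_pd_val.
- apply is_pd_mult; [|apply is_pd_const].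
  apply (is_pd_ip b F F (at_ (pdv b F) p) (at_ (pdv b F) p)); intros; now apply smooth_vec_pd.
- cbv beta; unfold ip; rewrite (lor3_sym (at_ F p) (at_ (pdv b F) p)); field.
Qed.
End SmoothVectors.

(** * The moving frame and its structure equations *)

Section Frame.
Variables (Om : C -> Prop) (G : nat -> C -> R) (s : R).
Hypothesis HOm : open Om.
Hypothesis HG : harmonic_H2 Om G.
Hypothesis Hs : s * s = 1.

Let HGs : smooth_vec Om G.
Proof. destruct HG as [H _]; exact H. Qed.

Notation Gx := (pdv false G).
Notation Gy := (pdv true G).
Let HGx : smooth_vec Om Gx := smooth_pdv Om false G HGs.
Let HGy : smooth_vec Om Gy := smooth_pdv Om true G HGs.

Definition cA : C -> R := ip Gx Gx.
Definition cB : C -> R := ip Gy Gy.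
Definition cC : C -> R := ip Gx Gy.
Definition cJ (q : C) : R := det3 (at_ G q) (at_ Gx q) (at_ Gy q).
(* [hopf1 + i hopf2] is the coefficient [Q = - <G_z, G_z>]. *)
Definition hopf1 (q : C) : R := (cB q - cA q) / 4.
Definition hopf2 (q : C) : R := cC q / 2.
(* Weierstrass data with this [Q] are roots of [tau^2 - (cA + cB) tau + 4 |Q|^2 = 0]; the discriminant is
   [4 cJ^2], and the sign [s] selects the root. *)
Definition ft (q : C) : R := (cA q + cB q) / 2 + s * cJ q.
(* Orthogonal of squared length [2 ft], hence a tangent frame even where [dG] degenerates. *)
Definition frame1 (k : nat) (q : C) : R := Gx k q - s * crossf G Gy k q.
Definition frame2 (k : nat) (q : C) : R := Gy k q + s * crossf G Gx k q.

Lemma smooth_cA : smooth_on Om cA.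
Proof. now apply smooth_ip. Qed.
Lemma smooth_cB : smooth_on Om cB.
Proof. now apply smooth_ip. Qed.
Lemma smooth_cC : smooth_on Om cC.
Proof. now apply smooth_ip. Qed.
Lemma smooth_cJ : smooth_on Om cJ.
Proof. apply (smooth_ip Om HOm G (crossf Gx Gy)); [exact HGs|now apply smooth_crossf]. Qed.
#[local] Hint Resolve smooth_cA smooth_cB smooth_cC smooth_cJ : core.
Lemma smooth_hopf1 : smooth_on Om hopf1.
Proof. unfold hopf1; smooth; intros; lra. Qed.
Lemma smooth_hopf2 : smooth_on Om hopf2.
Proof. unfold hopf2; smooth; intros; lra. Qed.
Lemma smooth_ft : smooth_on Om ft.
Proof. unfold ft; smooth; intros; lra. Qed.
Lemma smooth_frame1 : smooth_vec Om frame1.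
Proof.
intros k Hk; unfold frame1.
assert (H1 := HGx k Hk); assert (H2 := smooth_crossf Om HOm G Gy HGs HGy k Hk); smooth.
Qed.
Lemma smooth_frame2 : smooth_vec Om frame2.
Proof.
intros k Hk; unfold frame2.
assert (H1 := HGy k Hk); assert (H2 := smooth_crossf Om HOm G Gx HGs HGx k Hk); smooth.
Qed.

Section AtPoint.
Variable p : C.
Hypothesis Hp : Om p.

Lemma GG : ip G G p = -1.
Proof. destruct HG as [_ [H _]]; apply (H p Hp). Qed.

Let GGc : forall q, Om q -> ip G G q = -1.
Proof. destruct HG as [_ [H _]]; intros q Hq; apply (H q Hq). Qed.

Lemma ip_sym F H q : ip F H q = ip H F q.
Proof. apply lor3_sym. Qed.

Lemma G_pd b q : Om q -> ip G (pdv b G) q = 0.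
Proof.
intros Hq; assert (H := pd_ip_const Om HOm b G G (-1) q HGs HGs GGc Hq).
rewrite (ip_sym (pdv b G)) in H; lra.
Qed.

Lemma G_pdpd b b' : ip G (pdv b' (pdv b G)) p = - ip (pdv b' G) (pdv b G) p.
Proof.
assert (H := pd_ip_const Om HOm b' G (pdv b G) 0 p HGs (smooth_pdv Om b G HGs) (G_pd b) Hp); lra.
Qed.

(** Differentiating [ip G G = -1] twice evaluates the normal part of the Laplacian; harmonicity then
    takes the explicit form needed to eliminate [G_yy]. *)
Lemma harmonic_eq k : (k < 3)%nat -> pdv true Gy k p = (cA p + cB p) * G k p - pdv false Gx k p.
Proof.
intros Hk; destruct HG as [_ [_ H]]; specialize (H p Hp k Hk).
assert (E : lor3 (lapv G p) (at_ G p) = - (cA p + cB p)).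
{ assert (E1 := G_pdpd false false); assert (E2 := G_pdpd true true).
  transitivity (ip G (pdv false Gx) p + ip G (pdv true Gy) p); [unfold lapv, ip, at_, pdv, lor3, dx, dy; ring|].
  unfold cA, cB; rewrite E1, E2; ring. }
rewrite E in H; unfold lapv, dx, dy in H; unfold pdv; lra.
Qed.

Lemma cJ_sq : cJ p * cJ p = cA p * cB p - cC p * cC p.
Proof.
unfold cJ; rewrite det3_sq.
assert (H1 := GG); assert (H2 := G_pd false p Hp); assert (H3 := G_pd true p Hp).
unfold ip in H1, H2, H3; rewrite H1, H2, H3; unfold cA, cB, cC, ip; ring.
Qed.

Lemma ft_quadratic : ft p * ft p - (cA p + cB p) * ft p + 4 * (hopf1 p * hopf1 p + hopf2 p * hopf2 p) = 0.
Proof.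
assert (H := cJ_sq).
transitivity ((s * s) * (cJ p * cJ p) - (cA p * cB p - cC p * cC p)); [|rewrite Hs, H; ring].
unfold ft, hopf1, hopf2; field.
Qed.

Let g := at_ G p.
Let x := at_ Gx p.
Let y := at_ Gy p.
Let gg : lor3 g g = -1 := GG.
Let gx : lor3 g x = 0 := G_pd false p Hp.
Let gy : lor3 g y = 0 := G_pd true p Hp.

Lemma lor3_e1 v : lor3 v (at_ frame1 p) = lor3 v x - s * det3 v g y.
Proof. unfold frame1, crossf, at_, det3, g, x, y, lor3, at_; ring. Qed.
Lemma lor3_e2 v : lor3 v (at_ frame2 p) = lor3 v y + s * det3 v g x.
Proof. unfold frame2, crossf, at_, det3, g, x, y, lor3, at_; ring. Qed.

Lemma det3_cycle u v w : det3 u v w = det3 v w u.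
Proof. unfold det3, cross, lor3; ring. Qed.
Lemma det3_swap u v w : det3 u v w = - det3 v u w.
Proof. unfold det3, cross, lor3; ring. Qed.
Lemma det3_vuv u v : det3 v u v = 0.
Proof. unfold det3, cross, lor3; ring. Qed.
Lemma det3_vvu u v : det3 v v u = 0.
Proof. unfold det3, cross, lor3; ring. Qed.

Lemma G_e1 : ip G frame1 p = 0.
Proof. unfold ip; fold g; rewrite lor3_e1, gx, det3_vvu; ring. Qed.
Lemma G_e2 : ip G frame2 p = 0.
Proof. unfold ip; fold g; rewrite lor3_e2, gy, det3_vvu; ring. Qed.

Lemma Gx_e1 : ip Gx frame1 p = ft p - 2 * hopf1 p.
Proof.
unfold ip; rewrite lor3_e1; fold x; rewrite (det3_swap x g y).
unfold ft, hopf1, cA, cB, cJ, ip; fold x y g; field.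
Qed.
Lemma Gx_e2 : ip Gx frame2 p = 2 * hopf2 p.
Proof. unfold ip; rewrite lor3_e2; fold x; rewrite det3_vuv; unfold hopf2, cC, ip; fold x y; field. Qed.
Lemma Gy_e1 : ip Gy frame1 p = 2 * hopf2 p.
Proof. unfold ip; rewrite lor3_e1; fold y; rewrite det3_vuv, (lor3_sym y); unfold hopf2, cC, ip; fold x y; field. Qed.
Lemma Gy_e2 : ip Gy frame2 p = ft p + 2 * hopf1 p.
Proof.
unfold ip; rewrite lor3_e2; fold y; rewrite (det3_cycle y g x).
unfold ft, hopf1, cA, cB, cJ, ip; fold x y g; field.
Qed.

(** The cross product with [G] is the quarter turn of the tangent plane, with square minus the
    identity there; [s * s = 1] makes [frame2] the image of [frame1] under [s] times it. *)
Lemma e2_cross k : (k < 3)%nat -> frame2 k p = s * cross g (at_ frame1 p) k.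
Proof.
intros Hk.
assert (E : cross g (at_ frame1 p) k = cross g x k - s * cross g (cross g y) k).
{ revert k Hk; apply below3; cbv [cross crossf at_ frame1 g x y]; ring. }
rewrite E, cross_cross, gy, gg by exact Hk.
transitivity (y k + s * cross g x k); [reflexivity|].
transitivity ((s * s) * y k + s * cross g x k); [rewrite Hs; ring|ring].
Qed.

Lemma e1_e1 : ip frame1 frame1 p = 2 * ft p.
Proof.
unfold ip; rewrite lor3_e1.
assert (E : det3 (at_ frame1 p) g y = - cJ p - s * cB p).
{ unfold det3; rewrite lor3_sym, lor3_e1; fold (det3 (cross g y) g y).
  replace (lor3 (cross g y) x) with (det3 x g y) by (unfold det3; apply lor3_sym).
  rewrite (det3_swap x g y); fold (cJ p).
  replace (det3 (cross g y) g y) with (lor3 (cross g y) (cross g y)) by reflexivity.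
  rewrite lor3_cross_cross, gg, gy; unfold cB, ip; fold y; unfold cJ; fold g x y; ring. }
rewrite E, lor3_sym.
replace (lor3 x (at_ frame1 p)) with (ip Gx frame1 p) by reflexivity; rewrite Gx_e1.
transitivity (ft p - 2 * hopf1 p + s * cJ p + (s * s) * cB p); [ring|rewrite Hs; unfold ft, hopf1; field].
Qed.

Lemma e1_e2 : ip frame1 frame2 p = 0.
Proof.
unfold ip; rewrite (lor3_ext _ (at_ frame2 p) (at_ frame1 p) (fun k => s * cross g (at_ frame1 p) k)).
- transitivity (s * det3 (at_ frame1 p) g (at_ frame1 p)); [unfold det3, lor3; ring|rewrite det3_vuv; ring].
- reflexivity.
- exact e2_cross.
Qed.

Lemma e2_e2 : ip frame2 frame2 p = 2 * ft p.
Proof.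
unfold ip; rewrite (lor3_ext (at_ frame2 p) (at_ frame2 p) (fun k => s * cross g (at_ frame1 p) k) (fun k => s * cross g (at_ frame1 p) k))
  by exact e2_cross.
transitivity ((s * s) * lor3 (cross g (at_ frame1 p)) (cross g (at_ frame1 p))); [unfold lor3; ring|].
rewrite Hs, lor3_cross_cross, gg.
replace (lor3 g (at_ frame1 p)) with (ip G frame1 p) by reflexivity; rewrite G_e1.
replace (lor3 (at_ frame1 p) (at_ frame1 p)) with (ip frame1 frame1 p) by reflexivity; rewrite e1_e1; ring.
Qed.
End AtPoint.

Lemma pd_comm_vec F k p : smooth_vec Om F -> Om p -> (k < 3)%nat ->
  pdv true (pdv false F) k p = pdv false (pdv true F) k p.
Proof. intros HF Hp Hk; apply (pd_comm Om HOm (F k)); [now apply HF|exact Hp]. Qed.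

Section AtPoint2.
Variable p : C.
Hypothesis Hp : Om p.
Let g := at_ G p.
Let x := at_ Gx p.
Let y := at_ Gy p.
Let xx := at_ (pdv false Gx) p.
Let xy := at_ (pdv false Gy) p.

Lemma e1x_val k : (k < 3)%nat -> pdv false frame1 k p = xx k - s * (cross x y k + cross g xy k).
Proof.
intros Hk; apply is_pd_unique; unfold frame1.
assert (H1 := smooth_vec_pd Om false Gx p k HGx Hp Hk).
assert (H2 := is_pd_crossf false G Gy x xy p k
  (fun k Hk => smooth_vec_pd Om false G p k HGs Hp Hk) (fun k Hk => smooth_vec_pd Om false Gy p k HGy Hp Hk) Hk).
eapply is_pd_val; [apply is_pd_minus; [exact H1|apply is_pd_mult; [apply is_pd_const|exact H2]]|].
cbv beta; unfold xx, g, y; ring.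
Qed.

Lemma e1y_val k : (k < 3)%nat -> pdv true frame1 k p = xy k + s * cross g xx k.
Proof.
intros Hk; apply is_pd_unique; unfold frame1.
assert (H1 := smooth_vec_pd Om true Gx p k HGx Hp Hk).
assert (H2 := is_pd_crossf true G Gy y (at_ (pdv true Gy) p) p k
  (fun k Hk => smooth_vec_pd Om true G p k HGs Hp Hk) (fun k Hk => smooth_vec_pd Om true Gy p k HGy Hp Hk) Hk).
eapply is_pd_val; [apply is_pd_minus; [exact H1|apply is_pd_mult; [apply is_pd_const|exact H2]]|].
cbv beta; fold g y.
replace (cross y y k) with 0 by (revert k Hk H1 H2; apply (below3 (fun k => _ -> _ -> 0 = cross y y k)); intros; unfold cross; ring).
assert (E : cross g (at_ (pdv true Gy) p) k = - cross g xx k).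
{ assert (Y0 := harmonic_eq p Hp 0 ltac:(lia)); assert (Y1 := harmonic_eq p Hp 1 ltac:(lia));
  assert (Y2 := harmonic_eq p Hp 2 ltac:(lia)).
  clear H1 H2; revert k Hk; apply below3; unfold cross, at_; rewrite ?Y0, ?Y1, ?Y2; unfold xx, g, at_; ring. }
rewrite E; unfold at_; rewrite (pd_comm_vec G k p HGs Hp Hk).
unfold xy, at_; ring.
Qed.

(** Harmonicity of [G] read on the frame: up to a normal term, the vertical derivative of [frame1]
    is the quarter turn, times [s], of its horizontal derivative, a Cauchy-Riemann equation. *)
Lemma e1y_cross k : (k < 3)%nat -> pdv true frame1 k p = s * cross g (at_ (pdv false frame1) p) k - lor3 g xy * g k.
Proof.
intros Hk; rewrite e1y_val by exact Hk.
assert (E : cross g (at_ (pdv false frame1) p) k = cross g xx k - s * (cross g (cross x y) k + cross g (cross g xy) k)).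
{ rewrite (cross_ext g (at_ (pdv false frame1) p) g (fun k => xx k - s * (cross x y k + cross g xy k)) k)
    by (auto; exact e1x_val).
  revert k Hk; apply below3; unfold cross; ring. }
rewrite E, !cross_cross by exact Hk.
assert (g1 : lor3 g g = -1) by exact (GG p Hp).
assert (g2 : lor3 g x = 0) by exact (G_pd false p Hp).
assert (g3 : lor3 g y = 0) by exact (G_pd true p Hp).
rewrite g1, g2, g3.
transitivity (s * cross g xx k + (s * s) * (xy k + g k * lor3 g xy) - lor3 g xy * g k); [rewrite Hs; ring|ring].
Qed.

Lemma t_x : pd false ft p = ip (pdv false frame1) frame1 p.
Proof.
apply (is_pd_eq_on Om HOm false ft (fun q => ip frame1 frame1 q * / 2) p).
- intros q Hq; rewrite e1_e1 by exact Hq; field.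
- exact Hp.
- apply (smooth_is_pd Om); [apply smooth_ft|exact Hp].
- apply (is_pd_half_norm Om); [exact smooth_frame1|exact Hp].
Qed.

Lemma t_y : pd true ft p = ip (pdv true frame1) frame1 p.
Proof.
apply (is_pd_eq_on Om HOm true ft (fun q => ip frame1 frame1 q * / 2) p).
- intros q Hq; rewrite e1_e1 by exact Hq; field.
- exact Hp.
- apply (smooth_is_pd Om); [apply smooth_ft|exact Hp].
- apply (is_pd_half_norm Om); [exact smooth_frame1|exact Hp].
Qed.

(** The Cauchy-Riemann relation [e1y_cross] turns a rotation coefficient of the frame into a
    derivative of [ft], half its squared length. The connection of the frame is thus given by the
    gradient of [ln ft]. *)
Lemma e1x_e2 : ip (pdv false frame1) frame2 p = - pd true ft p.
Proof.
rewrite t_y; unfold ip.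
rewrite (lor3_ext (at_ (pdv false frame1) p) (at_ frame2 p) (at_ (pdv false frame1) p) (fun k => s * cross g (at_ frame1 p) k))
  by (auto; exact (e2_cross p Hp)).
rewrite (lor3_ext (at_ (pdv true frame1) p) (at_ frame1 p)
  (fun k => s * cross g (at_ (pdv false frame1) p) k + (- lor3 g xy) * g k + 0 * 0) (at_ frame1 p))
  by (auto; intros k Hk; unfold at_ at 1; rewrite e1y_cross by exact Hk; ring).
assert (E := G_e1 p Hp); unfold ip in E; fold g in E.
transitivity (s * det3 (at_ (pdv false frame1) p) g (at_ frame1 p)); [unfold det3, lor3; ring|].
transitivity (- (s * det3 (at_ frame1 p) g (at_ (pdv false frame1) p) + (- lor3 g xy) * lor3 g (at_ frame1 p)));
  [rewrite E; unfold det3, cross, lor3; ring|unfold det3, lor3; ring].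
Qed.

Lemma e1y_e2 : ip (pdv true frame1) frame2 p = pd false ft p.
Proof.
rewrite t_x; unfold ip.
rewrite (lor3_ext (at_ (pdv true frame1) p) (at_ frame2 p)
  (fun k => s * cross g (at_ (pdv false frame1) p) k + (- lor3 g xy) * g k + 0 * 0) (fun k => s * cross g (at_ frame1 p) k)).
2: { intros k Hk; unfold at_ at 1; rewrite e1y_cross by exact Hk; ring. }
2: { exact (e2_cross p Hp). }
assert (E := G_e1 p Hp); unfold ip in E; fold g in E.
assert (g1 : lor3 g g = -1) by exact (GG p Hp).
transitivity ((s * s) * lor3 (cross g (at_ (pdv false frame1) p)) (cross g (at_ frame1 p)) - s * lor3 g xy * det3 g g (at_ frame1 p));
  [unfold det3, lor3; ring|].
rewrite Hs, lor3_cross_cross, g1, E, det3_vvu; ring.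
Qed.
End AtPoint2.

Hypothesis Ht : forall q, Om q -> 0 < ft q.

Definition log_dx (q : C) : R := pd false ft q / ft q.
Definition log_dy (q : C) : R := pd true ft q / ft q.

Lemma smooth_log_dx : smooth_on Om log_dx.
Proof. assert (S := smooth_ft); unfold log_dx; smooth; intros; apply Rgt_not_eq; now apply Ht. Qed.
Lemma smooth_log_dy : smooth_on Om log_dy.
Proof. assert (S := smooth_ft); unfold log_dy; smooth; intros; apply Rgt_not_eq; now apply Ht. Qed.

Section FrameEquations.
Variable p : C.
Hypothesis Hp : Om p.

Lemma frame_det : det3 (at_ G p) (at_ frame1 p) (at_ frame2 p) <> 0.
Proof.
intros E; assert (H := det3_sq (at_ G p) (at_ frame1 p) (at_ frame2 p)); rewrite E in H.
assert (H1 := GG p Hp); assert (H2 := G_e1 p Hp); assert (H3 := G_e2 p Hp).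
assert (H4 := e1_e1 p Hp); assert (H5 := e1_e2 p Hp); assert (H6 := e2_e2 p Hp).
unfold ip in *; rewrite H1, H2, H3, H4, H5, H6 in H.
assert (H7 := Ht p Hp); assert (0 < ft p * ft p) by now apply Rmult_lt_0_compat. lra.
Qed.

Lemma frame_expand v a b c :
  lor3 v (at_ G p) = - c -> lor3 v (at_ frame1 p) = 2 * ft p * a -> lor3 v (at_ frame2 p) = 2 * ft p * b ->
  forall k, (k < 3)%nat -> v k = a * frame1 k p + b * frame2 k p + c * G k p.
Proof.
intros H1 H2 H3.
assert (H4 := GG p Hp); assert (H5 := G_e1 p Hp); assert (H6 := G_e2 p Hp).
assert (H7 := e1_e1 p Hp); assert (H8 := e1_e2 p Hp); assert (H9 := e2_e2 p Hp).
assert (H5' := ip_sym G frame1 p); assert (H6' := ip_sym G frame2 p); assert (H8' := ip_sym frame1 frame2 p).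
unfold ip in *.
assert (E : forall z, lor3 (fun k => a * frame1 k p + b * frame2 k p + c * G k p) z =
  a * lor3 (at_ frame1 p) z + b * lor3 (at_ frame2 p) z + c * lor3 (at_ G p) z) by (intros; apply lor3_comb).
apply (lorentz_basis_eq _ _ _ _ _ frame_det); rewrite E, ?H1, ?H2, ?H3, ?H4, ?H7, ?H9.
- rewrite <- H5', <- H6', H5, H6; ring.
- rewrite <- H8', H8, H5; ring.
- rewrite H8, H6; ring.
Qed.

Lemma frame_independent a b c : (forall k, (k < 3)%nat -> a * frame1 k p + b * frame2 k p + c * G k p = 0) ->
  a = 0 /\ b = 0 /\ c = 0.
Proof.
intros H.
assert (H4 := GG p Hp); assert (H5 := G_e1 p Hp); assert (H6 := G_e2 p Hp).
assert (H7 := e1_e1 p Hp); assert (H8 := e1_e2 p Hp); assert (H9 := e2_e2 p Hp).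
assert (H5' := ip_sym G frame1 p); assert (H6' := ip_sym G frame2 p); assert (H8' := ip_sym frame1 frame2 p).
assert (Ht0 := Ht p Hp).
assert (E : forall z, a * lor3 (at_ frame1 p) z + b * lor3 (at_ frame2 p) z + c * lor3 (at_ G p) z = 0).
{ intros z; rewrite <- lor3_comb; rewrite (lor3_ext _ z (fun _ => 0) z); [unfold lor3; ring| |auto].
  intros k Hk; exact (H k Hk). }
assert (E1 := E (at_ frame1 p)); assert (E2 := E (at_ frame2 p)); assert (E3 := E (at_ G p)).
unfold ip in *; rewrite H7, <- H8', H8, H5 in E1; rewrite H8, H9, H6 in E2; rewrite <- H5', <- H6', H5, H6, H4 in E3.
repeat split; [apply Rmult_eq_reg_r with (2 * ft p)|apply Rmult_eq_reg_r with (2 * ft p)|]; lra.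
Qed.

Lemma Gx_frame k : (k < 3)%nat -> Gx k p = ((ft p - 2 * hopf1 p) * frame1 k p + 2 * hopf2 p * frame2 k p) / (2 * ft p).
Proof.
intros Hk; assert (Ht0 := Ht p Hp).
transitivity ((ft p - 2 * hopf1 p) / (2 * ft p) * frame1 k p + 2 * hopf2 p / (2 * ft p) * frame2 k p + 0 * G k p); [|field; lra].
apply (frame_expand (at_ Gx p)); [| | |exact Hk].
- assert (H := G_pd false p Hp); rewrite lor3_sym; unfold ip in H; rewrite H; ring.
- assert (H := Gx_e1 p); unfold ip in H; rewrite H; field; lra.
- assert (H := Gx_e2 p); unfold ip in H; rewrite H; field; lra.
Qed.

Lemma Gy_frame k : (k < 3)%nat -> Gy k p = (2 * hopf2 p * frame1 k p + (ft p + 2 * hopf1 p) * frame2 k p) / (2 * ft p).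
Proof.
intros Hk; assert (Ht0 := Ht p Hp).
transitivity (2 * hopf2 p / (2 * ft p) * frame1 k p + (ft p + 2 * hopf1 p) / (2 * ft p) * frame2 k p + 0 * G k p); [|field; lra].
apply (frame_expand (at_ Gy p)); [| | |exact Hk].
- assert (H := G_pd true p Hp); rewrite lor3_sym; unfold ip in H; rewrite H; ring.
- assert (H := Gy_e1 p); unfold ip in H; rewrite H; field; lra.
- assert (H := Gy_e2 p); unfold ip in H; rewrite H; field; lra.
Qed.

Let deriv_zero b F H : smooth_vec Om F -> smooth_vec Om H -> (forall q, Om q -> ip F H q = 0) ->
  lor3 (at_ (pdv b F) p) (at_ H p) = - lor3 (at_ (pdv b H) p) (at_ F p).
Proof.
intros HF HH E; assert (X := pd_ip_const Om HOm b F H 0 p HF HH E Hp).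
unfold ip in X; rewrite (lor3_sym (at_ F p)) in X; lra.
Qed.

Let e1G q : Om q -> ip frame1 G q = 0.
Proof. intros Hq; rewrite ip_sym; now apply G_e1. Qed.
Let e2G q : Om q -> ip frame2 G q = 0.
Proof. intros Hq; rewrite ip_sym; now apply G_e2. Qed.
Let e2e1 q : Om q -> ip frame2 frame1 q = 0.
Proof. intros Hq; rewrite ip_sym; now apply e1_e2. Qed.

Let e2_norm b : lor3 (at_ (pdv b frame2) p) (at_ frame2 p) = pd b ft p.
Proof.
assert (S2 := smooth_frame2).
apply (is_pd_eq_on Om HOm b (fun q => ip frame2 frame2 q * / 2) ft p).
- intros q Hq; rewrite e2_e2 by exact Hq; field.
- exact Hp.
- exact (is_pd_half_norm Om b frame2 p S2 Hp).
- apply (smooth_is_pd Om); [apply smooth_ft|exact Hp].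
Qed.

Lemma e1x_frame k : (k < 3)%nat ->
  pdv false frame1 k p = log_dx p / 2 * frame1 k p + - (log_dy p / 2) * frame2 k p + (ft p - 2 * hopf1 p) * G k p.
Proof.
assert (Ht0 := Ht p Hp).
apply (frame_expand (at_ (pdv false frame1) p)).
- rewrite (deriv_zero false frame1 G smooth_frame1 HGs e1G); f_equal; apply Gx_e1.
- transitivity (pd false ft p); [symmetry; now apply t_x|unfold log_dx; field; lra].
- transitivity (- pd true ft p); [now apply e1x_e2|unfold log_dy; field; lra].
Qed.

Lemma e1y_frame k : (k < 3)%nat ->
  pdv true frame1 k p = log_dy p / 2 * frame1 k p + log_dx p / 2 * frame2 k p + 2 * hopf2 p * G k p.
Proof.
assert (Ht0 := Ht p Hp).
apply (frame_expand (at_ (pdv true frame1) p)).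
- rewrite (deriv_zero true frame1 G smooth_frame1 HGs e1G); f_equal; apply Gy_e1.
- transitivity (pd true ft p); [symmetry; now apply t_y|unfold log_dy; field; lra].
- transitivity (pd false ft p); [now apply e1y_e2|unfold log_dx; field; lra].
Qed.

Lemma e2x_frame k : (k < 3)%nat ->
  pdv false frame2 k p = log_dy p / 2 * frame1 k p + log_dx p / 2 * frame2 k p + 2 * hopf2 p * G k p.
Proof.
assert (Ht0 := Ht p Hp).
apply (frame_expand (at_ (pdv false frame2) p)).
- rewrite (deriv_zero false frame2 G smooth_frame2 HGs e2G); f_equal; apply Gx_e2.
- rewrite (deriv_zero false frame2 frame1 smooth_frame2 smooth_frame1 e2e1).
  transitivity (- - pd true ft p); [f_equal; now apply e1x_e2|unfold log_dy; field; lra].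
- rewrite e2_norm; unfold log_dx; field; lra.
Qed.

Lemma e2y_frame k : (k < 3)%nat ->
  pdv true frame2 k p = - (log_dx p / 2) * frame1 k p + log_dy p / 2 * frame2 k p + (ft p + 2 * hopf1 p) * G k p.
Proof.
assert (Ht0 := Ht p Hp).
apply (frame_expand (at_ (pdv true frame2) p)).
- rewrite (deriv_zero true frame2 G smooth_frame2 HGs e2G); f_equal; apply Gy_e2.
- rewrite (deriv_zero true frame2 frame1 smooth_frame2 smooth_frame1 e2e1).
  transitivity (- pd false ft p); [f_equal; now apply e1y_e2|unfold log_dx; field; lra].
- rewrite e2_norm; unfold log_dy; field; lra.
Qed.
End FrameEquations.

(* Bochner formula, read off from the integrability condition of the frame. *)
Lemma gauss_equation p : Om p ->
  pd false log_dx p + pd true log_dy p = ft p - 4 * (hopf1 p * hopf1 p + hopf2 p * hopf2 p) / ft p.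
Proof.
intros Hp; assert (Ht0 := Ht p Hp).
assert (SLx := smooth_log_dx); assert (SLy := smooth_log_dy); assert (St := smooth_ft).
assert (SQ1 := smooth_hopf1); assert (SQ2 := smooth_hopf2).
(* The components of the vanishing difference of mixed derivatives of [frame1]; the one along
   [frame2] is, up to the factor [- / 2], the Gauss equation. *)
assert (H := frame_independent p Hp
  (pd true log_dx p / 2 - pd false log_dy p / 2)
  (- ((pd false log_dx p + pd true log_dy p) / 2) + ((ft p * ft p - 4 * (hopf1 p * hopf1 p + hopf2 p * hopf2 p)) / (2 * ft p)))
  (pd true ft p - 2 * pd true hopf1 p - 2 * pd false hopf2 p - log_dy p * ft p)).
destruct H as [_ [H _]].
- intros k Hk.
  assert (S1 := smooth_frame1 k Hk); assert (S2 := smooth_frame2 k Hk); assert (SG := HGs k Hk).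
  assert (D1 : is_pd true (pdv false frame1 k) p (pd true (pdv false frame1 k) p)).
  { apply (smooth_is_pd Om); [now apply smooth_pd|exact Hp]. }
  assert (D2 : is_pd false (pdv true frame1 k) p (pd false (pdv true frame1 k) p)).
  { apply (smooth_is_pd Om); [now apply smooth_pd|exact Hp]. }
  assert (E1 := is_pd_eq_on Om HOm true (pdv false frame1 k)
     (fun q => log_dx q * / 2 * frame1 k q - log_dy q * / 2 * frame2 k q + (ft q - 2 * hopf1 q) * G k q) p _ _
     ltac:(intros q Hq; rewrite (e1x_frame q Hq k Hk); field) Hp D1 ltac:(pdauto)).
  assert (E2 := is_pd_eq_on Om HOm false (pdv true frame1 k)
     (fun q => log_dy q * / 2 * frame1 k q + log_dx q * / 2 * frame2 k q + 2 * hopf2 q * G k q) p _ _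
     ltac:(intros q Hq; rewrite (e1y_frame q Hq k Hk); field) Hp D2 ltac:(pdauto)).
  assert (E := pd_comm_vec frame1 k p smooth_frame1 Hp Hk).
  unfold pdv at 1 3 in E; rewrite E1, E2 in E; clear E1 E2 D1 D2.
  assert (F1 := e1x_frame p Hp k Hk); assert (F2 := e1y_frame p Hp k Hk).
  assert (F3 := e2x_frame p Hp k Hk); assert (F4 := e2y_frame p Hp k Hk).
  assert (F5 := Gx_frame p Hp k Hk); assert (F6 := Gy_frame p Hp k Hk).
  unfold pdv in F1, F2, F3, F4, F5, F6; rewrite F1, F2, F3, F4, F5, F6 in E.
  apply Rminus_diag_eq in E; rewrite <- E; field; lra.
- unfold Rdiv in *. apply Rmult_eq_reg_l with (- / 2); [|lra].
  apply Rminus_diag_uniq; rewrite <- H; field; lra.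
Qed.

End Frame.

(** * The sign of the Jacobian in the Weierstrass data *)

Lemma ball_open (c : C) r : open (fun q => ball c r q).
Proof.
intros q Hq; apply (proj1 (ball_C _ _ _)) in Hq; destruct Hq as [H1 H2].
assert (He : 0 < Rmin (r - Rabs (fst q - fst c)) (r - Rabs (snd q - snd c)))
  by (apply Rmin_glb_lt; lra).
exists (mkposreal _ He); intros q' Hq'; apply (proj1 (ball_C _ _ _)) in Hq'; simpl in Hq'; destruct Hq' as [H3 H4].
assert (M1 := Rmin_l (r - Rabs (fst q - fst c)) (r - Rabs (snd q - snd c))).
assert (M2 := Rmin_r (r - Rabs (fst q - fst c)) (r - Rabs (snd q - snd c))).
apply ball_C; split.
- replace (fst q' - fst c) with (fst q' - fst q + (fst q - fst c)) by ring.
  eapply Rle_lt_trans; [apply Rabs_triang|lra].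
- replace (snd q' - snd c) with (snd q' - snd q + (snd q - snd c)) by ring.
  eapply Rle_lt_trans; [apply Rabs_triang|lra].
Qed.

Lemma continuous_near (f : C -> R) p e : continuous f p -> 0 < e ->
  exists d, 0 < d /\ forall q, ball p d q -> Rabs (f q - f p) < e.
Proof.
intros H He; destruct (proj1 (filterlim_locally f (f p)) H (mkposreal e He)) as [d Hd].
exists d; split; [apply cond_pos|]; intros q Hq; exact (Hd q Hq).
Qed.

Lemma harmonic_sub (Om U : C -> Prop) G : (forall p, U p -> Om p) -> harmonic_H2 Om G -> harmonic_H2 U G.
Proof.
intros HU [H1 [H2 H3]]; split; [|split].
- intros k Hk; apply (smooth_sub Om); auto.
- auto.
- auto.
Qed.

(** With zero Jacobian the Gram determinant of [G_x] and [G_y] vanishes, so the tangent vector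
    [cB G_x - cC G_y] is null, hence zero by [tangent_pos]. If [cB] vanishes too, [G_y] itself is
    zero. *)
Lemma degenerate_singular Om G p : open Om -> harmonic_H2 Om G -> Om p -> cJ G p = 0 -> singular_point Om G p.
Proof.
intros HOm HG Hp HJ; split; [exact Hp|]; intros [_ Hr]; apply Hr; clear Hr.
assert (E := cJ_sq Om G HOm HG p Hp); rewrite HJ in E.
assert (HH : in_H2 (at_ G p)) by now apply HG.
assert (gx := G_pd Om G HOm HG false p Hp); assert (gy := G_pd Om G HOm HG true p Hp).
destruct (Req_dec (cB G p) 0) as [HB|HB].
- exists 0, 1; split; [right; lra|]; intros k Hk.
  assert (Z := proj2 (tangent_pos (at_ G p) (at_ (pdv true G) p) HH gy) HB k Hk).
  change (pd true (G k) p = 0) in Z; unfold dx, dy; rewrite Z; ring.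
- exists (cB G p), (- cC G p); split; [now left|]; intros k Hk.
  set (v := fun k => cB G p * at_ (pdv false G) p k + (- cC G p) * at_ (pdv true G) p k + 0 * 0).
  assert (Hv : lor3 (at_ G p) v = 0).
  { transitivity (cB G p * ip G (pdv false G) p + (- cC G p) * ip G (pdv true G) p);
      [unfold v, ip, lor3; ring|rewrite gx, gy; ring]. }
  assert (Z := proj2 (tangent_pos (at_ G p) v HH Hv)).
  assert (Zv : v k = 0).
  { apply Z; [|exact Hk].
    transitivity (cB G p * (cA G p * cB G p - cC G p * cC G p)); [|rewrite <- E; ring].
    transitivity (cB G p * cB G p * cA G p - 2 * cB G p * cC G p * cC G p + cC G p * cC G p * cB G p); [|ring].
    unfold v, cA, cB, cC, ip; set (b := lor3 (at_ (pdv true G) p) (at_ (pdv true G) p));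
    set (c := lor3 (at_ (pdv false G) p) (at_ (pdv true G) p)).
    transitivity (b * b * lor3 (at_ (pdv false G) p) (at_ (pdv false G) p) - 2 * b * c * c + c * c * b); [|ring].
    replace (c * c * b) with (c * c * lor3 (at_ (pdv true G) p) (at_ (pdv true G) p)) by reflexivity.
    replace (2 * b * c * c) with (2 * b * c * lor3 (at_ (pdv false G) p) (at_ (pdv true G) p)) by reflexivity.
    unfold lor3; ring. }
  rewrite <- Zv; unfold v, dx, dy, at_, pdv; ring.
Qed.

(** * Vanishing to infinite order *)

Section Flat.
Variable Om : C -> Prop.
Hypothesis HOm : open Om.

Lemma pds_zero_on (U : C -> Prop) f l : open U -> (forall q, U q -> f q = 0) -> forall q, U q -> pds l f q = 0.
Proof.
intros HU Hf; induction l as [|b l IH]; simpl; [exact Hf|].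
intros q Hq; rewrite (pd_ext_on U HU b _ (fun _ => 0) IH q Hq).
apply is_pd_unique, is_pd_const.
Qed.

Lemma smooth_pds l f : smooth_on Om f -> smooth_on Om (pds l f).
Proof. intros Hf; induction l as [|b l IH]; simpl; [exact Hf|now apply smooth_pd]. Qed.

(** On each [U] every derivative vanishes with the function, and continuity of the derivatives
    carries this to the limit point [r]. *)
Lemma flat_at_closure f r : smooth_on Om f -> Om r ->
  (forall e, 0 < e -> exists U q, open U /\ U q /\ Om q /\ ball r e q /\ (forall q', U q' -> f q' = 0)) ->
  forall l, pds l f r = 0.
Proof.
intros Hf Hr H l.
destruct (Req_dec (pds l f r) 0) as [|Hne]; [assumption|exfalso].
assert (Hc := smooth_continuous Om _ r (smooth_pds l f Hf) Hr).
destruct (continuous_near _ _ _ Hc (Rabs_pos_lt _ Hne)) as [d [Hd Hnear]].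
destruct (H d Hd) as [U [q [HU [Uq [Oq [Bq Hz]]]]]].
assert (X := Hnear q Bq); rewrite (pds_zero_on U f l HU Hz q Uq) in X.
rewrite Rminus_0_l, Rabs_Ropp in X; lra.
Qed.

Definition maxdist (r q : C) : R := Rmax (Rabs (fst q - fst r)) (Rabs (snd q - snd r)).

(** Induction on the order for all flat functions at once: the bound for the two partial
    derivatives, which are flat as well, is integrated along two sides of a rectangle. *)
Lemma flat_infinite_order r m : Om r -> forall f, smooth_on Om f -> (forall l, pds l f r = 0) ->
  exists d c, 0 < d /\ 0 <= c /\ forall q, ball r d q -> Rabs (f q) <= c * maxdist r q ^ m.
Proof.
intros Hr; induction m as [|m IH]; intros f Hf H0.
- destruct (continuous_locally_bounded f r (smooth_continuous Om f r Hf Hr)) as [d [K [Hd [HK HB]]]].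
  exists d, K; repeat split; auto; intros q Hq; simpl; rewrite Rmult_1_r; now apply HB.
- destruct (IH (pd false f)) as [d1 [c1 [Hd1 [Hc1 B1]]]]; [now apply smooth_pd| |].
  { intros l; rewrite <- pds_app; apply H0. }
  destruct (IH (pd true f)) as [d2 [c2 [Hd2 [Hc2 B2]]]]; [now apply smooth_pd| |].
  { intros l; rewrite <- pds_app; apply H0. }
  destruct (HOm r Hr) as [d3 Hd3].
  set (d := Rmin d1 (Rmin d2 d3)).
  assert (L1 : d <= d1) by apply Rmin_l.
  assert (L2 : d <= d2) by (eapply Rle_trans; [apply Rmin_r|apply Rmin_l]).
  assert (L3 : d <= d3) by (eapply Rle_trans; [apply Rmin_r|apply Rmin_r]).
  exists d, (c1 + c2); split; [|split; [lra|]].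
  { repeat apply Rmin_glb_lt; auto; apply cond_pos. }
  intros [x y] Hq; destruct r as [x0 y0].
  apply (proj1 (ball_C _ _ _)) in Hq; simpl in Hq; destruct Hq as [Hx Hy].
  set (M := maxdist (x0, y0) (x, y)).
  assert (HM1 : Rabs (x - x0) <= M) by apply Rmax_l.
  assert (HM2 : Rabs (y - y0) <= M) by apply Rmax_r.
  assert (HM0 : 0 <= M) by (eapply Rle_trans; [apply Rabs_pos|exact HM1]).
  assert (Z0 : Rabs (x0 - x0) < d) by (rewrite Rminus_diag, Rabs_R0; eapply Rle_lt_trans; [apply Rabs_pos|exact Hx]).
  assert (Z1 : Rabs (y0 - y0) < d) by (rewrite Rminus_diag, Rabs_R0; eapply Rle_lt_trans; [apply Rabs_pos|exact Hx]).
  assert (Hin : forall a b, Rabs (a - x0) < d -> Rabs (b - y0) < d -> Om (a, b)).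
  { intros a b Ha Hb; apply Hd3, ball_C; simpl; lra. }
  assert (Hbt : forall a b t, Rmin a b <= t <= Rmax a b -> Rabs (t - a) <= Rabs (b - a)).
  { intros a b t; unfold Rmin, Rmax; destruct (Rle_dec a b); intros;
    unfold Rabs; repeat match goal with |- context [Rcase_abs ?z] => destruct (Rcase_abs z) end; lra. }
  assert (H00 : f (x0, y0) = 0) by exact (H0 nil).
  assert (E1 : Rabs (f (x, y0) - f (x0, y0)) <= c1 * M ^ m * Rabs (x - x0)).
  { apply (MVT_bound (fun t => f (t, y0)) (fun t => pd false f (t, y0))).
    - intros t Ht; apply (smooth_is_pd Om f false (t, y0) Hf); apply Hin; auto.
      now apply (between_near x0 x).
    - intros t Ht; eapply Rle_trans; [apply B1|].
      + apply ball_C; simpl; split; [|lra].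
        assert (X := between_near x0 x x0 d Z0 Hx t Ht); lra.
      + apply Rmult_le_compat_l; [exact Hc1|]; apply pow_incr; unfold maxdist; simpl.
        split; [eapply Rle_trans; [apply Rabs_pos|apply Rmax_l]|].
        apply Rmax_lub; [eapply Rle_trans; [now apply Hbt|exact HM1]|].
        rewrite Rminus_diag, Rabs_R0; exact HM0. }
  assert (E2 : Rabs (f (x, y) - f (x, y0)) <= c2 * M ^ m * Rabs (y - y0)).
  { apply (MVT_bound (fun t => f (x, t)) (fun t => pd true f (x, t))).
    - intros t Ht; apply (smooth_is_pd Om f true (x, t) Hf); apply Hin; auto.
      now apply (between_near y0 y).
    - intros t Ht; eapply Rle_trans; [apply B2|].
      + apply ball_C; simpl; split; [lra|].
        assert (X := between_near y0 y y0 d Z1 Hy t Ht); lra.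
      + apply Rmult_le_compat_l; [exact Hc2|]; apply pow_incr; unfold maxdist; simpl.
        split; [eapply Rle_trans; [apply Rabs_pos|apply Rmax_l]|].
        apply Rmax_lub; [exact HM1|eapply Rle_trans; [now apply Hbt|exact HM2]]. }
  replace (f (x, y)) with ((f (x, y0) - f (x0, y0)) + (f (x, y) - f (x, y0))) by (rewrite H00; ring).
  eapply Rle_trans; [apply Rabs_triang|].
  assert (HMm : 0 <= M ^ m) by now apply pow_le.
  assert (c1 * M ^ m * Rabs (x - x0) <= c1 * M ^ m * M) by (apply Rmult_le_compat_l; [now apply Rmult_le_pos|exact HM1]).
  assert (c2 * M ^ m * Rabs (y - y0) <= c2 * M ^ m * M) by (apply Rmult_le_compat_l; [now apply Rmult_le_pos|exact HM2]).
  change (M ^ S m) with (M * M ^ m).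
  apply Rle_trans with (c1 * M ^ m * M + c2 * M ^ m * M); [lra|right; ring].
Qed.
End Flat.

(** * Constancy of the sign *)

Section Sign.
Variables (Om : C -> Prop) (G : nat -> C -> R) (tau : C -> R).
Hypothesis HOm : open Om.
Hypothesis HSC : simply_connected Om.
Hypothesis HG : harmonic_H2 Om G.
Hypothesis Htau : smooth_on Om tau.
Hypothesis Hpos : forall p, Om p -> 0 < tau p.
Hypothesis Hquad : forall p, Om p ->
  (cA G p + cB G p) * tau p = tau p * tau p + 4 * (hopf1 G p * hopf1 G p + hopf2 G p * hopf2 G p).
Hypothesis Hsing : singular_set_empty_interior Om G.

Let tp := ft G 1.
Let tm := ft G (-1).
Let f q := tau q - tp q.
Let g q := tau q - tm q.

Let Stp : smooth_on Om tp := smooth_ft Om G 1 HOm HG.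
Let Stm : smooth_on Om tm := smooth_ft Om G (-1) HOm HG.
Let Sf : smooth_on Om f. Proof. unfold f; smooth. Qed.
Let Sg : smooth_on Om g. Proof. unfold g; smooth. Qed.

(** The quadratic equation for [tau], factored through its two roots [tp] and [tm]. *)
Let fg p : Om p -> f p * g p = 0.
Proof.
intros Hp; assert (H := Hquad p Hp); assert (HJ := cJ_sq Om G HOm HG p Hp).
transitivity (tau p * tau p - (cA G p + cB G p) * tau p + (cA G p + cB G p) * (cA G p + cB G p) / 4 - cJ G p * cJ G p);
  [unfold f, g, tp, tm, ft; field|].
rewrite H, HJ; unfold hopf1, hopf2; field.
Qed.

Let tp_tm p : tp p - tm p = 2 * cJ G p.
Proof. unfold tp, tm, ft; field. Qed.

Lemma regular_dense p e : Om p -> 0 < e -> exists q, ball p e q /\ Om q /\ cJ G q <> 0.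
Proof.
intros Hp He.
apply Classical_Prop.NNPP; intros Hno.
destruct (HOm p Hp) as [d Hd].
assert (Hm : 0 < Rmin d e) by (apply Rmin_glb_lt; [apply cond_pos|exact He]).
apply (Hsing (fun q => ball p (Rmin d e) q) (ball_open p (Rmin d e))) with p.
- intros q Hq; assert (Oq : Om q) by (apply Hd; now apply ball_le with (Rmin d e); [apply Rmin_l|]).
  apply degenerate_singular; auto.
  destruct (Req_dec (cJ G q) 0) as [|Hne]; [assumption|exfalso; apply Hno].
  exists q; split; [apply ball_le with (Rmin d e); [apply Rmin_r|exact Hq]|now split].
- apply (ball_center p (mkposreal _ Hm)).
Qed.

Let clo (u : C -> R) (x : C) := forall e, 0 < e -> exists y, ball x e y /\ Om y /\ u y <> 0.

(** Connectedness of [Om]. Were the closures disjoint, [g] would vanish near each point of [clo f],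
    and then [f], which differs from it by [2 * cJ], would be nonzero at the dense regular points;
    so [clo f] would be open as well as closed. *)
Lemma closure_meet : (exists p, Om p /\ f p <> 0) -> (exists q, Om q /\ g q <> 0) ->
  exists r, Om r /\ clo f r /\ clo g r.
Proof.
intros [p [Hp Hfp]] [q [Hq Hgq]].
apply Classical_Prop.NNPP; intros Hno.
assert (Hself : forall (u : C -> R) x, Om x -> u x <> 0 -> clo u x).
{ intros u x Hx Hu e He; exists x; split; [apply (ball_center x (mkposreal e He))|now split]. }
destruct (proj1 (proj2 HSC) p q Hp Hq) as [c [Hc [C0 C1]]].
apply Hno; exists q; split; [exact Hq|split; [|now apply Hself]].
rewrite <- C1; apply (path_propagation Om (clo f) c Hc); [|rewrite C0; now apply Hself|lra].
intros x Hx.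
destruct (Classical_Prop.classic (clo f x)) as [Hfx|Hfx].
- destruct (Classical_Prop.classic (clo g x)) as [Hgx|Hgx]; [exfalso; apply Hno; now exists x|].
  apply Classical_Pred_Type.not_all_ex_not in Hgx; destruct Hgx as [e He].
  apply Classical_Prop.imply_to_and in He; destruct He as [He Hn].
  exists (mkposreal _ He); intros y y' _ Hy' _ Oy' _ e' He'; simpl in Hy'.
  assert (Hb := ball_open x e y' Hy'); destruct Hb as [d Hd].
  assert (Hm : 0 < Rmin d e') by (apply Rmin_glb_lt; [apply cond_pos|exact He']).
  destruct (regular_dense y' _ Oy' Hm) as [z [Bz [Oz Jz]]].
  exists z; split; [apply ball_le with (Rmin d e'); [apply Rmin_r|exact Bz]|split; [exact Oz|]].
  intros Hfz; apply Hn; exists z; split; [|split; [exact Oz|]].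
  + apply Hd; apply ball_le with (Rmin d e'); [apply Rmin_l|exact Bz].
  + intros Hgz; apply Jz; assert (T := tp_tm z); unfold f in Hfz; unfold g in Hgz; lra.
- apply Classical_Pred_Type.not_all_ex_not in Hfx; destruct Hfx as [e He].
  apply Classical_Prop.imply_to_and in He; destruct He as [He Hn].
  exists (mkposreal _ He); intros y y' Hy _ _ _ Hfy; exfalso; apply Hn; simpl in Hy.
  destruct (ball_open x e y Hy) as [d Hd].
  destruct (Hfy d (cond_pos d)) as [z [Bz [Oz Fz]]]; exists z; split; [now apply Hd|now split].
Qed.

Let nonzero_open (u : C -> R) : smooth_on Om u -> open (fun q => Om q /\ u q <> 0).
Proof.
intros Hu q [Oq Hq].
destruct (continuous_near u q _ (smooth_continuous Om u q Hu Oq) (Rabs_pos_lt _ Hq)) as [d [Hd Hn]].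
assert (L := HOm q Oq); destruct L as [d' Hd'].
assert (Hm : 0 < Rmin d d') by (apply Rmin_glb_lt; [exact Hd|apply cond_pos]).
exists (mkposreal _ Hm); intros z Hz; simpl in Hz; split.
- apply Hd'; apply ball_le with (Rmin d d'); [apply Rmin_r|exact Hz].
- intros E; assert (X := Hn z (ball_le _ _ _ (Rmin_l d d') _ Hz)).
  rewrite E, Rminus_0_l, Rabs_Ropp in X; lra.
Qed.

(* Here [f] and [g], the distances of [tau] to the two roots, vanish to infinite order at [r], hence so does
   [w = ln (tp / tm)]; since [w_xx + w_yy = 4 cJ] is a bounded positive multiple of [w], [w] vanishes near [r]. *)
Lemma no_common_closure r : Om r -> clo f r -> clo g r -> False.
Proof.
intros Hr Hfr Hgr.
(* The flatness of each function comes from the other one: [r] is a limit of points of the open set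
   where [g] is nonzero, and [f] vanishes on that set. *)
assert (Ff : forall l, pds l f r = 0).
{ apply (flat_at_closure Om f r Sf Hr); intros e He.
  destruct (Hgr e He) as [q [Bq [Oq Hq]]].
  exists (fun q => Om q /\ g q <> 0), q; split; [now apply nonzero_open|split; [now split|split; [exact Oq|split; [exact Bq|]]]].
  intros z [Oz Hz]; destruct (Rmult_integral _ _ (fg z Oz)); [assumption|contradiction]. }
assert (Fg : forall l, pds l g r = 0).
{ apply (flat_at_closure Om g r Sg Hr); intros e He.
  destruct (Hfr e He) as [q [Bq [Oq Hq]]].
  exists (fun q => Om q /\ f q <> 0), q; split; [now apply nonzero_open|split; [now split|split; [exact Oq|split; [exact Bq|]]]].
  intros z [Oz Hz]; destruct (Rmult_integral _ _ (fg z Oz)); [contradiction|assumption]. }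
assert (Hf0 : tp r = tau r) by (assert (X := Ff nil); simpl in X; unfold f in X; lra).
assert (Hg0 : tm r = tau r) by (assert (X := Fg nil); simpl in X; unfold g in X; lra).
set (t0 := tau r); assert (Ht0 : 0 < t0) by now apply Hpos.
destruct (continuous_near tp r (t0 / 2) (smooth_continuous Om tp r Stp Hr)) as [d1 [Hd1 N1]]; [lra|].
destruct (continuous_near tm r (t0 / 2) (smooth_continuous Om tm r Stm Hr)) as [d2 [Hd2 N2]]; [lra|].
destruct (HOm r Hr) as [d3 Hd3].
set (R1 := Rmin d1 (Rmin d2 d3)).
assert (L1 : R1 <= d1) by apply Rmin_l.
assert (L2 : R1 <= d2) by (eapply Rle_trans; [apply Rmin_r|apply Rmin_l]).
assert (L3 : R1 <= d3) by (eapply Rle_trans; [apply Rmin_r|apply Rmin_r]).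
assert (HR1 : 0 < R1) by (repeat apply Rmin_glb_lt; auto; apply cond_pos).
set (U := fun q : C => ball r R1 q).
assert (HU : open U) by apply ball_open.
assert (HUO : forall q, U q -> Om q) by (intros q Hq; apply Hd3; now apply ball_le with R1).
assert (Hb1 : forall q, U q -> t0 / 2 < tp q < 2 * t0).
{ intros q Hq; assert (X := N1 q (ball_le _ _ _ L1 _ Hq)); rewrite Hf0 in X; fold t0 in X.
  apply Rabs_def2 in X; lra. }
assert (Hb2 : forall q, U q -> t0 / 2 < tm q < 2 * t0).
{ intros q Hq; assert (X := N2 q (ball_le _ _ _ L2 _ Hq)); rewrite Hg0 in X; fold t0 in X.
  apply Rabs_def2 in X; lra. }
assert (HGU := harmonic_sub Om U G HUO HG).
set (w := fun q => ln (tp q) - ln (tm q)).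
assert (Stp' := smooth_sub Om U tp HUO Stp).
assert (Stm' := smooth_sub Om U tm HUO Stm).
assert (Hp1 : forall q, U q -> 0 < ft G 1 q) by (intros q Hq; assert (X := Hb1 q Hq); unfold tp in X; lra).
assert (Hp2 : forall q, U q -> 0 < ft G (-1) q) by (intros q Hq; assert (X := Hb2 q Hq); unfold tm in X; lra).
assert (Sw : smooth_on U w).
{ unfold w; apply smooth_minus; [exact HU|apply smooth_ln; auto|apply smooth_ln; auto]. }
assert (Hln : forall b (u : C -> R) q, smooth_on U u -> U q -> 0 < u q -> is_pd b (fun q => ln (u q)) q (pd b u q / u q)).
{ intros b u q Hu Hq Hpu; eapply is_pd_val; [apply is_pd_ln; [exact Hpu|now apply (smooth_is_pd U)]|].
  unfold Rdiv; ring. }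
assert (Dw : forall b q, U q -> pd b w q = pd b tp q / tp q - pd b tm q / tm q).
{ intros b q Hq; apply is_pd_unique; unfold w; apply is_pd_minus; apply Hln; auto. }
(* The product of the two roots is [4 |Q|^2], so the right side of the Bochner formula is the
   difference of the roots. *)
assert (Gau : forall s q, s * s = 1 -> (forall q, U q -> 0 < ft G s q) -> U q ->
  pd false (log_dx G s) q + pd true (log_dy G s) q = 2 * s * cJ G q).
{ intros s q Hs Hps Hq; rewrite (gauss_equation U G s HU HGU Hs Hps q Hq).
  assert (X := ft_quadratic U G s HU HGU Hs q Hq); assert (Y := Hps q Hq).
  apply Rmult_eq_reg_r with (ft G s q); [|lra].
  transitivity (ft G s q * ft G s q - 4 * (hopf1 G q * hopf1 G q + hopf2 G q * hopf2 G q)); [field; lra|].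
  replace (4 * (hopf1 G q * hopf1 G q + hopf2 G q * hopf2 G q)) with ((cA G q + cB G q) * ft G s q - ft G s q * ft G s q) by lra.
  unfold ft; field. }
assert (Lw : forall q, U q -> pd false (pd false w) q + pd true (pd true w) q = 4 * cJ G q).
{ intros q Hq.
  rewrite (pd_ext_on U HU false (pd false w) (fun q => log_dx G 1 q - log_dx G (-1) q) (Dw false) q Hq).
  rewrite (pd_ext_on U HU true (pd true w) (fun q => log_dy G 1 q - log_dy G (-1) q) (Dw true) q Hq).
  assert (S1 := smooth_log_dx U G 1 HU HGU Hp1); assert (S2 := smooth_log_dx U G (-1) HU HGU Hp2).
  assert (S3 := smooth_log_dy U G 1 HU HGU Hp1); assert (S4 := smooth_log_dy U G (-1) HU HGU Hp2).
  rewrite (is_pd_unique _ _ _ _ (is_pd_minus _ _ _ _ _ _ (smooth_is_pd U _ false q S1 Hq) (smooth_is_pd U _ false q S2 Hq))).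
  rewrite (is_pd_unique _ _ _ _ (is_pd_minus _ _ _ _ _ _ (smooth_is_pd U _ true q S3 Hq) (smooth_is_pd U _ true q S4 Hq))).
  assert (G1 := Gau 1 q ltac:(ring) Hp1 Hq); assert (G2 := Gau (-1) q ltac:(ring) Hp2 Hq); lra. }
(* The mean value theorem for [ln] compares [w] with [tp - tm = 2 * cJ]; the bound
   [2 * xi <= 4 * t0] is the constant handed to unique continuation. *)
assert (MV : forall q, U q -> exists xi, t0 / 2 <= xi <= 2 * t0 /\ 2 * cJ G q = xi * w q).
{ intros q Hq; assert (X1 := Hb1 q Hq); assert (X2 := Hb2 q Hq).
  destruct (MVT_gen ln (tm q) (tp q) (fun x => / x)) as [xi [Hxi E]].
  - intros x Hx; apply is_derive_ln; revert Hx; unfold Rmin, Rmax; destruct (Rle_dec (tm q) (tp q)); lra.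
  - intros x Hx; apply continuity_pt_filterlim; apply continuous_ln.
    revert Hx; unfold Rmin, Rmax; destruct (Rle_dec (tm q) (tp q)); lra.
  - assert (Hx : t0 / 2 <= xi <= 2 * t0) by (revert Hxi; unfold Rmin, Rmax; destruct (Rle_dec (tm q) (tp q)); lra).
    exists xi; split; [exact Hx|]; unfold w; rewrite E, tp_tm; field; lra. }
destruct (strong_unique_continuation U r R1 HU HR1 (fun q Hq => Hq) w (4 * t0) Sw) as [d [Hd HZ]].
- lra.
- intros q Hq; rewrite Lw by exact Hq; destruct (MV q Hq) as [xi [Hxi E]].
  replace (4 * cJ G q) with (2 * (2 * cJ G q)) by ring; rewrite E.
  replace (w q * (2 * (xi * w q))) with (2 * xi * (w q * w q)) by ring.
  apply Rmult_le_pos; [lra|apply Rle_0_sqr].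
- intros q Hq; rewrite Lw by exact Hq; destruct (MV q Hq) as [xi [Hxi E]].
  replace (4 * cJ G q) with (2 * (2 * cJ G q)) by ring; rewrite E.
  replace (2 * (xi * w q)) with (2 * xi * w q) by ring; rewrite Rabs_mult, (Rabs_pos_eq (2 * xi)) by lra.
  apply Rmult_le_compat_r; [apply Rabs_pos|lra].
- intros m.
  destruct (flat_infinite_order Om HOm r m Hr f Sf Ff) as [a1 [c1 [Ha1 [Hc1 B1]]]].
  destruct (flat_infinite_order Om HOm r m Hr g Sg Fg) as [a2 [c2 [Ha2 [Hc2 B2]]]].
  exists (Rmin R1 (Rmin a1 a2)), ((c1 + c2) * (2 / t0)); split; [apply Rmin_glb_lt; [exact HR1|now apply Rmin_glb_lt]|].
  intros q Hq; fold (maxdist r q).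
  assert (Uq : U q) by (apply ball_le with (2 := Hq); apply Rmin_l).
  assert (Bq1 : ball r a1 q) by (apply ball_le with (2 := Hq); eapply Rle_trans; [apply Rmin_r|apply Rmin_l]).
  assert (Bq2 : ball r a2 q) by (apply ball_le with (2 := Hq); eapply Rle_trans; [apply Rmin_r|apply Rmin_r]).
  specialize (B1 q Bq1); specialize (B2 q Bq2).
  destruct (MV q Uq) as [xi [Hxi E]].
  assert (EJ : Rabs (2 * cJ G q) <= (c1 + c2) * maxdist r q ^ m).
  { rewrite <- tp_tm; replace (tp q - tm q) with (g q + - f q) by (unfold f, g; ring).
    eapply Rle_trans; [apply Rabs_triang|]; rewrite Rabs_Ropp; lra. }
  rewrite E, Rabs_mult, (Rabs_pos_eq xi) in EJ by lra.
  assert (Hw : t0 / 2 * Rabs (w q) <= (c1 + c2) * maxdist r q ^ m).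
  { eapply Rle_trans; [|exact EJ]; apply Rmult_le_compat_r; [apply Rabs_pos|lra]. }
  apply Rmult_le_reg_l with (t0 / 2); [lra|]; eapply Rle_trans; [exact Hw|right; field; lra].
- set (e := Rmin d R1); assert (He : 0 < e) by now apply Rmin_glb_lt.
  (* Centre of a square inside the upper half of [ball r e], where [w] is known to vanish. *)
  set (c := (fst r, snd r + e / 2) : C).
  apply (Hsing (fun q => ball c (e / 4) q) (ball_open c (e / 4))) with c.
  + intros q Hq; apply (proj1 (ball_C _ _ _)) in Hq; simpl in Hq; destruct Hq as [H1 H2].
    assert (Bq : ball r e q).
    { apply ball_C; split; [lra|]; apply Rabs_def2 in H2; apply Rabs_def1; lra. }
    assert (Uq : U q) by (apply ball_le with (2 := Bq); apply Rmin_r).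
    apply degenerate_singular; auto.
    destruct (MV q Uq) as [xi [Hxi E]].
    rewrite (HZ q) in E; [lra|apply ball_le with (2 := Bq); apply Rmin_l|].
    apply Rabs_def2 in H2; lra.
  + assert (He4 : 0 < e / 4) by lra; apply (ball_center c (mkposreal _ He4)).
Qed.

Theorem sign_constant : exists s, s * s = 1 /\ forall p, Om p -> tau p = ft G s p.
Proof.
destruct (Classical_Prop.classic (exists p, Om p /\ f p <> 0)) as [H1|H1].
- destruct (Classical_Prop.classic (exists p, Om p /\ g p <> 0)) as [H2|H2].
  + exfalso; destruct (closure_meet H1 H2) as [r [Hr [Hf Hg]]]; now apply (no_common_closure r).
  + exists (-1); split; [ring|]; intros p Hp.
    destruct (Req_dec (g p) 0) as [E|E]; [unfold g, tm in E; lra|exfalso; apply H2; now exists p].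
- exists 1; split; [ring|]; intros p Hp.
  destruct (Req_dec (f p) 0) as [E|E]; [unfold f, tp in E; lra|exfalso; apply H1; now exists p].
Qed.
End Sign.

(** * The linearized system *)

Definition vec4 (x0 x1 x2 x3 : R) (i : nat) : R :=
  match i with 0%nat => x0 | 1%nat => x1 | 2%nat => x2 | _ => x3 end.

Section LinearSystem.
Variables (Om : C -> Prop) (G : nat -> C -> R) (s : R).
Hypothesis HOm : open Om.
Hypothesis HG : harmonic_H2 Om G.
Hypothesis Hs : s * s = 1.
Hypothesis Ht : forall q, Om q -> 0 < ft G s q.

Notation t := (ft G s).
Notation Lx := (log_dx G s).
Notation Ly := (log_dy G s).
Notation Q1 := (hopf1 G).
Notation Q2 := (hopf2 G).

Let HGs : smooth_vec Om G.
Proof. destruct HG as [H _]; exact H. Qed.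
Let St : smooth_on Om t := smooth_ft Om G s HOm HG.
Let SQ1 : smooth_on Om Q1 := smooth_hopf1 Om G HOm HG.
Let SQ2 : smooth_on Om Q2 := smooth_hopf2 Om G HOm HG.
Let SLx : smooth_on Om Lx := smooth_log_dx Om G s HOm HG Ht.
Let SLy : smooth_on Om Ly := smooth_log_dy Om G s HOm HG Ht.

Lemma pd_t b p : Om p -> pd b t p = (if b then Ly p else Lx p) * t p.
Proof. intros Hp; assert (H := Ht p Hp); destruct b; unfold log_dx, log_dy; field; lra. Qed.

Lemma Lx_Ly p : Om p -> pd true Lx p = pd false Ly p.
Proof.
intros Hp; assert (H := Ht p Hp).
assert (D1 : is_pd true Lx p (pd true (pd false t) p * / t p + pd false t p * (- / (t p * t p) * pd true t p))).
{ unfold log_dx; eapply is_pd_val; [pdauto; lra|reflexivity]. }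
assert (D2 : is_pd false Ly p (pd false (pd true t) p * / t p + pd true t p * (- / (t p * t p) * pd false t p))).
{ unfold log_dy; eapply is_pd_val; [pdauto; lra|reflexivity]. }
rewrite (is_pd_unique _ _ _ _ D1), (is_pd_unique _ _ _ _ D2), (pd_comm Om HOm t p St Hp).
field; lra.
Qed.

Lemma pd_cc b p : Om p ->
  pd b (cA G) p = 2 * ip (pdv b (pdv false G)) (pdv false G) p /\
  pd b (cB G) p = 2 * ip (pdv b (pdv true G)) (pdv true G) p /\
  pd b (cC G) p = ip (pdv b (pdv false G)) (pdv true G) p + ip (pdv b (pdv true G)) (pdv false G) p.
Proof.
intros Hp; assert (S1 := smooth_pdv Om false G HGs); assert (S2 := smooth_pdv Om true G HGs).
unfold cA, cB, cC; rewrite !(pd_ip Om) by assumption.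
rewrite (ip_sym (pdv false G) (pdv b (pdv false G))), (ip_sym (pdv true G) (pdv b (pdv true G))),
  (ip_sym (pdv false G) (pdv b (pdv true G))); repeat split; ring.
Qed.

Lemma pd_Q b p : Om p ->
  pd b Q1 p = (pd b (cB G) p - pd b (cA G) p) / 4 /\ pd b Q2 p = pd b (cC G) p / 2.
Proof.
intros Hp.
assert (S1 := smooth_cA Om G HOm HG); assert (S2 := smooth_cB Om G HOm HG); assert (S3 := smooth_cC Om G HOm HG).
split; apply is_pd_unique; unfold hopf1, hopf2; (eapply is_pd_val; [pdauto; lra|cbv beta; field]).
Qed.

(** Cauchy-Riemann equations of the Hopf differential. Once harmonicity has replaced [G_yy], the
    normal term drops out because [G_x] and [G_y] are tangent. *)
Lemma Q_holomorphic p : Om p -> pd false Q1 p = pd true Q2 p /\ pd true Q1 p = - pd false Q2 p.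
Proof.
intros Hp.
destruct (pd_Q false p Hp) as [E1 E2]; destruct (pd_Q true p Hp) as [E3 E4].
rewrite E1, E2, E3, E4; clear E1 E2 E3 E4.
destruct (pd_cc false p Hp) as [E1 [E2 E3]]; destruct (pd_cc true p Hp) as [E4 [E5 E6]].
rewrite E1, E2, E3, E4, E5, E6; clear E1 E2 E3 E4 E5 E6.
set (x := at_ (pdv false G) p); set (y := at_ (pdv true G) p).
set (xx := at_ (pdv false (pdv false G)) p); set (xy := at_ (pdv false (pdv true G)) p).
assert (gx : lor3 (at_ G p) x = 0) by exact (G_pd Om G HOm HG false p Hp).
assert (gy : lor3 (at_ G p) y = 0) by exact (G_pd Om G HOm HG true p Hp).
assert (Eyx : forall v, lor3 (at_ (pdv true (pdv false G)) p) v = lor3 xy v).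
{ intros v; apply lor3_ext; [|auto]; intros k Hk.
  exact (pd_comm_vec Om HOm G k p HGs Hp Hk). }
assert (Eyy : forall v, lor3 (at_ (pdv true (pdv true G)) p) v = (cA G p + cB G p) * lor3 (at_ G p) v - lor3 xx v).
{ intros v; transitivity (lor3 (fun k => (cA G p + cB G p) * at_ G p k + (-1) * xx k + 0 * 0) v).
  - apply lor3_ext; [|auto]; intros k Hk; unfold at_, xx.
    rewrite (harmonic_eq Om G HOm HG p Hp k Hk); unfold at_; ring.
  - unfold lor3; ring. }
unfold ip; fold x y xx xy; rewrite !Eyx, !Eyy, gx, gy; split; field.
Qed.

#[local] Opaque log_dx log_dy hopf1 hopf2 ft frame1 frame2.

(* The unknowns are numbered in the order (a, b, W, h); [sysA] is the system in the x direction, [sysB] in the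
   y direction. *)
Definition sysA (i j : nat) : C -> R :=
  match i, j with
  | 0%nat, 0%nat => fun p => Lx p * / 2
  | 0%nat, 1%nat => fun p => - (Ly p * / 2)
  | 0%nat, 2%nat => fun p => t p + 2 * Q1 p
  | 1%nat, 0%nat => fun p => Ly p * / 2
  | 1%nat, 1%nat => fun p => Lx p * / 2
  | 1%nat, 2%nat => fun p => - (2 * Q2 p)
  | 2%nat, 0%nat => fun p => / 2 + Q1 p / t p
  | 2%nat, 1%nat => fun p => - (Q2 p / t p)
  | 3%nat, 0%nat => fun p => 1
  | _, _ => fun p => 0
  end.

Definition sysB (i j : nat) : C -> R :=
  match i, j with
  | 0%nat, 0%nat => fun p => Ly p * / 2
  | 0%nat, 1%nat => fun p => Lx p * / 2
  | 0%nat, 2%nat => fun p => - (2 * Q2 p)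
  | 1%nat, 0%nat => fun p => - (Lx p * / 2)
  | 1%nat, 1%nat => fun p => Ly p * / 2
  | 1%nat, 2%nat => fun p => t p - 2 * Q1 p
  | 2%nat, 0%nat => fun p => - (Q2 p / t p)
  | 2%nat, 1%nat => fun p => / 2 - Q1 p / t p
  | 3%nat, 1%nat => fun p => 1
  | _, _ => fun p => 0
  end.

Let t_nz q : Om q -> t q <> 0.
Proof. intros Hq; apply Rgt_not_eq; now apply Ht. Qed.

Lemma smooth_sysA i j : smooth_on Om (sysA i j).
Proof.
assert (SD1 : smooth_on Om (fun p => Q1 p / t p)) by (apply smooth_div; auto).
assert (SD2 : smooth_on Om (fun p => Q2 p / t p)) by (apply smooth_div; auto).
destruct i as [|[|[|[|i]]]]; destruct j as [|[|[|[|j]]]]; unfold sysA; smooth; intros; lra.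
Qed.

Lemma smooth_sysB i j : smooth_on Om (sysB i j).
Proof.
assert (SD1 : smooth_on Om (fun p => Q1 p / t p)) by (apply smooth_div; auto).
assert (SD2 : smooth_on Om (fun p => Q2 p / t p)) by (apply smooth_div; auto).
destruct i as [|[|[|[|i]]]]; destruct j as [|[|[|[|j]]]]; unfold sysB; smooth; intros; lra.
Qed.

(** Sixteen scalar identities. They all follow from the symmetry of the second derivatives of [ln t]
    ([HE1]), the Bochner formula ([HE2]) and the Cauchy-Riemann equations ([HE3], [HE4]). *)
Lemma sys_flat p i k : Om p -> (i < 4)%nat -> (k < 4)%nat ->
  pd true (sysA i k) p + vsum 4 (fun j => sysA i j p * sysB j k p) =
  pd false (sysB i k) p + vsum 4 (fun j => sysB i j p * sysA j k p).
Proof.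
intros Hp Hi Hk; assert (Htp := Ht p Hp); assert (Hnz := t_nz p Hp).
assert (HE1 := Lx_Ly p Hp).
assert (HE2 : pd false Lx p = t p - 4 * (Q1 p * Q1 p + Q2 p * Q2 p) / t p - pd true Ly p)
  by (assert (X := gauss_equation Om G s HOm HG Hs Ht p Hp); lra).
destruct (Q_holomorphic p Hp) as [HE3 HE4].
assert (HE5 : pd false t p = Lx p * t p) by exact (pd_t false p Hp).
assert (HE6 : pd true t p = Ly p * t p) by exact (pd_t true p Hp).
assert (DA : exists l, is_pd true (sysA i k) p l /\ exists m, is_pd false (sysB i k) p m /\
  l + vsum 4 (fun j => sysA i j p * sysB j k p) = m + vsum 4 (fun j => sysB i j p * sysA j k p)).
{ destruct i as [|[|[|[|i]]]]; [| | | |lia]; (destruct k as [|[|[|[|k]]]]; [| | | |lia]);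
  unfold sysA at 1, sysB at 1;
  (eexists; split; [pdauto; exact Hnz|eexists; split; [pdauto; exact Hnz|]]);
  cbn [vsum]; cbv [sysA sysB];
  rewrite ?HE1, ?HE2, ?HE3, ?HE4, ?HE5, ?HE6; field; exact Hnz. }
destruct DA as [l [D1 [m [D2 E]]]].
now rewrite (is_pd_unique _ _ _ _ D1), (is_pd_unique _ _ _ _ D2).
Qed.

(* The system of the paper for h, made linear by the auxiliary unknowns a = h_x, b = h_y
   and W = 1/u = sqrt ((tau + 2 |h_z|^2) / tau). *)
Definition solves (a b W h : C -> R) (p : C) : Prop :=
  (is_pd false a p (t p * W p + (Lx p * a p - Ly p * b p) / 2 + 2 * Q1 p * W p) /\
   is_pd true a p ((Ly p * a p + Lx p * b p) / 2 - 2 * Q2 p * W p)) /\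
  (is_pd false b p ((Ly p * a p + Lx p * b p) / 2 - 2 * Q2 p * W p) /\
   is_pd true b p (t p * W p - (Lx p * a p - Ly p * b p) / 2 - 2 * Q1 p * W p)) /\
  (is_pd false W p (a p / 2 + (Q1 p * a p - Q2 p * b p) / t p) /\
   is_pd true W p (b p / 2 - (Q2 p * a p + Q1 p * b p) / t p)) /\
  (is_pd false h p (a p) /\ is_pd true h p (b p)).

Lemma solves_sol_at a b W h p : Om p -> solves a b W h p ->
  sol_at 4 sysA sysB (fun q => vec4 (a q) (b q) (W q) (h q)) p.
Proof.
intros Hp [[A1 A2] [[B1 B2] [[W1 W2] [H1 H2]]]] i Hi; assert (Hnz := t_nz p Hp).
destruct i as [|[|[|[|i]]]]; [| | | |lia]; simpl;
(split; (eapply is_pd_val; [eassumption|field; exact Hnz])).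
Qed.

Lemma sol_at_solves X p : Om p -> sol_at 4 sysA sysB X p ->
  solves (fun q => X q 0%nat) (fun q => X q 1%nat) (fun q => X q 2%nat) (fun q => X q 3%nat) p.
Proof.
intros Hp H; assert (Hnz := t_nz p Hp).
destruct (H 0%nat ltac:(lia)) as [A1 A2]; destruct (H 1%nat ltac:(lia)) as [B1 B2].
destruct (H 2%nat ltac:(lia)) as [W1 W2]; destruct (H 3%nat ltac:(lia)) as [H1 H2].
simpl in *.
refine (conj (conj _ _) (conj (conj _ _) (conj (conj _ _) (conj _ _))));
(eapply is_pd_val; [eassumption|field; exact Hnz]).
Qed.

(** The unknown [h] does not occur on the right-hand sides, so [h'] can be shifted to agree with [h]
    at [z0] and remain a solution. *)
Lemma solves_unique z0 a b W h a' b' W' h' : simply_connected Om -> Om z0 ->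
  (forall p, Om p -> solves a b W h p) -> (forall p, Om p -> solves a' b' W' h' p) ->
  a z0 = a' z0 -> b z0 = b' z0 -> W z0 = W' z0 ->
  forall p, Om p -> a p = a' p /\ b p = b' p /\ W p = W' p /\ h' p = h p + (h' z0 - h z0).
Proof.
intros HSC Hz0 H H' Ea Eb EW p Hp.
assert (U := flat_unique_solution 4 Om sysA sysB HOm (fun i j _ _ => smooth_sysA i j)
  (fun i j _ _ => smooth_sysB i j) sys_flat z0
  (fun q => vec4 (a q) (b q) (W q) (h q)) (fun q => vec4 (a' q) (b' q) (W' q) (h' q - (h' z0 - h z0)))
  HSC Hz0).
assert (E : eqn 4 (vec4 (a p) (b p) (W p) (h p)) (vec4 (a' p) (b' p) (W' p) (h' p - (h' z0 - h z0)))).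
{ apply U; auto.
  - intros q Hq; apply solves_sol_at; auto.
  - intros q Hq; apply (solves_sol_at a' b' W' (fun q => h' q - (h' z0 - h z0))); [exact Hq|].
    destruct (H' q Hq) as [S1 [S2 [S3 [S4 S5]]]]; refine (conj S1 (conj S2 (conj S3 (conj _ _)))).
    + eapply is_pd_val; [apply is_pd_minus; [exact S4|apply is_pd_const]|ring].
    + eapply is_pd_val; [apply is_pd_minus; [exact S5|apply is_pd_const]|ring].
  - intros i Hi; destruct i as [|[|[|[|i]]]]; simpl; auto; [ring|lia]. }
assert (E0 := E 0%nat ltac:(lia)); assert (E1 := E 1%nat ltac:(lia)).
assert (E2 := E 2%nat ltac:(lia)); assert (E3 := E 3%nat ltac:(lia)); simpl in *.
repeat split; auto; lra.
Qed.

(** Uniqueness for the flat system with one unknown and zero coefficients, compared with the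
    constant solution. *)
Lemma zero_gradient_constant f z0 : simply_connected Om -> Om z0 ->
  (forall b p, Om p -> is_pd b f p 0) -> forall p, Om p -> f p = f z0.
Proof.
intros HSC Hz0 Hf p Hp.
apply (flat_unique_solution 1 Om (fun _ _ _ => 0) (fun _ _ _ => 0) HOm
  (fun _ _ _ _ => smooth_const Om HOm 0) (fun _ _ _ _ => smooth_const Om HOm 0)
  (fun p i k _ _ _ => eq_refl) z0 (fun q _ => f q) (fun _ _ => f z0) HSC Hz0) with (i := 0%nat); auto.
- intros q Hq i Hi; simpl; split; (eapply is_pd_val; [apply Hf; exact Hq|ring]).
- intros q Hq i Hi; simpl; split; (eapply is_pd_val; [apply is_pd_const|ring]).
- intros i Hi; reflexivity.
Qed.

Lemma first_integral a b W h z0 : simply_connected Om -> Om z0 ->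
  (forall p, Om p -> solves a b W h p) ->
  W z0 * W z0 = 1 + (a z0 * a z0 + b z0 * b z0) / (2 * t z0) -> 0 < W z0 ->
  forall p, Om p -> W p * W p = 1 + (a p * a p + b p * b p) / (2 * t p) /\ 0 < W p.
Proof.
intros HSC Hz0 H E0 HW0.
assert (E : forall p, Om p -> W p * W p = 1 + (a p * a p + b p * b p) / (2 * t p)).
{ intros p Hp.
  set (f := fun p => W p * W p - (a p * a p + b p * b p) * / (2 * t p)).
  assert (Hc : f p = f z0).
  { apply zero_gradient_constant; auto; intros c q Hq; unfold f.
    assert (Hnz := t_nz q Hq); assert (Hpt := pd_t c q Hq).
    destruct (H q Hq) as [[A1 A2] [[B1 B2] [[W1 W2] _]]].
    assert (H2t : 2 * t q <> 0) by (assert (X := Ht q Hq); lra).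
    destruct c; (eapply is_pd_val; [pdauto; exact H2t|]); cbv beta; rewrite Hpt; field; exact Hnz. }
  unfold f, Rdiv in *; lra. }
assert (Hge : forall p, Om p -> 1 <= W p * W p).
{ intros p Hp; rewrite (E p Hp); assert (X := Ht p Hp).
  assert (0 <= (a p * a p + b p * b p) / (2 * t p)); [|lra].
  apply Rmult_le_pos; [assert (A := Rle_0_sqr (a p)); assert (B := Rle_0_sqr (b p)); unfold Rsqr in *; lra|].
  left; apply Rinv_0_lt_compat; lra. }
intros p Hp; split; [now apply E|].
destruct (proj1 (proj2 HSC) z0 p Hz0 Hp) as [c [Hc [C0 C1]]].
rewrite <- C1; apply (path_propagation Om (fun q => 0 < W q) c Hc); [|now rewrite C0|lra].
intros q Hq.
assert (HWc : continuous W q).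
{ assert (SS := solution_continuous 4 Om sysA sysB HOm (fun i j _ _ => smooth_sysA i j)
    (fun i j _ _ => smooth_sysB i j) sys_flat (fun q => vec4 (a q) (b q) (W q) (h q)) q 2
    (fun q Hq => solves_sol_at a b W h q Hq (H q Hq)) Hq ltac:(lia)); exact SS. }
(* Since [1 <= W * W], a positive value is at least 1, and oscillation below [1 / 2] about [q] keeps
   the other value within 1 of it. *)
destruct (continuous_near W q (1 / 2) HWc) as [d [Hd Hn]]; [lra|].
exists (mkposreal _ Hd); intros x x' Hx Hx' Ox Ox' Hpx; simpl in Hx, Hx'.
assert (N1 := Hn x Hx); assert (N2 := Hn x' Hx'); assert (G1 := Hge x Ox); assert (G2 := Hge x' Ox').
apply Rabs_def2 in N1; apply Rabs_def2 in N2.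
assert (1 <= W x) by nra.
destruct (Rlt_le_dec 0 (W x')) as [|Hneg]; [assumption|]; lra.
Qed.

Lemma solution_exists z0 a0 b0 : simply_connected Om -> Om z0 -> exists a b W h,
  (forall p, Om p -> solves a b W h p) /\
  smooth_on Om a /\ smooth_on Om b /\ smooth_on Om W /\ smooth_on Om h /\
  a z0 = a0 /\ b z0 = b0 /\ W z0 = sqrt (1 + (a0 * a0 + b0 * b0) / (2 * t z0)) /\
  (forall p, Om p -> W p * W p = 1 + (a p * a p + b p * b p) / (2 * t p) /\ 0 < W p).
Proof.
intros HSC Hz0.
set (W0 := sqrt (1 + (a0 * a0 + b0 * b0) / (2 * t z0))).
(* The value 0 given to [h] at [z0] normalises the vertical translation. *)
destruct (flat_global_solution 4 Om sysA sysB HOm (fun i j _ _ => smooth_sysA i j)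
    (fun i j _ _ => smooth_sysB i j) sys_flat z0 (vec4 a0 b0 W0 0) HSC Hz0) as [X [X0 HX]].
assert (HS : forall p, Om p -> solves (fun q => X q 0%nat) (fun q => X q 1%nat) (fun q => X q 2%nat) (fun q => X q 3%nat) p).
{ intros p Hp; apply sol_at_solves; auto. }
assert (SM : forall i, (i < 4)%nat -> smooth_on Om (fun q => X q i)).
{ apply (solution_smooth 4 Om sysA sysB HOm (fun i j _ _ => smooth_sysA i j)
    (fun i j _ _ => smooth_sysB i j) sys_flat X HX). }
assert (E0 := X0 0%nat ltac:(lia)); assert (E1 := X0 1%nat ltac:(lia)); assert (E2 := X0 2%nat ltac:(lia)); simpl in E0, E1, E2.
exists (fun q => X q 0%nat), (fun q => X q 1%nat), (fun q => X q 2%nat), (fun q => X q 3%nat).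
split; [exact HS|].
split; [apply SM; lia|split; [apply SM; lia|split; [apply SM; lia|split; [apply SM; lia|]]]].
split; [exact E0|split; [exact E1|split; [exact E2|]]].
assert (Hpos : 0 < 1 + (a0 * a0 + b0 * b0) / (2 * t z0)).
{ assert (Y := Ht z0 Hz0); assert (0 <= (a0 * a0 + b0 * b0) / (2 * t z0)); [|lra].
  apply Rmult_le_pos; [assert (A := Rle_0_sqr a0); assert (B := Rle_0_sqr b0); unfold Rsqr in *; lra|].
  left; apply Rinv_0_lt_compat; lra. }
apply (first_integral _ _ _ _ z0 HSC Hz0 HS); rewrite E2.
- rewrite E0, E1; apply sqrt_sqrt; lra.
- now apply sqrt_lt_R0.
Qed.
End LinearSystem.

(** * The surface of a solution *)

Section Surface.
Variables (Om : C -> Prop) (G : nat -> C -> R) (s : R).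
Hypothesis HOm : open Om.
Hypothesis HG : harmonic_H2 Om G.
Hypothesis Hs : s * s = 1.
Hypothesis Ht : forall q, Om q -> 0 < ft G s q.

Notation t := (ft G s).
Notation Lx := (log_dx G s).
Notation Ly := (log_dy G s).
Notation Q1 := (hopf1 G).
Notation Q2 := (hopf2 G).
Notation e1 := (frame1 G s).
Notation e2 := (frame2 G s).

Let HGs : smooth_vec Om G.
Proof. destruct HG as [H _]; exact H. Qed.
Let St : smooth_on Om t := smooth_ft Om G s HOm HG.
Let Se1 : smooth_vec Om e1 := smooth_frame1 Om G s HOm HG.
Let Se2 : smooth_vec Om e2 := smooth_frame2 Om G s HOm HG.
Let t_nz q : Om q -> 2 * t q <> 0.
Proof. intros Hq; assert (H := Ht q Hq); lra. Qed.

#[local] Opaque log_dx log_dy hopf1 hopf2 ft frame1 frame2.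

Definition in_frame (p : C) (x y z : R) (k : nat) : R := x * e1 k p + y * e2 k p + z * G k p.

Lemma lor3_in_frame p x y z x' y' z' : Om p ->
  lor3 (in_frame p x y z) (in_frame p x' y' z') = 2 * t p * (x * x' + y * y') - z * z'.
Proof.
intros Hp.
assert (H4 := GG Om G HG p Hp); assert (H5 := G_e1 Om G s HOm HG p Hp); assert (H6 := G_e2 Om G s HOm HG p Hp).
assert (H7 := e1_e1 Om G s HOm HG Hs p Hp); assert (H8 := e1_e2 Om G s HOm HG Hs p Hp).
assert (H9 := e2_e2 Om G s HOm HG Hs p Hp).
transitivity (x * x' * ip e1 e1 p + (x * y' + y * x') * ip e1 e2 p + y * y' * ip e2 e2 p
  + (x * z' + z * x') * ip G e1 p + (y * z' + z * y') * ip G e2 p + z * z' * ip G G p).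
- unfold in_frame, ip, lor3, at_; ring.
- rewrite H4, H5, H6, H7, H8, H9; ring.
Qed.

Lemma in_frame_exists p v : Om p -> exists x y z, forall k, (k < 3)%nat -> v k = in_frame p x y z k.
Proof.
intros Hp; assert (X := Ht p Hp).
exists (lor3 v (at_ e1 p) / (2 * t p)), (lor3 v (at_ e2 p) / (2 * t p)), (- lor3 v (at_ G p)).
apply (frame_expand Om G s HOm HG Hs Ht p Hp); [ring|field; lra|field; lra].
Qed.

Lemma in_frame_G p k : G k p = in_frame p 0 0 1 k.
Proof. unfold in_frame; ring. Qed.

Lemma is_pd_e1 b p k : Om p -> (k < 3)%nat -> is_pd b (e1 k) p
  (if b then in_frame p (Ly p / 2) (Lx p / 2) (2 * Q2 p) k else in_frame p (Lx p / 2) (- (Ly p / 2)) (t p - 2 * Q1 p) k).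
Proof.
intros Hp Hk; eapply is_pd_val; [apply (smooth_is_pd Om); [now apply Se1|exact Hp]|].
destruct b; [exact (e1y_frame Om G s HOm HG Hs Ht p Hp k Hk)|exact (e1x_frame Om G s HOm HG Hs Ht p Hp k Hk)].
Qed.

Lemma is_pd_e2 b p k : Om p -> (k < 3)%nat -> is_pd b (e2 k) p
  (if b then in_frame p (- (Lx p / 2)) (Ly p / 2) (t p + 2 * Q1 p) k else in_frame p (Ly p / 2) (Lx p / 2) (2 * Q2 p) k).
Proof.
intros Hp Hk; eapply is_pd_val; [apply (smooth_is_pd Om); [now apply Se2|exact Hp]|].
destruct b; [exact (e2y_frame Om G s HOm HG Hs Ht p Hp k Hk)|exact (e2x_frame Om G s HOm HG Hs Ht p Hp k Hk)].
Qed.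

Lemma is_pd_G b p k : Om p -> (k < 3)%nat -> is_pd b (G k) p
  (if b then in_frame p (2 * Q2 p / (2 * t p)) ((t p + 2 * Q1 p) / (2 * t p)) 0 k
   else in_frame p ((t p - 2 * Q1 p) / (2 * t p)) (2 * Q2 p / (2 * t p)) 0 k).
Proof.
intros Hp Hk; assert (Hnz := t_nz p Hp); eapply is_pd_val; [apply (smooth_is_pd Om); [now apply HGs|exact Hp]|].
destruct b.
- transitivity ((2 * Q2 p * e1 k p + (t p + 2 * Q1 p) * e2 k p) / (2 * t p)).
  + exact (Gy_frame Om G s HOm HG Hs Ht p Hp k Hk).
  + unfold in_frame; field; lra.
- transitivity (((t p - 2 * Q1 p) * e1 k p + 2 * Q2 p * e2 k p) / (2 * t p)).
  + exact (Gx_frame Om G s HOm HG Hs Ht p Hp k Hk).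
  + unfold in_frame; field; lra.
Qed.

(* For a solution of [solves] this field [N] has [N_x = a G + W frame1] and [N_y = b G + W frame2]. *)
Definition surf (a b W : C -> R) (k : nat) (q : C) : R :=
  W q * G k q + (a q * e1 k q + b q * e2 k q) * / (2 * t q).

Lemma surf_in_frame a b W p k : Om p -> surf a b W k p = in_frame p (a p / (2 * t p)) (b p / (2 * t p)) (W p) k.
Proof. intros Hp; assert (H := t_nz p Hp); unfold surf, in_frame; field; lra. Qed.

Section FromSolution.
Variables (a b W h : C -> R).
Hypothesis Hsol : forall p, Om p -> solves G s a b W h p.
Hypothesis Sa : smooth_on Om a.
Hypothesis Sb : smooth_on Om b.
Hypothesis SW : smooth_on Om W.
Hypothesis Sh : smooth_on Om h.
Hypothesis HW : forall p, Om p -> W p * W p = 1 + (a p * a p + b p * b p) / (2 * t p) /\ 0 < W p.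

Notation N := (surf a b W).

Lemma smooth_surf k : (k < 3)%nat -> smooth_on Om (N k).
Proof.
intros Hk; assert (S1 := Se1 k Hk); assert (S2 := Se2 k Hk); assert (S3 := HGs k Hk).
assert (S4 : smooth_on Om (fun q => / (2 * t q))).
{ apply smooth_inv; [exact HOm|exact t_nz|smooth]. }
unfold surf; smooth.
Qed.

Lemma is_pd_surf c p k : Om p -> (k < 3)%nat -> is_pd c (N k) p
  (if c then in_frame p 0 (W p) (b p) k else in_frame p (W p) 0 (a p) k).
Proof.
intros Hp Hk; assert (Hnz := t_nz p Hp).
destruct (Hsol p Hp) as [[A1 A2] [[B1 B2] [[W1 W2] _]]].
assert (P1 := is_pd_e1 c p k Hp Hk); assert (P2 := is_pd_e2 c p k Hp Hk); assert (P3 := is_pd_G c p k Hp Hk).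
assert (P4 := smooth_is_pd Om t c p St Hp); rewrite (pd_t Om G s Ht c p Hp) in P4.
unfold surf; destruct c; (eapply is_pd_val; [pdauto; exact Hnz|]); unfold in_frame; field; lra.
Qed.

Lemma lap_surf p k : Om p -> (k < 3)%nat ->
  pd false (pd false (N k)) p + pd true (pd true (N k)) p = in_frame p (a p) (b p) (4 * t p * W p) k.
Proof.
intros Hp Hk; assert (Hnz := t_nz p Hp).
destruct (Hsol p Hp) as [[A1 A2] [[B1 B2] [[W1 W2] _]]].
assert (E1 : pd false (pd false (N k)) p = pd false (fun q => W q * e1 k q + 0 * e2 k q + a q * G k q) p).
{ apply (pd_ext_on Om HOm); [|exact Hp]; intros q Hq; exact (is_pd_unique _ _ _ _ (is_pd_surf false q k Hq Hk)). }
assert (E2 : pd true (pd true (N k)) p = pd true (fun q => 0 * e1 k q + W q * e2 k q + b q * G k q) p).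
{ apply (pd_ext_on Om HOm); [|exact Hp]; intros q Hq; exact (is_pd_unique _ _ _ _ (is_pd_surf true q k Hq Hk)). }
assert (P1 := is_pd_e1 false p k Hp Hk); assert (P2 := is_pd_e2 false p k Hp Hk); assert (P3 := is_pd_G false p k Hp Hk).
assert (P1' := is_pd_e1 true p k Hp Hk); assert (P2' := is_pd_e2 true p k Hp Hk); assert (P3' := is_pd_G true p k Hp Hk).
simpl in P1, P2, P3, P1', P2', P3'.
assert (D1 : is_pd false (fun q => W q * e1 k q + 0 * e2 k q + a q * G k q) p
  (in_frame p 0 0 0 k + pd true (pd true (N k)) p * 0 +
   ((a p / 2 + (Q1 p * a p - Q2 p * b p) / t p) * e1 k p + W p * in_frame p (Lx p / 2) (- (Ly p / 2)) (t p - 2 * Q1 p) k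
   + ((t p * W p + (Lx p * a p - Ly p * b p) / 2 + 2 * Q1 p * W p) * G k p
   + a p * in_frame p ((t p - 2 * Q1 p) / (2 * t p)) (2 * Q2 p / (2 * t p)) 0 k)))).
{ eapply is_pd_val; [pdauto|cbv beta; unfold in_frame; ring]. }
assert (D2 : is_pd true (fun q => 0 * e1 k q + W q * e2 k q + b q * G k q) p
  ((b p / 2 - (Q2 p * a p + Q1 p * b p) / t p) * e2 k p
    + W p * in_frame p (- (Lx p / 2)) (Ly p / 2) (t p + 2 * Q1 p) k
   + ((t p * W p - (Lx p * a p - Ly p * b p) / 2 - 2 * Q1 p * W p) * G k p
   + b p * in_frame p (2 * Q2 p / (2 * t p)) ((t p + 2 * Q1 p) / (2 * t p)) 0 k))).
{ eapply is_pd_val; [pdauto|cbv beta; unfold in_frame; ring]. }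
rewrite E1, (is_pd_unique _ _ _ _ D1), E2, (is_pd_unique _ _ _ _ D2).
unfold in_frame; field; lra.
Qed.

(** The norm is the first integral. The sheet is decided by [lor3 N G = - W < 0]: by the
    Cauchy-Schwarz inequality for the space components, timelike unit vectors on opposite sheets
    have positive product. *)
Lemma surf_in_H2 p : Om p -> in_H2 (at_ N p).
Proof.
intros Hp; destruct (HW p Hp) as [HW1 HW2]; assert (Hnz := Ht p Hp).
assert (HGp : in_H2 (at_ G p)) by now apply HG.
assert (E : lor3 (at_ N p) (at_ N p) = -1).
{ rewrite (lor3_ext _ _ (in_frame p (a p / (2 * t p)) (b p / (2 * t p)) (W p)) (in_frame p (a p / (2 * t p)) (b p / (2 * t p)) (W p)))
    by (intros; now apply surf_in_frame).
  rewrite lor3_in_frame, HW1 by exact Hp; field; lra. }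
assert (EG : lor3 (at_ N p) (at_ G p) = - W p).
{ rewrite (lor3_ext _ _ (in_frame p (a p / (2 * t p)) (b p / (2 * t p)) (W p)) (in_frame p 0 0 1))
    by (intros; first [now apply surf_in_frame|apply in_frame_G]).
  rewrite lor3_in_frame by exact Hp; ring. }
split; [exact E|]; destruct HGp as [G1 G0].
apply Rnot_le_lt; intros Hle; unfold lor3 in *.
set (n0 := at_ N p 0%nat) in *; set (n1 := at_ N p 1%nat) in *; set (n2 := at_ N p 2%nat) in *.
set (g0 := at_ G p 0%nat) in *; set (g1 := at_ G p 1%nat) in *; set (g2 := at_ G p 2%nat) in *.
set (sg := n1 * g1 + n2 * g2).
assert (Hsg : sg * sg <= (n1 * n1 + n2 * n2) * (g1 * g1 + g2 * g2)).
{ assert (X := Rle_0_sqr (n1 * g2 - n2 * g1)); unfold Rsqr in X; unfold sg; lra. }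
replace (n1 * n1 + n2 * n2) with (n0 * n0 - 1) in Hsg by lra.
replace (g1 * g1 + g2 * g2) with (g0 * g0 - 1) in Hsg by lra.
assert (Hn : 1 <= n0 * n0) by (assert (X := Rle_0_sqr n1); assert (Y := Rle_0_sqr n2); unfold Rsqr in *; lra).
assert (Hgg : 0 < g0 * g0) by now apply Rmult_lt_0_compat.
assert (Hlt : sg < n0 * g0) by (unfold sg; lra).
assert (Hng : n0 * g0 <= 0) by (assert (0 <= - n0 * g0) by (apply Rmult_le_pos; lra); lra).
assert (n0 * g0 * (n0 * g0) < sg * sg) by nra.
lra.
Qed.

Lemma psi_dx k p : Om p -> (k < 3)%nat -> dxv (psi4 N h) p k = in_frame p (W p) 0 (a p) k.
Proof.
intros Hp Hk; rewrite <- (is_pd_unique _ _ _ _ (is_pd_surf false p k Hp Hk)).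
revert k Hk; apply below3; reflexivity.
Qed.
Lemma psi_dy k p : Om p -> (k < 3)%nat -> dyv (psi4 N h) p k = in_frame p 0 (W p) (b p) k.
Proof.
intros Hp Hk; rewrite <- (is_pd_unique _ _ _ _ (is_pd_surf true p k Hp Hk)).
revert k Hk; apply below3; reflexivity.
Qed.
Lemma psi_dx3 p : Om p -> dxv (psi4 N h) p 3%nat = a p.
Proof. intros Hp; apply is_pd_unique, (Hsol p Hp). Qed.
Lemma psi_dy3 p : Om p -> dyv (psi4 N h) p 3%nat = b p.
Proof. intros Hp; apply is_pd_unique, (Hsol p Hp). Qed.

Lemma lambda_surf p : Om p -> lambda_of N h p = 2 * t p * (W p * W p).
Proof.
intros Hp; unfold lambda_of, lor4; rewrite (psi_dx3 p Hp).
rewrite (lor3_ext _ _ (in_frame p (W p) 0 (a p)) (in_frame p (W p) 0 (a p))) by (intros; now apply psi_dx).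
rewrite lor3_in_frame by exact Hp; ring.
Qed.

Lemma conformal_surf p : Om p ->
  lor4 (dxv (psi4 N h) p) (dxv (psi4 N h) p) = lor4 (dyv (psi4 N h) p) (dyv (psi4 N h) p) /\
  lor4 (dxv (psi4 N h) p) (dyv (psi4 N h) p) = 0 /\ 0 < lambda_of N h p.
Proof.
intros Hp; rewrite (lambda_surf p Hp); unfold lor4; rewrite (psi_dx3 p Hp), (psi_dy3 p Hp).
rewrite (lor3_ext (dxv (psi4 N h) p) (dxv (psi4 N h) p) (in_frame p (W p) 0 (a p)) (in_frame p (W p) 0 (a p)))
  by (intros; now apply psi_dx).
rewrite (lor3_ext (dyv (psi4 N h) p) (dyv (psi4 N h) p) (in_frame p 0 (W p) (b p)) (in_frame p 0 (W p) (b p)))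
  by (intros; now apply psi_dy).
rewrite (lor3_ext (dxv (psi4 N h) p) (dyv (psi4 N h) p) (in_frame p (W p) 0 (a p)) (in_frame p 0 (W p) (b p)))
  by (intros; first [now apply psi_dx|now apply psi_dy]).
rewrite !lor3_in_frame by exact Hp; destruct (HW p Hp) as [_ HWp]; assert (X := Ht p Hp).
split; [ring|split; [ring|]].
apply Rmult_lt_0_compat; [lra|now apply Rmult_lt_0_compat].
Qed.

(** In frame coordinates the three orthogonality relations are linear and express [eta] through its
    vertical component; the normalisation leaves [1 / W] and [- / W] for the latter. *)
Lemma unit_normal_surf p eta : Om p -> unit_normal N h p eta ->
  eta 3%nat * W p * (eta 3%nat * W p) = 1 /\
  forall k, (k < 3)%nat -> eta k = in_frame p (- (eta 3%nat * W p * a p / (2 * t p)))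
     (- (eta 3%nat * W p * b p / (2 * t p))) (eta 3%nat * (1 - W p * W p)) k.
Proof.
intros Hp [H1 [H2 [H3 H4]]]; destruct (HW p Hp) as [HW1 HWp]; assert (X := Ht p Hp).
destruct (in_frame_exists p eta Hp) as [x [y [z Hn]]].
set (u := eta 3%nat) in *.
rewrite (lor3_ext _ _ (in_frame p x y z) (in_frame p (a p / (2 * t p)) (b p / (2 * t p)) (W p))) in H1
  by (intros; first [now apply Hn|now apply surf_in_frame]).
unfold lor4 in H2, H3, H4; fold u in H2, H3, H4; rewrite (psi_dx3 p Hp) in H2; rewrite (psi_dy3 p Hp) in H3.
rewrite (lor3_ext _ _ (in_frame p x y z) (in_frame p (W p) 0 (a p))) in H2 by (intros; first [now apply Hn|now apply psi_dx]).
rewrite (lor3_ext _ _ (in_frame p x y z) (in_frame p 0 (W p) (b p))) in H3 by (intros; first [now apply Hn|now apply psi_dy]).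
rewrite (lor3_ext _ _ (in_frame p x y z) (in_frame p x y z)) in H4 by (intros; now apply Hn).
rewrite lor3_in_frame in H1, H2, H3, H4 by exact Hp.
set (w := W p) in *; set (A := a p) in *; set (B := b p) in *; set (T := t p) in *.
assert (Ex : x = (z - u) * A / (2 * T * w)) by (apply Rmult_eq_reg_r with (2 * T * w); [field_simplify; [lra|lra]|];
  apply Rgt_not_eq; apply Rmult_lt_0_compat; lra).
assert (Ey : y = (z - u) * B / (2 * T * w)) by (apply Rmult_eq_reg_r with (2 * T * w); [field_simplify; [lra|lra]|];
  apply Rgt_not_eq; apply Rmult_lt_0_compat; lra).
assert (EAB : A * A + B * B = 2 * T * (w * w - 1)) by (rewrite HW1; field; lra).
assert (Ez : z = u * (1 - w * w)).
{ assert (E : 2 * T * (x * (A / (2 * T)) + y * (B / (2 * T))) - z * w =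
    ((z - u) * (A * A + B * B) - 2 * T * (z * w * w)) / (2 * T * w)) by (rewrite Ex, Ey; field; lra).
  rewrite E, EAB in H1.
  assert (E2 : (z - u) * (2 * T * (w * w - 1)) - 2 * T * (z * w * w) = 0).
  { apply Rmult_eq_reg_r with (/ (2 * T * w)); [rewrite Rmult_0_l; exact H1|].
    apply Rinv_neq_0_compat, Rgt_not_eq, Rmult_lt_0_compat; lra. }
  apply Rmult_eq_reg_l with (2 * T); lra. }
assert (Ex2 : x = - (u * w * A / (2 * T))) by (rewrite Ex, Ez; field; lra).
assert (Ey2 : y = - (u * w * B / (2 * T))) by (rewrite Ey, Ez; field; lra).
split.
- rewrite Ex2, Ey2, Ez in H4; rewrite <- H4.
  transitivity (u * u * (w * w) * ((2 * T * (w * w - 1)) / (2 * T)) - u * (1 - w * w) * (u * (1 - w * w)) + u * u); [field; lra|].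
  rewrite <- EAB; field; lra.
- intros k Hk; rewrite Hn, Ex2, Ey2, Ez by exact Hk; reflexivity.
Qed.

Lemma good_from_solution z0 th0 tau : Om z0 -> (forall p, Om p -> tau p = t p) ->
  a z0 = 2 * fst th0 -> b z0 = - (2 * snd th0) -> good_psi Om G tau z0 th0 N h.
Proof.
intros Hz0 Htau Ea Eb.
split; [exact smooth_surf|split; [exact Sh|split; [exact surf_in_H2|split; [exact conformal_surf|split; [|split]]]]].
- intros p eta Hp Hn; destruct (unit_normal_surf p eta Hp Hn) as [E _]; intros E0; rewrite E0 in E; lra.
- intros p eta Hp Hn Hpos; destruct (unit_normal_surf p eta Hp Hn) as [E Hk].
  destruct (HW p Hp) as [HW1 HWp]; assert (X := Ht p Hp).
  set (u := eta 3%nat) in *.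
  (* The canonical orientation selects the positive root. *)
  assert (Euw : u * W p = 1).
  { assert (0 < u * W p) by now apply Rmult_lt_0_compat. nra. }
  assert (Eu : u = / W p) by (apply Rmult_eq_reg_r with (W p); [rewrite Euw; field|]; lra).
  split; [|split].
  + rewrite (lambda_surf p Hp); unfold lor4; fold u.
    rewrite (lor3_ext (lapv (psi4 N h) p) eta (in_frame p (a p) (b p) (4 * t p * W p))
      (in_frame p (- (u * W p * a p / (2 * t p))) (- (u * W p * b p / (2 * t p))) (u * (1 - W p * W p)))).
    2: { intros k Hk3; rewrite <- (lap_surf p k Hp Hk3); revert k Hk3; apply below3; reflexivity. }
    2: exact Hk.
    assert (E3 : lapv (psi4 N h) p 3%nat = 2 * t p * W p).
    { destruct (Hsol p Hp) as [[A1 _] [[_ B2] _]].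
      change (pd false (pd false h) p + pd true (pd true h) p = 2 * t p * W p).
      rewrite (pd_ext_on Om HOm false (pd false h) a (fun q Hq => is_pd_unique _ _ _ _ (proj1 (proj2 (proj2 (proj2 (Hsol q Hq)))))) p Hp).
      rewrite (pd_ext_on Om HOm true (pd true h) b (fun q Hq => is_pd_unique _ _ _ _ (proj2 (proj2 (proj2 (proj2 (Hsol q Hq)))))) p Hp).
      rewrite (is_pd_unique _ _ _ _ A1), (is_pd_unique _ _ _ _ B2); field. }
    rewrite E3, lor3_in_frame by exact Hp.
    assert (EAB : a p * a p + b p * b p = 2 * t p * (W p * W p - 1)) by (rewrite HW1; field; lra).
    transitivity (- (u * W p) * (a p * a p + b p * b p) - 4 * t p * (u * W p) * (1 - W p * W p) + 2 * t p * (u * W p)); [field; lra|].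
    rewrite EAB, Euw; field.
  + intros k Hk3; rewrite Hk, surf_in_frame by assumption; rewrite Eu; unfold in_frame; field; lra.
  + rewrite (lambda_surf p Hp), (Htau p Hp), Eu; field; lra.
- destruct (Hsol z0 Hz0) as [_ [_ [_ [H1 H2]]]].
  split; unfold dz, dzb, dx, dy; rewrite (is_pd_unique _ _ _ _ H1), (is_pd_unique _ _ _ _ H2), Ea, Eb;
    destruct th0 as [r i]; unfold Cconj; simpl; f_equal; field.
Qed.
End FromSolution.
End Surface.

(** * Structure of an arbitrary surface *)

(** Lorentzian cross product of three vectors of [L^4], whose norm is minus their Gram
    determinant. *)
Definition cross4 (u v w : nat -> R) (k : nat) : R :=
  let d i j l := u i * (v j * w l - v l * w j) - u j * (v i * w l - v l * w i) + u l * (v i * w j - v j * w i) in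
  match k with
  | 0%nat => - d 1%nat 2%nat 3%nat
  | 1%nat => - d 0%nat 2%nat 3%nat
  | 2%nat => d 0%nat 1%nat 3%nat
  | _ => - d 0%nat 1%nat 2%nat
  end.

Lemma cross4_orth u v w : lor4 (cross4 u v w) u = 0 /\ lor4 (cross4 u v w) v = 0 /\ lor4 (cross4 u v w) w = 0.
Proof. unfold lor4, lor3, cross4; repeat split; ring. Qed.

Lemma cross4_norm u v w : lor4 (cross4 u v w) (cross4 u v w) =
  - (lor4 u u * (lor4 v v * lor4 w w - lor4 v w * lor4 v w)
     - lor4 u v * (lor4 u v * lor4 w w - lor4 v w * lor4 u w)
     + lor4 u w * (lor4 u v * lor4 v w - lor4 v v * lor4 u w)).
Proof. unfold lor4, lor3, cross4; ring. Qed.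

Lemma unit_normal_opp N h p eta : unit_normal N h p eta -> unit_normal N h p (fun k => - eta k).
Proof.
intros [H1 [H2 [H3 H4]]]; repeat split.
- transitivity (- lor3 eta (at_ N p)); [unfold lor3; ring|rewrite H1; ring].
- transitivity (- lor4 eta (dxv (psi4 N h) p)); [unfold lor4, lor3; ring|rewrite H2; ring].
- transitivity (- lor4 eta (dyv (psi4 N h) p)); [unfold lor4, lor3; ring|rewrite H3; ring].
- rewrite <- H4; unfold lor4, lor3; ring.
Qed.

Section Uniqueness.
Variables (Om : C -> Prop) (G : nat -> C -> R) (s : R) (tau : C -> R) (z0 : C) (th0 : C).
Hypothesis HOm : open Om.
Hypothesis HG : harmonic_H2 Om G.
Hypothesis Hs : s * s = 1.
Hypothesis Ht : forall q, Om q -> 0 < ft G s q.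
Hypothesis Htau : forall q, Om q -> tau q = ft G s q.
Hypothesis Hsing : singular_set_empty_interior Om G.
Variables (N : nat -> C -> R) (h : C -> R).
Hypothesis Hgood : good_psi Om G tau z0 th0 N h.

Notation t := (ft G s).
Notation Lx := (log_dx G s).
Notation Ly := (log_dy G s).
Notation Q1 := (hopf1 G).
Notation Q2 := (hopf2 G).
Notation e1 := (frame1 G s).
Notation e2 := (frame2 G s).
Notation Nx := (pdv false N).
Notation Ny := (pdv true N).
Let a : C -> R := pd false h.
Let b : C -> R := pd true h.
(** Equals [1 / u], as the product of [u G = eta + N] with [N] shows. *)
Let W (q : C) : R := - ip G N q.

Let HGs : smooth_vec Om G.
Proof. destruct HG as [H _]; exact H. Qed.
Let SN : smooth_vec Om N.
Proof. exact (proj1 Hgood). Qed.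
Let Sh : smooth_on Om h.
Proof. exact (proj1 (proj2 Hgood)). Qed.
Let Sa : smooth_on Om a := smooth_pd Om h false Sh.
Let Sb : smooth_on Om b := smooth_pd Om h true Sh.
Let SNx : smooth_vec Om Nx := smooth_pdv Om false N SN.
Let SNy : smooth_vec Om Ny := smooth_pdv Om true N SN.
Let SW : smooth_on Om W.
Proof. apply smooth_opp; [exact HOm|now apply smooth_ip]. Qed.

Let Q1E q : 4 * Q1 q = cB G q - cA G q.
Proof. unfold hopf1; field. Qed.
Let Q2E q : 2 * Q2 q = cC G q.
Proof. unfold hopf2; field. Qed.

#[local] Opaque log_dx log_dy hopf1 hopf2 ft frame1 frame2.

Let NN q : Om q -> ip N N q = -1.
Proof. intros Hq; destruct Hgood as [_ [_ [H _]]]; exact (proj1 (H q Hq)). Qed.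

Let NNd c q : Om q -> ip N (pdv c N) q = 0.
Proof.
intros Hq; assert (H := pd_ip_const Om HOm c N N (-1) q SN SN NN Hq).
rewrite (ip_sym (pdv c N)) in H; lra.
Qed.

Let conf q : Om q -> ip Nx Nx q + a q * a q = lambda_of N h q /\ ip Ny Ny q + b q * b q = lambda_of N h q /\
  ip Nx Ny q + a q * b q = 0 /\ 0 < lambda_of N h q.
Proof.
intros Hq; destruct Hgood as [_ [_ [_ [H _]]]]; destruct (H q Hq) as [H1 [H2 H3]].
split; [reflexivity|split; [|split; [exact H2|exact H3]]].
unfold lambda_of; rewrite H1; reflexivity.
Qed.

(** [good_psi] speaks of all unit normals without providing one. The cross product of position and
    tangent vectors has length [lam]; regular vertical projection makes its last component nonzero,
    so a sign can be chosen. *)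
Lemma positive_normal q : Om q -> exists eta, unit_normal N h q eta /\ 0 < eta 3%nat.
Proof.
intros Hq; destruct (conf q Hq) as [C1 [C2 [C3 C4]]].
set (lam := lambda_of N h q) in *.
set (u := fun k => if (k <? 3)%nat then N k q else 0).
set (n4 := cross4 u (dxv (psi4 N h) q) (dyv (psi4 N h) q)).
destruct (cross4_orth u (dxv (psi4 N h) q) (dyv (psi4 N h) q)) as [O1 [O2 O3]]; fold n4 in O1, O2, O3.
assert (Hn : lor4 n4 n4 = lam * lam).
{ unfold n4; rewrite cross4_norm.
  assert (E1 : lor4 u u = -1) by (rewrite <- (NN q Hq); cbv [lor4 lor3 u ip at_ Nat.ltb Nat.leb]; ring).
  assert (E2 : lor4 u (dxv (psi4 N h) q) = 0)
    by (rewrite <- (NNd false q Hq); cbv [lor4 lor3 u ip at_ dxv pdv dx psi4 Nat.ltb Nat.leb]; ring).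
  assert (E3 : lor4 u (dyv (psi4 N h) q) = 0)
    by (rewrite <- (NNd true q Hq); cbv [lor4 lor3 u ip at_ dyv pdv dy psi4 Nat.ltb Nat.leb]; ring).
  assert (E4 : lor4 (dxv (psi4 N h) q) (dxv (psi4 N h) q) = lam) by (rewrite <- C1; reflexivity).
  assert (E5 : lor4 (dyv (psi4 N h) q) (dyv (psi4 N h) q) = lam) by (rewrite <- C2; reflexivity).
  assert (E6 : lor4 (dxv (psi4 N h) q) (dyv (psi4 N h) q) = 0) by (rewrite <- C3; reflexivity).
  rewrite E1, E2, E3, E4, E5, E6; ring. }
assert (Hu : unit_normal N h q (fun k => n4 k / lam)).
{ split; [|split; [|split]].
  - transitivity (lor4 n4 u / lam); [cbv [lor4 lor3 u at_ Nat.ltb Nat.leb]; field; repeat split; lra|rewrite O1; field; repeat split; lra].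
  - transitivity (lor4 n4 (dxv (psi4 N h) q) / lam); [unfold lor4, lor3; field; repeat split; lra|rewrite O2; field; repeat split; lra].
  - transitivity (lor4 n4 (dyv (psi4 N h) q) / lam); [unfold lor4, lor3; field; repeat split; lra|rewrite O3; field; repeat split; lra].
  - transitivity (lor4 n4 n4 / (lam * lam)); [unfold lor4, lor3; field; repeat split; lra|rewrite Hn; field; repeat split; lra]. }
assert (Hne : n4 3%nat / lam <> 0).
{ destruct Hgood as [_ [_ [_ [_ [H _]]]]]; exact (H q _ Hq Hu). }
destruct (Rtotal_order (n4 3%nat / lam) 0) as [Hl|[Hl|Hl]]; [|contradiction|].
- exists (fun k => - (n4 k / lam)); split; [now apply unit_normal_opp|lra].
- exists (fun k => n4 k / lam); split; [exact Hu|lra].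
Qed.

(** Elimination of the normal: [eta = u G - N] is substituted into the orthogonality relations, the
    normalisation and the mean curvature equation. *)
Lemma gauss_map_facts q : Om q -> exists u, 0 < u /\ u * W q = 1 /\ lambda_of N h q * (u * u) = 2 * t q /\
  ip G Nx q = - a q /\ ip G Ny q = - b q /\
  u * (lor3 (lapv N q) (at_ G q) + (pd false a q + pd true b q)) - lor3 (lapv N q) (at_ N q) = lambda_of N h q.
Proof.
intros Hq; destruct (positive_normal q Hq) as [eta [Hn Hpos]].
destruct Hgood as [_ [_ [_ [_ [_ [H _]]]]]]; destruct (H q eta Hq Hn Hpos) as [H1 [H2 H3]]; clear H.
destruct Hn as [N1 [N2 [N3 N4]]].
set (u := eta 3%nat) in *; exists u.
assert (He : forall k, (k < 3)%nat -> eta k = u * G k q + (-1) * N k q + 0 * 0).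
{ intros k Hk; rewrite (H2 k Hk); field; repeat split; lra. }
assert (E : forall v, lor3 eta v = u * lor3 (at_ G q) v - lor3 (at_ N q) v).
{ intros v; rewrite (lor3_ext eta v _ v He (fun _ _ => eq_refl)); unfold lor3, at_; ring. }
unfold lor4 in N2, N3, N4, H1; rewrite E in N1, N2, N3; fold u in N2, N3, N4, H1.
rewrite lor3_sym, E in H1.
assert (A0 := NN q Hq); assert (A1 := NNd false q Hq); assert (A2 := NNd true q Hq).
unfold ip in A0, A1, A2.
rewrite A0 in N1.
change (lor3 (at_ N q) (dxv (psi4 N h) q)) with (lor3 (at_ N q) (at_ Nx q)) in N2; rewrite A1 in N2.
change (lor3 (at_ N q) (dyv (psi4 N h) q)) with (lor3 (at_ N q) (at_ Ny q)) in N3; rewrite A2 in N3.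
change (lor3 (at_ G q) (dxv (psi4 N h) q)) with (ip G Nx q) in N2.
change (lor3 (at_ G q) (dyv (psi4 N h) q)) with (ip G Ny q) in N3.
change (dxv (psi4 N h) q 3%nat) with (a q) in N2.
change (dyv (psi4 N h) q 3%nat) with (b q) in N3.
split; [exact Hpos|split; [unfold W, ip; lra|split; [|split; [|split]]]].
- rewrite <- (Htau q Hq), H3; field.
- apply Rmult_eq_reg_l with u; [|lra]; lra.
- apply Rmult_eq_reg_l with u; [|lra]; lra.
- rewrite (lor3_sym _ (at_ G q)), (lor3_sym _ (at_ N q)).
  change (lapv (psi4 N h) q 3%nat) with (pd false a q + pd true b q) in H1.
  change (lor3 (at_ G q) (lapv (psi4 N h) q)) with (lor3 (at_ G q) (lapv N q)) in H1.
  change (lor3 (at_ N q) (lapv (psi4 N h) q)) with (lor3 (at_ N q) (lapv N q)) in H1.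
  lra.
Qed.

Let GNd (c : bool) q : Om q -> ip G (pdv c N) q = - (if c then b q else a q).
Proof. intros Hq; destruct (gauss_map_facts q Hq) as [u [_ [_ [_ [H1 [H2 _]]]]]]; destruct c; assumption. Qed.

Section AtPoint.
Variable p : C.
Hypothesis Hp : Om p.
Let g := at_ G p.
Let gx := at_ (pdv false G) p.
Let gy := at_ (pdv true G) p.
Let lam := lambda_of N h p.
(** The part of [Nx] orthogonal to [G], because [ip G Nx = - a]. With [Ey] it is an orthogonal frame
    of squared length [lam], to be identified with [W] times the moving frame. *)
Let Ex (k : nat) : R := Nx k p - a p * G k p.
Let Ey (k : nat) : R := Ny k p - b p * G k p.

Let gg : lor3 g g = -1 := GG Om G HG p Hp.
Let ggx : lor3 gx g = 0.
Proof. rewrite lor3_sym; exact (G_pd Om G HOm HG false p Hp). Qed.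
Let ggy : lor3 gy g = 0.
Proof. rewrite lor3_sym; exact (G_pd Om G HOm HG true p Hp). Qed.

Let Exv v : lor3 Ex v = lor3 (at_ Nx p) v - a p * lor3 g v.
Proof. unfold Ex, g, at_, lor3; ring. Qed.
Let Eyv v : lor3 Ey v = lor3 (at_ Ny p) v - b p * lor3 g v.
Proof. unfold Ey, g, at_, lor3; ring. Qed.
Let gNx : lor3 g (at_ Nx p) = - a p := GNd false p Hp.
Let gNy : lor3 g (at_ Ny p) = - b p := GNd true p Hp.

Let Exg : lor3 Ex g = 0.
Proof. rewrite Exv, gg, lor3_sym, gNx; ring. Qed.
Let Eyg : lor3 Ey g = 0.
Proof. rewrite Eyv, gg, lor3_sym, gNy; ring. Qed.

Let ExEx : lor3 Ex Ex = lam.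
Proof.
destruct (conf p Hp) as [C1 _]; unfold ip in C1; fold lam in C1.
rewrite Exv, (lor3_sym _ Ex), (lor3_sym g Ex), Exg, Exv, gNx; lra.
Qed.
Let EyEy : lor3 Ey Ey = lam.
Proof.
destruct (conf p Hp) as [_ [C1 _]]; unfold ip in C1; fold lam in C1.
rewrite Eyv, (lor3_sym _ Ey), (lor3_sym g Ey), Eyg, Eyv, gNy; lra.
Qed.
Let ExEy : lor3 Ex Ey = 0.
Proof.
destruct (conf p Hp) as [_ [_ [C1 _]]]; unfold ip in C1.
rewrite Exv, (lor3_sym _ Ey), (lor3_sym g Ey), Eyg, Eyv, gNx, (lor3_sym (at_ Ny p)); lra.
Qed.
Let lam_pos : 0 < lam.
Proof. apply (conf p Hp). Qed.

Let basis : det3 g Ex Ey <> 0.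
Proof.
intros E; assert (H := det3_sq g Ex Ey).
rewrite E, gg, ExEx, EyEy, ExEy, (lor3_sym g Ex), (lor3_sym g Ey), Exg, Eyg in H.
assert (0 < lam * lam) by now apply Rmult_lt_0_compat; lra. lra.
Qed.

Let expand v : lor3 v g = 0 -> forall k, (k < 3)%nat ->
  v k = lor3 v Ex / lam * Ex k + lor3 v Ey / lam * Ey k + 0 * 0.
Proof.
intros Hv.
assert (E : forall z, lor3 (fun k => lor3 v Ex / lam * Ex k + lor3 v Ey / lam * Ey k + 0 * 0) z =
   lor3 v Ex / lam * lor3 Ex z + lor3 v Ey / lam * lor3 Ey z) by (intros; unfold lor3; ring).
apply (lorentz_basis_eq g Ex Ey); [exact basis|..]; rewrite E.
- rewrite Hv, Exg, Eyg; ring.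
- rewrite ExEx, (lor3_sym Ey), ExEy; field; repeat split; lra.
- rewrite ExEy, EyEy; field; repeat split; lra.
Qed.

Let expand_prod v w : lor3 v g = 0 -> lor3 v w = (lor3 v Ex * lor3 w Ex + lor3 v Ey * lor3 w Ey) / lam.
Proof.
intros Hv; rewrite (lor3_ext v w _ w (expand v Hv) (fun _ _ => eq_refl)).
rewrite (lor3_sym w Ex), (lor3_sym w Ey).
transitivity (lor3 v Ex / lam * lor3 Ex w + lor3 v Ey / lam * lor3 Ey w); [unfold lor3; ring|field; repeat split; lra].
Qed.

Let Tv (k : nat) : R := N k p - W p * G k p.

Let TvE v : lor3 Tv v = lor3 (at_ N p) v - W p * lor3 g v.
Proof. unfold Tv, g, at_, lor3; ring. Qed.

Let Ng : lor3 (at_ N p) g = - W p.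
Proof. unfold W, ip, g; rewrite lor3_sym; ring. Qed.

Let Tg : lor3 Tv g = 0.
Proof. rewrite TvE, Ng, gg; ring. Qed.
Let TEx : lor3 Tv Ex = a p * W p.
Proof.
rewrite TvE, (lor3_sym _ Ex), (lor3_sym g Ex), Exg, Exv, (lor3_sym (at_ Nx p)).
assert (H := NNd false p Hp); unfold ip in H; rewrite H, (lor3_sym g), Ng; ring.
Qed.
Let TEy : lor3 Tv Ey = b p * W p.
Proof.
rewrite TvE, (lor3_sym _ Ey), (lor3_sym g Ey), Eyg, Eyv, (lor3_sym (at_ Ny p)).
assert (H := NNd true p Hp); unfold ip in H; rewrite H, (lor3_sym g), Ng; ring.
Qed.

(** The squared length of [Tv], the part of [N] orthogonal to [G], is computed directly and from its
    components along [Ex] and [Ey]. *)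
Lemma angle_identity : (a p * a p + b p * b p) * (W p * W p) = lam * (W p * W p - 1).
Proof.
assert (H := expand_prod Tv Tv Tg); rewrite TEx, TEy in H.
assert (TT : lor3 Tv Tv = W p * W p - 1).
{ rewrite TvE, (lor3_sym _ Tv), (lor3_sym g Tv), Tg, TvE, (lor3_sym g), Ng.
  assert (X := NN p Hp); unfold ip in X; rewrite X; ring. }
rewrite TT in H; rewrite H; field; repeat split; lra.
Qed.

Lemma W_pos : 0 < W p.
Proof.
destruct (gauss_map_facts p Hp) as [u [Hu [E _]]].
apply Rmult_lt_reg_l with u; [exact Hu|rewrite E, Rmult_0_r; lra].
Qed.

Lemma lam_W : lam = 2 * t p * (W p * W p).
Proof.
destruct (gauss_map_facts p Hp) as [u [Hu [E [E2 _]]]]; fold lam in E2; rewrite <- E2.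
transitivity (lam * ((u * W p) * (u * W p))); [rewrite E; ring|ring].
Qed.

Lemma W_sq : W p * W p = 1 + (a p * a p + b p * b p) / (2 * t p).
Proof.
assert (H := angle_identity); rewrite lam_W in H; assert (Hw := W_pos); assert (X := Ht p Hp).
assert (Hww : 0 < W p * W p) by now apply Rmult_lt_0_compat.
assert (E : a p * a p + b p * b p = 2 * t p * (W p * W p - 1)).
{ apply Rmult_eq_reg_r with (W p * W p); [rewrite H; ring|lra]. }
rewrite E; field; repeat split; lra.
Qed.

Let mxx := lor3 gx Ex.
Let mxy := lor3 gx Ey.
Let myx := lor3 gy Ex.
Let myy := lor3 gy Ey.

Let m_val c : lor3 gx (at_ (pdv c N) p) = (if c then mxy else mxx) /\ lor3 gy (at_ (pdv c N) p) = (if c then myy else myx).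
Proof.
unfold mxx, mxy, myx, myy; rewrite (lor3_sym gx Ex), (lor3_sym gx Ey), (lor3_sym gy Ex), (lor3_sym gy Ey), !Exv, !Eyv.
rewrite (lor3_sym g gx), (lor3_sym g gy), ggx, ggy.
split; destruct c; rewrite lor3_sym; ring.
Qed.

Let GN_second c c' : ip (pdv c' G) (pdv c N) p + ip G (pdv c' (pdv c N)) p = - pd c' (if c then b else a) p.
Proof.
rewrite <- (pd_ip Om c' G (pdv c N) p HGs (smooth_pdv Om c N SN) Hp).
rewrite (pd_ext_on Om HOm c' (ip G (pdv c N)) (fun q => - (if c then b else a) q)).
- apply is_pd_unique, is_pd_opp; destruct c; now apply (smooth_is_pd Om).
- intros q Hq; rewrite (GNd c q Hq); destruct c; reflexivity.
- exact Hp.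
Qed.

(** The relations [ip G Nx = - a] and [ip G Ny = - b] are differentiated crosswise, and the mixed
    derivatives of [N] and [h] cancel. *)
Lemma m_sym : mxy = myx.
Proof.
assert (H1 : ip (pdv true G) Nx p + ip G (pdv true Nx) p = - pd true a p) by exact (GN_second false true).
assert (H2 : ip (pdv false G) Ny p + ip G (pdv false Ny) p = - pd false b p) by exact (GN_second true false).
assert (E1 : ip G (pdv true Nx) p = ip G (pdv false Ny) p).
{ apply lor3_ext; [auto|]; intros k Hk; exact (pd_comm_vec Om HOm N k p SN Hp Hk). }
assert (E2 : pd true a p = pd false b p) by exact (pd_comm Om HOm h p Sh Hp).
assert (M1 : ip (pdv true G) Nx p = myx) by exact (proj2 (m_val false)).
assert (M2 : ip (pdv false G) Ny p = mxy) by exact (proj1 (m_val true)).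
lra.
Qed.

(** The same relations differentiated in their own directions; the Laplacians of [N] and [h] are
    eliminated by the mean curvature equation. *)
Lemma m_trace : mxx + myy = 2 * t p * W p.
Proof.
destruct (gauss_map_facts p Hp) as [u [Hu [E1 [E2 [_ [_ E3]]]]]]; fold lam in E2, E3.
assert (H1 : ip (pdv false G) Nx p + ip G (pdv false Nx) p = - pd false a p) by exact (GN_second false false).
assert (H2 : ip (pdv true G) Ny p + ip G (pdv true Ny) p = - pd true b p) by exact (GN_second true true).
assert (G1 : ip (pdv false G) Nx p = mxx) by exact (proj1 (m_val false)).
assert (G2 : ip (pdv true G) Ny p = myy) by exact (proj2 (m_val true)).
assert (Hn : forall c, ip N (pdv c (pdv c N)) p = - ip (pdv c N) (pdv c N) p).
{ intros c; assert (X := pd_ip_const Om HOm c N (pdv c N) 0 p SN (smooth_pdv Om c N SN) (NNd c) Hp); lra. }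
assert (L1 : lor3 (lapv N p) (at_ N p) = ip N (pdv false Nx) p + ip N (pdv true Ny) p)
  by (unfold lapv, ip, at_, pdv, lor3, dx, dy; ring).
assert (L2 : lor3 (lapv N p) (at_ G p) = ip G (pdv false Nx) p + ip G (pdv true Ny) p)
  by (unfold lapv, ip, at_, pdv, lor3, dx, dy; ring).
rewrite L1, L2, (Hn false), (Hn true) in E3.
destruct (conf p Hp) as [C1 [C2 _]]; fold lam in C1, C2.
rewrite G1 in H1; rewrite G2 in H2.
assert (Etr : u * (mxx + myy) = lam - (a p * a p + b p * b p)).
{ replace (ip G (pdv false Nx) p) with (- pd false a p - mxx) in E3 by lra.
  replace (ip G (pdv true Ny) p) with (- pd true b p - myy) in E3 by lra. lra. }
assert (HA := angle_identity).
assert (Hw := W_pos).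
assert (E4 : lam - (a p * a p + b p * b p) = lam * (u * u)).
{ transitivity (lam - (a p * a p + b p * b p) * (W p * W p) * (u * u)).
  - transitivity (lam - (a p * a p + b p * b p) * ((u * W p) * (u * W p))); [rewrite E1; ring|ring].
  - rewrite HA; transitivity (lam - lam * ((u * W p) * (u * W p)) + lam * (u * u)); [ring|rewrite E1; ring]. }
rewrite E4, E2 in Etr.
apply Rmult_eq_reg_l with u; [|lra]; rewrite Etr.
transitivity (2 * t p * (u * W p)); [rewrite E1; ring|ring].
Qed.

(** For a symmetric matrix, [cB - cA] and [cC] factor through the trace. The trace is known and
    nonzero, so the Hopf coefficients determine the remaining entries. *)
Lemma m_values : mxx = W p * (t p - 2 * Q1 p) /\ myy = W p * (t p + 2 * Q1 p) /\ mxy = W p * (2 * Q2 p).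
Proof.
assert (HA : cA G p = (mxx * mxx + mxy * mxy) / lam) by exact (expand_prod gx gx ggx).
assert (HB : cB G p = (myx * myx + myy * myy) / lam) by exact (expand_prod gy gy ggy).
assert (HC : cC G p = (mxx * myx + mxy * myy) / lam) by exact (expand_prod gx gy ggx).
assert (Htr := m_trace); assert (Hsy := m_sym); rewrite <- Hsy in HB, HC.
assert (Hl := lam_W); assert (Hw := W_pos); assert (X := Ht p Hp).
assert (EQ1 : 4 * Q1 p = (myy - mxx) / W p).
{ transitivity (cB G p - cA G p); [apply Q1E|].
  rewrite HA, HB, Hl.
  transitivity ((myy - mxx) * (mxx + myy) / (2 * t p * (W p * W p))); [field; repeat split; lra|rewrite Htr; field; repeat split; lra]. }
assert (EQ2 : 2 * Q2 p = mxy / W p).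
{ transitivity (cC G p); [apply Q2E|].
  rewrite HC, Hl.
  transitivity (mxy * (mxx + myy) / (2 * t p * (W p * W p))); [field; repeat split; lra|rewrite Htr; field; repeat split; lra]. }
assert (E1 : myy - mxx = 4 * Q1 p * W p) by (rewrite EQ1; field; repeat split; lra).
assert (E2 : mxy = 2 * Q2 p * W p) by (rewrite EQ2; field; repeat split; lra).
repeat split; lra.
Qed.

(** Where [cJ] is nonzero, [G], [G_x] and [G_y] form a basis, and by [m_values] the vectors [Ex] and
    [W * frame1] have the same products with it; likewise [Ey] and [W * frame2]. *)
Lemma derivative_at_regular k : cJ G p <> 0 -> (k < 3)%nat ->
  Nx k p = a p * G k p + W p * e1 k p /\ Ny k p = b p * G k p + W p * e2 k p.
Proof.
intros HJ Hk; destruct m_values as [M1 [M2 M3]]; assert (Hsy := m_sym).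
assert (B1 := Gx_e1 G s p); assert (B2 := Gx_e2 G s p); assert (B3 := Gy_e1 G s p); assert (B4 := Gy_e2 G s p).
assert (B5 := G_e1 Om G s HOm HG p Hp); assert (B6 := G_e2 Om G s HOm HG p Hp).
unfold ip in B1, B2, B3, B4, B5, B6; fold g gx gy in B1, B2, B3, B4, B5, B6.
assert (S1 : forall v, lor3 (fun k => W p * e1 k p) v = W p * lor3 v (at_ e1 p)) by (intros; unfold lor3, at_; ring).
assert (S2 : forall v, lor3 (fun k => W p * e2 k p) v = W p * lor3 v (at_ e2 p)) by (intros; unfold lor3, at_; ring).
assert (E1 : forall k, (k < 3)%nat -> Ex k = W p * e1 k p).
{ apply (lorentz_basis_eq g gx gy Ex (fun k => W p * e1 k p)); [exact HJ|..]; rewrite S1.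
  - rewrite Exg, B5; ring.
  - rewrite B1, lor3_sym; exact M1.
  - rewrite B3, lor3_sym; fold myx; rewrite <- Hsy; exact M3. }
assert (E2 : forall k, (k < 3)%nat -> Ey k = W p * e2 k p).
{ apply (lorentz_basis_eq g gx gy Ey (fun k => W p * e2 k p)); [exact HJ|..]; rewrite S2.
  - rewrite Eyg, B6; ring.
  - rewrite B2, lor3_sym; exact M3.
  - rewrite B4, lor3_sym; exact M2. }
split; [rewrite <- (E1 k Hk)|rewrite <- (E2 k Hk)]; unfold Ex, Ey; ring.
Qed.

Lemma N_from_derivatives : (forall k, (k < 3)%nat -> Nx k p = a p * G k p + W p * e1 k p /\ Ny k p = b p * G k p + W p * e2 k p) ->
  forall k, (k < 3)%nat -> N k p = surf G s a b W k p.
Proof.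
intros H k Hk; assert (E := expand Tv Tg k Hk); rewrite TEx, TEy in E.
destruct (H k Hk) as [H1 H2]; assert (Hw := W_pos); assert (X := Ht p Hp).
unfold Tv, Ex, Ey in E; rewrite H1, H2, lam_W in E; unfold surf.
apply Rplus_eq_reg_l with (- (W p * G k p)).
transitivity (N k p - W p * G k p); [ring|rewrite E; field; repeat split; lra].
Qed.
End AtPoint.

Lemma dense_zero f : smooth_on Om f -> (forall q, Om q -> cJ G q <> 0 -> f q = 0) -> forall p, Om p -> f p = 0.
Proof.
intros Sf H p Hp; destruct (Req_dec (f p) 0) as [|Hne]; [assumption|exfalso].
destruct (continuous_near f p _ (smooth_continuous Om f p Sf Hp) (Rabs_pos_lt _ Hne)) as [d [Hd Hn]].
destruct (regular_dense Om G HOm HG Hsing p d Hp Hd) as [q [Bq [Oq Jq]]].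
assert (X := Hn q Bq); rewrite (H q Oq Jq), Rminus_0_l, Rabs_Ropp in X; lra.
Qed.

Lemma derivative_everywhere p k : Om p -> (k < 3)%nat ->
  Nx k p = a p * G k p + W p * e1 k p /\ Ny k p = b p * G k p + W p * e2 k p.
Proof.
intros Hp Hk.
assert (S1 := smooth_frame1 Om G s HOm HG k Hk); assert (S2 := smooth_frame2 Om G s HOm HG k Hk).
assert (S3 := HGs k Hk); assert (S4 := SNx k Hk); assert (S5 := SNy k Hk).
split; apply Rminus_diag_uniq.
- apply (dense_zero (fun q => Nx k q - (a q * G k q + W q * e1 k q))); [smooth| |exact Hp].
  intros q Oq Jq; destruct (derivative_at_regular q Oq k Jq Hk) as [E _]; rewrite E; ring.
- apply (dense_zero (fun q => Ny k q - (b q * G k q + W q * e2 k q))); [smooth| |exact Hp].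
  intros q Oq Jq; destruct (derivative_at_regular q Oq k Jq Hk) as [_ E]; rewrite E; ring.
Qed.

Lemma good_is_surf p k : Om p -> (k < 3)%nat -> N k p = surf G s a b W k p.
Proof. intros Hp; apply (N_from_derivatives p Hp); intros; now apply derivative_everywhere. Qed.

Notation fr := (in_frame G s).

Let N_frame p k : Om p -> (k < 3)%nat -> at_ N p k = fr p (a p / (2 * t p)) (b p / (2 * t p)) (W p) k.
Proof. intros Hp Hk; unfold at_; rewrite good_is_surf by assumption; now apply (surf_in_frame Om). Qed.

Let N_pd c p k : Om p -> (k < 3)%nat -> is_pd c (N k) p (if c then fr p 0 (W p) (b p) k else fr p (W p) 0 (a p) k).
Proof.
intros Hp Hk; destruct (derivative_everywhere p k Hp Hk) as [H1 H2].
eapply is_pd_val; [apply (smooth_is_pd Om); [now apply SN|exact Hp]|].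
destruct c; [change (pd true (N k) p) with (Ny k p); rewrite H2
  |change (pd false (N k) p) with (Nx k p); rewrite H1]; unfold in_frame; ring.
Qed.

(** [a], [b] and [- W] are the products of [N] with [frame1], [frame2] and [G]. The derivatives of
    all these vectors are known in the frame, and the product rule yields the linear system. *)
Lemma good_solves p : Om p -> solves G s a b W h p.
Proof.
intros Hp; assert (X := Ht p Hp).
assert (Ha : forall q, Om q -> ip N e1 q = a q).
{ intros q Hq; assert (Y := Ht q Hq); unfold ip.
  rewrite (lor3_ext _ (at_ e1 q) (fr q (a q / (2 * t q)) (b q / (2 * t q)) (W q)) (fr q 1 0 0)).
  - rewrite (lor3_in_frame Om) by assumption; field; repeat split; lra.
  - intros; now apply N_frame.
  - intros; unfold in_frame, at_; ring. }
assert (Hb : forall q, Om q -> ip N e2 q = b q).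
{ intros q Hq; assert (Y := Ht q Hq); unfold ip.
  rewrite (lor3_ext _ (at_ e2 q) (fr q (a q / (2 * t q)) (b q / (2 * t q)) (W q)) (fr q 0 1 0)).
  - rewrite (lor3_in_frame Om) by assumption; field; repeat split; lra.
  - intros; now apply N_frame.
  - intros; unfold in_frame, at_; ring. }
assert (Fe1 : forall k, (k < 3)%nat -> at_ e1 p k = fr p 1 0 0 k) by (intros; unfold in_frame, at_; ring).
assert (Fe2 : forall k, (k < 3)%nat -> at_ e2 p k = fr p 0 1 0 k) by (intros; unfold in_frame, at_; ring).
assert (FG : forall k, (k < 3)%nat -> at_ G p k = fr p 0 0 1 k) by (intros; unfold in_frame, at_; ring).
assert (FN := fun k => N_frame p k Hp).
assert (Dip : forall c (F : nat -> C -> R) x y z x' y' z',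
   (forall k, (k < 3)%nat -> at_ F p k = fr p x y z k) ->
   (forall k, (k < 3)%nat -> is_pd c (F k) p (fr p x' y' z' k)) ->
   is_pd c (ip N F) p ((if c then 2 * t p * (W p * y) - b p * z else 2 * t p * (W p * x) - a p * z)
     + (a p * x' + b p * y' - W p * z'))).
{ intros c F x y z x' y' z' H1 H2.
  eapply is_pd_val; [apply (is_pd_ip c N F (if c then fr p 0 (W p) (b p) else fr p (W p) 0 (a p)) (fr p x' y' z'))|].
  - intros k Hk; eapply is_pd_val; [now apply N_pd|destruct c; reflexivity].
  - exact H2.
  - rewrite (lor3_ext _ (at_ F p) (if c then fr p 0 (W p) (b p) else fr p (W p) 0 (a p)) (fr p x y z) (fun _ _ => eq_refl) H1).
    rewrite (lor3_ext (at_ N p) _ (fr p (a p / (2 * t p)) (b p / (2 * t p)) (W p)) (fr p x' y' z') FN (fun _ _ => eq_refl)).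
    destruct c; rewrite !(lor3_in_frame Om) by assumption; field; repeat split; lra. }
assert (De1 := is_pd_e1 Om G s HOm HG Hs Ht); assert (De2 := is_pd_e2 Om G s HOm HG Hs Ht).
assert (DG := is_pd_G Om G s HOm HG Hs Ht).
refine (conj (conj _ _) (conj (conj _ _) (conj (conj _ _) (conj _ _)))).
- apply (is_pd_ext_on Om HOm false (ip N e1) a p _ Ha Hp).
  eapply is_pd_val; [apply (Dip false e1 1 0 0 _ _ _ Fe1 (fun k Hk => De1 false p k Hp Hk))|simpl; field].
- apply (is_pd_ext_on Om HOm true (ip N e1) a p _ Ha Hp).
  eapply is_pd_val; [apply (Dip true e1 1 0 0 _ _ _ Fe1 (fun k Hk => De1 true p k Hp Hk))|simpl; field].
- apply (is_pd_ext_on Om HOm false (ip N e2) b p _ Hb Hp).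
  eapply is_pd_val; [apply (Dip false e2 0 1 0 _ _ _ Fe2 (fun k Hk => De2 false p k Hp Hk))|simpl; field].
- apply (is_pd_ext_on Om HOm true (ip N e2) b p _ Hb Hp).
  eapply is_pd_val; [apply (Dip true e2 0 1 0 _ _ _ Fe2 (fun k Hk => De2 true p k Hp Hk))|simpl; field].
- apply (is_pd_ext_on Om HOm false (fun q => - ip N G q) W p); [intros; unfold W; now rewrite ip_sym|exact Hp|].
  eapply is_pd_val; [apply is_pd_opp, (Dip false G 0 0 1 _ _ _ FG (fun k Hk => DG false p k Hp Hk))|simpl; field; repeat split; lra].
- apply (is_pd_ext_on Om HOm true (fun q => - ip N G q) W p); [intros; unfold W; now rewrite ip_sym|exact Hp|].
  eapply is_pd_val; [apply is_pd_opp, (Dip true G 0 0 1 _ _ _ FG (fun k Hk => DG true p k Hp Hk))|simpl; field; repeat split; lra].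
- now apply (smooth_is_pd Om).
- now apply (smooth_is_pd Om).
Qed.

Lemma good_structure : exists W', (forall p, Om p -> solves G s (pd false h) (pd true h) W' h p) /\
  (forall p k, Om p -> (k < 3)%nat -> N k p = surf G s (pd false h) (pd true h) W' k p) /\
  (forall p, Om p -> W' p * W' p = 1 + (pd false h p * pd false h p + pd true h p * pd true h p) / (2 * t p) /\ 0 < W' p).
Proof.
exists W; split; [exact good_solves|split; [exact good_is_surf|]].
intros p Hp; split; [now apply W_sq|now apply W_pos].
Qed.
End Uniqueness.

(** * The complex system and the explicit formula *)

Lemma Cmod_sq (z : C) : Cmod z ^ 2 = fst z * fst z + snd z * snd z.
Proof.
unfold Cmod; rewrite pow2_sqrt; [ring|].
assert (H1 := pow2_ge_0 (fst z)); assert (H2 := pow2_ge_0 (snd z)); lra.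
Qed.

(** The identity for [mu], with [tau0 = 2 tau] and denominators cleared, is the quadratic equation
    of which [tau] is a root. *)
Lemma weierstrass_facts Om G (Q : C -> C) tau : open Om ->
  weierstrass_data Om G (fun p => Copp (Q p)) (fun p => 2 * tau p) ->
  smooth_on Om tau /\ forall p, Om p -> 0 < tau p /\ Q p = (hopf1 G p, hopf2 G p) /\
   (cA G p + cB G p) * tau p = tau p * tau p + 4 * (hopf1 G p * hopf1 G p + hopf2 G p * hopf2 G p).
Proof.
intros HOm [Hs H]; split.
- apply smooth_ext with (fun p => / 2 * (2 * tau p)); [exact HOm|intros; field|].
  apply smooth_mult; [exact HOm|now apply smooth_const|exact Hs].
- intros p Hp; destruct (H p Hp) as [H1 [H2 H3]].
  assert (HQ : Q p = (hopf1 G p, hopf2 G p)).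
  { assert (E1 := f_equal fst H2); assert (E2 := f_equal snd H2).
    unfold lor3C, dzv, dz, Cplus, Cmult, Copp, dx, dy in E1, E2; cbn [fst snd] in E1, E2.
    rewrite (surjective_pairing (Q p)).
    unfold hopf1, hopf2, cA, cB, cC, ip, lor3, at_, pdv; f_equal; lra. }
  split; [lra|split; [exact HQ|]].
  assert (E := f_equal fst H3).
  assert (EL : fst (Cmult (RtoC 2) (lor3C (dzv G p) (dzbv G p))) = (cA G p + cB G p) / 2).
  { unfold lor3C, dzv, dzbv, dz, dzb, cA, cB, ip, lor3, at_, pdv, dx, dy, Cplus, Cmult, Copp, RtoC; cbn [fst snd]; field. }
  rewrite EL, Cmod_sq, HQ in E; cbn [fst snd Copp RtoC] in E.
  apply Rmult_eq_reg_r with (/ 2); [|lra].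
  transitivity ((cA G p + cB G p) / 2 * tau p); [field|].
  rewrite E; field; lra.
Qed.

Section Final.
Variables (Om : C -> Prop) (G : nat -> C -> R) (Q : C -> C) (tau : C -> R) (s : R) (z0 : C) (th0 : C).
Hypothesis HOm : open Om.
Hypothesis HG : harmonic_H2 Om G.
Hypothesis Hs : s * s = 1.
Hypothesis Ht : forall q, Om q -> 0 < ft G s q.
Hypothesis Htau : forall q, Om q -> tau q = ft G s q.
Hypothesis HQ : forall q, Om q -> Q q = (hopf1 G q, hopf2 G q).

Notation t := (ft G s).
Notation Lx := (log_dx G s).
Notation Ly := (log_dy G s).
Notation Q1 := (hopf1 G).
Notation Q2 := (hopf2 G).

Let ln_tau b p : Om p -> pd b (fun q => ln (tau q)) p = if b then Ly p else Lx p.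
Proof.
intros Hp; assert (X := Ht p Hp).
rewrite (pd_ext_on Om HOm b (fun q => ln (tau q)) (fun q => ln (t q))); [|intros q Hq; now rewrite Htau|exact Hp].
rewrite (is_pd_unique _ _ _ _ (is_pd_ln b t p _ X (smooth_is_pd Om t b p (smooth_ft Om G s HOm HG) Hp))).
destruct b; unfold log_dx, log_dy; field; lra.
Qed.

Let ftE p : 2 * t p = cA G p + cB G p + 2 * s * cJ G p.
Proof. unfold ft; field. Qed.

#[local] Opaque log_dx log_dy hopf1 hopf2 ft frame1 frame2.

Let ang (h : C -> R) (p : C) : R := sqrt ((tau p + 2 * Cmod (dz h p) ^ 2) / tau p).

Lemma ang_arg h p : Om p -> (tau p + 2 * Cmod (dz h p) ^ 2) / tau p =
  1 + (pd false h p * pd false h p + pd true h p * pd true h p) * / (2 * t p).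
Proof.
intros Hp; assert (X := Ht p Hp); rewrite Cmod_sq, (Htau p Hp); unfold dz, dx, dy; cbn [fst snd]; field; lra.
Qed.

Lemma ang_arg_pos h p : Om p -> 0 < 1 + (pd false h p * pd false h p + pd true h p * pd true h p) * / (2 * t p).
Proof.
intros Hp; assert (X := Ht p Hp).
assert (0 <= (pd false h p * pd false h p + pd true h p * pd true h p) * / (2 * t p)); [|lra].
apply Rmult_le_pos; [|left; apply Rinv_0_lt_compat; lra].
assert (A := Rle_0_sqr (pd false h p)); assert (B := Rle_0_sqr (pd true h p)); unfold Rsqr in *; lra.
Qed.

Lemma ang_pos h p : Om p -> 0 < ang h p.
Proof. intros Hp; unfold ang; rewrite ang_arg by exact Hp; apply sqrt_lt_R0; now apply ang_arg_pos. Qed.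

Lemma ang_sq h p : Om p -> ang h p * ang h p =
  1 + (pd false h p * pd false h p + pd true h p * pd true h p) * / (2 * t p).
Proof. intros Hp; unfold ang; rewrite ang_arg by exact Hp; apply sqrt_sqrt; left; now apply ang_arg_pos. Qed.

Lemma ang_unique h p w : Om p -> 0 < w ->
  w * w = 1 + (pd false h p * pd false h p + pd true h p * pd true h p) / (2 * t p) -> w = ang h p.
Proof.
intros Hp Hw E; unfold ang; rewrite ang_arg by exact Hp; unfold Rdiv in E; rewrite <- E.
symmetry; apply sqrt_square; lra.
Qed.

Lemma sqrt_prod h p : Om p -> sqrt (tau p * (tau p + 2 * Cmod (dz h p) ^ 2)) = t p * ang h p.
Proof.
intros Hp; assert (X := Ht p Hp); assert (Y := ang_pos h p Hp).
rewrite <- (sqrt_square (t p * ang h p)) by (apply Rmult_le_pos; lra); f_equal.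
transitivity (t p * t p * (ang h p * ang h p)); [|ring].
rewrite ang_sq by exact Hp; rewrite <- ang_arg, (Htau p Hp) by exact Hp; field; lra.
Qed.

Lemma dz_second h p : smooth_on Om h -> Om p ->
  dzC (dz h) p = ((pd false (pd false h) p - pd true (pd true h) p) / 4,
                  - (pd false (pd true h) p + pd true (pd false h) p) / 4) /\
  dzbC (dz h) p = ((pd false (pd false h) p + pd true (pd true h) p) / 4, 0).
Proof.
intros Sh Hp.
assert (S1 := smooth_pd Om h false Sh); assert (S2 := smooth_pd Om h true Sh).
assert (D1 : forall c, pd c (fun q => Re (dz h q)) p = pd c (pd false h) p / 2).
{ intros c; apply is_pd_unique; unfold dz, dx, dy, Re; cbn [fst snd].
  assert (P1 := smooth_is_pd Om _ c p S1 Hp).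
  unfold Rdiv; eapply is_pd_val; [apply is_pd_mult; [exact P1|apply is_pd_const]|cbv beta; ring]. }
assert (D2 : forall c, pd c (fun q => Im (dz h q)) p = - pd c (pd true h) p / 2).
{ intros c; apply is_pd_unique; unfold dz, dx, dy, Im; cbn [fst snd].
  assert (P1 := smooth_is_pd Om _ c p S2 Hp).
  unfold Rdiv; eapply is_pd_val; [apply is_pd_mult; [apply is_pd_opp; exact P1|apply is_pd_const]|cbv beta; ring]. }
assert (E := pd_comm Om HOm h p Sh Hp).
unfold dzC, dzbC, dx, dy; rewrite !D1, !D2, E; split; f_equal; field.
Qed.

Let rhs1 h p : Om p -> Cplus (Cmult (dz (fun q => ln (tau q)) p) (dz h p)) (Cmult (Q p) (RtoC (ang h p))) =
  ((Lx p * pd false h p - Ly p * pd true h p) / 4 + Q1 p * ang h p,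
   - (Lx p * pd true h p + Ly p * pd false h p) / 4 + Q2 p * ang h p).
Proof.
intros Hp; rewrite (HQ p Hp).
assert (E1 : dz (fun q => ln (tau q)) p = (Lx p / 2, - Ly p / 2)).
{ unfold dz, dx, dy; rewrite !ln_tau by exact Hp; reflexivity. }
rewrite E1; unfold dz, dx, dy, Cplus, Cmult, RtoC; cbn [fst snd]; f_equal; field.
Qed.

Lemma h_system_of_solves h W : smooth_on Om h ->
  (forall p, Om p -> solves G s (pd false h) (pd true h) W h p) ->
  (forall p, Om p -> W p = ang h p) -> dz h z0 = th0 -> h_system Om Q tau z0 th0 h.
Proof.
intros Sh H HW Hth; split; [|exact Hth]; intros p Hp.
destruct (dz_second h p Sh Hp) as [E1 E2]; rewrite E1, E2.
destruct (H p Hp) as [[A1 A2] [[B1 B2] _]].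
apply is_pd_unique in A1; apply is_pd_unique in A2; apply is_pd_unique in B1; apply is_pd_unique in B2.
change (sqrt ((tau p + 2 * Cmod (dz h p) ^ 2) / tau p)) with (ang h p).
rewrite (rhs1 h p Hp), (sqrt_prod h p Hp), A1, A2, B1, B2, (HW p Hp).
unfold RtoC; split; f_equal; field.
Qed.

(** Real and imaginary parts give the second derivatives of [h]; the equations for the auxiliary
    unknown are then obtained by differentiating the square root that defines [ang]. *)
Lemma solves_of_h_system h : smooth_on Om h -> h_system Om Q tau z0 th0 h ->
  forall p, Om p -> solves G s (pd false h) (pd true h) (ang h) h p.
Proof.
intros Sh [H _] p Hp; assert (X := Ht p Hp).
destruct (H p Hp) as [H1 H2]; destruct (dz_second h p Sh Hp) as [E1 E2]; rewrite E1 in H1; rewrite E2 in H2.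
change (sqrt ((tau p + 2 * Cmod (dz h p) ^ 2) / tau p)) with (ang h p) in H1.
rewrite (rhs1 h p Hp) in H1; rewrite (sqrt_prod h p Hp) in H2.
assert (F1 := f_equal fst H1); assert (F2 := f_equal snd H1); assert (F3 := f_equal fst H2).
unfold RtoC in F3; cbn [fst snd] in F1, F2, F3; clear H1 H2.
assert (F4 := pd_comm Om HOm h p Sh Hp).
set (a := pd false h) in *; set (b := pd true h) in *; set (w := ang h p) in *.
assert (V1 : pd false a p = t p * w + (Lx p * a p - Ly p * b p) / 2 + 2 * Q1 p * w) by lra.
assert (V2 : pd true b p = t p * w - (Lx p * a p - Ly p * b p) / 2 - 2 * Q1 p * w) by lra.
assert (V3 : pd true a p = (Ly p * a p + Lx p * b p) / 2 - 2 * Q2 p * w) by lra.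
assert (V4 : pd false b p = (Ly p * a p + Lx p * b p) / 2 - 2 * Q2 p * w) by lra.
assert (Sa : smooth_on Om a) by now apply smooth_pd.
assert (Sb : smooth_on Om b) by now apply smooth_pd.
assert (St := smooth_ft Om G s HOm HG).
assert (P1 : is_pd false a p (t p * w + (Lx p * a p - Ly p * b p) / 2 + 2 * Q1 p * w))
  by (rewrite <- V1; now apply (smooth_is_pd Om)).
assert (P2 : is_pd true b p (t p * w - (Lx p * a p - Ly p * b p) / 2 - 2 * Q1 p * w))
  by (rewrite <- V2; now apply (smooth_is_pd Om)).
assert (P3 : is_pd true a p ((Ly p * a p + Lx p * b p) / 2 - 2 * Q2 p * w))
  by (rewrite <- V3; now apply (smooth_is_pd Om)).
assert (P4 : is_pd false b p ((Ly p * a p + Lx p * b p) / 2 - 2 * Q2 p * w))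
  by (rewrite <- V4; now apply (smooth_is_pd Om)).
assert (Pt := fun c => smooth_is_pd Om t c p St Hp).
assert (Hpt := fun c => pd_t Om G s Ht c p Hp).
assert (Hw : 0 < w) by now apply ang_pos.
assert (Hw2 := ang_sq h p Hp); fold a b w in Hw2.
assert (Hnz : 2 * t p <> 0) by lra.
assert (Dang : forall c l, is_pd c (fun q => 1 + (a q * a q + b q * b q) * / (2 * t q)) p l ->
   is_pd c (ang h) p (/ (2 * w) * l)).
{ intros c l Hl; apply (is_pd_ext_on Om HOm c (fun q => sqrt (1 + (a q * a q + b q * b q) * / (2 * t q)))).
  - intros q Hq; unfold ang; now rewrite ang_arg.
  - exact Hp.
  - apply is_pd_comp; [|exact Hl]; rewrite <- Hw2.
    assert (Hww : 0 < w * w) by now apply Rmult_lt_0_compat.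
    auto_derive; [exact Hww|]; rewrite sqrt_square by lra; field; lra. }
assert (Pt0 := Pt false); assert (Pt1 := Pt true); rewrite Hpt in Pt0, Pt1; clear Pt.
refine (conj (conj P1 P3) (conj (conj P4 P2) (conj (conj _ _) (conj _ _)))).
- eapply is_pd_val; [apply Dang; pdauto; exact Hnz|]; cbv beta.
  (* The derivative of the radicand is divisible by [w]; its cancellation against the derivative of
     the root is what makes the equation for [W] linear. *)
  transitivity (/ (2 * w) * (w * (a p + 2 * (Q1 p * a p - Q2 p * b p) / t p))); [field; repeat split; lra|field; repeat split; lra].
- eapply is_pd_val; [apply Dang; pdauto; exact Hnz|]; cbv beta.
  transitivity (/ (2 * w) * (w * (b p - 2 * (Q2 p * a p + Q1 p * b p) / t p))); [field; repeat split; lra|field; repeat split; lra].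
- now apply (smooth_is_pd Om).
- now apply (smooth_is_pd Om).
Qed.

Lemma dz_components h p : dz h p = th0 -> pd false h p = 2 * fst th0 /\ pd true h p = - (2 * snd th0).
Proof. intros <-; unfold dz, dx, dy; cbn [fst snd]; split; field. Qed.

Lemma explicit_formula a b W h p k : Om p -> cJ G p <> 0 -> (k < 3)%nat ->
  pd false h p = a p -> pd true h p = b p -> W p = ang h p ->
  surf G s a b W k p =
    4 * Re (Cmult (dz (G k) p)
         (Cplus (Cmult (Cmult (RtoC 2) (Cconj (Q p))) (dz h p)) (Cmult (RtoC (tau p)) (dzb h p))))
    / (tau p ^ 2 - 4 * Cmod (Q p) ^ 2) + G k p * sqrt ((tau p + 2 * Cmod (dz h p) ^ 2) / tau p).
Proof.
intros Hp HJ Hk Ea Eb EW; assert (X := Ht p Hp).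
(* By the quadratic equation the denominator equals [2 * s * cJ * t], which is nonzero at regular
   points. *)
assert (HD : t p * t p - 4 * (Q1 p * Q1 p + Q2 p * Q2 p) <> 0).
{ assert (E := ft_quadratic Om G s HOm HG Hs p Hp).
  assert (E2 := ftE p).
  replace (t p * t p - 4 * (Q1 p * Q1 p + Q2 p * Q2 p)) with (2 * s * cJ G p * t p).
  - assert (s <> 0) by (intros E0; rewrite E0 in Hs; lra).
    repeat apply Rmult_integral_contrapositive_currified; lra.
  - transitivity ((2 * t p - (cA G p + cB G p)) * t p); [rewrite E2; ring|lra]. }
change (sqrt ((tau p + 2 * Cmod (dz h p) ^ 2) / tau p)) with (ang h p); rewrite <- EW.
rewrite Cmod_sq, (HQ p Hp), (Htau p Hp).
assert (Gx := is_pd_unique _ _ _ _ (is_pd_G Om G s HOm HG Hs Ht false p k Hp Hk)).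
assert (Gy := is_pd_unique _ _ _ _ (is_pd_G Om G s HOm HG Hs Ht true p k Hp Hk)).
unfold dz, dzb, dx, dy, Cmult, Cplus, Cconj, RtoC, Re; cbn [fst snd].
rewrite Gx, Gy, Ea, Eb; unfold surf, in_frame; field.
split; [lra|]; intros E; apply HD; lra.
Qed.
End Final.

Theorem mainTheorem6 :
  forall (Om : C -> Prop) (G : nat -> C -> R) (Q : C -> C) (tau : C -> R)
         (z0 : C) (th0 : C),
    open Om -> simply_connected Om ->
    harmonic_H2 Om G ->
    weierstrass_data Om G (fun p => Copp (Q p)) (fun p => 2 * tau p) ->
    singular_set_empty_interior Om G ->
    regular_point Om G z0 ->
    exists (N : nat -> C -> R) (h : C -> R),
      good_psi Om G tau z0 th0 N h /\
      (* unique up to vertical translations *)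
      (forall N' h', good_psi Om G tau z0 th0 N' h' ->
         exists c : R, forall p, Om p ->
           (forall k, (k < 3)%nat -> N' k p = N k p) /\ h' p = h p + c) /\
      (* h solves the system, uniquely up to additive constants *)
      h_system Om Q tau z0 th0 h /\
      (forall h', smooth_on Om h' -> h_system Om Q tau z0 th0 h' ->
         exists c : R, forall p, Om p -> h' p = h p + c) /\
      (* explicit formula for psi at regular points of G *)
      (forall p, regular_point Om G p -> forall k, (k < 3)%nat ->
         N k p =
           4 * Re (Cmult (dz (G k) p)
                     (Cplus (Cmult (Cmult (RtoC 2) (Cconj (Q p))) (dz h p))
                            (Cmult (RtoC (tau p)) (dzb h p))))
             / ((tau p)^2 - 4 * (Cmod (Q p))^2)
           + G k p * sqrt ((tau p + 2 * (Cmod (dz h p))^2) / tau p)).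
Proof.
intros Om G Q tau z0 th0 HOm HSC HG HWd Hsing [Hz0 _].
destruct (weierstrass_facts Om G Q tau HOm HWd) as [Stau Hfacts].
destruct (sign_constant Om G tau HOm HSC HG Stau (fun p Hp => proj1 (Hfacts p Hp))
  (fun p Hp => proj2 (proj2 (Hfacts p Hp))) Hsing) as [s [Hs Htau]].
assert (Ht : forall q, Om q -> 0 < ft G s q) by (intros q Hq; rewrite <- Htau by exact Hq; now apply Hfacts).
assert (HQ : forall q, Om q -> Q q = (hopf1 G q, hopf2 G q)) by (intros q Hq; now apply Hfacts).
destruct (solution_exists Om G s HOm HG Hs Ht z0 (2 * fst th0) (- (2 * snd th0)) HSC Hz0)
  as [a [b [W [h [Hsol [Sa [Sb [SW [Sh [Ea [Eb [EW HW]]]]]]]]]]]].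
assert (Dh : forall p, Om p -> pd false h p = a p /\ pd true h p = b p).
{ intros p Hp; destruct (Hsol p Hp) as [_ [_ [_ [H1 H2]]]]; split; now apply is_pd_unique. }
assert (HWang : forall p, Om p -> W p = sqrt ((tau p + 2 * Cmod (dz h p) ^ 2) / tau p)).
{ intros p Hp; destruct (HW p Hp) as [H1 H2]; destruct (Dh p Hp) as [D1 D2].
  apply (ang_unique Om G tau s Ht Htau h p (W p) Hp H2); now rewrite D1, D2. }
assert (Hgood : good_psi Om G tau z0 th0 (surf G s a b W) h).
{ apply (good_from_solution Om G s HOm HG Hs Ht a b W h Hsol Sa Sb SW Sh HW); auto. }
assert (Hdz : dz h z0 = th0) by (destruct Hgood as [_ [_ [_ [_ [_ [_ [H _]]]]]]]; exact H).
(* All candidates share the same initial values: [h_z(z0)] gives the first two unknowns, and the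
   first integral with positivity gives [W]. *)
assert (Init : forall h' W', dz h' z0 = th0 -> 0 < W' z0 ->
  W' z0 * W' z0 = 1 + (pd false h' z0 * pd false h' z0 + pd true h' z0 * pd true h' z0) / (2 * ft G s z0) ->
  a z0 = pd false h' z0 /\ b z0 = pd true h' z0 /\ W z0 = W' z0).
{ intros h' W' E Hp EW'; destruct (dz_components th0 h' z0 E) as [D1 D2].
  rewrite D1, D2 in EW' |- *; split; [exact Ea|split; [exact Eb|]].
  rewrite EW, <- EW'; apply sqrt_square; lra. }
exists (surf G s a b W), h; split; [exact Hgood|split; [|split; [|split]]].
- intros N' h' Hg'.
  destruct (good_structure Om G s tau z0 th0 HOm HG Hs Ht Htau Hsing N' h' Hg') as [W' [Hs' [HN' HW']]].
  assert (Hdz' : dz h' z0 = th0) by (destruct Hg' as [_ [_ [_ [_ [_ [_ [H _]]]]]]]; exact H).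
  destruct (HW' z0 Hz0) as [HW1 HW2]; destruct (Init h' W' Hdz' HW2 HW1) as [I1 [I2 I3]].
  exists (h' z0 - h z0); intros p Hp.
  destruct (solves_unique Om G s HOm HG Hs Ht z0 a b W h (pd false h') (pd true h') W' h' HSC Hz0 Hsol Hs' I1 I2 I3 p Hp)
    as [U1 [U2 [U3 U4]]].
  split; [|exact U4]; intros k Hk; rewrite (HN' p k Hp Hk); unfold surf; rewrite U1, U2, U3; reflexivity.
- apply (h_system_of_solves Om G Q tau s z0 th0 HOm HG Ht Htau HQ h W Sh); [|exact HWang|exact Hdz].
  intros p Hp; destruct (Hsol p Hp) as [[A1 A2] [[B1 B2] [[W1 W2] [H1 H2]]]]; destruct (Dh p Hp) as [D1 D2].
  assert (X1 : forall q, Om q -> a q = pd false h q) by (intros q Hq; now destruct (Dh q Hq)).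
  assert (X2 : forall q, Om q -> b q = pd true h q) by (intros q Hq; now destruct (Dh q Hq)).
  unfold solves; rewrite D1, D2.
  refine (conj (conj _ _) (conj (conj _ _) (conj (conj W1 W2) (conj H1 H2))));
    (eapply is_pd_ext_on; [exact HOm| |exact Hp|eassumption]; assumption).
- intros h' Sh' Hsys; set (W' := fun p => sqrt ((tau p + 2 * Cmod (dz h' p) ^ 2) / tau p)).
  assert (Hs' := solves_of_h_system Om G Q tau s z0 th0 HOm HG Ht Htau HQ h' Sh' Hsys).
  assert (HW2 := ang_pos Om G tau s Ht Htau h' z0 Hz0).
  assert (HW1 := ang_sq Om G tau s Ht Htau h' z0 Hz0).
  destruct (Init h' W' (proj2 Hsys) HW2 HW1) as [I1 [I2 I3]].
  exists (h' z0 - h z0); intros p Hp.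
  exact (proj2 (proj2 (proj2 (solves_unique Om G s HOm HG Hs Ht z0 a b W h (pd false h') (pd true h') W' h'
    HSC Hz0 Hsol Hs' I1 I2 I3 p Hp)))).
- intros p Hreg k Hk; assert (Hp : Om p) by apply Hreg; destruct (Dh p Hp) as [D1 D2].
  apply (explicit_formula Om G Q tau s HOm HG Hs Ht Htau HQ a b W h p k); auto.
  intros HJ; destruct (degenerate_singular Om G p HOm HG Hp HJ) as [_ Hn]; contradiction.
Qed.
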